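(* Each of the following statements is (separately) consistent with $\mathsf{ZFC}$: (1) $\max\{\mathfrak b,\mathfrak e^{\mathrm{const}}(2)\}<\operatorname{non}(M_{\mathcal{ED}})$; and dually, $\operatorname{cov}(M_{\mathcal{ED}})<\min\{\mathfrak d,\mathfrak v^{\mathrm{const}}(2)\}$. (2) $\operatorname{non}(M_{\mathrm{Fin}\otimes\mathrm{Fin}})<\operatorname{non}(K_{\mathcal{ED}_{\mathrm{fin}}})$; and dually, $\operatorname{cov}(K_{\mathcal{ED}_{\mathrm{fin}}})<\operatorname{cov}(M_{\mathrm{Fin}\otimes\mathrm{Fin}})$. (3) $\max\{\mathfrak b,\mathfrak e^{\mathrm{const}}_b(2)\}<\operatorname{non}(K_{\mathcal{ED}_{\mathrm{fin}}})$ for any increasing $b\in(\omega\setminus2)^\omega$; and dually, $\operatorname{cov}(K_{\mathcal{ED}_{\mathrm{fin}}})<\min\{\mathfrak d,\mathfrak v^{\mathrm{const}}_b(2)\}$ for any increasing $b\in(\omega\setminus2)^\omega$. (In each item the displayed inequality and its dual are two separate consistency assertions.)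
   Context: For an ideal $\mathscr I$ on a countable set $X$ (proper, containing all finite sets): $M_{\mathscr I}$ is the $\sigma$-ideal on $X^\omega$ generated by the sets $M_\phi=\{x\in X^\omega:\forall^\infty n\ x(n)\in\phi(x\upharpoonright n)\}$, $\phi\colon X^{<\omega}\to\mathscr I$; $K_{\mathscr I}$ is the $\sigma$-ideal on $X^\omega$ generated by the sets $K_\phi=\{x\in X^\omega:\forall^\infty n\ x(n)\in\phi(n)\}$, $\phi\colon\omega\to\mathscr I$. For a $\sigma$-ideal $\mathcal I$ on $Y$, $\operatorname{non}(\mathcal I)$ is the least size of a subset of $Y$ not in $\mathcal I$ and $\operatorname{cov}(\mathcal I)$ is the least size of a subfamily of $\mathcal I$ covering $Y$. $\mathfrak b,\mathfrak d$ are the bounding and dominating numbers. With $(A)_n=\{m:\langle n,m\rangle\in A\}$: $\mathrm{Fin}\otimes\mathrm{Fin}=\{A\subseteq\omega\times\omega:\forall^\infty n\ |(A)_n|<\omega\}$; $\mathcal{ED}=\{A\subseteq\omega\times\omega:\exists k<\omega\,\forall^\infty n\ |(A)_n|\le k\}$; $\mathcal{ED}_{\mathrm{fin}}$ is the restriction of $\mathcal{ED}$ to $\Delta=\{(n,m)\in\omega\times\omega:m\le n\}$ (an ideal on $\Delta$). A predictor is a function $\pi\colon\omega^{<\omega}\to\omega$; $\mathrm{Pred}$ is the set of predictors. $f\sqsubset^{\mathrm{pc},2}\pi$ means: for all but finitely many $i<\omega$ there is $j\in[i,i+2)$ with $f(j)=\pi(f\upharpoonright j)$. $\mathfrak e^{\mathrm{const}}(2)$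 is the least size of $F\subseteq\omega^\omega$ such that for every $\pi\in\mathrm{Pred}$ there is $f\in F$ with $\neg(f\sqsubset^{\mathrm{pc},2}\pi)$; $\mathfrak v^{\mathrm{const}}(2)$ is the least size of $\Pi\subseteq\mathrm{Pred}$ such that for every $f\in\omega^\omega$ there is $\pi\in\Pi$ with $f\sqsubset^{\mathrm{pc},2}\pi$. For $b\in(\omega\setminus2)^\omega$, $\mathfrak e^{\mathrm{const}}_b(2)$ and $\mathfrak v^{\mathrm{const}}_b(2)$ are defined in the same way, with $\omega^\omega$ replaced by $\prod_{n<\omega}b(n)$ and $\mathrm{Pred}$ replaced by the set $\mathrm{Pred}_b$ of functions $\pi$ with domain $\bigcup_{n<\omega}\prod_{i<n}b(i)$ and $\pi(\sigma)\in b(|\sigma|)$. *)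

(* Defs.v *)
(* Consistency with ZFC is a statement about first-order proofs, so formulas,
   proofs and the axioms of ZFC are represented syntactically, and the objects of
   the theorem (ideals, cardinals, predictors) occur only inside formulas. *)
From Stdlib Require Import List Arith.
Import ListNotations.

(* De Bruijn syntax. The only terms are variables; the connectives missing here
   are classical abbreviations, defined below. *)
Inductive form : Type :=
| Bot : form
| Mem : nat -> nat -> form
| Equ : nat -> nat -> form
| Imp : form -> form -> form
| All : form -> form.

Definition up (r : nat -> nat) (i : nat) : nat :=
  match i with 0 => 0 | S i => S (r i) end.

Fixpoint ren (r : nat -> nat) (p : form) : form :=
  match p with
  | Bot => Bot
  | Mem i j => Mem (r i) (r j)
  | Equ i j => Equ (r i) (r j)
  | Imp p q => Imp (ren r p) (ren r q)
  | All p => All (ren (up r) p)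
  end.

Definition inst (y : nat) (p : form) : form :=
  ren (fun i => match i with 0 => y | S i => i end) p.

(* All free indices of [p] are below [n]. *)
Fixpoint scoped (n : nat) (p : form) : Prop :=
  match p with
  | Bot => True
  | Mem i j => i < n /\ j < n
  | Equ i j => i < n /\ j < n
  | Imp p q => scoped n p /\ scoped n q
  | All p => scoped (S n) p
  end.

Inductive prv : list form -> form -> Prop :=
| prv_ax G p : In p G -> prv G p
| prv_impI G p q : prv (p :: G) q -> prv G (Imp p q)
| prv_impE G p q : prv G (Imp p q) -> prv G p -> prv G q
| prv_raa G p : prv (Imp p Bot :: G) Bot -> prv G p
| prv_allI G p : prv (map (ren S) G) p -> prv G (All p)
| prv_allE G p y : prv G (All p) -> prv G (inst y p)
| prv_refl G x : prv G (Equ x x)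
| prv_subst G p x y : prv G (Equ x y) -> prv G (inst x p) -> prv G (inst y p).

Definition theory := form -> Prop.

Definition proves (T : theory) (p : form) : Prop :=
  exists G, (forall q, In q G -> T q) /\ prv G p.

Definition consistent (T : theory) : Prop := ~ proves T Bot.

(* An [fml] takes the number [d] of enclosing quantifiers. A variable is the
   level of its quantifier, counted from the outside, so that level [x] has
   index [d - S x] under [d] quantifiers; metalanguage functions then serve as
   binders, and [p 0] is the de Bruijn sentence written as [p]. *)
Definition var := nat.
Definition fml := nat -> form.

Definition fbot : fml := fun _ => Bot.
Definition fmem (x y : var) : fml := fun d => Mem (d - S x) (d - S y).
Definition fequ (x y : var) : fml := fun d => Equ (d - S x) (d - S y).
Definition fimp (p q : fml) : fml := fun d => Imp (p d) (q d).
Definition fall (p : var -> fml) : fml := fun d => All (p d (S d)).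
Definition fneg (p : fml) : fml := fimp p fbot.
Definition fand (p q : fml) : fml := fneg (fimp p (fneg q)).
Definition for_ (p q : fml) : fml := fimp (fneg p) q.
Definition fiff (p q : fml) : fml := fand (fimp p q) (fimp q p).
Definition fex (p : var -> fml) : fml := fneg (fall (fun x => fneg (p x))).

Declare Scope zf_scope.
Delimit Scope zf_scope with zf.
Bind Scope zf_scope with fml.
Open Scope zf_scope.

Notation "x ∈ y" := (fmem x y) (at level 70) : zf_scope.
Notation "x ≡ y" := (fequ x y) (at level 70) : zf_scope.
Notation "¬ p" := (fneg p) (at level 75, right associativity) : zf_scope.
Notation "p ∧ q" := (fand p q) (at level 80, right associativity) : zf_scope.
Notation "p ∨ q" := (for_ p q) (at level 85, right associativity) : zf_scope.
Notation "p ⇒ q" := (fimp p q) (at level 90, right associativity) : zf_scope.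
Notation "p ⇔ q" := (fiff p q) (at level 95, no associativity) : zf_scope.
Notation "∀ x , p" := (fall (fun x => p))
  (at level 200, x name, p at level 200) : zf_scope.
Notation "∃ x , p" := (fex (fun x => p))
  (at level 200, x name, p at level 200) : zf_scope.
Notation "∀ x ∈ a , p" := (fall (fun x => fimp (fmem x a) p))
  (at level 200, x name, a at level 69, p at level 200) : zf_scope.
Notation "∃ x ∈ a , p" := (fex (fun x => fand (fmem x a) p))
  (at level 200, x name, a at level 69, p at level 200) : zf_scope.

(* [t : term] is a set-valued expression given by its graph: [t z] is the
   formula expressing that the value of [t] is [z]. *)
Definition term := var -> fml.

Notation "'LET' x := t 'IN' p" := (fex (fun x => fand (t x) p))
  (at level 200, x name, t at level 99, p at level 200) : zf_scope.
Notation "{{ z | p }}" := ((fun s => fall (fun z => fiff (fmem z s) p)) : term)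
  (at level 0, z name, p at level 200) : zf_scope.

Definition sub (a b : var) : fml := ∀ z ∈ a, z ∈ b.
Definition empty : term := {{ z | fbot }}.
Definition upair (x y : var) : term := {{ z | z ≡ x ∨ z ≡ y }}.
Definition union (a : var) : term := {{ z | ∃ y ∈ a, z ∈ y }}.
Definition power (a : var) : term := {{ z | sub z a }}.
Definition inter (a b : var) : term := {{ z | z ∈ a ∧ z ∈ b }}.
Definition succ (x : var) : term := {{ z | z ∈ x ∨ z ≡ x }}.

Definition inductive (a : var) : fml :=
  (LET e := empty IN e ∈ a) ∧ (∀ x ∈ a, LET s := succ x IN s ∈ a).

Definition omega : term := fun w => inductive w ∧ ∀ v, inductive v ⇒ sub w v.

Fixpoint falls (n : nat) (f : list var -> fml) : fml :=
  match n with
  | 0 => f []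
  | S n => ∀ x, falls n (fun xs => f (x :: xs))
  end.

(* The de Bruijn formula [p] with its free index [i] read as the [i]-th entry of [xs]. *)
Definition app_form (p : form) (xs : list var) : fml :=
  fun d => ren (fun i => d - S (nth i xs 0)) p.

Definition extensionality : fml := ∀ x, ∀ y, (∀ z, z ∈ x ⇔ z ∈ y) ⇒ x ≡ y.
Definition foundation : fml := ∀ x, (∃ y, y ∈ x) ⇒ ∃ y ∈ x, ¬ (∃ z ∈ x, z ∈ y).
Definition pairing : fml := ∀ x, ∀ y, ∃ z, upair x y z.
Definition union_axiom : fml := ∀ a, ∃ u, union a u.
Definition power_axiom : fml := ∀ a, ∃ u, power a u.
Definition infinity : fml := ∃ a, inductive a.

Definition separation (n : nat) (p : form) : fml :=
  falls n (fun ps => ∀ a, ∃ s,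
    ∀ x, x ∈ s ⇔ x ∈ a ∧ app_form p (x :: ps)).

Definition replacement (n : nat) (p : form) : fml :=
  falls n (fun ps => ∀ a,
    (∀ x ∈ a, ∀ y, ∀ z,
       app_form p (x :: y :: ps) ∧ app_form p (x :: z :: ps) ⇒ y ≡ z) ⇒
    ∃ b, ∀ y, y ∈ b ⇔ ∃ x ∈ a, app_form p (x :: y :: ps)).

Definition choice : fml :=
  ∀ a, (∀ x ∈ a, ∃ z, z ∈ x) ∧
       (∀ x ∈ a, ∀ y ∈ a, (∃ z, z ∈ x ∧ z ∈ y) ⇒ x ≡ y) ⇒
       ∃ c, ∀ x ∈ a, ∃ y, ∀ z, z ∈ x ∧ z ∈ c ⇔ z ≡ y.

Inductive ZFC : theory :=
| ZFC_extensionality : ZFC (extensionality 0)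
| ZFC_foundation : ZFC (foundation 0)
| ZFC_pairing : ZFC (pairing 0)
| ZFC_union : ZFC (union_axiom 0)
| ZFC_power : ZFC (power_axiom 0)
| ZFC_infinity : ZFC (infinity 0)
| ZFC_separation n p : scoped (1 + n) p -> ZFC (separation n p 0)
| ZFC_replacement n p : scoped (2 + n) p -> ZFC (replacement n p 0)
| ZFC_choice : ZFC (choice 0).

Definition ZFC_plus (p : fml) : theory := fun q => ZFC q \/ q = p 0.

Definition opair (x y : var) : term :=
  fun p => LET u := upair x x IN LET v := upair x y IN upair u v p.

Definition prod (a b : var) : term :=
  {{ p | ∃ x ∈ a, ∃ y ∈ b, opair x y p }}.

Definition app (f x : var) : term := fun y => ∃ p ∈ f, opair x y p.

Definition func (f a b : var) : fml :=
  (∀ p ∈ f, ∃ x ∈ a, ∃ y ∈ b, opair x y p) ∧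
  (∀ x ∈ a, ∃ y ∈ b, ∀ z, app f x z ⇔ z ≡ y).

Definition bijection (f a b : var) : fml :=
  func f a b ∧ ∀ y ∈ b, ∃ x ∈ a, ∀ z, app f z y ⇔ z ≡ x.

Definition equinum (a b : var) : fml := ∃ f, bijection f a b.

Definition restr (f n : var) : term :=
  {{ p | p ∈ f ∧ ∃ k ∈ n, ∃ y, opair k y p }}.

Definition funs (a b : var) : term := {{ f | func f a b }}.

(* [X^{<ω}]; a sequence of length [n] is a function with domain the von Neumann number [n]. *)
Definition fin_seqs (X : var) : term :=
  {{ s | LET w := omega IN ∃ n ∈ w, func s n X }}.

Definition transitive (a : var) : fml := ∀ x ∈ a, sub x a.
Definition ordinal (a : var) : fml := transitive a ∧ ∀ x ∈ a, transitive x.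
Definition leq (m n : var) : fml := m ∈ n ∨ m ≡ n.

(* The initial ordinal equinumerous with [a]. *)
Definition card (a : var) : term :=
  fun k => ordinal k ∧ equinum k a ∧ ∀ l ∈ k, ¬ equinum l a.

Definition least_size (P : var -> fml) : term :=
  fun k => (∃ a, P a ∧ card a k) ∧ (∀ a, ∀ l, P a ∧ card a l ⇒ leq k l).

Definition max_card (s t : term) : term := fun m =>
  LET k := s IN LET l := t IN (m ≡ k ∨ m ≡ l) ∧ leq k m ∧ leq l m.
Definition min_card (s t : term) : term := fun m =>
  LET k := s IN LET l := t IN (m ≡ k ∨ m ≡ l) ∧ leq m k ∧ leq m l.
Definition less_card (s t : term) : fml := LET k := s IN LET l := t IN k ∈ l.

Notation "s ≺ t" := (less_card s t) (at level 70) : zf_scope.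

Definition almost_all (p : var -> fml) : fml :=
  LET w := omega IN ∃ m ∈ w, ∀ n ∈ w, leq m n ⇒ p n.

Definition baire : term := fun Y => LET w := omega IN funs w w Y.

Definition leq_star (f g : var) : fml :=
  almost_all (fun n => LET u := app f n IN LET v := app g n IN leq u v).

Definition bounding : term := least_size (fun F => LET Y := baire IN
  sub F Y ∧ ∀ g ∈ Y, ∃ f ∈ F, ¬ leq_star f g).

Definition dominating : term := least_size (fun F => LET Y := baire IN
  sub F Y ∧ ∀ g ∈ Y, ∃ f ∈ F, leq_star g f).

Definition sigma_ideal (Y J : var) : fml :=
  (∀ a ∈ J, sub a Y) ∧
  (LET e := empty IN e ∈ J) ∧
  (∀ a ∈ J, ∀ b, sub b a ⇒ b ∈ J) ∧
  (LET w := omega IN ∀ h, func h w J ⇒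
     LET u := {{ z | ∃ n ∈ w, LET a := app h n IN z ∈ a }} IN u ∈ J).

Definition sigma_generated (Y G : var) : term := fun J =>
  sigma_ideal Y J ∧ sub G J ∧ ∀ J', sigma_ideal Y J' ∧ sub G J' ⇒ sub J J'.

Definition seqs (X : term) : term :=
  fun Y => LET x := X IN LET w := omega IN funs w x Y.

(* Generated by the sets of [f : ω -> X] with [f(n) ∈ phi(f|n)] for almost all
   [n], where [phi] maps finite sequences in [X] to members of [I]. *)
Definition M_ideal (X I : term) : term := fun J =>
  LET x := X IN LET i := I IN LET Y := seqs X IN
  LET S := fin_seqs x IN
  LET G := {{ A | ∃ phi, func phi S i ∧
    (LET B := {{ f | f ∈ Y ∧ almost_all (fun n =>
       LET s := restr f n IN LET c := app phi s IN LET v := app f n IN v ∈ c) }}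
     IN A ≡ B) }} IN
  sigma_generated Y G J.

(* As [M_ideal], but [phi : ω -> I] sees only the length of [f|n]. *)
Definition K_ideal (X I : term) : term := fun J =>
  LET i := I IN LET Y := seqs X IN
  LET w := omega IN
  LET G := {{ A | ∃ phi, func phi w i ∧
    (LET B := {{ f | f ∈ Y ∧ almost_all (fun n =>
       LET c := app phi n IN LET v := app f n IN v ∈ c) }}
     IN A ≡ B) }} IN
  sigma_generated Y G J.

Definition non (Y J : term) : term := least_size (fun A =>
  LET y := Y IN LET j := J IN sub A y ∧ ¬ (A ∈ j)).

Definition cov (Y J : term) : term := least_size (fun C =>
  LET y := Y IN LET j := J IN sub C j ∧ ∀ f ∈ y, ∃ a ∈ C, f ∈ a).

Definition section (A n : var) : term :=
  {{ m | LET p := opair n m IN p ∈ A }}.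

Definition omega2 : term := fun Y => LET w := omega IN prod w w Y.

Definition finite (a : var) : fml := LET w := omega IN LET k := card a IN k ∈ w.

Definition FinFin : term :=
  {{ A | (LET Y := omega2 IN sub A Y) ∧
         almost_all (fun n => LET s := section A n IN finite s) }}.

Definition ED : term :=
  {{ A | (LET Y := omega2 IN sub A Y) ∧
         (LET w := omega IN ∃ k ∈ w, almost_all (fun n =>
            LET s := section A n IN LET l := card s IN leq l k)) }}.

Definition Delta : term :=
  {{ p | LET w := omega IN ∃ n ∈ w, ∃ m ∈ w, leq m n ∧ opair n m p }}.

Definition EDfin : term :=
  {{ B | LET I := ED IN LET D := Delta IN ∃ A ∈ I, inter A D B }}.

(* [f(j) = pi(f|j)] *)
Definition guesses (pi f j : var) : fml :=
  LET s := restr f j IN LET v := app f j IN app pi s v.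

Definition predicts2 (pi f : var) : fml :=
  almost_all (fun i => ∃ j, leq i j ∧
    (LET e := succ i IN LET e' := succ e IN j ∈ e') ∧ guesses pi f j).

Definition evasion2 (Y P : term) : term := least_size (fun F =>
  LET y := Y IN LET p := P IN
  sub F y ∧ ∀ pi ∈ p, ∃ f ∈ F, ¬ predicts2 pi f).

Definition prediction2 (Y P : term) : term := least_size (fun Q =>
  LET y := Y IN LET p := P IN
  sub Q p ∧ ∀ f ∈ y, ∃ pi ∈ Q, predicts2 pi f).

Definition Pred : term := fun P =>
  LET w := omega IN LET S := fin_seqs w IN funs S w P.

Definition e_const : term := evasion2 baire Pred.
Definition v_const : term := prediction2 baire Pred.

(* [f] belongs to the product of the [b(i)] for [i ∈ n], where [n ≤ ω]. *)
Definition in_prod (f n b : var) : fml :=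
  LET w := omega IN func f n w ∧
  ∀ i ∈ n, LET v := app f i IN LET c := app b i IN v ∈ c.

Definition prod_b (b : var) : term :=
  {{ f | LET w := omega IN in_prod f w b }}.

Definition fin_seqs_b (b : var) : term :=
  {{ s | LET w := omega IN ∃ n ∈ w, in_prod s n b }}.

(* [pi(s) ∈ b(|s|)]; the length [|s|] is the [n] with [in_prod s n b]. *)
Definition Pred_b (b : var) : term :=
  {{ pi | LET w := omega IN LET S := fin_seqs_b b IN func pi S w ∧
     ∀ s ∈ S, ∃ n ∈ w, in_prod s n b ∧
       LET v := app pi s IN LET c := app b n IN v ∈ c }}.

Definition e_const_b (b : var) : term := evasion2 (prod_b b) (Pred_b b).
Definition v_const_b (b : var) : term := prediction2 (prod_b b) (Pred_b b).

(* [b ∈ (ω∖2)^ω] *)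
Definition bound_fun (b : var) : fml :=
  LET w := omega IN
  LET two := (fun t => LET z := empty IN LET o := succ z IN succ o t) IN
  LET D := {{ n | n ∈ w ∧ ¬ (n ∈ two) }} IN
  func b w D.

Definition increasing (b : var) : fml :=
  LET w := omega IN ∀ n ∈ w, ∀ m ∈ n,
    LET u := app b m IN LET v := app b n IN u ∈ v.

(* Main.v *)
(* Each consistency is proved by forcing, with the types of Rocq as ground model: a name is a well-founded tree of
   names and conditions indexed by a type, all of ZFC is forced, and a filter meeting countably many dense sets gives
   a model of the forced sentences, to which soundness applies.

   The poset adds Cohen reals indexed by [I] and, along a well-order [W], sequences of sets in ED. The item at [w]
   promises to capture, from some level on, finitely many names that depend only on the coordinates below [w]. As [W]
   is long, every [T]-indexed family of reals depends only on the coordinates below some [w], so it is captured at [w].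
   Conversely no [A]-indexed family of functions bounds (predicts, captures) all the Cohen reals. Otherwise
   uncountably many Cohen reals are bounded by the same member from the same place on, and a Delta-system of conditions
   [p n] forces this for distinct Cohen reals with a common stem. The [p n] have a limit: a condition all of whose
   extensions are compatible with infinitely many [p n]. Below the limit the next values of the Cohen reals
   are still free, a contradiction. In the limit a promised name is replaced by its limit values along the [p n], and
   the levels where only its first coordinates converge are absorbed by raising a bound; so this works when
   second coordinates are bounded by first ones, as they are on Delta, or by later first coordinates, which can be
   arranged on [omega * omega] when only boundedness and predictors are at stake.

   With [A] countable and [T = I] of size continuum, the Cohen reals are a family of size [I] that is large for the
   smaller cardinals, while families of size [I] are small for the ideal. With [T] countable and [A = W], the [W] many
   captured sets cover, while [W] many functions do not dominate. *)
From Stdlib Require Import List Arith Lia Cantor Wellfounded.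
From Stdlib Require Import Classical ClassicalEpsilon FunctionalExtensionality PropExtensionality.
From mathcomp Require ssrbool eqtype boolp wochoice.
Require Import Defs.
Import ListNotations.

(** Sizes in an extension are compared through images of a single index set: the family witnessing
    the smaller cardinal is an image of it and no family for the larger one is. This takes the place
    of preservation of cardinals. As a filter meets only countably many dense sets, the extension is
    a term model in which countably many names are controlled. A claim about all coordinates is
    therefore shown to be forced, one coordinate at a time: a condition refuting it would belong to
    another extension, built for that coordinate, in which the claim is true. Finite amalgams
    suffice against a predictor, since the four continuations of a stem by two bits can be realized
    in one condition. A bounding function is defeated only by infinitely many Cohen reals at once,
    hence the limits. Against Fin⊗Fin one needs infinitely many columns with infinitely many points
    in each, that is a limit of limits; this requires limits that keep the common root, which are
    obtained when second coordinates are bounded by first ones. *)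

Lemma well_order_exists (T : Type) : exists lt : T -> T -> Prop,
  well_founded lt /\ (forall x y, lt x y \/ x = y \/ lt y x) /\
  (forall x y z, lt x y -> lt y z -> lt x z).
Proof.
  destruct (wochoice.well_ordering_principle (boolp.boolp_classicType__canonical__eqtype_Equality T)) as [R HR].
  change (T -> T -> bool) in R.
  (* Every nonempty set has a unique least element for [R]; the order axioms below come from sets
     with one, two and three elements. *)
  assert (Hmin : forall Q : T -> Prop, (exists x, Q x) -> exists z, Q z /\ (forall x, Q x -> R z x = true) /\
    forall z', Q z' -> (forall x, Q x -> R z' x = true) -> z = z').
  { intros Q [x Hx].
    set (A := fun x : T => if excluded_middle_informative (Q x) then true else false).
    assert (HA : forall x, A x = true <-> Q x).
    { intros y; unfold A; destruct (excluded_middle_informative (Q y)); split; auto; discriminate. }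
    destruct (HR A) as [z [[Hz Hl] Hu]]; [exists x; apply HA, Hx|].
    exists z; split; [apply HA, Hz|]; split.
    - intros y Hy; apply Hl, HA, Hy.
    - intros z' Hz' Hl'; apply Hu; split; [apply HA, Hz'|]; intros y Hy; apply Hl', HA, Hy. }
  assert (Hrefl : forall x, R x x = true).
  { intros x; destruct (Hmin (eq x)) as [z [<- [H _]]]; eauto. }
  assert (Hanti : forall x y, R x y = true -> R y x = true -> x = y).
  { intros x y H H'; destruct (Hmin (fun z => z = x \/ z = y)) as [z [_ [_ Hu]]]; eauto.
    transitivity z; [symmetry|]; apply Hu; auto; intros w [->| ->]; auto. }
  assert (Htot : forall x y, R x y = true \/ R y x = true).
  { intros x y; destruct (Hmin (fun z => z = x \/ z = y)) as [z [[->| ->] [H _]]]; eauto. }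
  assert (Hwf : well_founded (fun x y => R x y = true /\ x <> y)).
  { intros x; apply NNPP; intros Hn.
    destruct (Hmin (fun x => ~ Acc (fun x y => R x y = true /\ x <> y) x)) as [z [Hz [Hl _]]]; eauto.
    apply Hz; constructor; intros y [Hy Hyz]; apply NNPP; intros Hy'; apply Hyz, Hanti; auto. }
  assert (Htri : forall x y, (R x y = true /\ x <> y) \/ x = y \/ (R y x = true /\ y <> x)).
  { intros x y; destruct (classic (x = y)) as [->|Hn]; auto; destruct (Htot x y); [left|right; right]; auto. }
  exists (fun x y => R x y = true /\ x <> y); split; [exact Hwf|split; [exact Htri|]].
  intros x y z [H1 H2] [H3 H4]; split.
  - destruct (Hmin (fun w => w = x \/ w = y \/ w = z)) as [w [[->|[->| ->]] [Hl _]]]; eauto.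
    + destruct H2; apply Hanti; auto.
    + destruct H4; apply Hanti; auto.
  - intros ->; apply H2, Hanti; auto.
Qed.

(** * The formulas as predicates on a model *)

(* The mirror of [Defs] is parametrized by the quantifier and the connectives: with the classically encoded ones [rex],
   [rand], [ror] it is convertible to [sat] of the formula, and with [@ex], [and], [or] it is what one reasons with. *)
Section Sem.
Context {M : Type} (E : M -> M -> Prop).
Context (EX : (M -> Prop) -> Prop) (AND OR : Prop -> Prop -> Prop).

Notation "'Some' x , p" := (EX (fun x => p)) (at level 200, x name, p at level 200).
Notation "'Some' x 'of' a , p" := (EX (fun x => AND (E x a) p)) (at level 200, x name, a at level 69, p at level 200).
Notation "'All' x 'of' a , p" := (forall x, E x a -> p) (at level 200, x name, a at level 69, p at level 200).
Notation "'Let' x := t 'in' p" := (EX (fun x => AND (t x) p)) (at level 200, x name, t at level 99, p at level 200).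
Notation "p /& q" := (AND p q) (at level 80, right associativity).
Notation "p \| q" := (OR p q) (at level 85, right associativity).
Definition seqv (p q : Prop) : Prop := (p -> q) /& (q -> p).
Notation "p <=> q" := (seqv p q) (at level 95).
Definition setof (P : M -> Prop) (s : M) : Prop := forall z, E z s <=> P z.

Definition Sub a b := All z of a, E z b.
Definition Empty := setof (fun z => False).
Definition Upair x y := setof (fun z => z = x \| z = y).
Definition Union a := setof (fun z => Some y of a, E z y).
Definition Power a := setof (fun z => Sub z a).
Definition Inter a b := setof (fun z => E z a /& E z b).
Definition Succ x := setof (fun z => E z x \| z = x).
Definition Inductive_ a := (Let e := Empty in E e a) /& (All x of a, Let s := Succ x in E s a).
Definition Omega w := Inductive_ w /& forall v, Inductive_ v -> Sub w v.
Definition Opair x y p := Let u := Upair x x in Let v := Upair x y in Upair u v p.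
Definition Prod a b := setof (fun p => Some x of a, Some y of b, Opair x y p).
Definition App f x y := Some p of f, Opair x y p.
Definition Func f a b :=
  (All p of f, Some x of a, Some y of b, Opair x y p) /&
  (All x of a, Some y of b, forall z, App f x z <=> z = y).
Definition Bij f a b := Func f a b /& All y of b, Some x of a, forall z, App f z y <=> z = x.
Definition Equinum a b := Some f, Bij f a b.
Definition Restr f n := setof (fun p => E p f /& Some k of n, Some y, Opair k y p).
Definition Funs a b := setof (fun f => Func f a b).
Definition FinSeqs X := setof (fun s => Let w := Omega in Some n of w, Func s n X).
Definition Transitive a := All x of a, Sub x a.
Definition Ordinal a := Transitive a /& All x of a, Transitive x.
Definition Leq m n := E m n \| m = n.
Definition Card a k := Ordinal k /& Equinum k a /& All l of k, (Equinum l a -> False).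
Definition LeastSize (P : M -> Prop) k :=
  (Some a, P a /& Card a k) /& (forall a l, P a /& Card a l -> Leq k l).
Definition MaxCard (s t : M -> Prop) m :=
  Let k := s in Let l := t in (m = k \| m = l) /& Leq k m /& Leq l m.
Definition MinCard (s t : M -> Prop) m :=
  Let k := s in Let l := t in (m = k \| m = l) /& Leq m k /& Leq m l.
Definition LessCard (s t : M -> Prop) := Let k := s in Let l := t in E k l.
Definition AlmostAll (p : M -> Prop) :=
  Let w := Omega in Some m of w, All n of w, (Leq m n -> p n).
Definition Baire Y := Let w := Omega in Funs w w Y.
Definition LeqStar f g := AlmostAll (fun n => Let u := App f n in Let v := App g n in Leq u v).
Definition UnbddFam F := Let Y := Baire in
  Sub F Y /& All g of Y, Some f of F, (LeqStar f g -> False).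
Definition Bounding := LeastSize UnbddFam.
Definition DomFam F := Let Y := Baire in
  Sub F Y /& All g of Y, Some f of F, LeqStar g f.
Definition Dominating := LeastSize DomFam.
Definition SigmaIdeal Y J :=
  (All a of J, Sub a Y) /&
  (Let e := Empty in E e J) /&
  (All a of J, forall b, Sub b a -> E b J) /&
  (Let w := Omega in forall h, Func h w J ->
     Let u := setof (fun z => Some n of w, Let a := App h n in E z a) in E u J).
Definition SigmaGen Y G J :=
  SigmaIdeal Y J /& Sub G J /& forall J', SigmaIdeal Y J' /& Sub G J' -> Sub J J'.
Definition Seqs (X : M -> Prop) Y := Let x := X in Let w := Omega in Funs w x Y.
Definition MSet Y phi := setof (fun f => E f Y /& AlmostAll (fun n =>
       Let s := Restr f n in Let c := App phi s in Let v := App f n in E v c)).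
Definition KSet Y phi := setof (fun f => E f Y /& AlmostAll (fun n =>
       Let c := App phi n in Let v := App f n in E v c)).
Definition MIdeal (X I : M -> Prop) J :=
  Let x := X in Let i := I in Let Y := Seqs X in Let S := FinSeqs x in
  Let G := setof (fun A => Some phi, Func phi S i /& (Let B := MSet Y phi in A = B)) in
  SigmaGen Y G J.
Definition KIdeal (X I : M -> Prop) J :=
  Let i := I in Let Y := Seqs X in Let w := Omega in
  Let G := setof (fun A => Some phi, Func phi w i /& (Let B := KSet Y phi in A = B)) in
  SigmaGen Y G J.
Definition NonFam (Y J : M -> Prop) A := Let y := Y in Let j := J in Sub A y /& (E A j -> False).
Definition Non Y J := LeastSize (NonFam Y J).
Definition CovFam (Y J : M -> Prop) C :=
  Let y := Y in Let j := J in Sub C j /& All f of y, Some a of C, E f a.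
Definition Cov Y J := LeastSize (CovFam Y J).
Definition Sect A n := setof (fun m => Let p := Opair n m in E p A).
Definition Omega2 Y := Let w := Omega in Prod w w Y.
Definition Finite a := Let w := Omega in Let k := Card a in E k w.
Definition FinFin_ := setof (fun A => (Let Y := Omega2 in Sub A Y) /&
         AlmostAll (fun n => Let s := Sect A n in Finite s)).
Definition ED_ := setof (fun A => (Let Y := Omega2 in Sub A Y) /&
         (Let w := Omega in Some k of w, AlmostAll (fun n =>
            Let s := Sect A n in Let l := Card s in Leq l k))).
Definition Delta_ := setof (fun p => Let w := Omega in Some n of w, Some m of w, Leq m n /& Opair n m p).
Definition EDfin_ := setof (fun B => Let I := ED_ in Let D := Delta_ in Some A of I, Inter A D B).
Definition Guesses pi f j := Let s := Restr f j in Let v := App f j in App pi s v.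
Definition Predicts2 pi f := AlmostAll (fun i => Some j, Leq i j /&
    (Let e := Succ i in Let e' := Succ e in E j e') /& Guesses pi f j).
Definition EvFam (Y P : M -> Prop) F := Let y := Y in Let p := P in
  Sub F y /& All pi of p, Some f of F, (Predicts2 pi f -> False).
Definition Evasion2 Y P := LeastSize (EvFam Y P).
Definition PrFam (Y P : M -> Prop) Q := Let y := Y in Let p := P in
  Sub Q p /& All f of y, Some pi of Q, Predicts2 pi f.
Definition Prediction2 Y P := LeastSize (PrFam Y P).
Definition Pred_ P := Let w := Omega in Let S := FinSeqs w in Funs S w P.
Definition InProd f n b := Let w := Omega in Func f n w /&
  All i of n, Let v := App f i in Let c := App b i in E v c.
Definition ProdB b := setof (fun f => Let w := Omega in InProd f w b).
Definition FinSeqsB b := setof (fun s => Let w := Omega in Some n of w, InProd s n b).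
Definition PredB b := setof (fun pi => Let w := Omega in Let S := FinSeqsB b in Func pi S w /&
     All s of S, Some n of w, InProd s n b /&
       Let v := App pi s in Let c := App b n in E v c).
Definition BoundFun b := Let w := Omega in
  Let two := (fun t => Let z := Empty in Let o := Succ z in Succ o t) in
  Let D := setof (fun n => E n w /& (E n two -> False)) in Func b w D.
Definition Increasing b := Let w := Omega in All n of w, All m of n,
    Let u := App b m in Let v := App b n in E u v.

Definition Stmt1a := LessCard (MaxCard Bounding (Evasion2 Baire Pred_)) (Non (Seqs Omega2) (MIdeal Omega2 ED_)).
Definition Stmt1b := LessCard (Cov (Seqs Omega2) (MIdeal Omega2 ED_)) (MinCard Dominating (Prediction2 Baire Pred_)).
Definition Stmt2a := LessCard (Non (Seqs Omega2) (MIdeal Omega2 FinFin_)) (Non (Seqs Delta_) (KIdeal Delta_ EDfin_)).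
Definition Stmt2b := LessCard (Cov (Seqs Delta_) (KIdeal Delta_ EDfin_)) (Cov (Seqs Omega2) (MIdeal Omega2 FinFin_)).
Definition Stmt3a := forall b, BoundFun b /& Increasing b ->
  LessCard (MaxCard Bounding (Evasion2 (ProdB b) (PredB b))) (Non (Seqs Delta_) (KIdeal Delta_ EDfin_)).
Definition Stmt3b := forall b, BoundFun b /& Increasing b ->
  LessCard (Cov (Seqs Delta_) (KIdeal Delta_ EDfin_)) (MinCard Dominating (Prediction2 (ProdB b) (PredB b))).
End Sem.

Definition scons {X} (x : X) (e : nat -> X) (i : nat) : X := match i with 0 => x | S i => e i end.

Fixpoint sat {M} (E : M -> M -> Prop) (e : nat -> M) (p : form) : Prop :=
  match p with
  | Bot => False
  | Mem i j => E (e i) (e j)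
  | Equ i j => e i = e j
  | Imp p q => sat E e p -> sat E e q
  | All p => forall x, sat E (scons x e) p
  end.

Definition rex {M} (P : M -> Prop) : Prop := (forall x, P x -> False) -> False.
Definition rand (p q : Prop) : Prop := (p -> q -> False) -> False.
Definition ror (p q : Prop) : Prop := (p -> False) -> q.

Lemma rex_eq {M} : @rex M = @ex M.
Proof.
  extensionality P; apply propositional_extensionality; unfold rex; split.
  - intros H; apply NNPP; intros H1; apply H; intros x Hx; apply H1; eauto.
  - intros [x Hx] H; eauto.
Qed.
Lemma rand_eq : rand = and.
Proof.
  extensionality p; extensionality q; apply propositional_extensionality; unfold rand; split; [|tauto].
  intros H; apply NNPP; tauto.
Qed.
Lemma ror_eq : ror = or.
Proof.
  extensionality p; extensionality q; apply propositional_extensionality; unfold ror; split; [|tauto].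
  intros H; apply NNPP; tauto.
Qed.

Section C.
Context {M : Type} (E : M -> M -> Prop) (e : nat -> M).
Lemma sat1a : sat E e ((max_card bounding e_const ≺ non (seqs omega2) (M_ideal omega2 ED)) 0)
  = Stmt1a E (@ex M) and or.
Proof. rewrite <- rex_eq, <- rand_eq, <- ror_eq. reflexivity. Qed.
Lemma sat1b : sat E e ((cov (seqs omega2) (M_ideal omega2 ED) ≺ min_card dominating v_const) 0)
  = Stmt1b E (@ex M) and or.
Proof. rewrite <- rex_eq, <- rand_eq, <- ror_eq. reflexivity. Qed.
Lemma sat2a : sat E e ((non (seqs omega2) (M_ideal omega2 FinFin)
        ≺ non (seqs Delta) (K_ideal Delta EDfin)) 0)
  = Stmt2a E (@ex M) and or.
Proof. rewrite <- rex_eq, <- rand_eq, <- ror_eq. reflexivity. Qed.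
Lemma sat2b : sat E e ((cov (seqs Delta) (K_ideal Delta EDfin)
        ≺ cov (seqs omega2) (M_ideal omega2 FinFin)) 0)
  = Stmt2b E (@ex M) and or.
Proof. rewrite <- rex_eq, <- rand_eq, <- ror_eq. reflexivity. Qed.
Lemma sat3a : sat E e ((∀ b, bound_fun b ∧ increasing b ⇒
        max_card bounding (e_const_b b)
          ≺ non (seqs Delta) (K_ideal Delta EDfin)) 0)
  = Stmt3a E (@ex M) and or.
Proof. rewrite <- rex_eq, <- rand_eq, <- ror_eq. reflexivity. Qed.
Lemma sat3b : sat E e ((∀ b, bound_fun b ∧ increasing b ⇒
        cov (seqs Delta) (K_ideal Delta EDfin)
          ≺ min_card dominating (v_const_b b)) 0)
  = Stmt3b E (@ex M) and or.
Proof. rewrite <- rex_eq, <- rand_eq, <- ror_eq. reflexivity. Qed.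
End C.

(** * Soundness and definability *)

Section Soundness.
Context {M : Type} (E : M -> M -> Prop).

Lemma sat_ext p : forall e e', (forall i, e i = e' i) -> sat E e p <-> sat E e' p.
Proof.
  induction p; simpl; intros e e' H; rewrite ?H; try tauto.
  - rewrite (IHp1 e e'), (IHp2 e e') by auto; tauto.
  - split; intros Hx x; eapply IHp; try apply (Hx x); intros [|i]; simpl; auto.
Qed.

Lemma sat_ren p : forall r e, sat E e (ren r p) <-> sat E (fun i => e (r i)) p.
Proof.
  induction p; simpl; intros r e; try tauto.
  - rewrite IHp1, IHp2; tauto.
  - split; intros H x; specialize (H x); [apply IHp in H|apply IHp];
      (eapply sat_ext; [|exact H]); intros [|i]; reflexivity.
Qed.

Lemma sat_inst p y e : sat E e (inst y p) <-> sat E (scons (e y) e) p.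
Proof. unfold inst; rewrite sat_ren; apply sat_ext; intros [|i]; reflexivity. Qed.

Lemma soundness G p : prv G p -> forall e, (forall q, In q G -> sat E e q) -> sat E e p.
Proof.
  induction 1; intros e He.
  - auto.
  - intros Hp; apply IHprv; intros r [<-|Hr]; auto.
  - apply (IHprv1 e He), IHprv2, He.
  - apply NNPP; intros Hn; apply (IHprv e); intros q [<-|Hq]; auto.
  - intros x; apply IHprv; intros q Hq; apply in_map_iff in Hq as [r [<- Hr]].
    apply sat_ren; apply (He r Hr).
  - apply sat_inst, (IHprv e He).
  - reflexivity.
  - apply sat_inst; specialize (IHprv1 e He); simpl in IHprv1; rewrite <- IHprv1.
    apply sat_inst, (IHprv2 e He).
Qed.

Lemma consistent_of_model (T : theory) (x : M) :
  (forall q e, T q -> sat E e q) -> consistent T.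
Proof. intros H [G [HG Hp]]; exact (soundness _ _ Hp (fun _ => x) (fun q Hq => H q _ (HG q Hq))). Qed.
End Soundness.

(* Even variables carry the arguments of a definable predicate, odd variables its parameters. *)
Definition mix {M} (r pe : nat -> M) (i : nat) : M :=
  if Nat.even i then r (Nat.div2 i) else pe (Nat.div2 i).

Lemma mix_even {M} (r pe : nat -> M) i : mix r pe (2 * i) = r i.
Proof. unfold mix; rewrite Nat.even_even, Nat.div2_double; reflexivity. Qed.
Lemma mix_odd {M} (r pe : nat -> M) i : mix r pe (S (2 * i)) = pe i.
Proof.
  unfold mix; rewrite Nat.even_succ, <- Nat.negb_even, Nat.even_even, Nat.div2_succ_double.
  reflexivity.
Qed.
Lemma parity_split i : (exists k, i = 2 * k) \/ (exists k, i = S (2 * k)).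
Proof. destruct (Nat.Even_or_Odd i) as [[k ->]|[k ->]]; [left|right]; exists k; lia. Qed.
Definition remix (f g : nat -> nat) (i : nat) : nat :=
  if Nat.even i then f (Nat.div2 i) else g (Nat.div2 i).
Lemma remix_even f g i : remix f g (2 * i) = f i. Proof. exact (mix_even f g i). Qed.
Lemma remix_odd f g i : remix f g (S (2 * i)) = g i. Proof. exact (mix_odd f g i). Qed.

Section Definability.
Context {M : Type} (E : M -> M -> Prop) (m0 : M).

(** Definability with parameters. The predicate takes a whole environment of arguments, so that
    passing under a quantifier is a shift of the environment. *)
Definition D (Q : (nat -> M) -> Prop) : Prop :=
  exists p pe, forall r, sat E (mix r pe) p <-> Q r.
Definition V (t : (nat -> M) -> M) : Prop :=
  exists i pe, forall r, t r = mix r pe i.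

Lemma V_var k : V (fun r => r k).
Proof. exists (2 * k), (fun _ => m0); intros r; rewrite mix_even; reflexivity. Qed.
Lemma V_const a : V (fun r => a).
Proof. exists 1, (fun _ => a); intros r; reflexivity. Qed.

(** Two definitions are combined over the joint parameters [mix p q]: both renamings fix the
    argument variables, and they send the parameters of the first definition to the even places and
    those of the second to the odd ones. *)
Definition lsh := remix (fun k => 2 * k) (fun k => S (2 * (2 * k))).
Definition rsh := remix (fun k => 2 * k) (fun k => S (2 * S (2 * k))).
Lemma mix_lsh (r p q : nat -> M) i : mix r (mix p q) (lsh i) = mix r p i.
Proof.
  unfold lsh; destruct (parity_split i) as [[k ->]|[k ->]];
    rewrite ?remix_even, ?remix_odd, ?mix_even, ?mix_odd, ?mix_even; reflexivity.
Qed.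
Lemma mix_rsh (r p q : nat -> M) i : mix r (mix p q) (rsh i) = mix r q i.
Proof.
  unfold rsh; destruct (parity_split i) as [[k ->]|[k ->]];
    rewrite ?remix_even, ?remix_odd, ?mix_even, ?mix_odd, ?mix_odd; reflexivity.
Qed.

Lemma D_mem s t : V s -> V t -> D (fun r => E (s r) (t r)).
Proof.
  clear m0; intros [i [p Hp]] [j [q Hq]]; exists (Mem (lsh i) (rsh j)), (mix p q); intros r; simpl.
  rewrite mix_lsh, mix_rsh, Hp, Hq; tauto.
Qed.
Lemma D_eq s t : V s -> V t -> D (fun r => s r = t r).
Proof.
  clear m0; intros [i [p Hp]] [j [q Hq]]; exists (Equ (lsh i) (rsh j)), (mix p q); intros r; simpl.
  rewrite mix_lsh, mix_rsh, Hp, Hq; tauto.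
Qed.
Lemma D_False : D (fun r => False).
Proof. exists Bot, (fun _ => m0); intros r; simpl; tauto. Qed.
Lemma D_imp P Q : D P -> D Q -> D (fun r => P r -> Q r).
Proof.
  clear m0; intros [i [p Hp]] [j [q Hq]]; exists (Imp (ren lsh i) (ren rsh j)), (mix p q); intros r; simpl.
  rewrite !sat_ren, <- Hp, <- Hq.
  rewrite (sat_ext E i _ (mix r p)), (sat_ext E j _ (mix r q));
    intros; rewrite ?mix_lsh, ?mix_rsh; tauto.
Qed.
Lemma D_all (Q : M -> (nat -> M) -> Prop) :
  D (fun r => Q (r 0) (fun i => r (S i))) -> D (fun r => forall x, Q x r).
Proof.
  intros [p [q H]].
  (* Argument 0 becomes the bound variable, argument [k + 1] becomes argument [k] seen from under
     the quantifier, and every parameter moves up by one. *)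
  exists (All (ren (remix (fun k => match k with 0 => 0 | S k => S (2 * k) end) (fun k => S (S (2 * k)))) p)), q.
  intros r; cbn [sat]; split; intros Hx x; specialize (Hx x).
  - apply (H (scons x r)); rewrite sat_ren in Hx; eapply sat_ext; [|exact Hx].
    intros i; destruct (parity_split i) as [[[|k] ->]|[k ->]]; rewrite ?remix_even, ?remix_odd, ?mix_even, ?mix_odd; cbn [scons]; rewrite ?mix_even, ?mix_odd; reflexivity.
  - apply sat_ren; apply (H (scons x r)) in Hx; eapply sat_ext; [|exact Hx].
    intros i; destruct (parity_split i) as [[[|k] ->]|[k ->]]; rewrite ?remix_even, ?remix_odd, ?mix_even, ?mix_odd; cbn [scons]; rewrite ?mix_even, ?mix_odd; reflexivity.
Qed.
Lemma D_equiv P Q : (forall r, P r <-> Q r) -> D P -> D Q.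
Proof. intros H [p [q Hp]]; exists p, q; intros r; rewrite Hp; auto. Qed.
Lemma D_not P : D P -> D (fun r => ~ P r).
Proof. intros H; exact (D_imp _ _ H D_False). Qed.
Lemma D_and P Q : D P -> D Q -> D (fun r => P r /\ Q r).
Proof.
  intros H1 H2; eapply D_equiv; [|apply D_not, (D_imp _ _ H1 (D_not _ H2))].
  intros r; simpl; tauto.
Qed.
Lemma D_or P Q : D P -> D Q -> D (fun r => P r \/ Q r).
Proof.
  intros H1 H2; eapply D_equiv; [|apply (D_imp _ _ (D_not _ H1) H2)].
  intros r; simpl; tauto.
Qed.
Lemma D_iff P Q : D P -> D Q -> D (fun r => P r <-> Q r).
Proof. intros H1 H2; apply D_and; apply D_imp; auto. Qed.
Lemma D_ex (Q : M -> (nat -> M) -> Prop) :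
  D (fun r => Q (r 0) (fun i => r (S i))) -> D (fun r => exists x, Q x r).
Proof.
  intros H; eapply D_equiv; [|apply D_not, (D_all (fun x r => ~ Q x r)), D_not, H].
  intros r; simpl; split; [|firstorder].
  intros H1; apply NNPP; intros H2; apply H1; intros x Hx; apply H2; eauto.
Qed.

Lemma D_R2 (R : M -> M -> Prop) : D (fun r => R (r 1) (r 0)) -> forall s t, V s -> V t -> D (fun r => R (s r) (t r)).
Proof.
  clear m0; intros [p [pe H]] s t [i [ps Hs]] [j [pt Ht]].
  exists (ren (remix (fun k => match k with 0 => lsh j | _ => rsh (lsh i) end) (fun k => rsh (rsh (S (2 * k))))) p),
    (mix pt (mix ps pe)); intros r.
  rewrite sat_ren, Hs, Ht, <- (H (fun k => match k with 0 => mix r pt j | _ => mix r ps i end)).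
  apply sat_ext; intros k; destruct (parity_split k) as [[[|n] ->]|[n ->]];
    rewrite ?remix_even, ?remix_odd, ?mix_rsh, ?mix_lsh, ?mix_even, ?mix_odd; auto.
Qed.
Lemma D_R1 (Q : M -> Prop) : D (fun r => Q (r 0)) -> forall t, V t -> D (fun r => Q (t r)).
Proof. intros H t Ht; exact (D_R2 (fun _ => Q) H t t Ht Ht). Qed.
End Definability.

#[global] Opaque D V.

(** Definability by recursion on the shape of the predicate. A predicate that is not unfolded must
    be definable by a hypothesis, which is why such facts are asserted before [dfn] is called. *)
Ltac dfn1 :=
  first
  [ apply D_and | apply D_or | apply D_not | apply D_iff
  | apply D_ex | apply D_all | apply D_imp | apply D_False; assumption
  | apply D_mem; [first [apply V_const | apply V_var; assumption] .. ]
  | apply D_eq; [first [apply V_const | apply V_var; assumption] .. ] | assumption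
  | match goal with H : D ?E (fun r => ?R (r 1) (r 0)) |- D ?E (fun r => ?R _ _) => apply (D_R2 E R H) end;
    [first [apply V_const | apply V_var; assumption] .. ]
  | match goal with H : D ?E (fun r => ?R (r 0)) |- D ?E (fun r => ?R _) => apply (D_R1 E R H) end;
    [first [apply V_const | apply V_var; assumption] .. ] ]; cbv beta.
Ltac dfn := unfold Sub, Empty, Upair, Union, Power, Inter, Succ, Inductive_, Omega, Opair, Prod,
  App, Func, Bij, Equinum, Restr, Funs, FinSeqs, Transitive, Ordinal, Leq, Card, AlmostAll, Baire,
  LeqStar, MSet, KSet, Sect, Guesses, Predicts2, InProd, setof, seqv; cbv beta; repeat dfn1.

(** * Set theory in a model *)

(* Only models with standard natural numbers are needed: [om] consists of the values [num n]. *)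
Record model {M : Type} (E : M -> M -> Prop) (om : M) (num : nat -> M) : Prop := {
  m_ext : forall x y, (forall z, E z x <-> E z y) -> x = y;
  m_pair : forall x y, exists z, Upair E and or x y z;
  m_union : forall a, exists u, Union E (@ex M) and a u;
  m_power : forall a, exists u, Power E and a u;
  m_sep : forall p e a, exists s, forall x, E x s <-> E x a /\ sat E (scons x e) p;
  m_found : forall x, (exists y, E y x) -> exists y, E y x /\ forall z, E z x -> ~ E z y;
  m_bij : forall a, exists k, Ordinal E and k /\ Equinum E (@ex M) and or k a;
  m_om : forall z, E z om <-> exists n, z = num n;
  m_num : forall z n, E z (num n) <-> exists m, m < n /\ z = num m }.

Section TM.
Context {M : Type} (E : M -> M -> Prop) (om : M) (num : nat -> M) (HM : model E om num).
Local Notation cUpair := (Upair E and or).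
Local Notation cOpair := (Opair E (@ex M) and or).
Local Notation cApp := (App E (@ex M) and or).
Local Notation cFunc := (Func E (@ex M) and or).
Local Notation cBij := (Bij E (@ex M) and or).
Local Notation cEquinum := (Equinum E (@ex M) and or).
Local Notation cOrdinal := (Ordinal E and).
Local Notation cCard := (Card E (@ex M) and or).
Local Notation cLeq := (Leq E or).
Local Notation cLeastSize := (LeastSize E (@ex M) and or).
Local Notation DM := (D E).
Local Notation EXM := (@ex M).

Lemma setof_unique P s t : setof E and P s -> setof E and P t -> s = t.
Proof. intros H H'; apply (m_ext _ _ _ HM); intros z; destruct (H z), (H' z); tauto. Qed.

(** This removes the relational terms of the formulas: once a term is known to have the single value
    [c], its [LET] is a substitution. *)
Lemma let_iff (T : M -> Prop) (p : M -> Prop) c :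
  (forall x, T x <-> x = c) -> (exists x, T x /\ p x) <-> p c.
Proof.
  intros H; split.
  - intros [x [Hx Hp]]; apply H in Hx; subst; auto.
  - intros Hp; exists c; split; [apply H; auto|auto].
Qed.

Lemma sep_ex a (Q : M -> Prop) : DM (fun r => Q (r 0)) -> exists s, forall x, E x s <-> E x a /\ Q x.
Proof.
  Transparent D. intros [p [pe H]]. Opaque D.
  (* Separation supplies the tested element as variable 0, so all argument variables are sent there
     and the parameters follow it. *)
  destruct (m_sep _ _ _ HM (ren (remix (fun _ => 0) S) p) pe a) as [s Hs]; exists s; intros x.
  rewrite (Hs x), sat_ren, <- (H (fun _ => x)).
  rewrite (sat_ext E p _ (mix (fun _ => x) pe)); [tauto|].
  intros i; destruct (parity_split i) as [[k ->]|[k ->]];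
    rewrite ?remix_even, ?remix_odd, ?mix_even, ?mix_odd; reflexivity.
Qed.

Definition sp a Q := epsilon (inhabits om) (fun s => forall x, E x s <-> E x a /\ Q x).
Lemma sp_spec a Q : DM (fun r => Q (r 0)) -> forall x, E x (sp a Q) <-> E x a /\ Q x.
Proof. intros H; apply (epsilon_spec (inhabits om) (fun s => forall x, E x s <-> E x a /\ Q x)), sep_ex, H. Qed.

Definition upr x y := epsilon (inhabits om) (cUpair x y).
Lemma upr_spec x y z : E z (upr x y) <-> z = x \/ z = y.
Proof. exact (epsilon_spec (inhabits om) (cUpair x y) (m_pair _ _ _ HM x y) z). Qed.
Definition un a := epsilon (inhabits om) (Union E (@ex M) and a).
Lemma un_spec a z : E z (un a) <-> exists y, E y a /\ E z y.
Proof. exact (epsilon_spec (inhabits om) (Union E (@ex M) and a) (m_union _ _ _ HM a) z). Qed.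
Definition pow a := epsilon (inhabits om) (Power E and a).
Lemma pow_spec a z : E z (pow a) <-> Sub E z a.
Proof. exact (epsilon_spec (inhabits om) (Power E and a) (m_power _ _ _ HM a) z). Qed.

Lemma Upair_iff x y u : cUpair x y u <-> u = upr x y.
Proof.
  split; [|intros ->; exact (upr_spec x y)].
  intros H; exact (setof_unique _ _ _ H (upr_spec x y)).
Qed.
Definition pr x y := upr (upr x x) (upr x y).
Lemma Opair_iff x y p : cOpair x y p <-> p = pr x y.
Proof.
  unfold Opair; rewrite (let_iff _ _ (upr x x)) by apply Upair_iff.
  rewrite (let_iff _ _ (upr x y)) by apply Upair_iff. apply Upair_iff.
Qed.
Lemma upr_eq x y u : upr x x = upr y u -> x = y /\ x = u.
Proof.
  intros H; split; symmetry.
  - assert (H1 : E y (upr x x)) by (rewrite H; apply upr_spec; auto); apply upr_spec in H1; tauto.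
  - assert (H1 : E u (upr x x)) by (rewrite H; apply upr_spec; auto); apply upr_spec in H1; tauto.
Qed.
Lemma pr_inj x y x' y' : pr x y = pr x' y' -> x = x' /\ y = y'.
Proof.
  unfold pr; intros H.
  assert (x = x') as <-.
  { assert (H1 : E (upr x x) (upr (upr x' x') (upr x' y'))) by (rewrite <- H; apply upr_spec; auto).
    apply upr_spec in H1 as [H1|H1]; apply upr_eq in H1; tauto. }
  split; auto.
  assert (H1 : E (upr x y) (upr (upr x x) (upr x y'))) by (rewrite <- H; apply upr_spec; auto).
  assert (H2 : E (upr x y') (upr (upr x x) (upr x y))) by (rewrite H; apply upr_spec; auto).
  apply upr_spec in H1 as [H1|H1]; apply upr_spec in H2 as [H2|H2].
  - symmetry in H1, H2; apply upr_eq in H1, H2; intuition congruence.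
  - symmetry in H1; apply upr_eq in H1 as [_ <-]. apply upr_eq in H2 as [H3 H2] || symmetry in H2; apply upr_eq in H2; intuition congruence.
  - symmetry in H2; apply upr_eq in H2 as [_ <-]. symmetry in H1; apply upr_eq in H1; intuition congruence.
  - assert (E y (upr x y')) by (rewrite <- H1; apply upr_spec; auto).
    assert (E y' (upr x y)) by (rewrite H1; apply upr_spec; auto).
    apply upr_spec in H0, H3; intuition congruence.
Qed.

Lemma App_iff f x y : cApp f x y <-> E (pr x y) f.
Proof.
  unfold App; split.
  - intros [p [Hp H]]; apply Opair_iff in H; subst; auto.
  - intros H; exists (pr x y); split; auto; apply Opair_iff; auto.
Qed.

Definition pd a b := sp (pow (pow (un (upr a b)))) (fun z => exists x, E x a /\ exists y, E y b /\ cOpair x y z).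
Lemma pd_spec a b z : E z (pd a b) <-> exists x y, E x a /\ E y b /\ z = pr x y.
Proof.
  unfold pd; rewrite sp_spec by dfn; split.
  - intros [_ [x [Hx [y [Hy Hz]]]]]; apply Opair_iff in Hz; eauto.
  - intros [x [y [Hx [Hy ->]]]]; split; [|exists x; split; auto; exists y; split; auto; apply Opair_iff; auto].
    apply pow_spec; intros u Hu; apply pow_spec; intros v Hv; apply un_spec.
    assert (v = x \/ v = y) as [->| ->].
    { apply upr_spec in Hu as [->| ->]; apply upr_spec in Hv; tauto. }
    + exists a; split; auto; apply upr_spec; auto.
    + exists b; split; auto; apply upr_spec; auto.
Qed.
Lemma pd_pr a b x y : E (pr x y) (pd a b) <-> E x a /\ E y b.
Proof.
  rewrite pd_spec; split; [|intros []; eauto].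
  intros [x' [y' [Hx [Hy H]]]]; apply pr_inj in H as [-> ->]; auto.
Qed.
Lemma Prod_iff a b z : Prod E (@ex M) and or a b z <-> z = pd a b.
Proof.
  assert (H : Prod E (@ex M) and or a b (pd a b)).
  { intros w; split.
    - intros Hw; apply pd_spec in Hw as [x [y [Hx [Hy ->]]]]; exists x; split; auto; exists y; split; auto; apply Opair_iff; auto.
    - intros [x [Hx [y [Hy Hw]]]]; apply Opair_iff in Hw as ->; apply pd_pr; auto. }
  split; [intros H'; exact (setof_unique _ _ _ H' H)|intros ->; exact H].
Qed.

Lemma Func_iff f a b : cFunc f a b <->
  (forall z, E z f -> exists x y, E x a /\ E y b /\ z = pr x y) /\
  (forall x, E x a -> exists y, E y b /\ forall z, E (pr x z) f <-> z = y).
Proof.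
  unfold Func; split; intros [H1 H2]; split.
  - intros z Hz; destruct (H1 z Hz) as [x [Hx [y [Hy H]]]]; apply Opair_iff in H; eauto.
  - intros x Hx; destruct (H2 x Hx) as [y [Hy H]]; exists y; split; auto.
    intros z; rewrite <- App_iff; apply H.
  - intros z Hz; destruct (H1 z Hz) as [x [y [Hx [Hy ->]]]]; exists x; split; auto; exists y; split; auto; apply Opair_iff; auto.
  - intros x Hx; destruct (H2 x Hx) as [y [Hy H]]; exists y; split; auto.
    intros z; unfold seqv; rewrite App_iff; apply H.
Qed.

Definition ap f x := epsilon (inhabits om) (fun y => E (pr x y) f).
Lemma ap_spec f a b x : cFunc f a b -> E x a -> E (ap f x) b /\ forall z, E (pr x z) f <-> z = ap f x.
Proof.
  intros H Hx; apply Func_iff in H as [_ H]; destruct (H x Hx) as [y [Hy H']].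
  assert (ap f x = y) as ->; auto.
  apply H'. unfold ap. apply (epsilon_spec (inhabits om) (fun y => E (pr x y) f)). exists y; apply H'; auto.
Qed.
Lemma func_pr f a b x y : cFunc f a b -> E (pr x y) f -> E x a /\ E y b /\ y = ap f x.
Proof.
  intros H Hp; destruct (proj1 (Func_iff _ _ _) H) as [H1 _].
  destruct (H1 _ Hp) as [x' [y' [Hx [Hy He]]]]; apply pr_inj in He as [<- <-].
  destruct (ap_spec f a b x H Hx) as [_ H3]; split; auto; split; auto; apply H3; auto.
Qed.
Lemma func_ap f a b x : cFunc f a b -> E x a -> E (pr x (ap f x)) f.
Proof. intros H Hx; apply (ap_spec f a b x H Hx); auto. Qed.
Lemma App_let f a b x (p : M -> Prop) : cFunc f a b -> E x a ->
  (exists v, cApp f x v /\ p v) <-> p (ap f x).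
Proof. intros H Hx; apply (let_iff (cApp f x) p); intros y; rewrite App_iff; apply (ap_spec f a b x H Hx). Qed.
Lemma func_ext f g a b c : cFunc f a b -> cFunc g a c -> (forall x, E x a -> ap f x = ap g x) -> f = g.
Proof.
  intros Hf Hg H; apply (m_ext _ _ _ HM); intros z; split; intros Hz.
  - destruct (proj1 (proj1 (Func_iff _ _ _) Hf) z Hz) as [x [y [Hx [_ ->]]]].
    apply (func_pr _ _ _ _ _ Hf) in Hz as [_ [_ ->]]; rewrite H by auto; eapply func_ap; eauto.
  - destruct (proj1 (proj1 (Func_iff _ _ _) Hg) z Hz) as [x [y [Hx [_ ->]]]].
    apply (func_pr _ _ _ _ _ Hg) in Hz as [_ [_ ->]]; rewrite <- H by auto; eapply func_ap; eauto.
Qed.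

Definition lam a b (R : M -> M -> Prop) := sp (pd a b) (fun z => exists x y, cOpair x y z /\ R x y).
Lemma lam_spec a b R x y : DM (fun r => R (r 1) (r 0)) ->
  E (pr x y) (lam a b R) <-> E x a /\ E y b /\ R x y.
Proof.
  intros HR; unfold lam; rewrite sp_spec by dfn; rewrite pd_pr; split.
  - intros [[Hx Hy] [x' [y' [H HR']]]]; apply Opair_iff in H; apply pr_inj in H as [<- <-]; auto.
  - intros [Hx [Hy H]]; split; auto; exists x, y; split; auto; apply Opair_iff; auto.
Qed.
Lemma lam_func a b R : DM (fun r => R (r 1) (r 0)) ->
  (forall x, E x a -> exists y, E y b /\ R x y) ->
  (forall x y y', E x a -> E y b -> E y' b -> R x y -> R x y' -> y = y') ->
  cFunc (lam a b R) a b /\ forall x, E x a -> R x (ap (lam a b R) x).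
Proof.
  intros HR Ht Hf; assert (H : cFunc (lam a b R) a b).
  { apply Func_iff; split.
    - intros z Hz; unfold lam in Hz; rewrite sp_spec in Hz by dfn; destruct Hz as [Hz _].
      apply pd_spec in Hz as [x [y [Hx [Hy ->]]]]; eauto.
    - intros x Hx; destruct (Ht x Hx) as [y [Hy Hxy]]; exists y; split; auto.
      intros z; rewrite lam_spec by auto; split; [intros [_ [Hz Hz']]; eauto|intros ->; auto]. }
  split; auto; intros x Hx; pose proof (func_ap _ _ _ x H Hx) as H1.
  apply lam_spec in H1; tauto.
Qed.

Definition fs a b := sp (pow (pd a b)) (fun f => cFunc f a b).
Lemma fs_spec a b f : E f (fs a b) <-> cFunc f a b.
Proof.
  unfold fs; rewrite sp_spec by dfn; split; [tauto|]; intros H; split; auto.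
  apply pow_spec; intros z Hz; apply (proj1 (Func_iff _ _ _)) in H as [H _].
  destruct (H z Hz) as [x [y [Hx [Hy ->]]]]; apply pd_pr; auto.
Qed.
Lemma Funs_iff a b s : Funs E (@ex M) and or a b s <-> s = fs a b.
Proof.
  split; [|intros ->; exact (fs_spec a b)].
  intros H; exact (setof_unique _ _ _ H (fs_spec a b)).
Qed.

Lemma E_irrefl x : ~ E x x.
Proof.
  intros H; destruct (m_found _ _ _ HM (upr x x)) as [y [Hy H1]]; [exists x; apply upr_spec; auto|].
  apply upr_spec in Hy as Hy'; assert (y = x) as -> by tauto. exact (H1 x Hy H).
Qed.

Lemma ord_elem a x : cOrdinal a -> E x a -> cOrdinal x.
Proof. intros [H1 H2] Hx; split; [exact (H2 x Hx)|]; intros y Hy; apply H2; exact (H1 x Hx y Hy). Qed.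

Definition sc a := un (upr a (upr a a)).
Lemma sc_spec a z : E z (sc a) <-> E z a \/ z = a.
Proof.
  unfold sc; rewrite un_spec; split.
  - intros [y [Hy Hz]]; apply upr_spec in Hy as [->| ->]; auto; apply upr_spec in Hz; tauto.
  - intros [H| ->]; [exists a|exists (upr a a)]; split; rewrite ?upr_spec; auto.
Qed.
Lemma Succ_iff x s : Succ E and or x s <-> s = sc x.
Proof. split; [|intros ->; exact (sc_spec x)]. intros H; exact (setof_unique _ _ _ H (sc_spec x)). Qed.

Lemma minimal a (Q : M -> Prop) x : DM (fun r => Q (r 0)) -> E x a -> Q x ->
  exists y, E y a /\ Q y /\ forall z, E z y -> E z a -> ~ Q z.
Proof.
  intros HD Hx HQ; destruct (m_found _ _ _ HM (sp a Q)) as [y [Hy H]].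
  - exists x; apply sp_spec; auto.
  - apply sp_spec in Hy as [Hy HQy]; auto. exists y; split; auto; split; auto.
    intros z Hz Hza HQz; apply (H z); auto; apply sp_spec; auto.
Qed.

(** Take the least [x] in [sc a] not comparable with all of [sc b], then the least [y] in [sc b] not
    comparable with [x]; minimality gives the two the same elements. Minimal elements are taken
    inside sets, hence the successors and the definability of comparability. *)
Lemma ord_trich a b : cOrdinal a -> cOrdinal b -> E a b \/ a = b \/ E b a.
Proof.
  intros Ha Hb. set (C := fun x y => E x y \/ x = y \/ E y x).
  enough (forall x, E x (sc a) -> forall y, E y (sc b) -> C x y) as H
    by (apply H; apply sc_spec; auto).
  assert (Ta : forall z, E z (sc a) -> forall w, E w z -> E w (sc a)).
  { intros z Hz w Hw; apply sc_spec; left; apply sc_spec in Hz as [Hz| ->]; auto; exact (proj1 Ha z Hz w Hw). }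
  assert (Tb : forall z, E z (sc b) -> forall w, E w z -> E w (sc b)).
  { intros z Hz w Hw; apply sc_spec; left; apply sc_spec in Hz as [Hz| ->]; auto; exact (proj1 Hb z Hz w Hw). }
  assert (Oa : forall z, E z (sc a) -> cOrdinal z).
  { intros z Hz; apply sc_spec in Hz as [Hz| ->]; auto; exact (ord_elem _ _ Ha Hz). }
  assert (Ob : forall z, E z (sc b) -> cOrdinal z).
  { intros z Hz; apply sc_spec in Hz as [Hz| ->]; auto; exact (ord_elem _ _ Hb Hz). }
  intros x0 Hx0; apply NNPP; intros Hn0.
  destruct (minimal (sc a) (fun x => ~ forall y, E y (sc b) -> C x y) x0) as [x [Hx [Hn Hmx]]];
    [unfold C; dfn|auto..].
  apply not_all_ex_not in Hn as [y0 Hn]; apply imply_to_and in Hn as [Hy0 Hn].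
  destruct (minimal (sc b) (fun y => ~ C x y) y0) as [y [Hy [HC Hmy]]]; [unfold C; dfn|auto..].
  apply HC; right; left; apply (m_ext _ _ _ HM); intros z; split; intros Hz.
  - assert (H : C z y) by (apply NNPP; intros H1; apply (Hmx z Hz); eauto).
    destruct H as [H|[->|H]]; auto; exfalso; apply HC; right; right; auto.
    exact (proj1 (Oa x Hx) z Hz y H).
  - assert (H : C x z) by (apply NNPP; intros H1; apply (Hmy z Hz); eauto).
    destruct H as [H|[->|H]]; auto; exfalso; apply HC; left; auto.
    exact (proj1 (Ob y Hy) z Hz x H).
Qed.

Lemma ord_least (Q : M -> Prop) k : DM (fun r => Q (r 0)) -> cOrdinal k -> Q k ->
  exists k, cOrdinal k /\ Q k /\ forall l, cOrdinal l -> Q l -> cLeq k l.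
Proof.
  intros HD Hk HQ; destruct (minimal (sc k) Q k) as [m [Hm [HQm H]]]; auto; [apply sc_spec; auto|].
  assert (Om : cOrdinal m) by (apply sc_spec in Hm as [Hm| ->]; auto; eapply ord_elem; eauto).
  exists m; split; auto; split; auto; intros l Hl HQl.
  destruct (ord_trich m l Om Hl) as [H1|[H1|H1]]; [left|right|]; auto.
  exfalso; apply (H l); auto; apply sc_spec; left.
  apply sc_spec in Hm as [Hm| ->]; auto; exact (proj1 Hk m Hm l H1).
Qed.

Definition bijR (R : M -> M -> Prop) a b :=
  (forall x y, R x y -> E x a /\ E y b) /\
  (forall x, E x a -> exists y, R x y) /\ (forall y, E y b -> exists x, R x y) /\
  (forall x y y', R x y -> R x y' -> y = y') /\ (forall x x' y, R x y -> R x' y -> x = x').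

Lemma Bij_iff f a b : cBij f a b <->
  (forall z, E z f -> exists x y, z = pr x y) /\ bijR (fun x y => E (pr x y) f) a b.
Proof.
  unfold Bij; split.
  - intros [H1 H2]; pose proof (proj1 (Func_iff _ _ _) H1) as [H3 H4]; split; [|split; [|split; [|split; [|split]]]].
    + intros z Hz; destruct (H3 z Hz) as [x [y [_ [_ H]]]]; eauto.
    + intros x y H; apply (func_pr _ _ _ _ _ H1) in H; tauto.
    + intros x Hx; exists (ap f x); eapply func_ap; eauto.
    + intros y Hy; destruct (H2 y Hy) as [x [Hx H]]; exists x; apply App_iff, H; auto.
    + intros x y y' Hy Hy'; apply (func_pr _ _ _ _ _ H1) in Hy, Hy'; intuition congruence.
    + intros x x' y Hx Hx'; destruct (H2 y) as [x0 [Hx0 H]]; [apply (func_pr _ _ _ _ _ H1) in Hx; tauto|].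
      rewrite (proj1 (H x)), (proj1 (H x')) by (apply App_iff; auto); auto.
  - intros [H0 [H1 [H2 [H3 [H4 H5]]]]]; split.
    + apply Func_iff; split.
      * intros z Hz; destruct (H0 z Hz) as [x [y ->]]; apply H1 in Hz as Hz'; exists x, y; tauto.
      * intros x Hx; destruct (H2 x Hx) as [y Hy]; exists y; split; [apply H1 in Hy; tauto|].
        intros z; split; [eauto|intros ->; auto].
    + intros y Hy; destruct (H3 y Hy) as [x Hx]; exists x; split; [apply H1 in Hx; tauto|].
      intros z; split; [intros Hz; apply App_iff in Hz; eauto|intros ->; apply App_iff; auto].
Qed.

Lemma equinum_elim a b : cEquinum a b -> exists f, bijR (fun x y => E (pr x y) f) a b.
Proof. intros [f H]; apply Bij_iff in H; exists f; tauto. Qed.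
(** Equivalent to membership of [pr x y], but written with the formula for pairs: [pr] is chosen by
    epsilon, so this is the form whose definability can be read off. *)
Definition rel_of f x y := exists z, cOpair x y z /\ E z f.
Lemma rel_of_iff f x y : rel_of f x y <-> E (pr x y) f.
Proof. unfold rel_of; apply (let_iff (cOpair x y) (fun z => E z f)); intros z; apply Opair_iff. Qed.
Lemma bijR_eq R S a b : (forall x y, R x y <-> S x y) -> bijR R a b -> bijR S a b.
Proof.
  intros H; unfold bijR; intros [H1 [H2 [H3 [H4 H5]]]]; repeat split.
  - apply H in H0; apply H1 in H0; tauto.
  - apply H in H0; apply H1 in H0; tauto.
  - intros x Hx; destruct (H2 x Hx) as [y Hy]; exists y; apply H; auto.
  - intros x Hx; destruct (H3 x Hx) as [y Hy]; exists y; apply H; auto.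
  - intros x y y' Hy Hy'; apply H in Hy, Hy'; eauto.
  - intros x y y' Hy Hy'; apply H in Hy, Hy'; eauto.
Qed.
Lemma equinum_elim' a b : cEquinum a b -> exists f, bijR (rel_of f) a b.
Proof.
  intros H; apply equinum_elim in H as [f H]; exists f; eapply bijR_eq; [|exact H].
  intros x y; symmetry; apply rel_of_iff.
Qed.

Lemma card_ex a : exists k, cCard a k.
Proof.
  destruct (m_bij _ _ _ HM a) as [k [Hk Hb]].
  destruct (ord_least (fun k => cEquinum k a) k) as [m [Hm [Hmb H]]]; auto; [dfn|].
  exists m; split; auto; split; auto; intros l Hl Hla.
  destruct (H l); auto; [eapply ord_elem; eauto|..].
  - apply (E_irrefl m). exact (proj1 Hm l Hl m H0).
  - subst; exact (E_irrefl _ Hl).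
Qed.

Lemma least_size_ex (P : M -> Prop) a : DM (fun r => P (r 0)) -> P a -> exists k, cLeastSize P k.
Proof.
  intros HD HP; destruct (card_ex a) as [k Hk].
  assert (HD' : DM (fun r => exists a, P a /\ cCard a (r 0))) by dfn.
  destruct (ord_least (fun k => exists a, P a /\ cCard a k) k) as [m [Hm [Hma H]]].
  - exact HD'.
  - apply Hk.
  - eauto.
  - exists m; split; auto; intros b l [Hb Hl]; apply H; [apply Hl|eauto].
Qed.

Lemma least_size_ord P k : cLeastSize P k -> cOrdinal k.
Proof. intros [[a [_ H]] _]; apply H. Qed.

(** The map is a set of the model and may be partial on [T], so that subsets of images, the empty
    set included, are images as well. *)
Definition img T z := exists f,
  (forall t y y', E t T -> rel_of f t y -> rel_of f t y' -> y = y') /\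
  forall y, E y z -> exists t, E t T /\ rel_of f t y.

Lemma img_intro T z b (R : M -> M -> Prop) : DM (fun r => R (r 1) (r 0)) -> Sub E z b ->
  (forall t y y', E t T -> E y b -> E y' b -> R t y -> R t y' -> y = y') ->
  (forall y, E y z -> exists t, E t T /\ R t y) -> img T z.
Proof.
  intros HD Hb Hf Hs; exists (lam T b R); split.
  - intros t y y' Ht Hy Hy'; apply rel_of_iff, lam_spec in Hy, Hy'; auto; eapply Hf; intuition eauto.
  - intros y Hy; destruct (Hs y Hy) as [t [Ht H]]; exists t; split; auto; apply rel_of_iff, lam_spec; auto.
Qed.

(** Were [l] at most [k], a witness [z] of size [l] would inject into [a], and composing with the
    map from [T] onto [a] would make [z] an image of [T]. *)
Lemma least_size_lt T P Q k l a : P a -> img T a -> (forall z, Q z -> ~ img T z) ->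
  cLeastSize P k -> cLeastSize Q l -> E k l.
Proof.
  intros Ha Hi Hn Hk Hl; destruct (card_ex a) as [k0 Hk0].
  pose proof (proj2 Hk a k0 (conj Ha Hk0)) as Hle.
  destruct (ord_trich k l (least_size_ord _ _ Hk) (least_size_ord _ _ Hl)) as [H|H]; auto.
  exfalso; destruct Hl as [[z [Hz Hlz]] _]; apply (Hn z Hz).
  assert (Hs : Sub E l k0).
  { assert (Hlk : Sub E l k).
    { intros w Hw; destruct H as [->|H]; auto; exact (proj1 (least_size_ord _ _ Hk) l H w Hw). }
    intros w Hw; apply Hlk in Hw; destruct Hle as [Hle| ->]; auto.
    exact (proj1 (proj1 Hk0) k Hle w Hw). }
  destruct Hlz as [_ [Hlz _]], Hk0 as [_ [Hk0 _]].
  apply equinum_elim' in Hlz as [g [G1 [G2 [G3 [G4 G5]]]]]; apply equinum_elim' in Hk0 as [h [H1 [H2 [H3 [H4 H5]]]]].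
  destruct Hi as [f [F1 F2]].
  apply (img_intro T z z (fun t y => exists w, rel_of g w y /\ exists x, rel_of h w x /\ rel_of f t x)).
  - unfold rel_of; dfn.
  - intros w; auto.
  - intros t y y' Ht _ _ [w [Hw [x [Hx Hf]]]] [w' [Hw' [x' [Hx' Hf']]]].
    assert (x = x') as <- by eauto. assert (w = w') as <- by eauto. eauto.
  - intros y Hy; destruct (G3 y Hy) as [w Hw]; destruct (G1 _ _ Hw) as [Hwl _].
    destruct (H2 w (Hs w Hwl)) as [x Hx]; destruct (H1 _ _ Hx) as [_ Hxa].
    destruct (F2 x Hxa) as [t [Ht Hf]]; exists t; split; auto; exists w; split; auto; exists x; auto.
Qed.

(** The value is made unique by taking the element of [Q] with the least index in an enumeration of
    [Q] by an ordinal. *)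
Lemma choice_fun T Q (R : M -> M -> Prop) : DM (fun r => R (r 1) (r 0)) ->
  (forall t, E t T -> exists y, E y Q /\ R t y) ->
  exists f, cFunc f T Q /\ forall t, E t T -> R t (ap f t).
Proof.
  intros HD Ht; destruct (m_bij _ _ _ HM Q) as [k [Hk Hb]].
  apply equinum_elim' in Hb as [g [G1 [G2 [G3 [G4 G5]]]]].
  set (R' := fun t y => R t y /\ exists w, rel_of g w y /\ forall v, E v w -> forall y', rel_of g v y' -> ~ R t y').
  assert (HD' : DM (fun r => R' (r 1) (r 0))) by (unfold R', rel_of; dfn).
  destruct (lam_func T Q R') as [H1 H2]; auto.
  - intros t Ht'; destruct (Ht t Ht') as [y [Hy HR]]; destruct (G3 y Hy) as [w Hw].
    destruct (ord_least (fun w => exists y, rel_of g w y /\ R t y) w) as [v [Hv [[y' [Hy' HR']] Hm]]].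
    + unfold rel_of; dfn.
    + eapply ord_elem; [exact Hk|apply (G1 _ _ Hw)].
    + eauto.
    + exists y'; split; [apply (G1 _ _ Hy')|]; split; auto; exists v; split; auto.
      intros u Hu y'' Hy'' HR''; destruct (Hm u) as [H|H]; eauto.
      * eapply ord_elem; eauto.
      * exact (E_irrefl _ (proj1 Hv u Hu v H)).
      * subst; exact (E_irrefl _ Hu).
  - intros t y y' Ht' Hy Hy' [HR [w [Hw Hm]]] [HR' [w' [Hw' Hm']]].
    assert (Ow : forall w y, rel_of g w y -> cOrdinal w) by (intros; eapply ord_elem; [exact Hk|eapply G1; eauto]).
    destruct (ord_trich w w') as [H|[H|H]]; eauto.
    + exfalso; exact (Hm' w H y Hw HR).
    + subst; eauto.
    + exfalso; exact (Hm w' H y' Hw' HR').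
  - exists (lam T Q R'); split; auto; intros t Ht'; apply (H2 t Ht').
Qed.
Lemma num_om n : E (num n) om.
Proof. apply (m_om _ _ _ HM); eauto. Qed.
Lemma num_inj m n : num m = num n -> m = n.
Proof.
  intros H; destruct (lt_eq_lt_dec m n) as [[Hl|Hl]|Hl]; auto; exfalso; apply (E_irrefl (num m)).
  - rewrite H at 2; apply (m_num _ _ _ HM); eauto.
  - rewrite H at 1; apply (m_num _ _ _ HM); eauto.
Qed.
Lemma num_E m n : E (num m) (num n) <-> m < n.
Proof.
  rewrite (m_num _ _ _ HM); split; [|eauto].
  intros [k [Hk H]]; apply num_inj in H; lia.
Qed.
Lemma Leq_num m n : Leq E or (num m) (num n) <-> m <= n.
Proof.
  unfold Leq; rewrite num_E; split.
  - intros [H|H]; [lia|apply num_inj in H; lia].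
  - intros H; apply Nat.lt_eq_cases in H as [H| ->]; auto.
Qed.
Lemma Succ_num n s : Succ E and or (num n) s <-> s = num (S n).
Proof.
  rewrite Succ_iff.
  assert (sc (num n) = num (S n)) as ->; [|tauto].
  apply (m_ext _ _ _ HM); intros z; rewrite sc_spec, !(m_num _ _ _ HM); split.
  - intros [[m [Hm ->]]| ->]; [exists m|exists n]; split; auto; lia.
  - intros [m [Hm ->]]; destruct (Nat.eq_dec m n) as [->|]; [right; auto|left; exists m; split; auto; lia].
Qed.
Lemma Empty_num e : Empty E and e <-> e = num 0.
Proof.
  split.
  - intros H; apply (m_ext _ _ _ HM); intros z; rewrite (m_num _ _ _ HM); split.
    + intros Hz; destruct (proj1 (H z) Hz).
    + intros [m [Hm _]]; lia.
  - intros -> z; unfold seqv; rewrite (m_num _ _ _ HM); split; [|tauto]. intros [m [Hm _]]; lia.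
Qed.
Lemma Inductive_om : Inductive_ E EXM and or om.
Proof.
  split.
  - exists (num 0); split; [apply Empty_num; auto|apply num_om].
  - intros x Hx; apply (m_om _ _ _ HM) in Hx as [n ->]; exists (num (S n)); split; [apply Succ_num; auto|apply num_om].
Qed.
Lemma Inductive_num v n : Inductive_ E EXM and or v -> E (num n) v.
Proof.
  intros [[e [He Hev]] H]; induction n; [apply Empty_num in He; subst; auto|].
  destruct (H _ IHn) as [s [Hs Hsv]]; apply Succ_num in Hs; subst; auto.
Qed.
Lemma Omega_iff w : Omega E EXM and or w <-> w = om.
Proof.
  split.
  - intros [H1 H2]; apply (m_ext _ _ _ HM); intros z; split.
    + intros Hz; exact (H2 om Inductive_om z Hz).
    + intros Hz; apply (m_om _ _ _ HM) in Hz as [n ->]; apply Inductive_num; auto.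
  - intros ->; split; [apply Inductive_om|]; intros v Hv z Hz; apply (m_om _ _ _ HM) in Hz as [n ->]; apply Inductive_num; auto.
Qed.
Lemma let_om (p : M -> Prop) : (exists w, Omega E EXM and or w /\ p w) <-> p om.
Proof. apply let_iff, Omega_iff. Qed.

Lemma so_iff a (P : M -> Prop) s : DM (fun r => P (r 0)) -> (forall z, P z -> E z a) -> setof E and P s <-> s = sp a P.
Proof.
  intros HD Ha; assert (H : setof E and P (sp a P)).
  { intros z; unfold seqv; rewrite sp_spec by auto; split; [tauto|auto]. }
  split; [intros Hs; exact (setof_unique _ _ _ Hs H)|intros ->; exact H].
Qed.
Lemma so_in (P : M -> Prop) s z : setof E and P s -> E z s <-> P z.
Proof. intros H; destruct (H z); split; auto. Qed.

Lemma AlmostAll_iff (p : M -> Prop) : AlmostAll E EXM and or p <-> exists N, forall n, N <= n -> p (num n).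
Proof.
  unfold AlmostAll; rewrite let_om; split.
  - intros [m [Hm H]]; apply (m_om _ _ _ HM) in Hm as [N ->]; exists N; intros n Hn; apply H; [apply num_om|apply Leq_num; auto].
  - intros [N H]; exists (num N); split; [apply num_om|]; intros n Hn; apply (m_om _ _ _ HM) in Hn as [n' ->].
    rewrite Leq_num; auto.
Qed.

Lemma Baire_iff Y : Baire E EXM and or Y <-> Y = fs om om.
Proof. unfold Baire; rewrite let_om; apply Funs_iff. Qed.
Lemma Omega2_iff Y : Omega2 E EXM and or Y <-> Y = pd om om.
Proof. unfold Omega2; rewrite let_om; apply Prod_iff. Qed.
Lemma pd_om z : E z (pd om om) <-> exists a b, z = pr (num a) (num b).
Proof.
  rewrite pd_spec; split.
  - intros [x [y [Hx [Hy ->]]]]; apply (m_om _ _ _ HM) in Hx as [a ->], Hy as [b ->]; eauto.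
  - intros [a [b ->]]; exists (num a), (num b); auto using num_om.
Qed.
Lemma Delta_iff d : Delta_ E EXM and or d <-> d = sp (pd om om) (fun z => exists n, E n om /\ exists m, E m om /\ Leq E or m n /\ Opair E EXM and or n m z).
Proof.
  unfold Delta_; rewrite <- so_iff.
  - unfold setof, seqv; split; intros H z; specialize (H z); rewrite let_om in *; exact H.
  - dfn.
  - intros z [n [Hn [m [Hm [_ Hz]]]]]; apply Opair_iff in Hz as ->; apply pd_pr; auto.
Qed.
Lemma Delta_in d z : Delta_ E EXM and or d -> E z d <-> exists a b, b <= a /\ z = pr (num a) (num b).
Proof.
  intros H; rewrite (so_in _ _ _ H), let_om; split.
  - intros [n [Hn [m [Hm [Hl Hz]]]]]; apply (m_om _ _ _ HM) in Hm as [b ->], Hn as [a ->]; apply Opair_iff in Hz as ->.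
    apply Leq_num in Hl; eauto.
  - intros [a [b [Hab ->]]]; exists (num a); split; [apply num_om|]; exists (num b); split; [apply num_om|]; split; [apply Leq_num; auto|].
    apply Opair_iff; auto.
Qed.
Lemma Delta_ex : exists d, Delta_ E EXM and or d.
Proof. eexists; apply Delta_iff; reflexivity. Qed.

Lemma pr_un x y f : E (pr x y) f -> E x (un (un f)) /\ E y (un (un f)).
Proof.
  intros H; assert (Hu : E (upr x y) (un f)).
  { apply un_spec; exists (pr x y); split; auto; apply upr_spec; auto. }
  split; apply un_spec; exists (upr x y); split; auto; apply upr_spec; auto.
Qed.
Definition rs f n := sp f (fun p => exists k, E k n /\ exists y, Opair E EXM and or k y p).
Lemma Restr_iff f n s : Restr E EXM and or f n s <-> s = rs f n.
Proof.
  unfold rs; split.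
  - intros H; apply (m_ext _ _ _ HM); intros z; rewrite (so_in _ _ _ H), sp_spec by dfn; tauto.
  - intros -> z; unfold seqv; rewrite sp_spec by dfn; tauto.
Qed.
Lemma rs_in f n z : E z (rs f n) <-> E z f /\ exists k y, E k n /\ z = pr k y.
Proof.
  unfold rs; rewrite sp_spec by dfn; split.
  - intros [H [k [Hk [y Hy]]]]; apply Opair_iff in Hy; eauto.
  - intros [H [k [y [Hk ->]]]]; split; auto; exists k; split; auto; exists y; apply Opair_iff; auto.
Qed.
Definition fq X := sp (pow (pd om X)) (fun s => exists n, E n om /\ cFunc s n X).
Lemma fq_in X s : E s (fq X) <-> exists n, cFunc s (num n) X.
Proof.
  unfold fq; rewrite sp_spec by dfn; split.
  - intros [_ [n [Hn H]]]; apply (m_om _ _ _ HM) in Hn as [k ->]; eauto.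
  - intros [n H]; split; [|exists (num n); split; [apply num_om|auto]].
    apply pow_spec; intros z Hz; apply Func_iff in H as [H _].
    destruct (H z Hz) as [x [y [Hx [Hy ->]]]]; apply pd_pr; split; auto.
    apply (m_num _ _ _ HM) in Hx as [m [_ ->]]; apply num_om.
Qed.
Lemma FinSeqs_iff X S : FinSeqs E EXM and or X S <-> S = fq X.
Proof.
  assert (H : FinSeqs E EXM and or X (fq X)).
  { intros z; unfold seqv; rewrite let_om, fq_in; split.
    - intros [n Hn]; exists (num n); split; [apply num_om|auto].
    - intros [n [Hn H]]; apply (m_om _ _ _ HM) in Hn as [k ->]; eauto. }
  split; [intros HS; exact (setof_unique _ _ _ HS H)|intros ->; exact H].
Qed.
Definition sct A n := sp (un (un A)) (fun m => exists p, Opair E EXM and or n m p /\ E p A).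
Lemma sct_in A n m : E m (sct A n) <-> E (pr n m) A.
Proof.
  unfold sct; rewrite sp_spec by dfn.
  rewrite (let_iff (Opair E EXM and or n m) _ (pr n m)) by (intros; apply Opair_iff).
  split; [tauto|]; intros H; split; auto; apply pr_un in H; tauto.
Qed.
Lemma Sect_iff A n s : Sect E EXM and or A n s <-> s = sct A n.
Proof.
  assert (H : Sect E EXM and or A n (sct A n)).
  { intros z; unfold seqv; rewrite sct_in, (let_iff (Opair E EXM and or n z) _ (pr n z)) by (intros; apply Opair_iff); tauto. }
  split; [intros Hs; exact (setof_unique _ _ _ Hs H)|intros ->; exact H].
Qed.

Lemma Ordinal_num n : Ordinal E and (num n).
Proof.
  assert (T : forall n, Transitive E (num n)).
  { intros k x Hx y Hy; apply (m_num _ _ _ HM) in Hx as [m [Hm ->]]; apply (m_num _ _ _ HM) in Hy as [j [Hj ->]].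
    apply num_E; lia. }
  split; auto; intros x Hx; apply (m_num _ _ _ HM) in Hx as [m [_ ->]]; auto.
Qed.
Lemma fin_set (L : list M) : exists s, forall z, E z s <-> In z L.
Proof.
  induction L as [|x L [s Hs]].
  - exists (num 0); intros z; rewrite (m_num _ _ _ HM); split; [intros [m [Hm _]]; lia|intros []].
  - exists (un (upr s (upr x x))); intros z; rewrite un_spec; simpl; rewrite <- Hs; split.
    + intros [y [Hy Hz]]; apply upr_spec in Hy as [->| ->]; auto; apply upr_spec in Hz as [->| ->]; auto.
    + intros [<-|H]; [exists (upr x x)|exists s]; split; auto; apply upr_spec; auto.
Qed.
Lemma card_cover x n : Equinum E EXM and or (num n) x -> exists L, length L = n /\ forall z, E z x -> In z L.
Proof.
  intros H; apply equinum_elim in H as [f [H1 [H2 [H3 [H4 H5]]]]].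
  exists (map (fun k => epsilon (inhabits om) (fun y => E (pr (num k) y) f)) (seq 0 n)); split; [rewrite length_map, length_seq; auto|].
  intros z Hz; destruct (H3 z Hz) as [k Hk]; pose proof (H1 _ _ Hk) as [Hk' _].
  apply (m_num _ _ _ HM) in Hk' as [m [Hm ->]]; apply in_map_iff; exists m; split; [|apply in_seq; lia].
  apply (H4 (num m)); auto; apply (epsilon_spec (inhabits om) (fun y => E (pr (num m) y) f)); eauto.
Qed.
Lemma card_list x L : NoDup L -> (forall z, E z x <-> In z L) -> Card E EXM and or x (num (length L)).
Proof.
  intros HL Hx; split; [apply Ordinal_num|split].
  - destruct (fin_set (map (fun k => pr (num k) (nth k L om)) (seq 0 (length L)))) as [f Hf].
    assert (Hp : forall u v, E (pr u v) f <-> exists k, k < length L /\ u = num k /\ v = nth k L om).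
    { intros u v; rewrite Hf, in_map_iff; split.
      - intros [k [H Hk]]; apply in_seq in Hk; apply pr_inj in H as [<- <-]; exists k; split; auto; lia.
      - intros [k [Hk [-> ->]]]; exists k; split; auto; apply in_seq; lia. }
    exists f; apply Bij_iff; split; [|repeat split].
    + intros z Hz; apply Hf, in_map_iff in Hz as [k [<- _]]; eauto.
    + apply Hp in H as [k [Hk [-> ->]]]; apply num_E; auto.
    + apply Hp in H as [k [Hk [-> ->]]]; apply Hx, nth_In; auto.
    + intros u Hu; apply (m_num _ _ _ HM) in Hu as [k [Hk ->]]; exists (nth k L om); apply Hp; eauto.
    + intros y Hy; apply Hx, (In_nth L y om) in Hy as [k [Hk <-]]; exists (num k); apply Hp; eauto.
    + intros u y y' Hy Hy'; apply Hp in Hy as [k [Hk [-> ->]]], Hy' as [k' [Hk' [Hu ->]]]; apply num_inj in Hu; subst; auto.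
    + intros u u' y Hy Hy'; apply Hp in Hy as [k [Hk [-> ->]]], Hy' as [k' [Hk' [-> Hu]]].
      f_equal; exact (proj1 (NoDup_nth L om) HL k k' Hk Hk' Hu).
  - intros l Hl He; apply (m_num _ _ _ HM) in Hl as [m [Hm ->]]; apply card_cover in He as [L' [<- HL']].
    assert (length L <= length L'); [|lia].
    apply NoDup_incl_length; auto; intros z Hz; apply HL', Hx, Hz.
Qed.
Lemma bounded_list x v : (forall L, NoDup L -> (forall z, In z L -> E z x) -> length L <= v) ->
  exists L, NoDup L /\ (forall z, E z x <-> In z L) /\ length L <= v.
Proof.
  intros H; assert (Hk : forall k, k <= S v -> (exists L, NoDup L /\ (forall z, E z x <-> In z L) /\ length L <= v) \/
    exists L, NoDup L /\ (forall z, In z L -> E z x) /\ length L = k).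
  { induction k as [|k IH]; intros Hk; [right; exists []; repeat split; [constructor|intros z []]|].
    destruct IH as [IH|[L [H1 [H2 H3]]]]; [lia|left; auto|].
    destruct (classic (exists z, E z x /\ ~ In z L)) as [[z [Hz Hn]]|Hn].
    - right; exists (z :: L); repeat split; [constructor; auto|intros y [<-|Hy]; auto|simpl; lia].
    - left; exists L; split; auto; split; [|lia]; intros z; split; auto; intros Hz; apply NNPP; intros Hn'; apply Hn; eauto. }
  destruct (Hk (S v) (le_n _)) as [|[L [H1 [H2 H3]]]]; auto; specialize (H L H1 H2); lia.
Qed.

(** * Sigma-ideals generated by slaloms *)

Local Notation cSigma := (SigmaIdeal E EXM and or).
Local Notation cGen := (SigmaGen E EXM and or).

(* [h] enumerates members of a sigma-ideal, and [sun h] is their union. *)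
Definition sun h := sp (un (un (un h))) (fun z => exists n, E n om /\ exists a, App E EXM and or h n a /\ E z a).
Lemma sun_spec h : setof E and (fun z => exists n, E n om /\ exists a, App E EXM and or h n a /\ E z a) (sun h).
Proof.
  refine (proj2 (so_iff _ _ _ _ _) eq_refl); [dfn|].
  intros z [n [Hn [a [Ha Hz]]]]; apply App_iff in Ha; apply un_spec; exists a; split; auto.
  apply pr_un in Ha; tauto.
Qed.
Lemma sigma_iff Y J : cSigma Y J <-> (forall a, E a J -> Sub E a Y) /\ E (num 0) J /\
  (forall a, E a J -> forall b, Sub E b a -> E b J) /\
  forall h, cFunc h om J -> E (sun h) J.
Proof.
  unfold SigmaIdeal; rewrite let_om, (let_iff (Empty E and) _ (num 0)) by apply Empty_num.
  split; intros [H1 [H2 [H3 H4]]]; split; auto; split; auto; split; auto; intros h Hh.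
  - destruct (H4 h Hh) as [u [Hu HuJ]]; rewrite (setof_unique _ _ _ (sun_spec h) Hu); auto.
  - exists (sun h); split; [apply sun_spec|auto].
Qed.
Lemma sun_in h J z : cFunc h om J -> E z (sun h) <-> exists n, E z (ap h (num n)).
Proof.
  intros Hh; rewrite (so_in _ _ _ (sun_spec h)); split.
  - intros [n [Hn [a [Ha Hz]]]]; apply (m_om _ _ _ HM) in Hn as [k ->]; apply App_iff in Ha.
    apply (func_pr _ _ _ _ _ Hh) in Ha as [_ [_ ->]]; eauto.
  - intros [n Hz]; exists (num n); split; [apply num_om|]; exists (ap h (num n)); split; auto.
    apply App_iff, (func_ap _ _ _ _ Hh), num_om.
Qed.

(** Belonging to every sigma-ideal over [G] is definable, so the intersection of these ideals can be
    separated from the power set of [Y]. *)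
Lemma sigma_gen_ex Y G : (forall a, E a G -> Sub E a Y) -> exists J, cGen Y G J.
Proof.
  intros HG; set (Q := fun a => forall J, cSigma Y J /\ Sub E G J -> E a J).
  assert (HQ : DM (fun r => Q (r 0))) by (unfold Q, SigmaIdeal; dfn).
  assert (HJ : forall a, E a (sp (pow Y) Q) <-> Sub E a Y /\ Q a)
    by (intros a; rewrite sp_spec by auto; rewrite pow_spec; tauto).
  exists (sp (pow Y) Q); split; [|split].
  - apply sigma_iff; split; [intros a Ha; apply HJ in Ha; tauto|split; [|split]].
    + apply HJ; split; [intros z Hz; apply (m_num _ _ _ HM) in Hz as [m [Hm _]]; lia|].
      intros J [H1 _]; apply sigma_iff in H1; tauto.
    + intros a Ha b Hb; apply HJ in Ha as [H1 H2]; apply HJ; split; [intros z Hz; auto|].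
      intros J HJ'; pose proof (H2 J HJ') as H3; destruct HJ' as [H4 _]; apply sigma_iff in H4 as [_ [_ [H4 _]]]; eauto.
    + intros h Hh; apply HJ; split.
      * intros z Hz; apply (sun_in _ _ _ Hh) in Hz as [n Hn].
        destruct (ap_spec _ _ _ (num n) Hh (num_om n)) as [H1 _]; apply HJ in H1 as [H1 _]; auto.
      * intros J HJ'; pose proof HJ' as [H1 _]; apply sigma_iff in H1 as [_ [_ [_ H4]]]; apply H4.
        apply Func_iff in Hh as [F1 F2]; apply Func_iff; split.
        -- intros z Hz; destruct (F1 z Hz) as [x [y [Hx [Hy ->]]]]; exists x, y; split; auto; split; auto; apply HJ in Hy as [_ Hy]; auto.
        -- intros x Hx; destruct (F2 x Hx) as [y [Hy H]]; exists y; split; auto; apply HJ in Hy as [_ Hy]; auto.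
  - intros a Ha; apply HJ; split; auto; intros J [_ H]; auto.
  - intros J HJ' a Ha; apply HJ in Ha as [_ Ha]; auto.
Qed.

Section Generated.
(** The two kinds of ideals are treated together: [idx f n] is the argument at which a slalom is
    evaluated, either the restriction of [f] to [n] or [n] itself, and [lv] recovers [n] from it. *)
Context (x0 i0 dm : M) (idx : M -> nat -> M) (lv inS : M -> M -> Prop) (G : M).
Context (lv_D : DM (fun r => lv (r 1) (r 0))) (inS_D : DM (fun r => inS (r 1) (r 0))).
Context (idx_dm : forall f n, E f (fs om x0) -> E (idx f n) dm /\ lv (idx f n) (num n)).
Context (lv_ex : forall s, E s dm -> exists n, forall m, E m om -> lv s m -> m = num n).
Context (inS_iff : forall phi f, cFunc phi dm i0 -> E f (fs om x0) ->
  inS phi f <-> exists N, forall n, N <= n -> E (ap f (num n)) (ap phi (idx f n))).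
Context (diag : forall g, cFunc g dm x0 -> exists f, E f (fs om x0) /\ forall n, ap f (num n) = ap g (idx f n)).
Context (i_un : forall a b, E a i0 -> E b i0 -> exists c, E c i0 /\ Sub E a c /\ Sub E b c).
Context (i_co : forall c, E c i0 -> exists v, E v x0 /\ ~ E v c).
Context (i_sing : forall v, E v x0 -> exists c, E c i0 /\ E v c) (i_emp : exists c, E c i0).
Context (G_in : forall A, E A G <-> exists phi, cFunc phi dm i0 /\ forall f, E f A <-> E f (fs om x0) /\ inS phi f).
Let Y := fs om x0.

Lemma G_sub a : E a G -> Sub E a Y.
Proof. intros H z Hz; apply G_in in H as [phi [_ H]]; apply H in Hz; tauto. Qed.
Lemma gen_ex : exists J, cGen Y G J.
Proof. apply sigma_gen_ex, G_sub. Qed.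

Lemma i_bound (F : nat -> M) n : (forall j, j < n -> E (F j) i0) -> exists c, E c i0 /\ forall j, j < n -> Sub E (F j) c.
Proof.
  induction n as [|n IH]; intros H; [destruct i_emp as [c Hc]; exists c; split; auto; intros; lia|].
  destruct IH as [c [Hc H1]]; [auto|]; destruct (i_un c (F n)) as [d [Hd [H2 H3]]]; auto.
  exists d; split; auto; intros j Hj; destruct (Nat.eq_dec j n) as [->|]; auto; intros z Hz; apply H2, (H1 j); auto; lia.
Qed.

Definition desc a := Sub E a Y /\ exists phi, cFunc phi dm i0 /\ forall f, E f a -> inS phi f.
(** Countably many slaloms are replaced by one whose value at an index of level [n] contains the
    values there of those numbered up to [n]; from some place on it captures whatever one of them
    captures. So every set of the generated ideal is captured by a single slalom. *)
Lemma desc_sigma : cSigma Y (sp (pow Y) desc).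
Proof.
  assert (HD : DM (fun r => desc (r 0))) by (unfold desc; dfn).
  assert (HJ : forall a, E a (sp (pow Y) desc) <-> desc a).
  { intros a; rewrite sp_spec by auto; rewrite pow_spec; unfold desc; tauto. }
  apply sigma_iff; split; [intros a Ha; apply HJ in Ha; apply Ha|split; [|split]].
  - assert (He : forall z, ~ E z (num 0)) by (intros z Hz; apply (m_num _ _ _ HM) in Hz as [m [Hm _]]; lia).
    apply HJ; split; [intros z Hz; destruct (He z Hz)|].
    destruct i_emp as [c Hc]; destruct (choice_fun dm i0 (fun _ y => y = c)) as [phi [Hphi _]]; [dfn|eauto|].
    exists phi; split; auto; intros f Hf; destruct (He f Hf).
  - intros a Ha b Hb; apply HJ in Ha as [H1 [phi [H2 H3]]]; apply HJ; split; [intros z Hz; auto|exists phi; auto].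
  - intros h Hh; apply HJ; split.
    { intros z Hz; apply (sun_in _ _ _ Hh) in Hz as [n Hn].
      destruct (ap_spec _ _ _ (num n) Hh (num_om n)) as [H1 _]; apply HJ in H1 as [H1 _]; auto. }
    destruct (choice_fun om (fs dm i0) (fun n phi => exists a, App E EXM and or h n a /\ forall f, E f a -> inS phi f)) as [Ph [HP HP']].
    { dfn. }
    { intros t Ht; destruct (ap_spec _ _ _ t Hh Ht) as [H1 _]; apply HJ in H1 as [_ [phi [H2 H3]]].
      exists phi; split; [apply fs_spec; auto|]; exists (ap h t); split; auto.
      apply App_iff, (func_ap _ _ _ _ Hh Ht). }
    assert (HP2 : forall n, cFunc (ap Ph (num n)) dm i0).
    { intros n; apply fs_spec; apply (ap_spec _ _ _ _ HP), num_om. }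
    destruct (choice_fun dm i0 (fun s c => forall j, E j om -> forall n, E n om -> lv s n -> Leq E or j n ->
      forall phi, App E EXM and or Ph j phi -> forall d, App E EXM and or phi s d -> Sub E d c)) as [phi [H1 H2]].
    { dfn. }
    { intros s Hs; destruct (lv_ex s Hs) as [n Hn].
      destruct (i_bound (fun j => ap (ap Ph (num j)) s) (S n)) as [c [Hc H]].
      { intros j _; apply (ap_spec _ _ _ _ (HP2 j) Hs). }
      exists c; split; auto; intros j Hj n' Hn' Hl Hle ps Hps d Hd; rewrite (Hn n' Hn' Hl) in Hle.
      apply (m_om _ _ _ HM) in Hj as [k ->]; apply Leq_num in Hle.
      apply App_iff, (func_pr _ _ _ _ _ HP) in Hps as [_ [_ ->]].
      apply App_iff, (func_pr _ _ _ _ _ (HP2 k)) in Hd as [_ [_ ->]].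
      apply (H k); lia. }
    exists phi; split; auto; intros f Hf; apply (sun_in _ _ _ Hh) in Hf as [j Hf].
    pose proof (num_om j) as Hj.
    destruct (ap_spec _ _ _ (num j) Hh Hj) as [H3 _]; apply HJ in H3 as [H3 _]; specialize (H3 f Hf).
    destruct (HP' (num j) Hj) as [a [Ha Hin]]; apply App_iff, (func_pr _ _ _ _ _ Hh) in Ha as [_ [_ ->]].
    specialize (Hin f Hf); apply (inS_iff _ _ (HP2 j) H3) in Hin as [N HN]; apply (inS_iff _ _ H1 H3).
    (* Slalom number [j] captures [f] from [N] on, and it is taken into account from level [j]
       on. *)
    exists (N + j); intros n Hn; destruct (idx_dm f n H3) as [I1 I2].
    apply (H2 (idx f n) I1 (num j) Hj (num n) (num_om n) I2) with (phi := ap Ph (num j)) (d := ap (ap Ph (num j)) (idx f n)).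
    + apply Leq_num; lia.
    + apply App_iff, (func_ap _ _ _ _ HP Hj).
    + apply App_iff, (func_ap _ _ _ _ (HP2 j) I1).
    + apply HN; lia.
Qed.

Context (J : M) (HJ : cGen Y G J).
Lemma gen_desc a : E a J -> desc a.
Proof.
  intros Ha; assert (HD : DM (fun r => desc (r 0))) by (unfold desc; dfn).
  destruct HJ as [_ [_ H]]; assert (Hs : E a (sp (pow Y) desc)).
  { apply (H (sp (pow Y) desc)); auto; split; [apply desc_sigma|].
    intros b Hb; rewrite sp_spec by auto; rewrite pow_spec; pose proof (G_sub b Hb); split; auto; split; auto.
    apply G_in in Hb as [phi [H1 H2]]; exists phi; split; auto; intros f Hf; apply H2 in Hf; tauto. }
  rewrite sp_spec in Hs by auto; apply Hs.
Qed.
Lemma gen_in phi a : cFunc phi dm i0 -> Sub E a Y -> (forall f, E f a -> inS phi f) -> E a J.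
Proof.
  intros Hp Ha H; destruct HJ as [H1 [H2 _]]; apply sigma_iff in H1 as [_ [_ [H1 _]]].
  assert (Hb : forall f, E f (sp Y (inS phi)) <-> E f Y /\ inS phi f).
  { intros f; apply sp_spec. apply (D_R2 E inS inS_D); [apply V_const|apply V_var; exact om]. }
  apply (H1 (sp Y (inS phi))).
  - apply H2, G_in; exists phi; split; auto.
  - intros f Hf; apply Hb; auto.
Qed.
(** A function choosing a value outside the slalom at each index is followed along its own course,
    by [diag]; the resulting sequence is never captured. *)
Lemma gen_proper : ~ E Y J.
Proof.
  intros H; apply gen_desc in H as [_ [phi [Hp H]]].
  destruct (choice_fun dm x0 (fun s v => forall c, App E EXM and or phi s c -> ~ E v c)) as [g [Hg H1]]; [dfn| |].
  { intros s Hs; destruct (ap_spec _ _ _ _ Hp Hs) as [H2 _]; destruct (i_co _ H2) as [v [Hv Hn]].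
    exists v; split; auto; intros c Hc; apply App_iff, (func_pr _ _ _ _ _ Hp) in Hc as [_ [_ ->]]; auto. }
  destruct (diag g Hg) as [f [Hf Hd]]; pose proof (H f Hf) as Hi; apply (inS_iff _ _ Hp Hf) in Hi as [N HN].
  specialize (HN N (le_n N)); rewrite Hd in HN; destruct (idx_dm f N Hf) as [I1 _].
  apply (H1 _ I1) in HN; auto; apply App_iff, (func_ap _ _ _ _ Hp I1).
Qed.
Lemma gen_sing f : E f Y -> exists a, E a J /\ E f a.
Proof.
  intros Hf; exists (upr f f); split; [|apply upr_spec; auto].
  assert (Hf' : cFunc f om x0) by (apply fs_spec; auto).
  destruct (choice_fun dm i0 (fun s c => forall n, E n om -> lv s n -> forall v, App E EXM and or f n v -> E v c)) as [phi [H1 H2]]; [dfn| |].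
  { intros s Hs; destruct (lv_ex s Hs) as [n Hn].
    destruct (i_sing (ap f (num n))) as [c [Hc Hv]]; [apply (ap_spec _ _ _ _ Hf'), num_om|].
    exists c; split; auto; intros n' Hn' Hl v Hv'; rewrite (Hn n' Hn' Hl) in Hv'.
    apply App_iff, (func_pr _ _ _ _ _ Hf') in Hv' as [_ [_ ->]]; auto. }
  apply (gen_in phi); auto.
  - intros z Hz; apply upr_spec in Hz as [->| ->]; auto.
  - intros z Hz; assert (z = f) as -> by (apply upr_spec in Hz; tauto).
    apply (inS_iff _ _ H1 Hf); exists 0; intros n _; destruct (idx_dm f n Hf) as [I1 I2].
    apply (H2 _ I1 (num n) (num_om n) I2), App_iff, (func_ap _ _ _ _ Hf'), num_om.
Qed.
End Generated.

Definition inM phi f := AlmostAll E EXM and or (fun n => exists s, Restr E EXM and or f n s /\ exists c, cApp phi s c /\ exists v, cApp f n v /\ E v c).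
Definition inK phi f := AlmostAll E EXM and or (fun n => exists c, cApp phi n c /\ exists v, cApp f n v /\ E v c).

Lemma rs_pr f n x y : E (pr x y) (rs f n) <-> E (pr x y) f /\ E x n.
Proof.
  rewrite rs_in; split.
  - intros [H [k [y' [Hk He]]]]; apply pr_inj in He as [<- <-]; auto.
  - intros [H1 H2]; split; eauto.
Qed.
Lemma rs_func f a n X : cFunc f a X -> Sub E n a -> cFunc (rs f n) n X.
Proof.
  intros Hf Hn; apply Func_iff; split.
  - intros z Hz; apply rs_in in Hz as [Hz [k [y [Hk ->]]]]; apply (func_pr _ _ _ _ _ Hf) in Hz as [_ [Hy _]]; eauto.
  - intros x Hx; destruct (ap_spec _ _ _ x Hf (Hn x Hx)) as [H1 H2]; exists (ap f x); split; auto.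
    intros z; rewrite rs_pr, H2; tauto.
Qed.
Lemma rs_ap f a n X x : cFunc f a X -> Sub E n a -> E x n -> ap (rs f n) x = ap f x.
Proof.
  intros Hf Hn Hx; symmetry; pose proof (rs_func f a n X Hf Hn) as Hr.
  assert (H : E (pr x (ap f x)) (rs f n)) by (apply rs_pr; split; auto; apply (func_ap _ _ _ _ Hf); auto).
  apply (func_pr _ _ _ _ _ Hr) in H; tauto.
Qed.
Lemma num_sub k n : k <= n -> Sub E (num k) (num n).
Proof. intros H z Hz; apply (m_num _ _ _ HM) in Hz as [m [Hm ->]]; apply num_E; lia. Qed.
Lemma num_sub_om n : Sub E (num n) om.
Proof. intros z Hz; apply (m_num _ _ _ HM) in Hz as [m [Hm ->]]; apply num_om. Qed.
Lemma func_num_ext f g n b c : cFunc f (num n) b -> cFunc g (num n) c -> (forall k, k < n -> ap f (num k) = ap g (num k)) -> f = g.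
Proof.
  intros Hf Hg H; apply (func_ext _ _ _ _ _ Hf Hg); intros x Hx; apply (m_num _ _ _ HM) in Hx as [k [Hk ->]]; auto.
Qed.

(** * Recursion along omega in the model *)

Section Recursion.
Context (x0 g : M) (Hg : cFunc g (fq x0) x0).
Fixpoint sq n := match n with 0 => num 0 | S n => un (upr (sq n) (upr (pr (num n) (ap g (sq n))) (pr (num n) (ap g (sq n))))) end.
Lemma sq_in n z : E z (sq (S n)) <-> E z (sq n) \/ z = pr (num n) (ap g (sq n)).
Proof.
  simpl; rewrite un_spec; split.
  - intros [y [Hy Hz]]; apply upr_spec in Hy as [->| ->]; auto; apply upr_spec in Hz; tauto.
  - intros [H| ->]; [exists (sq n)|eexists]; split; try apply upr_spec; auto.
Qed.
Lemma sq_pr n x y : E (pr x y) (sq n) <-> exists k, k < n /\ x = num k /\ y = ap g (sq k).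
Proof.
  induction n as [|n IH].
  - simpl; rewrite (m_num _ _ _ HM); split; [intros [m [Hm _]]; lia|intros [k [Hk _]]; lia].
  - rewrite sq_in, IH; split.
    + intros [[k [Hk H]]|H]; [exists k; split; auto|]. apply pr_inj in H; exists n; split; auto.
    + intros [k [Hk [-> ->]]]; destruct (Nat.eq_dec k n) as [->|]; [right; auto|left; exists k; split; auto; lia].
Qed.
Lemma sq_func n : cFunc (sq n) (num n) x0.
Proof.
  induction n as [n IH] using lt_wf_ind; apply Func_iff; split.
  - assert (H : forall k z, k <= n -> E z (sq k) -> exists x y, z = pr x y).
    { induction k as [|k IHk]; intros z Hk Hz; [apply (m_num _ _ _ HM) in Hz as [m [Hm _]]; lia|].
      apply sq_in in Hz as [Hz| ->]; eauto; apply IHk; auto; lia. }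
    intros z Hz; destruct (H n z (le_n n) Hz) as [x [y ->]]; exists x, y; apply sq_pr in Hz as [k [Hk [-> ->]]].
    split; [apply num_E; auto|split; auto].
    apply (ap_spec _ _ _ _ Hg), fq_in; exists k; auto.
  - intros x Hx; apply (m_num _ _ _ HM) in Hx as [k [Hk ->]]; exists (ap g (sq k)); split.
    + apply (ap_spec _ _ _ _ Hg), fq_in; exists k; auto.
    + intros z; rewrite sq_pr; split; [|intros ->; exists k; auto].
      intros [j [Hj [He ->]]]; apply num_inj in He as ->; auto.
Qed.
Lemma sq_ap n k : k < n -> ap (sq n) (num k) = ap g (sq k).
Proof.
  intros Hk; symmetry; assert (H : E (pr (num k) (ap g (sq k))) (sq n)) by (apply sq_pr; eauto).
  apply (func_pr _ _ _ _ _ (sq_func n)) in H; tauto.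
Qed.
Lemma sq_rs n k : k <= n -> rs (sq n) (num k) = sq k.
Proof.
  intros Hk; pose proof (num_sub k n Hk) as Hs; apply (func_num_ext _ _ k x0 x0).
  - eapply rs_func; [apply sq_func|auto].
  - apply sq_func.
  - intros j Hj; rewrite (rs_ap _ _ _ _ _ (sq_func n) Hs) by (apply num_E; auto); rewrite !sq_ap by lia; auto.
Qed.
(** [sq n] is built by recursion outside the model; this property is definable and determines it,
    which lets the whole function be separated inside the model. *)
Definition good s n := forall k, E k n -> forall r, Restr E EXM and or s k r -> forall v, cApp g r v -> cApp s k v.
Lemma good_sq n : good (sq n) (num n).
Proof.
  intros k Hk r Hr v Hv; apply (m_num _ _ _ HM) in Hk as [j [Hj ->]]; apply Restr_iff in Hr as ->.
  rewrite sq_rs in Hv by lia; apply App_iff, (func_pr _ _ _ _ _ Hg) in Hv as [_ [_ ->]].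
  apply App_iff, sq_pr; eauto.
Qed.
Lemma good_unique s n : cFunc s (num n) x0 -> good s (num n) -> s = sq n.
Proof.
  intros Hs H; apply (func_num_ext _ _ n x0 x0); auto; [apply sq_func|].
  intros k; induction k as [k IH] using lt_wf_ind; intros Hk; rewrite sq_ap by auto.
  assert (Hr : rs s (num k) = sq k).
  { pose proof (num_sub k n ltac:(lia)) as Hsub; apply (func_num_ext _ _ k x0 x0); [eapply rs_func; eauto|apply sq_func|].
    intros j Hj; rewrite (rs_ap _ _ _ _ _ Hs Hsub) by (apply num_E; auto).
    rewrite IH by lia; rewrite !sq_ap by lia; auto. }
  assert (Hv : cApp s (num k) (ap g (sq k))).
  { apply (H (num k)) with (r := sq k); [apply num_E; auto|apply Restr_iff; auto|].
    apply App_iff, (func_ap _ _ _ _ Hg), fq_in; exists k; apply sq_func. }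
  apply App_iff, (func_pr _ _ _ _ _ Hs) in Hv as [_ [_ Hv]]; auto.
Qed.
Lemma recursion : exists f, E f (fs om x0) /\ forall n, ap f (num n) = ap g (rs f (num n)).
Proof.
  destruct (lam_func om x0 (fun n v => exists s, cFunc s n x0 /\ good s n /\ cApp g s v)) as [H1 H2].
  - unfold good; dfn.
  - intros x Hx; apply (m_om _ _ _ HM) in Hx as [n ->]; exists (ap g (sq n)).
    assert (Hq : E (sq n) (fq x0)) by (apply fq_in; exists n; apply sq_func).
    split; [apply (ap_spec _ _ _ _ Hg); auto|]; exists (sq n); split; [apply sq_func|split; [apply good_sq|]].
    apply App_iff, (func_ap _ _ _ _ Hg); auto.
  - intros x y y' Hx _ _ [s [S1 [S2 S3]]] [s' [S1' [S2' S3']]]; apply (m_om _ _ _ HM) in Hx as [n ->].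
    apply good_unique in S1 as ->, S1' as ->; auto.
    apply App_iff, (func_pr _ _ _ _ _ Hg) in S3 as [_ [_ ->]], S3' as [_ [_ ->]]; auto.
  - set (f := lam om x0 (fun n v => exists s, cFunc s n x0 /\ good s n /\ cApp g s v)) in *.
    assert (Hf : forall n, ap f (num n) = ap g (sq n)).
    { intros n; destruct (H2 (num n) (num_om n)) as [s [S1 [S2 S3]]]; apply good_unique in S1 as ->; auto.
      apply App_iff, (func_pr _ _ _ _ _ Hg) in S3; tauto. }
    exists f; split; [apply fs_spec; auto|]; intros n; rewrite Hf; f_equal; symmetry.
    apply (func_num_ext _ _ n x0 x0); [eapply rs_func; [exact H1|apply num_sub_om]|apply sq_func|].
    intros k Hk; rewrite (rs_ap _ _ _ _ _ H1 (num_sub_om n)) by (apply num_E; auto); rewrite Hf, sq_ap; auto.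
Qed.
End Recursion.

Record Ideal (x0 i0 : M) : Prop := {
  id_un : forall a b, E a i0 -> E b i0 -> exists c, E c i0 /\ Sub E a c /\ Sub E b c;
  id_co : forall c, E c i0 -> exists v, E v x0 /\ ~ E v c;
  id_sing : forall v, E v x0 -> exists c, E c i0 /\ E v c;
  id_emp : exists c, E c i0 }.
Record IdealJ (x0 i0 dm : M) (inS : M -> M -> Prop) (J : M) : Prop := {
  ij_sub : forall a, E a J -> Sub E a (fs om x0);
  ij_desc : forall a, E a J -> exists phi, cFunc phi dm i0 /\ forall f, E f a -> inS phi f;
  ij_in : forall phi a, cFunc phi dm i0 -> Sub E a (fs om x0) -> (forall f, E f a -> inS phi f) -> E a J;
  ij_proper : ~ E (fs om x0) J;
  ij_emp : exists a, E a J;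
  ij_down : forall a b, E a J -> Sub E b a -> E b J;
  ij_sing : forall f, E f (fs om x0) -> exists a, E a J /\ E f a }.

Lemma rs_fq x0 f n : E f (fs om x0) -> E (rs f (num n)) (fq x0) /\ cFunc (rs f (num n)) (num n) x0.
Proof.
  intros Hf; apply fs_spec in Hf.
  assert (H : cFunc (rs f (num n)) (num n) x0) by (eapply rs_func; [exact Hf|apply num_sub_om]).
  split; auto; apply fq_in; eauto.
Qed.
Lemma func_dom s a b X : cFunc s a X -> cFunc s b X -> a = b.
Proof.
  assert (L : forall a b, cFunc s a X -> cFunc s b X -> forall z, E z a -> E z b).
  { clear a b; intros a b Ha Hb z Hz; pose proof (func_ap _ _ _ _ Ha Hz) as H.
    apply (func_pr _ _ _ _ _ Hb) in H; tauto. }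
  intros Ha Hb; apply (m_ext _ _ _ HM); intros z; split; apply L; auto.
Qed.
Lemma inM_iff x0 i0 phi f : cFunc phi (fq x0) i0 -> E f (fs om x0) ->
  inM phi f <-> exists N, forall n, N <= n -> E (ap f (num n)) (ap phi (rs f (num n))).
Proof.
  intros Hp Hf; unfold inM; rewrite AlmostAll_iff.
  assert (H : forall n, (exists s, Restr E EXM and or f (num n) s /\ exists c, cApp phi s c /\ exists v, cApp f (num n) v /\ E v c) <->
    E (ap f (num n)) (ap phi (rs f (num n)))); [|split; intros [N HN]; exists N; intros n Hn; apply H; auto].
  intros n; rewrite (let_iff _ _ _ (fun s => Restr_iff f (num n) s)).
  rewrite (App_let _ _ _ _ _ Hp) by (apply rs_fq; auto).
  apply fs_spec in Hf; rewrite (App_let _ _ _ _ _ Hf) by apply num_om; tauto.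
Qed.
Lemma inK_iff x0 i0 phi f : cFunc phi om i0 -> E f (fs om x0) ->
  inK phi f <-> exists N, forall n, N <= n -> E (ap f (num n)) (ap phi (num n)).
Proof.
  intros Hp Hf; unfold inK; rewrite AlmostAll_iff.
  assert (H : forall n, (exists c, cApp phi (num n) c /\ exists v, cApp f (num n) v /\ E v c) <->
    E (ap f (num n)) (ap phi (num n))); [|split; intros [N HN]; exists N; intros n Hn; apply H; auto].
  intros n; rewrite (App_let _ _ _ _ _ Hp) by apply num_om.
  apply fs_spec in Hf; rewrite (App_let _ _ _ _ _ Hf) by apply num_om; tauto.
Qed.

Section Gens.
Context (Xt It : M -> Prop) (x0 i0 : M) (HX : forall x, Xt x <-> x = x0) (HIt : forall x, It x <-> x = i0) (HI : Ideal x0 i0).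
Lemma Seqs_iff Y : Seqs E EXM and or Xt Y <-> Y = fs om x0.
Proof. unfold Seqs; rewrite (let_iff Xt _ x0 HX), let_om; apply Funs_iff. Qed.

Definition genM := fun A => exists phi, cFunc phi (fq x0) i0 /\ exists B, MSet E EXM and or (fs om x0) phi B /\ A = B.
Definition genK := fun A => exists phi, cFunc phi om i0 /\ exists B, KSet E EXM and or (fs om x0) phi B /\ A = B.

Lemma MI_ok : (exists J, MIdeal E EXM and or Xt It J) /\ forall J, MIdeal E EXM and or Xt It J -> IdealJ x0 i0 (fq x0) inM J.
Proof.
  assert (HB : forall phi, DM (fun r => inM phi (r 0))) by (intros; unfold inM; dfn).
  assert (HBs : forall phi B, MSet E EXM and or (fs om x0) phi B -> forall f, E f B <-> E f (fs om x0) /\ inM phi f)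
    by (intros phi B H f; exact (so_in _ _ f H)).
  assert (HBe : forall phi, exists B, MSet E EXM and or (fs om x0) phi B).
  { intros phi; exists (sp (fs om x0) (fun f => E f (fs om x0) /\ inM phi f)); refine (proj2 (so_iff (fs om x0) (fun f => E f (fs om x0) /\ inM phi f) _ _ _) eq_refl); [pose proof (HB phi); dfn|tauto]. }
  set (G := sp (pow (fs om x0)) genM).
  assert (HG : forall G', setof E and genM G' <-> G' = G).
  { intros G'; apply so_iff; [unfold genM; dfn|]; intros A [phi [_ [B [HBB ->]]]].
    apply pow_spec; intros z Hz; apply (HBs _ _ HBB) in Hz; tauto. }
  assert (HJ : forall J, MIdeal E EXM and or Xt It J <-> SigmaGen E EXM and or (fs om x0) G J).
  { intros J; unfold MIdeal; rewrite (let_iff Xt _ x0 HX), (let_iff It _ i0 HIt).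
    rewrite (let_iff _ _ _ Seqs_iff), (let_iff _ _ _ (FinSeqs_iff x0)).
    exact (let_iff (setof E and genM) _ G HG). }
  assert (HGi : forall A, E A G <-> exists phi, cFunc phi (fq x0) i0 /\ forall f, E f A <-> E f (fs om x0) /\ inM phi f).
  { intros A; rewrite (so_in _ _ A (proj2 (HG G) eq_refl)); unfold genM; split.
    - intros [phi [H1 [B [H2 ->]]]]; exists phi; split; auto.
    - intros [phi [H1 H2]]; exists phi; split; auto; destruct (HBe phi) as [B H3]; exists B; split; auto.
      apply (m_ext _ _ _ HM); intros z; rewrite H2, (HBs _ _ H3); tauto. }
  assert (L1 : DM (fun r => cFunc (r 1) (r 0) x0)) by dfn.
  assert (L2 : DM (fun r => inM (r 1) (r 0))) by (unfold inM; dfn).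
  assert (L3 : forall f n, E f (fs om x0) -> E (rs f (num n)) (fq x0) /\ cFunc (rs f (num n)) (num n) x0) by apply rs_fq.
  assert (L4 : forall s, E s (fq x0) -> exists n, forall m, E m om -> cFunc s m x0 -> m = num n).
  { intros s Hs; apply fq_in in Hs as [n Hn]; exists n; intros m _ Hm; eapply func_dom; eauto. }
  destruct HI as [I1 I2 I3 I4]; split.
  - destruct (gen_ex x0 i0 (fq x0) inM G HGi) as [J HJ']; exists J; apply HJ; auto.
  - intros J HJ'; apply HJ in HJ'; split.
    + intros a Ha; apply (gen_desc x0 i0 (fq x0) (fun f n => rs f (num n)) (fun s n => cFunc s n x0) inM G L1 L2 L3 L4 (inM_iff x0 i0) I1 I4 HGi J HJ' a Ha).
    + intros a Ha; apply (gen_desc x0 i0 (fq x0) (fun f n => rs f (num n)) (fun s n => cFunc s n x0) inM G L1 L2 L3 L4 (inM_iff x0 i0) I1 I4 HGi J HJ' a Ha).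
    + intros phi a; apply (gen_in x0 i0 (fq x0) inM G L2 HGi J HJ').
    + apply (gen_proper x0 i0 (fq x0) (fun f n => rs f (num n)) (fun s n => cFunc s n x0) inM G L1 L2 L3 L4 (inM_iff x0 i0) (recursion x0) I1 I2 I4 HGi J HJ').
    + destruct HJ' as [H1 _]; apply sigma_iff in H1 as [_ [H1 _]]; eauto.
    + destruct HJ' as [H1 _]; apply sigma_iff in H1 as [_ [_ [H1 _]]]; eauto.
    + apply (gen_sing x0 i0 (fq x0) (fun f n => rs f (num n)) (fun s n => cFunc s n x0) inM G L1 L2 L3 L4 (inM_iff x0 i0) I3 HGi J HJ').
Qed.

Lemma KI_ok : (exists J, KIdeal E EXM and or Xt It J) /\ forall J, KIdeal E EXM and or Xt It J -> IdealJ x0 i0 om inK J.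
Proof.
  assert (HB : forall phi, DM (fun r => inK phi (r 0))) by (intros; unfold inK; dfn).
  assert (HBs : forall phi B, KSet E EXM and or (fs om x0) phi B -> forall f, E f B <-> E f (fs om x0) /\ inK phi f)
    by (intros phi B H f; exact (so_in _ _ f H)).
  assert (HBe : forall phi, exists B, KSet E EXM and or (fs om x0) phi B).
  { intros phi; exists (sp (fs om x0) (fun f => E f (fs om x0) /\ inK phi f)); refine (proj2 (so_iff (fs om x0) (fun f => E f (fs om x0) /\ inK phi f) _ _ _) eq_refl); [pose proof (HB phi); dfn|tauto]. }
  set (G := sp (pow (fs om x0)) genK).
  assert (HG : forall G', setof E and genK G' <-> G' = G).
  { intros G'; apply so_iff; [unfold genK; dfn|]; intros A [phi [_ [B [HBB ->]]]].
    apply pow_spec; intros z Hz; apply (HBs _ _ HBB) in Hz; tauto. }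
  assert (HJ : forall J, KIdeal E EXM and or Xt It J <-> SigmaGen E EXM and or (fs om x0) G J).
  { intros J; unfold KIdeal; rewrite (let_iff It _ i0 HIt).
    rewrite (let_iff _ _ _ Seqs_iff), let_om.
    exact (let_iff (setof E and genK) _ G HG). }
  assert (HGi : forall A, E A G <-> exists phi, cFunc phi om i0 /\ forall f, E f A <-> E f (fs om x0) /\ inK phi f).
  { intros A; rewrite (so_in _ _ A (proj2 (HG G) eq_refl)); unfold genK; split.
    - intros [phi [H1 [B [H2 ->]]]]; exists phi; split; auto.
    - intros [phi [H1 H2]]; exists phi; split; auto; destruct (HBe phi) as [B H3]; exists B; split; auto.
      apply (m_ext _ _ _ HM); intros z; rewrite H2, (HBs _ _ H3); tauto. }
  assert (L1 : DM (fun r => r 1 = r 0)) by dfn.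
  assert (L2 : DM (fun r => inK (r 1) (r 0))) by (unfold inK; dfn).
  assert (L3 : forall f n, E f (fs om x0) -> E (num n) om /\ num n = num n) by (intros; split; auto; apply num_om).
  assert (L4 : forall s, E s om -> exists n, forall m, E m om -> s = m -> m = num n).
  { intros s Hs; apply (m_om _ _ _ HM) in Hs as [n ->]; exists n; auto. }
  assert (L5 : forall g, cFunc g om x0 -> exists f, E f (fs om x0) /\ forall n, ap f (num n) = ap g (num n)).
  { intros g Hg; exists g; split; auto; apply fs_spec; auto. }
  destruct HI as [I1 I2 I3 I4]; split.
  - destruct (gen_ex x0 i0 om inK G HGi) as [J HJ']; exists J; apply HJ; auto.
  - intros J HJ'; apply HJ in HJ'; split.
    + intros a Ha; apply (gen_desc x0 i0 om (fun f n => num n) (fun s n => s = n) inK G L1 L2 L3 L4 (inK_iff x0 i0) I1 I4 HGi J HJ' a Ha).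
    + intros a Ha; apply (gen_desc x0 i0 om (fun f n => num n) (fun s n => s = n) inK G L1 L2 L3 L4 (inK_iff x0 i0) I1 I4 HGi J HJ' a Ha).
    + intros phi a; apply (gen_in x0 i0 om inK G L2 HGi J HJ').
    + apply (gen_proper x0 i0 om (fun f n => num n) (fun s n => s = n) inK G L1 L2 L3 L4 (inK_iff x0 i0) L5 I1 I2 I4 HGi J HJ').
    + destruct HJ' as [H1 _]; apply sigma_iff in H1 as [_ [H1 _]]; eauto.
    + destruct HJ' as [H1 _]; apply sigma_iff in H1 as [_ [_ [H1 _]]]; eauto.
    + apply (gen_sing x0 i0 om (fun f n => num n) (fun s n => s = n) inK G L1 L2 L3 L4 (inK_iff x0 i0) I3 HGi J HJ').
Qed.
End Gens.

(** * The ideals Fin⊗Fin, ED and its restriction to Delta *)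

Local Notation Om2 := (pd om om).

(** As omega is standard, a finite set of the model is one covered by a list, so the ideals can be
    described outside the model. *)
Definition cov_by A n (L : list M) := forall z, E (pr (num n) z) A -> In z L.
Definition ff A := exists N, forall n, N <= n -> exists L, cov_by A n L.
Definition edp A := exists k N, forall n, N <= n -> exists L, length L <= k /\ cov_by A n L.
Lemma edp_ff A : edp A -> ff A.
Proof. intros [k [N H]]; exists N; intros n Hn; destruct (H n Hn) as [L [_ HL]]; eauto. Qed.

Lemma small_card x L : (forall z, E z x -> In z L) -> exists n, n <= length L /\ Card E EXM and or x (num n).
Proof.
  intros H; destruct (bounded_list x (length L)) as [L' [H1 [H2 H3]]].
  - intros L' H1 H2; apply NoDup_incl_length; auto; intros z Hz; auto.
  - exists (length L'); split; auto; apply card_list; auto.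
Qed.
Lemma Finite_iff x : Finite E EXM and or x <-> exists L, forall z, E z x -> In z L.
Proof.
  unfold Finite; rewrite let_om; split.
  - intros [k [Hk Hkom]]; apply (m_om _ _ _ HM) in Hkom as [n ->]; destruct Hk as [_ [Hk _]].
    apply card_cover in Hk as [L [_ HL]]; eauto.
  - intros [L HL]; destruct (small_card x L HL) as [n [_ Hn]]; exists (num n); split; auto; apply num_om.
Qed.
Lemma card_leq x k : (exists l, Card E EXM and or x l /\ Leq E or l (num k)) <-> exists L, length L <= k /\ forall z, E z x -> In z L.
Proof.
  split.
  - intros [l [Hl Hle]].
    assert (exists n, l = num n) as [n ->].
    { destruct Hle as [H| ->]; eauto; apply (m_num _ _ _ HM) in H as [n [_ ->]]; eauto. }
    apply Leq_num in Hle; destruct Hl as [_ [Hl _]]; apply card_cover in Hl as [L [<- HL]]; eauto.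
  - intros [L [Hk HL]]; destruct (small_card x L HL) as [n [Hn Hc]]; exists (num n); split; auto; apply Leq_num; lia.
Qed.

Lemma FinFin_in F A : FinFin_ E EXM and or F -> E A F <-> Sub E A Om2 /\ ff A.
Proof.
  intros H; rewrite (so_in _ _ A H), (let_iff _ _ _ Omega2_iff), AlmostAll_iff.
  enough (Hs : forall n, (exists s, Sect E EXM and or A (num n) s /\ Finite E EXM and or s) <-> exists L, cov_by A n L).
  { unfold ff; split; (intros [H1 [N HN]]; split; auto; exists N; intros n Hn; apply Hs; auto). }
  intros n; rewrite (let_iff _ _ _ (Sect_iff A (num n))), Finite_iff.
  unfold cov_by; setoid_rewrite sct_in; tauto.
Qed.
Lemma FinFin_ex : exists F, FinFin_ E EXM and or F.
Proof.
  exists (sp (pow Om2) (fun A => (exists Y, Omega2 E EXM and or Y /\ Sub E A Y) /\ AlmostAll E EXM and or (fun n => exists s, Sect E EXM and or A n s /\ Finite E EXM and or s))).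
  refine (proj2 (so_iff _ _ _ _ _) eq_refl).
  - unfold Omega2, Finite; dfn.
  - intros A [H _]; rewrite (let_iff _ _ _ Omega2_iff) in H; apply pow_spec; auto.
Qed.
Lemma ED_in F A : ED_ E EXM and or F -> E A F <-> Sub E A Om2 /\ edp A.
Proof.
  intros H; rewrite (so_in _ _ A H), (let_iff _ _ _ Omega2_iff), let_om.
  assert (Hs : forall n k, (exists s, Sect E EXM and or A (num n) s /\ exists l, Card E EXM and or s l /\ Leq E or l (num k)) <-> exists L, length L <= k /\ cov_by A n L).
  { intros n k; rewrite (let_iff _ _ _ (Sect_iff A (num n))), card_leq.
    unfold cov_by; setoid_rewrite sct_in; tauto. }
  unfold edp; split.
  - intros [H1 [k [Hk H2]]]; split; auto; apply (m_om _ _ _ HM) in Hk as [k' ->]; apply AlmostAll_iff in H2 as [N HN].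
    exists k', N; intros n Hn; apply Hs; auto.
  - intros [H1 [k [N HN]]]; split; auto; exists (num k); split; [apply num_om|]; apply AlmostAll_iff.
    exists N; intros n Hn; apply Hs; auto.
Qed.
Lemma ED_ex : exists F, ED_ E EXM and or F.
Proof.
  exists (sp (pow Om2) (fun A => (exists Y, Omega2 E EXM and or Y /\ Sub E A Y) /\ exists w, Omega E EXM and or w /\ exists k, E k w /\
    AlmostAll E EXM and or (fun n => exists s, Sect E EXM and or A n s /\ exists l, Card E EXM and or s l /\ Leq E or l k))).
  refine (proj2 (so_iff _ _ _ _ _) eq_refl).
  - unfold Omega2, Finite; dfn.
  - intros A [H _]; rewrite (let_iff _ _ _ Omega2_iff) in H; apply pow_spec; auto.
Qed.
Lemma Delta_Om2 d : Delta_ E EXM and or d -> Sub E d Om2.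
Proof. intros Hd z Hz; apply (Delta_in _ _ Hd) in Hz as [a [b [_ ->]]]; apply pd_om; eauto. Qed.
Lemma EDfin_in F B d : Delta_ E EXM and or d -> EDfin_ E EXM and or F -> E B F <-> Sub E B d /\ edp B.
Proof.
  intros Hd H; rewrite (so_in _ _ B H); split.
  - intros [I [HI [D' [HD [A [HA HB]]]]]]; pose proof Delta_iff as Hu; apply Hu in HD, Hd; subst D' d.
    apply (ED_in _ _ HI) in HA as [_ [k [N HN]]]; split; [intros z Hz; apply HB in Hz; tauto|].
    exists k, N; intros n Hn; destruct (HN n Hn) as [L [HL1 HL2]]; exists L; split; auto; intros z Hz; apply HL2, (proj1 (HB _)), Hz.
  - intros [H1 H2]; destruct ED_ex as [I HI]; exists I; split; auto; exists d; split; auto; exists B; split.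
    + apply (ED_in _ _ HI); split; auto; intros z Hz; apply (Delta_Om2 d Hd); auto.
    + intros z; unfold seqv; split; [intros Hz; auto|tauto].
Qed.
Lemma EDfin_ex : exists F, EDfin_ E EXM and or F.
Proof.
  destruct Delta_ex as [d Hd].
  exists (sp (pow d) (fun B => exists I, ED_ E EXM and or I /\ exists D', Delta_ E EXM and or D' /\ exists A, E A I /\ Inter E and A D' B)).
  refine (proj2 (so_iff _ _ _ _ _) eq_refl).
  - unfold ED_, Delta_, Omega2; dfn.
  - intros B [I [_ [D' [HD [A [_ HB]]]]]]; apply Delta_iff in HD, Hd; subst D' d.
    apply pow_spec; intros z Hz; apply HB in Hz; tauto.
Qed.

Lemma cup_in a b z : E z (un (upr a b)) <-> E z a \/ E z b.
Proof.
  rewrite un_spec; split.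
  - intros [y [Hy Hz]]; apply upr_spec in Hy as [->| ->]; auto.
  - intros [H|H]; [exists a|exists b]; split; auto; apply upr_spec; auto.
Qed.
Lemma ff_cup a b : ff a -> ff b -> ff (un (upr a b)).
Proof.
  intros [N HN] [N' HN']; exists (N + N'); intros n Hn; destruct (HN n) as [L HL], (HN' n) as [L' HL']; try lia.
  exists (L ++ L'); intros z Hz; apply cup_in in Hz; apply in_or_app; destruct Hz; auto.
Qed.
Lemma edp_cup a b : edp a -> edp b -> edp (un (upr a b)).
Proof.
  intros [k [N HN]] [k' [N' HN']]; exists (k + k'), (N + N'); intros n Hn; destruct (HN n) as [L [Hl HL]], (HN' n) as [L' [Hl' HL']]; try lia.
  exists (L ++ L'); rewrite length_app; split; [lia|]; intros z Hz; apply cup_in in Hz; apply in_or_app; destruct Hz; auto.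
Qed.
Lemma edp_one v : edp (upr v v).
Proof.
  exists 1, 0; intros n _; destruct (classic (exists z, E (pr (num n) z) (upr v v))) as [[z Hz]|Hn].
  - exists [z]; split; auto; intros z' Hz'; apply upr_spec in Hz, Hz'.
    left; assert (H : pr (num n) z = pr (num n) z') by (transitivity v; [tauto|symmetry; tauto]).
    apply pr_inj in H; tauto.
  - exists []; split; auto; intros z Hz; destruct Hn; eauto.
Qed.
Lemma avoid_num (L : list M) : exists m, m <= length L /\ ~ In (num m) L.
Proof.
  apply NNPP; intros H.
  assert (Hl : length (map num (seq 0 (S (length L)))) <= length L); [|rewrite length_map, length_seq in Hl; lia].
  apply NoDup_incl_length.
  - apply NoDup_map_NoDup_ForallPairs; [|apply seq_NoDup]; intros x y _ _ He; exact (num_inj _ _ He).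
  - intros z Hz; apply in_map_iff in Hz as [m [<- Hm]]; apply in_seq in Hm; apply NNPP; intros Hn; apply H; exists m; split; auto; lia.
Qed.
Lemma one_sub v a : E v a -> Sub E (upr v v) a.
Proof. intros H z Hz; apply upr_spec in Hz as [->| ->]; auto. Qed.

Lemma FinFin_Ideal F : FinFin_ E EXM and or F -> Ideal Om2 F.
Proof.
  intros HF; pose proof (FinFin_in F) as HI; assert (H00 : E (pr (num 0) (num 0)) Om2) by (apply pd_om; eauto).
  assert (Hs : forall v, E v Om2 -> exists c, E c F /\ E v c).
  { intros v Hv; exists (upr v v); split; [|apply upr_spec; auto].
    apply HI; auto; split; [apply one_sub; auto|apply edp_ff, edp_one]. }
  split; auto.
  - intros a b Ha Hb; apply HI in Ha as [Ha Ha'], Hb as [Hb Hb']; auto.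
    exists (un (upr a b)); split; [|split; intros z Hz; apply cup_in; auto].
    apply HI; auto; split; [intros z Hz; apply cup_in in Hz as [|]; auto|apply ff_cup; auto].
  - intros c Hc; apply HI in Hc as [_ [N HN]]; auto; destruct (HN N) as [L HL]; auto.
    destruct (avoid_num L) as [m [_ Hm]]; exists (pr (num N) (num m)); split; [apply pd_om; eauto|].
    intros H; apply Hm, HL, H.
  - destruct (Hs _ H00) as [c [Hc _]]; eauto.
Qed.
Lemma ED_Ideal F : ED_ E EXM and or F -> Ideal Om2 F.
Proof.
  intros HF; pose proof (ED_in F) as HI; assert (H00 : E (pr (num 0) (num 0)) Om2) by (apply pd_om; eauto).
  assert (Hs : forall v, E v Om2 -> exists c, E c F /\ E v c).
  { intros v Hv; exists (upr v v); split; [|apply upr_spec; auto].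
    apply HI; auto; split; [apply one_sub; auto|apply edp_one]. }
  split; auto.
  - intros a b Ha Hb; apply HI in Ha as [Ha Ha'], Hb as [Hb Hb']; auto.
    exists (un (upr a b)); split; [|split; intros z Hz; apply cup_in; auto].
    apply HI; auto; split; [intros z Hz; apply cup_in in Hz as [|]; auto|apply edp_cup; auto].
  - intros c Hc; apply HI in Hc as [_ [k [N HN]]]; auto; destruct (HN N) as [L [_ HL]]; auto.
    destruct (avoid_num L) as [m [_ Hm]]; exists (pr (num N) (num m)); split; [apply pd_om; eauto|].
    intros H; apply Hm, HL, H.
  - destruct (Hs _ H00) as [c [Hc _]]; eauto.
Qed.
Lemma EDfin_Ideal F d : Delta_ E EXM and or d -> EDfin_ E EXM and or F -> Ideal d F.
Proof.
  intros Hd HF; pose proof (fun B => EDfin_in F B d Hd HF) as HI.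
  assert (H00 : E (pr (num 0) (num 0)) d) by (apply (Delta_in _ _ Hd); exists 0, 0; auto).
  assert (Hs : forall v, E v d -> exists c, E c F /\ E v c).
  { intros v Hv; exists (upr v v); split; [|apply upr_spec; auto].
    apply HI; auto; split; [apply one_sub; auto|apply edp_one]. }
  split; auto.
  - intros a b Ha Hb; apply HI in Ha as [Ha Ha'], Hb as [Hb Hb']; auto.
    exists (un (upr a b)); split; [|split; intros z Hz; apply cup_in; auto].
    apply HI; auto; split; [intros z Hz; apply cup_in in Hz as [|]; auto|apply edp_cup; auto].
  (* Level [N + k] of the triangle contains all second coordinates up to [k], and a list of length
     at most [k] misses one of them. *)
  - intros c Hc; apply HI in Hc as [_ [k [N HN]]]; auto; destruct (HN (N + k)) as [L [Hk HL]]; [lia|].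
    destruct (avoid_num L) as [m [Hm' Hm]]; exists (pr (num (N + k)) (num m)); split.
    + apply (Delta_in _ _ Hd); exists (N + k), m; split; auto; lia.
    + intros H; apply Hm, HL, H.
  - destruct (Hs _ H00) as [c [Hc _]]; eauto.
Qed.

Lemma less_least T P Q : DM (fun r => P (r 0)) -> DM (fun r => Q (r 0)) -> (exists a, P a /\ img T a) -> (exists z, Q z) ->
  (forall z, Q z -> ~ img T z) -> LessCard E EXM and (LeastSize E EXM and or P) (LeastSize E EXM and or Q).
Proof.
  intros DP DQ [a [Ha Hi]] [z Hz] Hn.
  destruct (least_size_ex P a DP Ha) as [k Hk], (least_size_ex Q z DQ Hz) as [l Hl].
  exists k; split; auto; exists l; split; auto; eapply (least_size_lt T P Q k l a); eauto.
Qed.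
Lemma less_max T P P' Q : DM (fun r => P (r 0)) -> DM (fun r => P' (r 0)) -> DM (fun r => Q (r 0)) ->
  (exists a, P a /\ img T a) -> (exists a, P' a /\ img T a) -> (exists z, Q z) -> (forall z, Q z -> ~ img T z) ->
  LessCard E EXM and (MaxCard E EXM and or (LeastSize E EXM and or P) (LeastSize E EXM and or P')) (LeastSize E EXM and or Q).
Proof.
  intros DP DP' DQ [a [Ha Hi]] [a' [Ha' Hi']] [z Hz] Hn.
  destruct (least_size_ex P a DP Ha) as [k Hk], (least_size_ex P' a' DP' Ha') as [k' Hk'], (least_size_ex Q z DQ Hz) as [l Hl].
  pose proof (least_size_lt T P Q k l a Ha Hi Hn Hk Hl) as H1.
  pose proof (least_size_lt T P' Q k' l a' Ha' Hi' Hn Hk' Hl) as H2.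
  pose proof (ord_trich k k' (least_size_ord _ _ Hk) (least_size_ord _ _ Hk')) as H3.
  destruct H3 as [H3|H3].
  - exists k'; split; [exists k; split; auto; exists k'; split; auto; unfold Leq; tauto|eauto].
  - exists k; split; [exists k; split; auto; exists k'; split; auto; unfold Leq; intuition|eauto].
Qed.
Lemma less_min T P Q Q' : DM (fun r => P (r 0)) -> DM (fun r => Q (r 0)) -> DM (fun r => Q' (r 0)) ->
  (exists a, P a /\ img T a) -> (exists z, Q z) -> (exists z, Q' z) -> (forall z, Q z -> ~ img T z) -> (forall z, Q' z -> ~ img T z) ->
  LessCard E EXM and (LeastSize E EXM and or P) (MinCard E EXM and or (LeastSize E EXM and or Q) (LeastSize E EXM and or Q')).
Proof.
  intros DP DQ DQ' [a [Ha Hi]] [z Hz] [z' Hz'] Hn Hn'.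
  destruct (least_size_ex P a DP Ha) as [k Hk], (least_size_ex Q z DQ Hz) as [l Hl], (least_size_ex Q' z' DQ' Hz') as [l' Hl'].
  pose proof (least_size_lt T P Q k l a Ha Hi Hn Hk Hl) as H1.
  pose proof (least_size_lt T P Q' k l' a Ha Hi Hn' Hk Hl') as H2.
  pose proof (ord_trich l l' (least_size_ord _ _ Hl) (least_size_ord _ _ Hl')) as H3.
  exists k; split; auto; destruct H3 as [H3|H3].
  - exists l; split; [exists l; split; auto; exists l'; split; auto; unfold Leq; tauto|auto].
  - exists l'; split; [exists l; split; auto; exists l'; split; auto; unfold Leq; intuition|auto].
Qed.

(** * Bounds for the cardinal characteristics *)

Section Conclusions.

(** An arbitrary set [η] serves as a family: it is read at [t] only when it has exactly one value
    there. *)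
Definition AFun η t h := cApp η t h /\ forall h', cApp η t h' -> h' = h.

Lemma AFun_func η T X t : cFunc η T X -> E t T -> AFun η t (ap η t).
Proof.
  intros H Ht; split; [apply App_iff, (func_ap _ _ _ _ H Ht)|].
  intros h Hh; apply App_iff, (func_pr _ _ _ _ _ H) in Hh; tauto.
Qed.
Lemma rel_app η t h : rel_of η t h <-> cApp η t h.
Proof. rewrite App_iff; apply rel_of_iff. Qed.
Lemma range_img C I Y : cFunc C I Y -> exists F, img I F /\ Sub E F Y /\ forall f, E f F <-> exists i, E i I /\ f = ap C i.
Proof.
  intros HC; exists (sp Y (fun f => exists i, E i I /\ cApp C i f)).
  assert (H : forall f, E f (sp Y (fun f => exists i, E i I /\ cApp C i f)) <-> exists i, E i I /\ f = ap C i).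
  { intros f; rewrite sp_spec by dfn; split.
    - intros [_ [i [Hi H]]]; apply App_iff, (func_pr _ _ _ _ _ HC) in H; exists i; tauto.
    - intros [i [Hi ->]]; split; [apply (ap_spec _ _ _ _ HC Hi)|]; exists i; split; auto.
      apply App_iff, (func_ap _ _ _ _ HC Hi). }
  split; [|split; auto].
  - apply (img_intro I _ Y (fun i f => cApp C i f)); [dfn| | |].
    + intros f Hf; apply H in Hf as [i [Hi ->]]; apply (ap_spec _ _ _ _ HC Hi).
    + intros i f f' Hi _ _ H1 H2; apply App_iff, (func_pr _ _ _ _ _ HC) in H1 as [_ [_ ->]], H2 as [_ [_ ->]]; auto.
    + intros f Hf; apply H in Hf as [i [Hi ->]]; exists i; split; auto; apply App_iff, (func_ap _ _ _ _ HC Hi).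
  - intros f Hf; apply H in Hf as [i [Hi ->]]; apply (ap_spec _ _ _ _ HC Hi).
Qed.

Context (I A C1 C2 C3 : M).
Context (FC1 : cFunc C1 I (fs om om)) (FC2 : cFunc C2 I (fs om om)) (FC2' : forall i n, E i I -> E (ap (ap C2 i) (num n)) (num 2)).
Context (FC3 : cFunc C3 I (fs om Om2)).
(* No [A]-indexed family [η] of functions (predictors, slaloms) bounds (predicts, captures) every member of the
   [I]-indexed family [C1] ([C2], [C3]). *)
Definition factA1 := forall η, exists i, E i I /\ forall t, E t A -> forall h, AFun η t h -> E h (fs om om) -> ~ LeqStar E EXM and or (ap C1 i) h.
Definition factA2 := forall η, exists i, E i I /\ forall t, E t A -> forall h, AFun η t h ->
  (forall s v v', cApp h s v -> cApp h s v' -> v = v') -> ~ Predicts2 E EXM and or h (ap C2 i).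
Definition factA3 := forall η, exists i, E i I /\ forall t, E t A -> forall h, AFun η t h ->
  (exists F, FinFin_ E EXM and or F /\ cFunc h (fq Om2) F) -> ~ inM h (ap C3 i).

Section Small.
Context (t0 : M) (Ht0 : E t0 A).
(** A family with a single member, through which the facts on families speak about one function,
    predictor or slalom. *)
Definition const h := upr (pr t0 h) (pr t0 h).
Lemma const_fun h : AFun (const h) t0 h.
Proof.
  split; [apply App_iff, upr_spec; auto|].
  intros h' H; apply App_iff, upr_spec in H.
  assert (H' : pr t0 h' = pr t0 h) by tauto; apply pr_inj in H'; tauto.
Qed.
Lemma unb_img : factA1 -> exists F, UnbddFam E EXM and or F /\ img I F.
Proof.
  intros HA; destruct (range_img _ _ _ FC1) as [F [H1 [H2 H3]]]; exists F; split; auto.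
  unfold UnbddFam; rewrite (let_iff _ _ _ Baire_iff); split; auto.
  intros g Hg; destruct (HA (const g)) as [i [Hi H]]; exists (ap C1 i); split; [apply H3; eauto|].
  apply (H t0 Ht0 g (const_fun g)); auto.
Qed.
Lemma ev_img Yt Pt Y P : (forall y, Yt y <-> y = Y) -> (forall p, Pt p <-> p = P) ->
  (forall i, E i I -> E (ap C2 i) Y) -> (forall h, E h P -> forall s v v', cApp h s v -> cApp h s v' -> v = v') ->
  factA2 -> exists F, EvFam E EXM and or Yt Pt F /\ img I F.
Proof.
  intros HY HP HC Hf HA; destruct (range_img _ _ _ FC2) as [F [H1 [H2 H3]]]; exists F; split; auto.
  unfold EvFam; rewrite (let_iff _ _ _ HY), (let_iff _ _ _ HP); split.
  - intros f Hf'; apply H3 in Hf' as [i [Hi ->]]; auto.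
  - intros g Hg; destruct (HA (const g)) as [i [Hi H]]; exists (ap C2 i); split; [apply H3; eauto|].
    apply (H t0 Ht0 g (const_fun g)); eauto.
Qed.
Lemma non_img F J : FinFin_ E EXM and or F -> IdealJ Om2 F (fq Om2) inM J ->
  factA3 -> exists a, (Sub E a (fs om Om2) /\ ~ E a J) /\ img I a.
Proof.
  intros HF HJ HA; destruct (range_img _ _ _ FC3) as [a [H1 [H2 H3]]]; exists a; split; auto; split; auto.
  intros Ha; destruct (ij_desc _ _ _ _ _ HJ a Ha) as [phi [Hp Hin]].
  destruct (HA (const phi)) as [i [Hi H]]; apply (H t0 Ht0 phi (const_fun phi)); eauto.
  apply Hin, H3; eauto.
Qed.
End Small.

Section Big.
Lemma dom_not_img z : factA1 -> DomFam E EXM and or z -> ~ img A z.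
Proof.
  unfold DomFam; rewrite (let_iff _ _ _ Baire_iff); intros HA [H1 H2] [η [G1 G2]].
  destruct (HA η) as [i [Hi H]]; destruct (H2 (ap C1 i)) as [h [Hh Hl]]; [apply (ap_spec _ _ _ _ FC1 Hi)|].
  destruct (G2 h Hh) as [t [Ht Hr]]; apply (H t Ht h); auto; split; [apply rel_app; auto|].
  intros h' Hh'; apply rel_app in Hh'; eauto.
Qed.
Lemma pr_not_img Yt Pt Y P z : (forall y, Yt y <-> y = Y) -> (forall p, Pt p <-> p = P) ->
  (forall i, E i I -> E (ap C2 i) Y) -> (forall h, E h P -> forall s v v', cApp h s v -> cApp h s v' -> v = v') ->
  factA2 -> PrFam E EXM and or Yt Pt z -> ~ img A z.
Proof.
  intros HY HP HC Hf; unfold PrFam; rewrite (let_iff _ _ _ HY), (let_iff _ _ _ HP); intros HA [H1 H2] [η [G1 G2]].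
  destruct (HA η) as [i [Hi H]]; destruct (H2 (ap C2 i)) as [h [Hh Hl]]; [auto|].
  destruct (G2 h Hh) as [t [Ht Hr]]; apply (H t Ht h); auto; [split; [apply rel_app; auto|]|].
  - intros h' Hh'; apply rel_app in Hh'; eauto.
  - apply Hf; auto.
Qed.
(** Every member of a cover is captured by one slalom; choosing a slalom for each index turns a
    cover that is an image of [A] into an [A]-indexed family capturing all of [C3]. *)
Lemma covFF_not_img F J z : FinFin_ E EXM and or F -> IdealJ Om2 F (fq Om2) inM J -> factA3 ->
  Sub E z J -> (forall f, E f (fs om Om2) -> exists a, E a z /\ E f a) -> ~ img A z.
Proof.
  intros HF HJ HA H1 H2 [e [G1 G2]].
  assert (HD : DM (fun r => inM (r 1) (r 0))) by (unfold inM; dfn).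
  destruct (choice_fun A (fs (fq Om2) F) (fun t phi => forall a, E a z -> rel_of e t a -> forall f, E f a -> inM phi f)) as [η [E1 E2]].
  - unfold rel_of; dfn.
  - intros t Ht; destruct (classic (exists a, E a z /\ rel_of e t a)) as [[a [Ha Hr]]|Hn].
    + destruct (ij_desc _ _ _ _ _ HJ a (H1 a Ha)) as [phi [Hp Hin]]; exists phi; split; [apply fs_spec; auto|].
      intros a' _ Ha'; rewrite (G1 t a' a Ht Ha' Hr); auto.
    (* The family [num 0] only provides some [i]; as [C3] at [i] is covered, [z] has a member whose
       slalom can serve as default. *)
    + destruct (HA (num 0)) as [i [Hi _]]; destruct (H2 (ap C3 i)) as [a [Ha _]]; [apply (ap_spec _ _ _ _ FC3 Hi)|].
      destruct (ij_desc _ _ _ _ _ HJ a (H1 a Ha)) as [phi [Hp Hin]]; exists phi; split; [apply fs_spec; auto|].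
      intros a' Ha' Hr; destruct Hn; eauto.
  - destruct (HA η) as [i [Hi H]]; destruct (H2 (ap C3 i)) as [a [Ha Hf]]; [apply (ap_spec _ _ _ _ FC3 Hi)|].
    destruct (G2 a Ha) as [t [Ht Hr]]; apply (H t Ht (ap η t)).
    + eapply AFun_func; eauto.
    + exists F; split; auto; apply fs_spec, (ap_spec _ _ _ _ E1 Ht).
    + apply (E2 t Ht a); auto.
Qed.
End Big.

Section Capture.
Context (x0 i0 dm J : M) (inS : M -> M -> Prop) (inS_D : DM (fun r => inS (r 1) (r 0))) (HJ : IdealJ x0 i0 dm inS J).
Context (W T PHI : M).
(* [PHI] is a [W]-indexed family of slaloms, and every [T]-indexed family of sequences is captured by one of them. *)
Definition factPHI := forall w, E w W -> exists phi, (forall p, cApp PHI w p <-> p = phi) /\ cFunc phi dm i0.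
Definition factB := forall Z, cFunc Z T (fs om x0) -> exists w, E w W /\ forall phi, cApp PHI w phi -> forall t, E t T -> forall f, cApp Z t f -> inS phi f.
Context (FP : factPHI) (FB : factB).
(** An image of [T], padded to a total family, is captured by one slalom and so lies in the
    ideal. *)
Lemma non_not_img z : Sub E z (fs om x0) -> ~ E z J -> ~ img T z.
Proof.
  intros Hz Hn [e [G1 G2]]; apply Hn.
  destruct (classic (exists y, E y z)) as [[y0 Hy0]|He].
  - destruct (choice_fun T (fs om x0) (fun t y => forall y', E y' z -> rel_of e t y' -> y = y')) as [Z [Z1 Z2]].
    + unfold rel_of; dfn.
    + intros t Ht; destruct (classic (exists y, E y z /\ rel_of e t y)) as [[y [Hy Hr]]|Hno].
      * exists y; split; auto; intros y' _ Hr'; eauto.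
      * exists y0; split; auto; intros y' Hy' Hr'; destruct Hno; eauto.
    + destruct (FB Z Z1) as [w [Hw H]]; destruct (FP w Hw) as [phi [P1 P2]]; apply (ij_in _ _ _ _ _ HJ phi); auto.
      intros f Hf; destruct (G2 f Hf) as [t [Ht Hr]]; apply (H phi (proj2 (P1 phi) eq_refl) t Ht).
      rewrite <- (Z2 t Ht f Hf Hr); apply App_iff, (func_ap _ _ _ _ Z1 Ht).
  - destruct (ij_emp _ _ _ _ _ HJ) as [a Ha]; apply (ij_down _ _ _ _ _ HJ a); auto; intros y Hy; destruct He; eauto.
Qed.

(** Applied to constant families, [factB] shows that the sets described by the slaloms of [PHI]
    cover the space. *)
Lemma cov_img (t0 : M) : E t0 T -> exists C, (Sub E C J /\ forall f, E f (fs om x0) -> exists a, E a C /\ E f a) /\ img W C.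
Proof.
  intros Ht0; set (Q := fun w B => exists phi, cApp PHI w phi /\ forall f, E f B <-> E f (fs om x0) /\ inS phi f).
  assert (HQ : DM (fun r => Q (r 1) (r 0))) by (unfold Q; dfn).
  set (C := sp (pow (fs om x0)) (fun B => exists w, E w W /\ Q w B)).
  assert (HC : forall B, E B C <-> exists w, E w W /\ Q w B).
  { intros B; unfold C; rewrite sp_spec by dfn; split; [tauto|]; intros [w [Hw [phi [H1 H2]]]]; split; [|exists w; split; auto; exists phi; auto].
    apply pow_spec; intros f Hf; apply H2 in Hf; tauto. }
  exists C; split; [split|].
  - intros B HB; apply HC in HB as [w [Hw [phi [H1 H2]]]]; destruct (FP w Hw) as [phi' [P1 P2]].
    apply P1 in H1 as ->; apply (ij_in _ _ _ _ _ HJ phi'); auto; intros f Hf; apply H2 in Hf; tauto.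
  - intros f Hf; destruct (choice_fun T (fs om x0) (fun t y => y = f)) as [Z [Z1 Z2]]; [dfn|eauto|].
    destruct (FB Z Z1) as [w [Hw H]]; destruct (FP w Hw) as [phi [P1 P2]].
    assert (Hin : inS phi f).
    { apply (H phi (proj2 (P1 phi) eq_refl) t0 Ht0); rewrite <- (Z2 t0 Ht0); apply App_iff, (func_ap _ _ _ _ Z1 Ht0). }
    assert (HB : forall g, E g (sp (fs om x0) (inS phi)) <-> E g (fs om x0) /\ inS phi g).
    { intros g; apply sp_spec, (D_R2 E inS inS_D); [apply V_const|apply V_var; exact om]. }
    exists (sp (fs om x0) (inS phi)); split; [|apply HB; auto].
    apply HC; exists w; split; auto; exists phi; split; auto; apply P1; auto.
  - apply (img_intro W C (pow (fs om x0)) Q HQ).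
    + intros B HB; apply HC in HB as [w [_ [phi [_ H]]]]; apply pow_spec; intros f Hf; apply H in Hf; tauto.
    + intros w B B' Hw _ _ [phi [H1 H2]] [phi' [H1' H2']]; destruct (FP w Hw) as [p [P1 _]].
      apply P1 in H1, H1'; subst phi phi'; apply (m_ext _ _ _ HM); intros z; rewrite H2, H2'; tauto.
    + intros B HB; apply HC; auto.
Qed.
End Capture.
End Conclusions.

(** * The six inequalities in a model with the required families *)

Section Six.
Local Notation cBaire := (Baire E EXM and or).
Local Notation cPred := (Pred_ E EXM and or).

Lemma Pred_iff P : cPred P <-> P = fs (fq om) om.
Proof.
  unfold Pred_; rewrite let_om, (let_iff _ _ _ (FinSeqs_iff om)); apply Funs_iff.
Qed.
Lemma fs_functional a b h s v v' : E h (fs a b) -> cApp h s v -> cApp h s v' -> v = v'.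
Proof.
  intros Hh H H'; apply fs_spec in Hh.
  apply App_iff, (func_pr _ _ _ _ _ Hh) in H as [_ [_ ->]], H' as [_ [_ ->]]; auto.
Qed.
Lemma dom_ex : exists z, DomFam E EXM and or z.
Proof.
  exists (fs om om); unfold DomFam; rewrite (let_iff _ _ _ Baire_iff); split; [intros z Hz; auto|].
  intros g Hg; exists g; split; auto; apply AlmostAll_iff; exists 0; intros n _; apply fs_spec in Hg.
  rewrite !(App_let _ _ _ _ _ Hg) by apply num_om; right; auto.
Qed.
Lemma predicts_self pi f : E f (fs om om) -> (forall n, cApp pi (rs f (num n)) (ap f (num n))) -> Predicts2 E EXM and or pi f.
Proof.
  intros Hf H; apply AlmostAll_iff; exists 0; intros n _; exists (num n); split; [right; auto|split].
  - exists (num (S n)); split; [apply Succ_num; auto|]; exists (num (S (S n))); split; [apply Succ_num; auto|].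
    apply num_E; lia.
  - unfold Guesses; rewrite (let_iff _ _ _ (fun s => Restr_iff f (num n) s)); apply fs_spec in Hf.
    rewrite (App_let _ _ _ _ _ Hf) by apply num_om; apply H.
Qed.
Lemma pr_ex : exists z, PrFam E EXM and or cBaire cPred z.
Proof.
  exists (fs (fq om) om); unfold PrFam; rewrite (let_iff _ _ _ Baire_iff), (let_iff _ _ _ Pred_iff).
  split; [intros z Hz; auto|]; intros f Hf; pose proof Hf as Hf'; apply fs_spec in Hf'.
  destruct (choice_fun (fq om) om (fun s v => forall n, E n om -> cFunc s n om -> cApp f n v)) as [pi [P1 P2]]; [dfn| |].
  - intros s Hs; apply fq_in in Hs as [n Hn]; exists (ap f (num n)); split.
    + apply (ap_spec _ _ _ _ Hf'), num_om.
    + intros m _ Hm; rewrite (func_dom _ _ _ _ Hm Hn); apply App_iff, (func_ap _ _ _ _ Hf'), num_om.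
  - exists pi; split; [apply fs_spec; auto|]; apply predicts_self; auto; intros n.
    destruct (rs_fq om f n Hf) as [H1 H2].
    specialize (P2 _ H1 (num n) (num_om n) H2); apply App_iff, (func_pr _ _ _ _ _ Hf') in P2 as [_ [_ P2]].
    rewrite <- P2; apply App_iff, (func_ap _ _ _ _ P1 H1).
Qed.

Section Bounded.
Context (b : M) (HB : BoundFun E EXM and or b).
Lemma bound_vals : cFunc b om om /\ forall n, exists k, 2 <= k /\ ap b (num n) = num k.
Proof.
  unfold BoundFun in HB; rewrite let_om in HB; destruct HB as [two [H2 [D0 [HD Hb]]]].
  rewrite (let_iff _ _ _ Empty_num), (let_iff _ _ _ (Succ_num 0)) in H2.
  apply Succ_num in H2 as ->.
  assert (Hv : forall n, E (ap b (num n)) D0) by (intros n; apply (ap_spec _ _ _ _ Hb), num_om).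
  split.
  - pose proof Hb as Hb'; apply Func_iff in Hb as [F1 F2]; apply Func_iff; split.
    + intros z Hz; destruct (F1 z Hz) as [x [y [Hx [Hy ->]]]]; exists x, y; split; auto; split; auto; apply HD in Hy; tauto.
    + intros x Hx; destruct (F2 x Hx) as [y [Hy H]]; exists y; split; auto; apply HD in Hy; tauto.
  - intros n; specialize (Hv n); apply HD in Hv as [H1 H2]; apply (m_om _ _ _ HM) in H1 as [k Hk]; exists k; split; auto.
    rewrite Hk, num_E in H2; lia.
Qed.
Lemma InProd_iff f n X : cFunc f n X -> Sub E n om ->
  InProd E EXM and or f n b <-> cFunc f n om /\ forall i, E i n -> E (ap f i) (ap b i).
Proof.
  intros Hf0 Hn; unfold InProd; rewrite let_om; destruct bound_vals as [Hb _].
  assert (H : cFunc f n om -> forall i, E i n -> (exists v, cApp f i v /\ exists c, cApp b i c /\ E v c) <-> E (ap f i) (ap b i)).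
  { intros Hf i Hi; rewrite (App_let _ _ _ _ _ Hf) by auto; rewrite (App_let _ _ _ _ _ Hb) by auto; tauto. }
  split; intros [Hf H1]; split; auto; intros i Hi; apply H; auto.
Qed.
Lemma InProd_func f n : InProd E EXM and or f n b -> cFunc f n om.
Proof. unfold InProd; rewrite let_om; tauto. Qed.

Definition PB := sp (fs om om) (fun f => exists w, Omega E EXM and or w /\ InProd E EXM and or f w b).
Definition SB := sp (fq om) (fun s => exists w, Omega E EXM and or w /\ exists n, E n w /\ InProd E EXM and or s n b).
Lemma ProdB_iff P : ProdB E EXM and or b P <-> P = PB.
Proof.
  apply so_iff; [dfn|]; intros f; rewrite let_om; intros H; apply fs_spec, InProd_func, H.
Qed.
Lemma FinSeqsB_iff S : FinSeqsB E EXM and or b S <-> S = SB.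
Proof.
  apply so_iff; [dfn|]; intros f; rewrite let_om; intros [n [Hn H]]; apply (m_om _ _ _ HM) in Hn as [k ->].
  apply fq_in; exists k; apply InProd_func, H.
Qed.
Definition predb pi := cFunc pi SB om /\ forall s, E s SB -> exists n, E n om /\ InProd E EXM and or s n b /\
  exists v, cApp pi s v /\ exists c, cApp b n c /\ E v c.
Definition PrB := sp (fs SB om) predb.
Lemma PredB_iff P : PredB E EXM and or b P <-> P = PrB.
Proof.
  assert (H : forall pi, (exists w, Omega E EXM and or w /\ exists S, FinSeqsB E EXM and or b S /\ (cFunc pi S w /\
     forall s, E s S -> exists n, E n w /\ InProd E EXM and or s n b /\ exists v, cApp pi s v /\ exists c, cApp b n c /\ E v c)) <-> predb pi).
  { intros pi; rewrite let_om, (let_iff _ _ _ FinSeqsB_iff); reflexivity. }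
  unfold PrB; rewrite <- (so_iff (fs SB om) predb); [|unfold predb; dfn|intros pi [Hp _]; apply fs_spec; auto].
  unfold PredB, setof, seqv; split; intros HP z; specialize (HP z); [rewrite H in HP|rewrite H]; exact HP.
Qed.
Lemma PB_in f : E f PB <-> cFunc f om om /\ forall i, E i om -> E (ap f i) (ap b i).
Proof.
  rewrite (so_in _ _ f (proj2 (ProdB_iff PB) eq_refl)), let_om; split.
  - intros H; pose proof (InProd_func _ _ H) as Hf; apply (InProd_iff _ _ _ Hf) in H; auto; intros z Hz; auto.
  - intros [Hf H]; apply (InProd_iff _ _ _ Hf); auto; intros z Hz; auto.
Qed.
Lemma prB_ex : exists z, PrFam E EXM and or (ProdB E EXM and or b) (PredB E EXM and or b) z.
Proof.
  exists PrB; unfold PrFam; rewrite (let_iff _ _ _ ProdB_iff), (let_iff _ _ _ PredB_iff); destruct bound_vals as [Hb _].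
  split; [intros z Hz; auto|]; intros f Hf; apply PB_in in Hf as [Hf Hv]; pose proof Hf as Hf'; apply fs_spec in Hf'.
  assert (HS : forall s, E s SB <-> exists n, InProd E EXM and or s (num n) b).
  { intros s; rewrite (so_in _ _ s (proj2 (FinSeqsB_iff SB) eq_refl)), let_om; split.
    - intros [n [Hn H]]; apply (m_om _ _ _ HM) in Hn as [k ->]; eauto.
    - intros [n H]; exists (num n); split; auto; apply num_om. }
  destruct (choice_fun SB om (fun s v => forall n, E n om -> InProd E EXM and or s n b -> cApp f n v)) as [pi [P1 P2]]; [dfn| |].
  - intros s Hs; apply HS in Hs as [n Hn]; exists (ap f (num n)); split.
    + apply (ap_spec _ _ _ _ Hf), num_om.
    + intros m _ Hm; apply InProd_func in Hm, Hn; rewrite (func_dom _ _ _ _ Hm Hn).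
      apply App_iff, (func_ap _ _ _ _ Hf), num_om.
  - assert (Hpi : forall s n, InProd E EXM and or s (num n) b -> ap pi s = ap f (num n)).
    { intros s n Hs; assert (H1 : E s SB) by (apply HS; eauto); specialize (P2 s H1 (num n) (num_om n) Hs).
      apply App_iff, (func_pr _ _ _ _ _ Hf) in P2; tauto. }
    exists pi; split.
    + apply (so_in _ _ pi (proj2 (PredB_iff PrB) eq_refl)); rewrite let_om, (let_iff _ _ _ FinSeqsB_iff); split; auto.
      intros s Hs; pose proof Hs as Hs'; apply HS in Hs' as [n Hn]; exists (num n); split; [apply num_om|split; auto].
      rewrite (App_let _ _ _ _ _ P1) by auto; rewrite (App_let _ _ _ _ _ Hb) by apply num_om.
      rewrite (Hpi _ _ Hn); apply Hv, num_om.
    + apply predicts_self; auto; intros n; destruct (rs_fq om f n Hf') as [H1 H2].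
      assert (Hs : InProd E EXM and or (rs f (num n)) (num n) b).
      { apply (InProd_iff _ _ _ H2); [apply num_sub_om|]; split; auto; intros i Hi.
        rewrite (rs_ap _ _ _ _ _ Hf (num_sub_om n) Hi); apply Hv, (num_sub_om n i Hi). }
      rewrite <- (Hpi _ _ Hs); apply App_iff, (func_ap _ _ _ _ P1), HS; eauto.
Qed.
(** Every value of [b] is at least 2, so binary sequences lie in every product and one family of
    Cohen reals serves all [b]. *)
Lemma two_PB f : cFunc f om om -> (forall n, E (ap f (num n)) (num 2)) -> E f PB.
Proof.
  intros Hf H; apply PB_in; split; auto; intros i Hi; apply (m_om _ _ _ HM) in Hi as [n ->].
  destruct bound_vals as [_ Hb]; destruct (Hb n) as [k [Hk ->]]; apply (num_sub 2 k Hk), H.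
Qed.
Lemma PrB_functional h : E h PrB -> forall s v v', cApp h s v -> cApp h s v' -> v = v'.
Proof.
  intros H s v v'; apply (fs_functional SB om); unfold PrB in H; rewrite sp_spec in H by (unfold predb; dfn); tauto.
Qed.
End Bounded.

Context (I A C1 C2 C3 : M).
Context (FC1 : cFunc C1 I (fs om om)) (FC2 : cFunc C2 I (fs om om)) (FC2' : forall i n, E i I -> E (ap (ap C2 i) (num n)) (num 2)).
Context (FC3 : cFunc C3 I (fs om Om2)).
Context (W T PHI : M).

Lemma C2_fs i : E i I -> E (ap C2 i) (fs om om).
Proof. intros Hi; apply (ap_spec _ _ _ _ FC2 Hi). Qed.
Lemma Pred_functional h : E h (fs (fq om) om) -> forall s v v', cApp h s v -> cApp h s v' -> v = v'.
Proof. intros H s v v'; apply fs_functional with (1 := H). Qed.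
Lemma C2_PB b : BoundFun E EXM and or b -> forall i, E i I -> E (ap C2 i) (PB b).
Proof. intros Hb i Hi; apply two_PB; auto; apply fs_spec, C2_fs, Hi. Qed.

Section NonCov.
Context (Xt : M -> Prop) (x0 i0 dm : M) (inS : M -> M -> Prop) (Jt : M -> Prop).
Context (HX : forall x, Xt x <-> x = x0) (inS_D : DM (fun r => inS (r 1) (r 0))).
Context (HJex : exists J, Jt J) (HJ : forall J, Jt J -> IdealJ x0 i0 dm inS J).
Lemma nf_iff a : NonFam E EXM and (Seqs E EXM and or Xt) Jt a <-> exists J, Jt J /\ Sub E a (fs om x0) /\ ~ E a J.
Proof. unfold NonFam; rewrite (let_iff _ _ _ (Seqs_iff Xt x0 HX)); reflexivity. Qed.
Lemma cf_iff a : CovFam E EXM and (Seqs E EXM and or Xt) Jt a <-> exists J, Jt J /\ Sub E a J /\ forall f, E f (fs om x0) -> exists b, E b a /\ E f b.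
Proof. unfold CovFam; rewrite (let_iff _ _ _ (Seqs_iff Xt x0 HX)); reflexivity. Qed.
Lemma nf_ex : exists z, NonFam E EXM and (Seqs E EXM and or Xt) Jt z.
Proof. destruct HJex as [J HJ']; exists (fs om x0); apply nf_iff; exists J; split; auto; split; [intros z Hz; auto|apply (HJ J HJ')]. Qed.
Lemma cf_ex : exists z, CovFam E EXM and (Seqs E EXM and or Xt) Jt z.
Proof. destruct HJex as [J HJ']; exists J; apply cf_iff; exists J; split; auto; split; [intros z Hz; auto|apply (HJ J HJ')]. Qed.
Context (FP : factPHI i0 dm W PHI) (FB : factB x0 inS W T PHI).
Lemma nf_not z : NonFam E EXM and (Seqs E EXM and or Xt) Jt z -> ~ img T z.
Proof. intros H; apply nf_iff in H as [J [H1 [H2 H3]]]; eapply non_not_img; eauto. Qed.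
Lemma cf_img t0 : E t0 T -> exists C, CovFam E EXM and (Seqs E EXM and or Xt) Jt C /\ img W C.
Proof.
  intros Ht; destruct HJex as [J HJ']; destruct (cov_img x0 i0 dm J inS inS_D (HJ J HJ') W T PHI FP FB t0 Ht) as [C [HC Hi]].
  exists C; split; auto; apply cf_iff; eauto.
Qed.
End NonCov.

Local Notation cDelta := (Delta_ E EXM and or).
Local Notation cEDfin := (EDfin_ E EXM and or).
Local Notation cED := (ED_ E EXM and or).
Local Notation cFF := (FinFin_ E EXM and or).
Local Notation cOm2 := (Omega2 E EXM and or).
Lemma inM_D : DM (fun r => inM (r 1) (r 0)).
Proof. unfold inM; dfn. Qed.
Lemma inK_D : DM (fun r => inK (r 1) (r 0)).
Proof. unfold inK; dfn. Qed.
Lemma ff_iff F : cFF F -> forall x, cFF x <-> x = F.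
Proof.
  intros HF x; split; [|intros ->; auto]; intros Hx; exact (setof_unique _ _ _ Hx HF).
Qed.
Lemma ed_iff F : cED F -> forall x, cED x <-> x = F.
Proof. intros HF x; split; [|intros ->; auto]; intros Hx; exact (setof_unique _ _ _ Hx HF). Qed.
Lemma edfin_iff F : cEDfin F -> forall x, cEDfin x <-> x = F.
Proof. intros HF x; split; [|intros ->; auto]; intros Hx; exact (setof_unique _ _ _ Hx HF). Qed.
Lemma delta_iff d : cDelta d -> forall x, cDelta x <-> x = d.
Proof. intros HF x; split; [|intros ->; auto]; intros Hx; exact (setof_unique _ _ _ Hx HF). Qed.

Ltac dfs := unfold UnbddFam, DomFam, EvFam, PrFam, NonFam, CovFam, Seqs, MIdeal, KIdeal, SigmaGen, SigmaIdeal, Omega2, Delta_,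
  EDfin_, ED_, FinFin_, Finite, Pred_, ProdB, PredB, FinSeqsB; dfn.

Lemma seqs2 : forall x, cOm2 x <-> x = Om2. Proof. exact Omega2_iff. Qed.

Section NonSide.
Context (HTI : T = I) (t0 : M) (Ht0 : E t0 A) (FA1 : factA1 I A C1) (FA2 : factA2 I A C2).
Lemma stmt1a i0 : cED i0 -> factPHI i0 (fq Om2) W PHI -> factB Om2 inM W T PHI -> Stmt1a E EXM and or.
Proof.
  intros Hi FP FB; destruct (MI_ok cOm2 cED Om2 i0 seqs2 (ed_iff i0 Hi) (ED_Ideal i0 Hi)) as [J1 J2].
  apply (less_max I); [dfs..| | | |].
  - exact (unb_img I A C1 FC1 t0 Ht0 FA1).
  - exact (ev_img I A C2 FC2 t0 Ht0 _ _ _ _ Baire_iff Pred_iff C2_fs Pred_functional FA2).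
  - exact (nf_ex cOm2 Om2 i0 _ inM _ seqs2 J1 J2).
  - rewrite <- HTI; exact (nf_not cOm2 Om2 i0 _ inM _ seqs2 J2 FP FB).
Qed.
Section K.
Context (d i0 : M) (Hd : cDelta d) (Hi : cEDfin i0) (FP : factPHI i0 om W PHI) (FB : factB d inK W T PHI).
Lemma stmt3a : Stmt3a E EXM and or.
Proof.
  intros b [Hb _]; destruct (KI_ok cDelta cEDfin d i0 (delta_iff d Hd) (edfin_iff i0 Hi) (EDfin_Ideal i0 d Hd Hi)) as [J1 J2].
  apply (less_max I); [dfs..| | | |].
  - exact (unb_img I A C1 FC1 t0 Ht0 FA1).
  - exact (ev_img I A C2 FC2 t0 Ht0 _ _ _ _ (ProdB_iff b) (PredB_iff b) (C2_PB b Hb) (PrB_functional b) FA2).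
  - exact (nf_ex cDelta d i0 _ inK _ (delta_iff d Hd) J1 J2).
  - rewrite <- HTI; exact (nf_not cDelta d i0 _ inK _ (delta_iff d Hd) J2 FP FB).
Qed.
Lemma stmt2a : factA3 I A C3 -> Stmt2a E EXM and or.
Proof.
  intros FA3; destruct (KI_ok cDelta cEDfin d i0 (delta_iff d Hd) (edfin_iff i0 Hi) (EDfin_Ideal i0 d Hd Hi)) as [J1 J2].
  destruct FinFin_ex as [F HF].
  destruct (MI_ok cOm2 cFF Om2 F seqs2 (ff_iff F HF) (FinFin_Ideal F HF)) as [[J HJ] J4].
  apply (less_least I); [dfs..| | |].
  - destruct (non_img I A C3 FC3 t0 Ht0 F J HF (J4 J HJ) FA3) as [a [Ha Hi']]; exists a; split; auto.
    apply (nf_iff cOm2 Om2 _ seqs2); eauto.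
  - exact (nf_ex cDelta d i0 _ inK _ (delta_iff d Hd) J1 J2).
  - rewrite <- HTI; exact (nf_not cDelta d i0 _ inK _ (delta_iff d Hd) J2 FP FB).
Qed.
End K.
End NonSide.

Section CovSide.
Context (t0 : M) (Ht0 : E t0 T) (FA1 : factA1 I W C1) (FA2 : factA2 I W C2).
Lemma stmt1b i0 : cED i0 -> factPHI i0 (fq Om2) W PHI -> factB Om2 inM W T PHI -> Stmt1b E EXM and or.
Proof.
  intros Hi FP FB; destruct (MI_ok cOm2 cED Om2 i0 seqs2 (ed_iff i0 Hi) (ED_Ideal i0 Hi)) as [J1 J2].
  apply (less_min W); [dfs..| | | | |].
  - exact (cf_img cOm2 Om2 i0 _ inM _ seqs2 inM_D J1 J2 FP FB t0 Ht0).
  - exact dom_ex.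
  - exact pr_ex.
  - intros z; exact (dom_not_img I W C1 FC1 z FA1).
  - intros z; exact (pr_not_img I W C2 _ _ _ _ z Baire_iff Pred_iff C2_fs Pred_functional FA2).
Qed.
Section K.
Context (d i0 : M) (Hd : cDelta d) (Hi : cEDfin i0) (FP : factPHI i0 om W PHI) (FB : factB d inK W T PHI).
Lemma stmt3b : Stmt3b E EXM and or.
Proof.
  intros b [Hb _]; destruct (KI_ok cDelta cEDfin d i0 (delta_iff d Hd) (edfin_iff i0 Hi) (EDfin_Ideal i0 d Hd Hi)) as [J1 J2].
  apply (less_min W); [dfs..| | | | |].
  - exact (cf_img cDelta d i0 _ inK _ (delta_iff d Hd) inK_D J1 J2 FP FB t0 Ht0).
  - exact dom_ex.
  - exact (prB_ex b Hb).
  - intros z; exact (dom_not_img I W C1 FC1 z FA1).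
  - intros z; exact (pr_not_img I W C2 _ _ _ _ z (ProdB_iff b) (PredB_iff b) (C2_PB b Hb) (PrB_functional b) FA2).
Qed.
Lemma stmt2b : factA3 I W C3 -> Stmt2b E EXM and or.
Proof.
  intros FA3; destruct (KI_ok cDelta cEDfin d i0 (delta_iff d Hd) (edfin_iff i0 Hi) (EDfin_Ideal i0 d Hd Hi)) as [J1 J2].
  destruct FinFin_ex as [F HF].
  destruct (MI_ok cOm2 cFF Om2 F seqs2 (ff_iff F HF) (FinFin_Ideal F HF)) as [J3 J4].
  apply (less_least W); [dfs..| | |].
  - exact (cf_img cDelta d i0 _ inK _ (delta_iff d Hd) inK_D J1 J2 FP FB t0 Ht0).
  - exact (cf_ex cOm2 Om2 F _ inM _ seqs2 J3 J4).
  - intros z Hz; apply (cf_iff cOm2 Om2 _ seqs2) in Hz as [J [HJ [Z1 Z2]]].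
    exact (covFF_not_img I W C3 FC3 F J z HF (J4 J HJ) FA3 Z1 Z2).
Qed.
End K.
End CovSide.
End Six.

End TM.

(** * Names and forcing *)

(* [Ob a] is the set of conditions attached to the element [f a]; it need not be closed downwards. *)
Inductive Name (P : Type) : Type := nm (A : Type) (f : A -> Name P) (Ob : A -> P -> Prop).
Arguments nm {P} A f Ob.

Class Order (P : Type) := {
  lep : P -> P -> Prop;
  lep_refl : forall p, lep p p;
  lep_trans : forall p q r, lep p q -> lep q r -> lep p r }.
#[global] Hint Resolve lep_refl lep_trans : core.

Section Forcing.
Context {P : Type} {OP : Order P}.
Local Notation Name := (Name P).

Definition dns (p : P) (X : P -> Prop) := forall q, lep q p -> exists r, lep r q /\ X r.

Lemma dns_mono p q X : lep q p -> dns p X -> dns q X.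
Proof. intros H HX r Hr; apply HX; eauto. Qed.
Lemma dns_now (p : P) (X : P -> Prop) : (forall q, lep q p -> X q) -> dns p X.
Proof. intros H q Hq; exists q; auto. Qed.
Lemma dns_bind p X Y : dns p X -> (forall q, lep q p -> X q -> dns q Y) -> dns p Y.
Proof.
  intros HX H q Hq; destruct (HX q Hq) as [r [Hr Hx]].
  destruct (H r (lep_trans _ _ _ Hr Hq) Hx r (lep_refl r)) as [s [Hs Hy]]; eauto.
Qed.
Lemma dns_imp p (X Y : P -> Prop) : dns p X -> (forall q, lep q p -> X q -> Y q) -> dns p Y.
Proof. intros HX H q Hq; destruct (HX q Hq) as [r [Hr Hx]]; exists r; split; eauto. Qed.

(** Both clauses compare [f a] with [g b] in this order, which keeps the recursion structural in
    [x]; symmetry is proved afterwards. *)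
Fixpoint eqn (x y : Name) {struct x} : P -> Prop :=
  match x, y with nm A f Ob, nm B g Ob' => fun p =>
    (forall a s q, Ob a s -> lep q s -> lep q p ->
       dns q (fun r => exists b t, Ob' b t /\ lep r t /\ eqn (f a) (g b) r)) /\
    (forall b s q, Ob' b s -> lep q s -> lep q p ->
       dns q (fun r => exists a t, Ob a t /\ lep r t /\ eqn (f a) (g b) r))
  end.

(** Membership realized at [r] by a definite element of [y], as opposed to forced membership, where
    the element is decided only densely. *)
Definition memr (x y : Name) (r : P) : Prop :=
  match y with nm B g Ob => exists b t, Ob b t /\ lep r t /\ eqn x (g b) r end.
Definition mem (x y : Name) (p : P) : Prop := dns p (memr x y).

Lemma eqn_mono x y p q : lep q p -> eqn x y p -> eqn x y q.
Proof. destruct x, y; simpl; intros H [H1 H2]; split; intros; eauto. Qed.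
Lemma eqn_stable x y p : dns p (eqn x y) -> eqn x y p.
Proof.
  destruct x as [A f Ob], y as [B g Ob']; simpl; intros H; split; intros a s q Ha Hs Hq q' Hq'.
  - destruct (H q') as [r [Hr [H1 _]]]; eauto.
    destruct (H1 a s r Ha) with (q := r) as [r' [Hr' Hx]]; eauto.
  - destruct (H q') as [r [Hr [_ H1]]]; eauto.
    destruct (H1 a s r Ha) with (q := r) as [r' [Hr' Hx]]; eauto.
Qed.
Lemma eqn_bind x y p X : dns p X -> (forall q, lep q p -> X q -> eqn x y q) -> eqn x y p.
Proof. intros H H1; apply eqn_stable; eapply dns_imp; eauto. Qed.
Lemma eqn_refl x : forall p, eqn x x p.
Proof.
  induction x as [A f IH Ob]; simpl; split; intros a s q Ha Hs Hq r Hr; exists r; split; auto; exists a, s; eauto.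
Qed.
Lemma eqn_sym x : forall y p, eqn x y p -> eqn y x p.
Proof.
  induction x as [A f IH Ob]; intros [B g Ob'] p [H1 H2]; simpl; split; intros a s q Ha Hs Hq.
  - eapply dns_imp; [exact (H2 a s q Ha Hs Hq)|]; intros r _ [b [t [Hb [Ht He]]]]; exists b, t; auto.
  - eapply dns_imp; [exact (H1 a s q Ha Hs Hq)|]; intros r _ [b [t [Hb [Ht He]]]]; exists b, t; auto.
Qed.
Lemma eqn_trans x : forall y z p, eqn x y p -> eqn y z p -> eqn x z p.
Proof.
  induction x as [A f IH Ob]; intros [B g Ob'] [C h Ob''] p [H1 H2] [H3 H4]; simpl; split; intros a s q Ha Hs Hq.
  - eapply dns_bind; [eapply (H1 a); eauto|]; intros r Hr [b [t [Hb [Ht He]]]].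
    eapply dns_imp; [eapply (H3 b t r); eauto|]; intros r' Hr' [c [u [Hc [Hu He']]]].
    exists c, u; split; auto; split; auto. eapply IH; [|exact He']; exact (eqn_mono _ _ _ _ Hr' He).
  - eapply dns_bind; [eapply (H4 a); eauto|]; intros r Hr [b [t [Hb [Ht He]]]].
    eapply dns_imp; [eapply (H2 b t r); eauto|]; intros r' Hr' [c [u [Hc [Hu He']]]].
    exists c, u; split; auto; split; auto. eapply IH; [exact He'|]; exact (eqn_mono _ _ _ _ Hr' He).
Qed.

Lemma mem_mono x y p q : lep q p -> mem x y p -> mem x y q.
Proof. apply dns_mono. Qed.
Lemma mem_stable x y p : dns p (mem x y) -> mem x y p.
Proof. intros H; eapply dns_bind; eauto. Qed.
Lemma mem_congr_l x x' y p : eqn x x' p -> mem x y p -> mem x' y p.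
Proof.
  destruct y as [B g Ob]; intros H Hm; eapply dns_imp; [exact Hm|]; intros q Hq [b [t [Hb [Ht He]]]].
  exists b, t; split; auto; split; auto. eapply eqn_trans; [|exact He]. apply eqn_sym; exact (eqn_mono _ _ _ _ Hq H).
Qed.
Lemma mem_congr_r x y y' p : eqn y y' p -> mem x y p -> mem x y' p.
Proof.
  destruct y as [B g Ob], y' as [C h Ob']; intros [H _] Hm; eapply dns_bind; [exact Hm|].
  intros q Hq [b [t [Hb [Ht He]]]]; eapply dns_imp; [eapply (H b t q); eauto|].
  intros r Hr [c [u [Hc [Hu He']]]]; exists c, u; split; auto; split; auto.
  eapply eqn_trans; [|exact He']; exact (eqn_mono _ _ _ _ Hr He).
Qed.
Lemma mem_intro A f Ob (a : A) s p : Ob a s -> lep p s -> mem (f a) (nm A f Ob) p.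
Proof. intros Ha Hs; apply dns_now; intros q Hq; exists a, s; split; auto; split; eauto using eqn_refl. Qed.
Lemma eqn_ext x y p : (forall z q, lep q p -> mem z x q <-> mem z y q) -> eqn x y p.
Proof.
  destruct x as [A f Ob], y as [B g Ob']; intros H; split; intros a s q Ha Hs Hq.
  - apply (proj1 (H (f a) q Hq)), (mem_intro A f Ob a s); auto.
  - eapply dns_imp; [apply (proj2 (H (g a) q Hq)), (mem_intro B g Ob' a s); auto|].
    intros r Hr [b [t [Hb [Ht He]]]]; exists b, t; split; auto; split; auto; apply eqn_sym; auto.
Qed.

Lemma mem_irrefl x : forall p, ~ mem x x p.
Proof.
  induction x as [A f IH Ob]; intros p H; destruct (H p (lep_refl p)) as [r [Hr [b [t [Hb [Ht He]]]]]].
  apply (IH b r). eapply mem_congr_r; [exact He|]. apply (mem_intro A f Ob b t); auto.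
Qed.

(** With implication and the universal quantifier as the only connectives, density enters through
    the atomic clauses alone; that a densely forced formula is forced then follows by induction. *)
Fixpoint forces (p : form) (e : nat -> Name) : P -> Prop :=
  match p with
  | Bot => fun _ => False
  | Mem i j => mem (e i) (e j)
  | Equ i j => eqn (e i) (e j)
  | Imp a b => fun p => forall q, lep q p -> forces a e q -> forces b e q
  | All a => fun p => forall x, forces a (scons x e) p
  end.

Lemma forces_mono a : forall e p q, lep q p -> forces a e p -> forces a e q.
Proof.
  induction a; simpl; intros e p q H; try tauto; eauto using mem_mono, eqn_mono.
Qed.
Lemma forces_stable a : forall e p, dns p (forces a e) -> forces a e p.
Proof.
  induction a; simpl; intros e p H.
  - destruct (H p (lep_refl p)) as [r [_ []]].
  - apply mem_stable; auto.
  - apply eqn_stable; auto.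
  - intros q Hq Ha; apply IHa2; intros r Hr; destruct (H r) as [s [Hs Hf]]; eauto.
    exists s; split; auto; apply Hf; auto; eapply forces_mono; [|exact Ha]; eauto.
  - intros x; apply IHa; eapply dns_imp; [exact H|]; auto.
Qed.
Lemma forces_bind a e p X : dns p X -> (forall q, lep q p -> X q -> forces a e q) -> forces a e p.
Proof. intros H H1; apply forces_stable; eapply dns_imp; eauto. Qed.
Lemma forces_ext a : forall e e' p, (forall i, e i = e' i) -> forces a e p <-> forces a e' p.
Proof.
  induction a; simpl; intros e e' p H; rewrite ?H; try tauto.
  - split; intros H1 q Hq H2; apply (IHa2 e e' q H), H1, (IHa1 e e' q H); auto.
  - split; intros H1 x; eapply IHa; try apply (H1 x); intros [|i]; simpl; auto.
Qed.
Lemma forces_scoped a : forall n e e' p, scoped n a -> (forall i, i < n -> e i = e' i) -> forces a e p <-> forces a e' p.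
Proof.
  induction a; simpl; intros m e e' p Hs H; try tauto.
  - rewrite !H by tauto; tauto.
  - rewrite !H by tauto; tauto.
  - split; intros H1 q Hq H2; apply (IHa2 m e e' q); try tauto; apply H1; auto; apply (IHa1 m e e' q); tauto.
  - split; intros H1 x; eapply IHa; try apply (H1 x); try exact Hs; intros [|i] Hi; simpl; first [reflexivity|apply H; lia|symmetry; apply H; lia].
Qed.
Lemma forces_ren a : forall r e p, forces (ren r a) e p <-> forces a (fun i => e (r i)) p.
Proof.
  induction a; simpl; intros r e p; try tauto.
  - split; intros H1 q Hq H2; apply IHa2, H1, IHa1; auto.
  - split; intros H1 x; specialize (H1 x); [apply IHa in H1|apply IHa];
      (eapply forces_ext; [|exact H1]); intros [|i]; reflexivity.
Qed.
Lemma forces_congr a : forall e e' p, (forall i, eqn (e i) (e' i) p) -> forces a e p -> forces a e' p.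
Proof.
  induction a; simpl; intros e e' p H; auto.
  - intros H1; eapply mem_congr_l; [apply H|]; eapply mem_congr_r; [apply H|auto].
  - intros H1; eapply eqn_trans; [apply eqn_sym, H|]; eapply eqn_trans; [exact H1|apply H].
  - intros H1 q Hq H2; eapply IHa2; [intros i; eapply eqn_mono; [exact Hq|apply H]|].
    apply H1; auto; eapply IHa1; [|exact H2]; intros i; apply eqn_sym; eapply eqn_mono; eauto.
  - intros H1 x; eapply IHa; [|apply (H1 x)]; intros [|i]; simpl; auto using eqn_refl.
Qed.

Lemma f_all p d e c : forces (fall p d) e c <-> forall x, forces (p d (S d)) (scons x e) c.
Proof. reflexivity. Qed.
Lemma f_imp a b d e c : forces (fimp a b d) e c <-> forall q, lep q c -> forces (a d) e q -> forces (b d) e q.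
Proof. reflexivity. Qed.
Lemma f_neg a d e c : forces (fneg a d) e c <-> forall q, lep q c -> ~ forces (a d) e q.
Proof. reflexivity. Qed.
Lemma f_and a b d e c : forces (fand a b d) e c <-> forces (a d) e c /\ forces (b d) e c.
Proof.
  unfold fand, fneg, fimp, fbot; simpl; split.
  - intros H; split; apply forces_stable; intros q Hq; apply NNPP; intros Hn; apply (H q Hq);
      intros r Hr Ha s Hs Hb; apply Hn.
    + exists r; auto.
    + exists s; eauto.
  - intros [Ha Hb] q Hq H; apply (H q (lep_refl q)) with q; eauto using forces_mono.
Qed.
Lemma f_or a b d e c : forces (for_ a b d) e c <-> dns c (fun q => forces (a d) e q \/ forces (b d) e q).
Proof.
  unfold for_, fneg, fimp, fbot; simpl; split.
  - intros H q Hq; destruct (classic (exists r, lep r q /\ forces (a d) e r)) as [[r [Hr Ha]]|Hn].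
    + exists r; auto.
    + exists q; split; auto; right; apply H; auto; intros r Hr Ha; apply Hn; eauto.
  - intros H q Hq Hn; eapply forces_bind; [eapply dns_mono; eauto|]; intros r Hr [Ha|Hb]; auto.
    destruct (Hn r Hr Ha).
Qed.
Lemma f_ex p d e c : forces (fex p d) e c <-> dns c (fun q => exists x, forces (p d (S d)) (scons x e) q).
Proof.
  unfold fex, fneg, fimp, fbot, fall; simpl; split.
  - intros H q Hq; apply NNPP; intros Hn; apply (H q Hq); intros x r Hr Hf; apply Hn; eauto.
  - intros H q Hq Hn; destruct (H q Hq) as [r [Hr [x Hx]]]; exact (Hn x r Hr Hx).
Qed.
Lemma f_iff a b d e c : forces (fiff a b d) e c <-> forall q, lep q c -> forces (a d) e q <-> forces (b d) e q.
Proof.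
  unfold fiff; rewrite f_and, !f_imp; split.
  - intros [H1 H2] q Hq; split; auto.
  - intros H; split; intros q Hq; apply H; auto.
Qed.
Lemma f_ex_i p d e c x : forces (p d (S d)) (scons x e) c -> forces (fex p d) e c.
Proof. intros H; apply f_ex, dns_now; intros q Hq; exists x; eapply forces_mono; eauto. Qed.

Lemma eqn_down x y p q : eqn x y p -> lep q p -> eqn x y q.
Proof. intros H Hq; exact (eqn_mono _ _ _ _ Hq H). Qed.
Lemma mem_down x y p q : mem x y p -> lep q p -> mem x y q.
Proof. intros H Hq; exact (mem_mono _ _ _ _ Hq H). Qed.
Lemma forces_down a e p q : forces a e p -> lep q p -> forces a e q.
Proof. intros H Hq; exact (forces_mono _ _ _ _ Hq H). Qed.

Definition upn (x y : Name) : Name := nm bool (fun b : bool => if b then x else y) (fun _ _ => True).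
Lemma mem_upn z x y p : mem z (upn x y) p <-> dns p (fun q => eqn z x q \/ eqn z y q).
Proof.
  split; intros H; eapply dns_imp; try exact H; intros q Hq; simpl.
  - intros [[] [t [_ [_ He]]]]; auto.
  - intros [He|He]; [exists true|exists false]; exists q; auto.
Qed.
Definition opn (x y : Name) : Name := upn (upn x x) (upn x y).

Lemma upn_eq x a b p : eqn (upn x x) (upn a b) p -> eqn x a p /\ eqn x b p.
Proof.
  intros H; apply eqn_sym in H; split.
  - assert (Hm : mem a (upn x x) p) by (eapply mem_congr_r; [exact H|]; apply mem_upn, dns_now; intros; left; apply eqn_refl).
    apply mem_upn in Hm; eapply eqn_bind; [exact Hm|]; intros q Hq [He|He]; apply eqn_sym; auto.
  - assert (Hm : mem b (upn x x) p) by (eapply mem_congr_r; [exact H|]; apply mem_upn, dns_now; intros; right; apply eqn_refl).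
    apply mem_upn in Hm; eapply eqn_bind; [exact Hm|]; intros q Hq [He|He]; apply eqn_sym; auto.
Qed.
(** The usual argument for Kuratowski pairs. Which component equals which is decided only below
    stronger conditions, so each case split is made after [eqn_bind]. *)
Lemma opn_inj x y x' y' p : eqn (opn x y) (opn x' y') p -> eqn x x' p /\ eqn y y' p.
Proof.
  assert (L : forall x y z w p, eqn (opn x y) (opn z w) p -> mem (upn x x) (opn z w) p /\ mem (upn x y) (opn z w) p).
  { clear; intros x y z w p H; split; eapply mem_congr_r; try exact H; apply mem_upn, dns_now; intros; [left|right]; apply eqn_refl. }
  intros H; assert (Hx : eqn x x' p).
  { destruct (L _ _ _ _ _ H) as [H1 _]; apply mem_upn in H1; eapply eqn_bind; [exact H1|].
    intros q Hq [He|He]; apply upn_eq in He; tauto. }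
  split; auto.
  destruct (L _ _ _ _ _ H) as [_ H1]; apply eqn_sym in H; destruct (L _ _ _ _ _ H) as [_ H2].
  apply mem_upn in H1, H2.
  eapply eqn_bind; [exact H1|]; intros q Hq C1; eapply eqn_bind; [eapply dns_mono; [exact Hq|exact H2]|].
  intros r Hr C2.
  assert (Hx' : eqn x x' r) by (eapply eqn_mono; [|exact Hx]; eauto).
  assert (C1' : eqn (upn x y) (upn x' x') r \/ eqn (upn x y) (upn x' y') r)
    by (destruct C1; [left|right]; eapply eqn_mono; eauto); clear C1.
  assert (K : forall a b p, eqn (upn a b) (upn a a) p -> eqn b a p).
  { clear; intros a b p H; apply eqn_sym, upn_eq in H; apply eqn_sym; tauto. }
  assert (Kx : eqn y x r \/ eqn (upn x y) (upn x' y') r).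
  { destruct C1' as [C|C]; auto; left; apply eqn_sym, upn_eq in C as [_ C].
    apply eqn_sym; eapply eqn_trans; [exact Hx'|exact C]. }
  assert (Ky : eqn y' x r \/ eqn (upn x' y') (upn x y) r).
  { destruct C2 as [C|C]; auto; left; apply eqn_sym, upn_eq in C as [_ C]; apply eqn_sym; exact C. }
  assert (Y1 : mem y (upn x y) r) by (apply mem_upn, dns_now; intros; right; apply eqn_refl).
  assert (Y2 : mem y' (upn x' y') r) by (apply mem_upn, dns_now; intros; right; apply eqn_refl).
  assert (F : eqn y x r -> mem y' (upn x y) r -> eqn y y' r).
  { intros Hy Hm; apply mem_upn in Hm; eapply eqn_bind; [exact Hm|]; intros s Hs [C|C]; apply eqn_sym; auto.
    eapply eqn_trans; [exact C|]; apply eqn_sym; eapply eqn_mono; eauto. }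
  destruct Kx as [Kx|Kx].
  - destruct Ky as [Ky|Ky].
    + eapply eqn_trans; [exact Kx|apply eqn_sym; exact Ky].
    + apply F; auto; eapply mem_congr_r; [exact Ky|exact Y2].
  - assert (Y3 : mem y (upn x' y') r) by (eapply mem_congr_r; [exact Kx|exact Y1]).
    apply mem_upn in Y3; eapply eqn_bind; [exact Y3|]; intros s Hs [C|C]; auto.
    assert (Hyx : eqn y x s) by (eapply eqn_trans; [exact C|]; apply eqn_sym; eapply eqn_mono; eauto).
    assert (Z : mem y' (upn x y) s).
    { eapply mem_congr_r; [apply eqn_sym; exact (eqn_mono _ _ _ _ Hs Kx)|exact (mem_mono _ _ _ _ Hs Y2)]. }
    apply mem_upn in Z; eapply eqn_bind; [exact Z|].
    intros s' Hs' [C'|C']; apply eqn_sym; auto; eapply eqn_trans; [exact C'|]; apply eqn_sym; exact (eqn_mono _ _ _ _ Hs' Hyx).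
Qed.

Lemma upair_name x y z d e c : x < d -> y < d -> z < d ->
  eqn (e (d - S z)) (upn (e (d - S x)) (e (d - S y))) c <-> forces (upair x y z d) e c.
Proof.
  intros Hx Hy Hz; unfold upair; rewrite f_all; split.
  - intros H w; apply f_iff; intros q Hq; rewrite f_or; unfold fmem, fequ; cbn [forces].
    replace (S d - S d) with 0 by lia. replace (S d - S z) with (S (d - S z)) by lia.
    replace (S d - S x) with (S (d - S x)) by lia. replace (S d - S y) with (S (d - S y)) by lia. simpl scons.
    assert (H' : eqn (e (d - S z)) (upn (e (d - S x)) (e (d - S y))) q) by (eapply eqn_mono; eauto).
    split.
    + intros Hm; apply mem_upn; eapply mem_congr_r; eauto.
    + intros Hm; eapply mem_congr_r; [apply eqn_sym; exact H'|]; apply mem_upn; auto.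
  - intros H; apply eqn_ext; intros w q Hq; specialize (H w); rewrite f_iff in H; specialize (H q Hq).
    rewrite f_or in H; unfold fmem, fequ in H; cbn [forces] in H.
    replace (S d - S d) with 0 in H by lia. replace (S d - S z) with (S (d - S z)) in H by lia.
    replace (S d - S x) with (S (d - S x)) in H by lia. replace (S d - S y) with (S (d - S y)) in H by lia. simpl scons in H.
    rewrite mem_upn; exact H.
Qed.
End Forcing.

(** * The forced axioms of set theory *)

Lemma scons_lift {X} (x : X) e d z : z < d -> scons x e (S d - S z) = e (d - S z).
Proof. intros H; replace (S d - S z) with (S (d - S z)) by lia; reflexivity. Qed.
Lemma scons_top {X} (x : X) e d : scons x e (S d - S d) = x.
Proof. rewrite Nat.sub_diag; reflexivity. Qed.

Ltac lk := repeat first [rewrite scons_top | rewrite scons_lift by lia].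
Ltac lkin H := repeat first [rewrite scons_top in H | rewrite scons_lift in H by lia].

Section ForcedZFC.
Context {P : Type} {OP : Order P}.
Local Notation Name := (Name P).

Lemma upn_congr x y x' y' p : eqn x x' p -> eqn y y' p -> eqn (upn x y) (upn x' y') p.
Proof.
  intros H H'; apply eqn_ext; intros z q Hq; rewrite !mem_upn by auto.
  assert (Hx : forall r, lep r q -> eqn x x' r) by (intros r Hr; exact (eqn_mono _ _ _ _ (lep_trans _ _ _ Hr Hq) H)).
  assert (Hy : forall r, lep r q -> eqn y y' r) by (intros r Hr; exact (eqn_mono _ _ _ _ (lep_trans _ _ _ Hr Hq) H')).
  split; intros Hd; eapply dns_imp; try exact Hd; intros r Hr [C|C]; [left|right|left|right];
   (eapply eqn_trans; [exact C|]); auto using eqn_sym.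
Qed.

Lemma opair_name x y z d e c : x < d -> y < d -> z < d ->
  eqn (e (d - S z)) (opn (e (d - S x)) (e (d - S y))) c <-> forces (opair x y z d) e c.
Proof.
  intros Hx Hy Hz; unfold opair; split.
  - intros H; apply f_ex_i with (upn (e (d - S x)) (e (d - S x))).
    apply f_and; split.
    { apply upair_name; auto; lk; apply eqn_refl; auto. }
    apply f_ex_i with (upn (e (d - S x)) (e (d - S y))).
    apply f_and; split.
    { apply upair_name; auto; lk; apply eqn_refl; auto. }
    apply upair_name; auto; lk; auto.
  - intros H; apply f_ex in H; eapply eqn_bind; eauto; intros q Hq [u Hu].
    apply f_and in Hu as [Hu H1]; apply upair_name in Hu; auto.
    lkin Hu.
    apply f_ex in H1; eapply eqn_bind; eauto; intros r Hr [v Hv].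
    apply f_and in Hv as [Hv H2]; apply upair_name in Hv, H2; auto.
    lkin Hv.
    lkin H2.
    eapply eqn_trans; eauto. apply upn_congr; auto; eapply eqn_down; eauto.
Qed.

Lemma ax_extensionality e c : forces (extensionality 0) e c.
Proof.
  intros x y q Hq H; apply eqn_ext; intros z r Hr.
  rewrite f_all in H; specialize (H z); rewrite f_iff in H; exact (H r Hr).
Qed.

Lemma ax_pairing e c : forces (pairing 0) e c.
Proof.
  intros x y; apply f_ex_i with (upn x y).
  apply upair_name; auto; apply eqn_refl; auto.
Qed.

Definition dom (x : Name) : Type := match x with nm A f o => A end.
Definition el (x : Name) : dom x -> Name := match x with nm A f o => f end.
Definition wt (x : Name) : dom x -> P -> Prop := match x with nm A f o => o end.

Lemma memr_iff x y r : memr x y r <-> exists b t, wt y b t /\ lep r t /\ eqn x (el y b) r.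
Proof. destruct y; reflexivity. Qed.

Definition unn (x : Name) : Name :=
  nm {a : dom x & dom (el x a)} (fun t => el (el x (projT1 t)) (projT2 t))
    (fun t p => exists s s', wt x (projT1 t) s /\ lep p s /\ wt (el x (projT1 t)) (projT2 t) s' /\ lep p s').
Lemma el_mem x a s p : wt x a s -> lep p s -> mem (el x a) x p.
Proof. destruct x; simpl; apply mem_intro; auto. Qed.

Lemma ax_union e c : forces (union_axiom 0) e c.
Proof.
  intros x; apply f_ex_i with (unn x); intros z; apply f_iff; intros q Hq.
  rewrite f_ex; unfold fmem; cbn [forces]; cbn [scons Nat.sub]; split; intros H.
  - eapply dns_imp; [exact H|]; intros r Hr [[a b] [t [[s [s' [Ha [Hs [Hb Hs']]]]] [Ht He]]]]; cbn [projT1 projT2] in *.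
    exists (el x a); apply f_and; unfold fmem; cbn [forces scons Nat.sub]; split.
    + eapply el_mem; eauto.
    + eapply mem_congr_l; [apply eqn_sym; exact He|eapply el_mem; eauto].
  - eapply dns_bind; eauto; intros r Hr [y Hy]; apply f_and in Hy as [Hy Hz].
    unfold fmem in Hy, Hz; cbn [forces scons Nat.sub] in Hy, Hz.
    eapply dns_bind; [exact Hy|]; intros r1 Hr1 Hm; apply memr_iff in Hm as [a [s [Ha [Hs He]]]].
    assert (Hz' : mem z (el x a) r1) by (eapply mem_congr_r; [exact He|eapply mem_down; eauto]).
    eapply dns_imp; [exact Hz'|]; intros r2 Hr2 Hm; apply memr_iff in Hm as [b [s' [Hb [Hs' He']]]].
    exists (existT _ a b), r2; simpl; split; [|auto]; exists s, s'; eauto.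
Qed.

(** A subset of [x] is forced equal to one built from the elements of [x], each with the conditions
    that force it into the subset; the names of this form make up the power set. *)
Definition pwn (x : Name) : Name :=
  nm (dom x -> P -> Prop)
     (fun X => nm (dom x) (el x) (fun a p => X a p /\ exists s, wt x a s /\ lep p s)) (fun _ _ => True).

Lemma ax_power e c : forces (power_axiom 0) e c.
Proof.
  intros x; apply f_ex_i with (pwn x); intros z; apply f_iff; intros q Hq.
  unfold sub, fmem; cbn [forces scons Nat.sub]; split; intros H.
  - intros w; apply f_imp; intros r Hr Hw; unfold fmem in *; cbn [forces scons Nat.sub] in *.
    eapply dns_bind; [eapply dns_mono; [exact Hr|exact H]|].
    intros r1 Hr1 [X [t [_ [_ He]]]].
    assert (Hw' : mem w (nm (dom x) (el x) (fun a p => X a p /\ exists s, wt x a s /\ lep p s)) r1)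
      by (eapply mem_congr_r; [exact He|eapply mem_down; eauto]).
    eapply dns_bind; [exact Hw'|]; intros r2 Hr2 [a [t' [[_ [s [Ha Hs]]] [Ht' He']]]]; simpl in *.
    eapply mem_congr_l; [apply eqn_sym; exact He'|eapply el_mem; eauto].
  - apply dns_now; auto; intros r Hr; exists (fun a p => mem (el x a) z p), r; split; auto; split; auto.
    apply eqn_ext; intros w r1 Hr1; split; intros Hw.
    + assert (Hx : mem w x r1).
      { apply (H w r1); [eauto|exact Hw]. }
      eapply dns_imp; [exact Hx|]; intros r2 Hr2 Hm; apply memr_iff in Hm as [a [s [Ha [Hs He]]]].
      exists a, r2; simpl; split; [|auto]; split; [|eauto].
      eapply mem_congr_l; [exact He|eapply mem_down; eauto].
    + eapply mem_stable; eapply dns_imp; [exact Hw|]; intros r2 Hr2 [a [t [[Ha _] [Ht He]]]]; simpl in *.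
      eapply mem_congr_l; [apply eqn_sym; exact He|eapply mem_down; eauto].
Qed.

(** If no condition below [r] forces some element to be minimal, induction on names shows that no
    name at all is forced into [x] below [r]. *)
Lemma ax_foundation e c : forces (foundation 0) e c.
Proof.
  intros x; apply f_imp; intros q Hq H; apply f_ex; intros r Hr.
  apply NNPP; intros Hn.
  assert (Hy : forall y s, lep s r -> ~ mem y x s).
  { induction y as [B g IH o]; intros s Hs Hm.
    apply Hn; exists s; split; auto; exists (nm B g o); apply f_and; split; [exact Hm|].
    apply f_neg; intros s1 Hs1 H1; apply f_ex in H1.
    destruct (H1 s1 (lep_refl _)) as [s2 [Hs2 [z Hz]]]; apply f_and in Hz as [Hz1 Hz2].
    unfold fmem in Hz1, Hz2; cbn [forces scons Nat.sub] in Hz1, Hz2.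
    destruct (Hz2 s2 (lep_refl _)) as [s3 [Hs3 [b [t [Hb [Ht He]]]]]].
    apply (IH b s3); [eauto 6|]; eapply mem_congr_l; [exact He|eapply mem_down; eauto]. }
  apply f_ex in H; destruct (H r Hr) as [s [Hs [y Hm]]].
  exact (Hy y s Hs Hm).
Qed.

Definition spn (X : Name -> P -> Prop) (x : Name) : Name :=
  nm (dom x) (el x) (fun a p => X (el x a) p /\ exists s, wt x a s /\ lep p s).
Lemma mem_spn (X : Name -> P -> Prop) x z p :
  (forall z q r, lep r q -> X z q -> X z r) -> (forall z q, dns q (X z) -> X z q) ->
  (forall z z' q, eqn z z' q -> X z q -> X z' q) ->
  mem z (spn X x) p <-> mem z x p /\ X z p.
Proof.
  intros Hm Hs Hc; split.
  - intros H; split.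
    + eapply mem_stable; eapply dns_imp; [exact H|]; intros q Hq [a [t [[_ [s [Ha Hs']]] [Ht He]]]].
      eapply mem_congr_l; [apply eqn_sym; exact He|eapply el_mem; eauto].
    + apply Hs; eapply dns_imp; [exact H|]; intros q Hq [a [t [[HX _] [Ht He]]]].
      eapply Hc; [apply eqn_sym; exact He|eauto].
  - intros [H HX]; eapply dns_imp; [exact H|]; intros q Hq Hmm; apply memr_iff in Hmm as [a [s [Ha [Hs' He]]]].
    exists a, q; simpl; split; [|auto]; split; [|eauto]; eapply Hc; [exact He|eauto].
Qed.

Lemma falls_intro n : forall f d e c,
  (forall xs e', (forall x, In x xs -> x < n + d) -> forces (f xs (n + d)) e' c) ->
  forces (falls n f d) e c.
Proof.
  induction n; simpl; intros f d e c H.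
  - apply H; intros x [].
  - intros x; apply IHn; intros xs e' Hxs; replace (n + S d) with (S (n + d)) by lia.
    apply H; intros y [<-|Hy]; [lia|]; apply Hxs in Hy; lia.
Qed.

Lemma nth_bound xs n j : (forall x, In x xs -> x < n) -> nth j xs 0 <= n.
Proof. intros H; destruct (nth_in_or_default j xs 0) as [H1| ->]; [apply H in H1|]; lia. Qed.

Lemma ax_separation n p e c : forces (separation n p 0) e c.
Proof.
  apply falls_intro; intros xs e' Hxs a.
  set (g := fun i => scons a e' (S n - S (nth i xs 0))).
  set (X := fun z q => forces p (scons z g) q).
  apply f_ex_i with (spn X a); intros z; apply f_iff; intros q Hq.
  rewrite f_and; unfold fmem; cbn [forces].
  rewrite Nat.add_0_r in *. lk. rewrite mem_spn.
  - assert (HX : X z q <-> forces (app_form p (S (S n) :: xs) (S (S (S n)))) (scons z (scons (spn X a) (scons a e'))) q); [|rewrite HX; reflexivity].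
    unfold X, app_form; rewrite forces_ren; apply forces_ext; intros [|i]; cbn [nth].
    + lk; reflexivity.
    + pose proof (nth_bound xs n i Hxs); cbn [scons]; unfold g; rewrite (scons_lift _ _ (S (S n)) (nth i xs 0)), (scons_lift _ _ (S n) (nth i xs 0)) by lia; reflexivity.
  - intros; eapply forces_down; eauto.
  - intros; eapply forces_stable; eauto.
  - intros w w' r He; apply forces_congr; auto; intros [|i]; simpl; auto; apply eqn_refl; auto.
Qed.

(** An index consists of an element of [x] and a condition, and epsilon picks a value forced there;
    functionality makes the choice unique up to forced equality. *)
Definition rpn (X : Name -> Name -> P -> Prop) (x : Name) : Name :=
  nm (dom x * P) (fun u => epsilon (inhabits x) (fun y => X (el x (fst u)) y (snd u)))
     (fun u p => lep p (snd u) /\ X (el x (fst u)) (epsilon (inhabits x) (fun y => X (el x (fst u)) y (snd u))) (snd u)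
        /\ exists s, wt x (fst u) s /\ lep p s).

Lemma mem_rpn (X : Name -> Name -> P -> Prop) x z p :
  (forall w z q r, lep r q -> X w z q -> X w z r) ->
  (forall w w' z z' q, eqn w w' q -> eqn z z' q -> X w z q -> X w' z' q) ->
  (forall w z z' q, lep q p -> mem w x q -> X w z q -> X w z' q -> eqn z z' q) ->
  mem z (rpn X x) p <-> dns p (fun q => exists w, mem w x q /\ X w z q).
Proof.
  intros Hm Hc Hf; split; intros H.
  - eapply dns_imp; [exact H|]; intros q Hq [[a s] [t [[Hs [HX [s' [Ha Hs']]]] [Ht He]]]]; simpl in *.
    exists (el x a); split; [eapply el_mem; eauto|]. eapply Hc; [apply eqn_refl; auto|apply eqn_sym; exact He|].
    eapply Hm; [|exact HX]; eauto.
  - eapply dns_bind; [exact H|]; intros q Hq [w [Hw HX]].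
    eapply dns_imp; [exact Hw|]; intros r Hr Hmm; apply memr_iff in Hmm as [a [s [Ha [Hs He]]]].
    assert (HX' : X (el x a) z r) by (eapply Hc; [exact He|apply eqn_refl; auto|eauto]).
    pose proof (epsilon_spec (inhabits x) (fun y => X (el x a) y r) (ex_intro _ z HX')) as HX''.
    exists (a, r), r; simpl; split; [split; [auto|split; [exact HX''|exists s; auto]]|split; auto].
    eapply (Hf (el x a)); [eauto|eapply el_mem; eauto|exact HX'|exact HX''].
Qed.

Lemma ax_replacement n p e c : forces (replacement n p 0) e c.
Proof.
  apply falls_intro; intros xs e' Hxs a; rewrite Nat.add_0_r in *.
  set (g := fun i => scons a e' (S n - S (nth i xs 0))).
  set (X := fun w z q => forces p (scons w (scons z g)) q).
  assert (HX1 : forall y1 y2 y3 q,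
     X y1 y2 q <-> forces (app_form p (S n :: S (S n) :: xs) (S (S (S (S n))))) (scons y3 (scons y2 (scons y1 (scons a e')))) q).
  { intros; unfold X, app_form; rewrite forces_ren; apply forces_ext; intros [|[|i]]; cbn [nth].
    - lk; reflexivity.
    - lk; reflexivity.
    - pose proof (nth_bound xs n i Hxs); cbn [scons]; unfold g; rewrite (scons_lift _ _ (S (S (S n))) (nth i xs 0)), (scons_lift _ _ (S (S n)) (nth i xs 0)), (scons_lift _ _ (S n) (nth i xs 0)) by lia; reflexivity. }
  assert (HX2 : forall y1 y2 y3 q,
     X y1 y3 q <-> forces (app_form p (S n :: S (S (S n)) :: xs) (S (S (S (S n))))) (scons y3 (scons y2 (scons y1 (scons a e')))) q).
  { intros; unfold X, app_form; rewrite forces_ren; apply forces_ext; intros [|[|i]]; cbn [nth].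
    - lk; reflexivity.
    - lk; reflexivity.
    - pose proof (nth_bound xs n i Hxs); cbn [scons]; unfold g; rewrite (scons_lift _ _ (S (S (S n))) (nth i xs 0)), (scons_lift _ _ (S (S n)) (nth i xs 0)), (scons_lift _ _ (S n) (nth i xs 0)) by lia; reflexivity. }
  assert (HX3 : forall y1 y2 b q,
     X y1 y2 q <-> forces (app_form p (S (S (S n)) :: S (S n) :: xs) (S (S (S (S n))))) (scons y1 (scons y2 (scons b (scons a e')))) q).
  { intros; unfold X, app_form; rewrite forces_ren; apply forces_ext; intros [|[|i]]; cbn [nth].
    - lk; reflexivity.
    - lk; reflexivity.
    - pose proof (nth_bound xs n i Hxs); cbn [scons]; unfold g; rewrite (scons_lift _ _ (S (S (S n))) (nth i xs 0)), (scons_lift _ _ (S (S n)) (nth i xs 0)), (scons_lift _ _ (S n) (nth i xs 0)) by lia; reflexivity. }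
  intros q Hq H.
  apply f_ex_i with (rpn X a); intros z; apply f_iff; intros r Hr.
  rewrite f_ex; unfold fmem at 1; cbn [forces]; lk.
  rewrite mem_rpn.
  - split; intros H0; eapply dns_imp; try exact H0; intros s Hs [w Hw]; exists w.
    + apply f_and; unfold fmem; cbn [forces]. lk.
      split; [tauto|]; apply HX3; tauto.
    + apply f_and in Hw as [Hw1 Hw2]; unfold fmem in Hw1; cbn [forces] in Hw1.
      lkin Hw1. split; auto; eapply HX3; exact Hw2.
  - intros; unfold X; eapply forces_down; eauto.
  - intros w w' y y' s Hw Hy; apply forces_congr; auto; intros [|[|i]]; simpl; auto; apply eqn_refl; auto.
  - intros w y y' s Hs Hw H1 H2.
    assert (Hw' : forces (fmem (S n) n (S (S n))) (scons w (scons a e')) s).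
    { unfold fmem; cbn [forces]; lk; exact Hw. }
    pose proof (H w s (lep_trans _ _ _ Hs Hr) Hw' y y' s (lep_refl s)) as H3.
    unfold fequ in H3; cbn [forces] in H3; lkin H3.
    apply H3. apply f_and; split; [apply HX1|apply HX2]; auto.
Qed.
End ForcedZFC.

(** * Well-orderings of names *)

Section Ordinals.
Context {P : Type} {OP : Order P} {T : Type} (lt : T -> T -> Prop).
Context (wf : well_founded lt) (S : T -> P -> Prop).
Local Notation Name := (Name P).

(** The conditions in [S t] put [t] in. The name [on t] denotes the order type of the elements below
    [t] that are in; when all are, it is the canonical name of an ordinal of the ground model. *)
Fixpoint oacc (t : T) (a : Acc lt t) : Name :=
  nm {u | lt u t} (fun u => oacc (proj1_sig u) (Acc_inv a (proj2_sig u))) (fun u => S (proj1_sig u)).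
Definition on (t : T) : Name := oacc t (wf t).
Definition oset : Name := nm T on S.

Lemma on_unfold t : on t = nm {u | lt u t} (fun u => on (proj1_sig u)) (fun u => S (proj1_sig u)).
Proof.
  unfold on at 1; destruct (wf t) as [a]; cbn [oacc]; f_equal; extensionality u.
  unfold on; f_equal; apply proof_irrelevance.
Qed.
Lemma mem_on x t p : mem x (on t) p <->
  dns p (fun r => exists u s, lt u t /\ S u s /\ lep r s /\ eqn x (on u) r).
Proof.
  rewrite on_unfold; unfold mem; split; intros H; eapply dns_imp; try exact H; intros r Hr.
  - intros [[u Hu] [s [Hs [Hrs He]]]]; exists u, s; auto.
  - intros [u [s [Hu [Hs [Hrs He]]]]]; exists (exist _ u Hu), s; auto.
Qed.
Lemma mem_oset x p : mem x oset p <-> dns p (fun r => exists u s, S u s /\ lep r s /\ eqn x (on u) r).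
Proof. reflexivity. Qed.
Lemma on_mem u t s p : lt u t -> S u s -> lep p s -> mem (on u) (on t) p.
Proof. intros Hu Hs Hp; apply mem_on, dns_now; intros q Hq; exists u, s; eauto using eqn_refl. Qed.
Lemma on_oset u s p : S u s -> lep p s -> mem (on u) oset p.
Proof. intros Hs Hp; apply mem_oset, dns_now; intros q Hq; exists u, s; eauto using eqn_refl. Qed.

Context (tri : forall x y, lt x y \/ x = y \/ lt y x).
Context (tr : forall x y z, lt x y -> lt y z -> lt x z).

Lemma on_inj t u s s' p : S t s -> S u s' -> lep p s -> lep p s' -> eqn (on t) (on u) p -> t = u.
Proof.
  intros Ht Hu Hs Hs' H; destruct (tri t u) as [Hl|[Hl|Hl]]; auto; exfalso.
  - apply (mem_irrefl (on t) p). eapply mem_congr_r; [apply eqn_sym; exact H|eapply on_mem; eauto].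
  - apply (mem_irrefl (on u) p). eapply mem_congr_r; [exact H|eapply on_mem; eauto].
Qed.

Lemma on_trans x y t p : mem x y p -> mem y (on t) p -> mem x (on t) p.
Proof.
  intros Hx Hy; apply mem_on in Hy; eapply dns_bind; [exact Hy|]; intros q Hq [u [s [Hu [Hs [Hqs He]]]]].
  assert (Hx' : mem x (on u) q) by (eapply mem_congr_r; [exact He|eapply mem_down; eauto]).
  apply mem_on in Hx'; change (mem x (on t) q); apply mem_on; eapply dns_imp; [exact Hx'|].
  intros r Hr [v [s' [Hv [Hs' [Hrs He']]]]]; exists v, s'; eauto.
Qed.
Lemma oset_trans x y p : mem x y p -> mem y oset p -> mem x oset p.
Proof.
  intros Hx Hy; apply mem_oset in Hy; eapply dns_bind; [exact Hy|]; intros q Hq [u [s [Hs [Hqs He]]]].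
  assert (Hx' : mem x (on u) q) by (eapply mem_congr_r; [exact He|eapply mem_down; eauto]).
  apply mem_on in Hx'; eapply dns_imp; [exact Hx'|].
  intros r Hr [v [s' [Hv [Hs' [Hrs He']]]]]; exists v, s'; auto.
Qed.

Lemma oset_ordinal e c : forces (ordinal 0 1) (scons oset e) c.
Proof.
  apply f_and; split.
  - intros y; apply f_imp; intros q Hq Hy z; apply f_imp; intros r Hr Hz.
    eapply oset_trans; [exact Hz|]; exact (mem_down _ _ _ _ Hy Hr).
  - intros x; apply f_imp; intros q Hq Hx y; apply f_imp; intros r Hr Hy z; apply f_imp; intros r1 Hr1 Hz.
    assert (Hx' : mem x oset q) by exact Hx. assert (Hy' : mem y x r) by exact Hy. assert (Hz' : mem z y r1) by exact Hz.
    change (mem z x r1). clear Hx Hy Hz. apply mem_oset in Hx'. eapply mem_stable, dns_imp; [eapply dns_mono; [|exact Hx']; eauto|].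
    intros r2 Hr2 [u [s [Hs [Hqs He]]]]. eapply mem_congr_r; [apply eqn_sym; exact He|].
    eapply on_trans; [eapply mem_down; eauto|]. eapply mem_congr_r; [exact He|eapply mem_down; eauto].
Qed.
End Ordinals.

Section Bij.
Context {P : Type} {OP : Order P}.
Local Notation Name := (Name P).

Lemma opn_congr x y x' y' p : eqn x x' p -> eqn y y' p -> eqn (opn x y) (opn x' y') p.
Proof. intros; unfold opn; auto using upn_congr. Qed.

Lemma app_name f x y d e c : f < d -> x < d -> y < d ->
  forces (app f x y d) e c <-> mem (opn (e (d - S x)) (e (d - S y))) (e (d - S f)) c.
Proof.
  intros Hf Hx Hy; unfold app; rewrite f_ex; split.
  - intros H; eapply mem_stable, dns_imp; [exact H|]; intros q Hq [z Hz]; apply f_and in Hz as [Hz1 Hz2].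
    unfold fmem in Hz1; cbn [forces] in Hz1; lkin Hz1. apply opair_name in Hz2; try lia; lkin Hz2.
    eapply mem_congr_l; [exact Hz2|exact Hz1].
  - intros H; apply dns_now; intros q Hq; exists (opn (e (d - S x)) (e (d - S y))); apply f_and; split.
    + unfold fmem; cbn [forces]; lk; eapply mem_down; eauto.
    + apply opair_name; try lia; lk; apply eqn_refl.
Qed.

Definition well_orderable : fml := ∀ a, ∃ k, ordinal k ∧ equinum k a.

Section Collapse.
Context {T : Type} (lt : T -> T -> Prop) (wf : well_founded lt).
Context (tri : forall x y, lt x y \/ x = y \/ lt y x) (tr : forall x y z, lt x y -> lt y z -> lt x z).
Context (g : T -> Name) (w : T -> P -> Prop).
Let a := nm T g w.
(** Here [t] is the first index of its value [g t]. Every element of the set has exactly one first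
    index, so the order type of the first indices is an ordinal in bijection with the set. *)
Let St (t : T) (p : P) := mem (g t) a p /\ forall t' q, lt t' t -> lep q p -> ~ eqn (g t') (g t) q.

Lemma St_down t p q : St t p -> lep q p -> St t q.
Proof. intros [H1 H2] Hq; split; [eapply mem_down; eauto|eauto]. Qed.

Lemma St_cover y p : mem y a p -> dns p (fun r => exists t, St t r /\ eqn y (g t) r).
Proof.
  intros H q Hq.
  assert (Hex : exists t, exists r, lep r q /\ eqn y (g t) r).
  { destruct (H q Hq) as [r [Hr [t [s [_ [_ He]]]]]]; eauto. }
  assert (Hmin : exists t, (exists r, lep r q /\ eqn y (g t) r) /\ forall t', lt t' t -> ~ exists r, lep r q /\ eqn y (g t') r).
  { destruct Hex as [t Ht]; revert Ht; induction t as [t IH] using (well_founded_induction wf); intros Ht.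
    destruct (classic (exists t', lt t' t /\ exists r, lep r q /\ eqn y (g t') r)) as [[t' [H1 H2]]|Hn]; [eauto|].
    exists t; split; auto; intros t' H1 H2; apply Hn; eauto. }
  destruct Hmin as [t [[r [Hr He]] Hm]]; exists r; split; auto; exists t; split; auto; split.
  - eapply mem_congr_l; [exact He|]; eapply mem_down; eauto.
  - intros t' s Ht' Hs He'; apply (Hm t' Ht'); exists s; split; eauto.
    eapply eqn_trans; [eapply eqn_down; eauto|apply eqn_sym; exact He'].
Qed.
Lemma St_unique t t' p : St t p -> St t' p -> eqn (g t) (g t') p -> t = t'.
Proof.
  intros [H1 H2] [H3 H4] He; destruct (tri t t') as [Hl|[Hl|Hl]]; auto; exfalso.
  - eapply H4; [exact Hl|apply lep_refl|exact He].
  - eapply H2; [exact Hl|apply lep_refl|apply eqn_sym; exact He].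
Qed.

Let k := oset lt wf St.
Let f := nm T (fun t => opn (on lt wf St t) (g t)) St.

Lemma mem_graph x y p : mem (opn x y) f p <->
  dns p (fun r => exists t, St t r /\ eqn x (on lt wf St t) r /\ eqn y (g t) r).
Proof.
  split; intros H; eapply dns_imp; try exact H; intros r Hr.
  - intros [t [s [Hs [Hrs He]]]]; apply opn_inj in He; exists t; split; [eapply St_down; eauto|auto].
  - intros [t [Ht [Hx Hy]]]; exists t, r; split; auto; split; auto; apply opn_congr; auto.
Qed.

Lemma mem_k x p : mem x k p <-> dns p (fun r => exists t, St t r /\ eqn x (on lt wf St t) r).
Proof.
  unfold k; rewrite mem_oset; split; intros H; eapply dns_imp; try exact H; intros r Hr.
  - intros [t [s [Hs [Hrs He]]]]; exists t; split; [eapply St_down; eauto|auto].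
  - intros [t [Ht He]]; exists t, r; auto.
Qed.

Lemma collapse_bij e c : forces (bijection 2 1 0 3) (scons f (scons k (scons a e))) c.
Proof.
  assert (Hgk : forall x y z p, mem (opn x y) f p -> mem (opn x z) f p -> eqn y z p).
  { intros x y z p H1 H2; apply mem_graph in H1, H2.
    eapply eqn_bind; [exact H1|]; intros q Hq [t [Ht [Hx Hy]]].
    eapply eqn_bind; [eapply dns_mono; [exact Hq|exact H2]|]; intros r Hr [t' [Ht' [Hx' Hz]]].
    assert (t = t') as <-.
    { eapply (on_inj lt wf St); [exact tri|eapply St_down; [exact Ht|exact Hr]|exact Ht'|eauto|eauto|].
      eapply eqn_trans; [apply eqn_sym; eapply eqn_down; eauto|exact Hx']. }
    eapply eqn_trans; [eapply eqn_down; eauto|apply eqn_sym; exact Hz]. }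
  assert (Hgi : forall x y z p, mem (opn x z) f p -> mem (opn y z) f p -> eqn x y p).
  { intros x y z p H1 H2; apply mem_graph in H1, H2.
    eapply eqn_bind; [exact H1|]; intros q Hq [t [Ht [Hx Hy]]].
    eapply eqn_bind; [eapply dns_mono; [exact Hq|exact H2]|]; intros r Hr [t' [Ht' [Hx' Hz]]].
    assert (t = t') as <-.
    { eapply St_unique; [eapply St_down; [exact Ht|exact Hr]|exact Ht'|].
      eapply eqn_trans; [apply eqn_sym; eapply eqn_down; eauto|exact Hz]. }
    eapply eqn_trans; [eapply eqn_down; eauto|apply eqn_sym; exact Hx']. }
  assert (Hcongr : forall x x' y y' p, eqn x x' p -> eqn y y' p -> mem (opn x y) f p -> mem (opn x' y') f p).
  { intros x x' y y' p Hx Hy H; eapply mem_congr_l; [apply opn_congr; eauto|exact H]. }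
  apply f_and; split; [apply f_and; split|].
  - intros p; apply f_imp; intros q Hq Hp; assert (Hp' : mem p f q) by exact Hp; clear Hp.
    apply f_ex; eapply dns_imp; [exact Hp'|]; intros r Hr [t [s [Hs [Hrs He]]]].
    assert (Hr1 : St t r) by (eapply St_down; eauto).
    exists (on lt wf St t); apply f_and; split; [exact (on_oset lt wf St t r r Hr1 (lep_refl r))|].
    apply f_ex_i with (g t); apply f_and; split; [exact (proj1 Hr1)|].
    apply opair_name; auto; exact He.
  - intros x; apply f_imp; intros q Hq Hx; assert (Hx' : mem x k q) by exact Hx; clear Hx; apply mem_k in Hx'.
    apply f_ex; eapply dns_imp; [exact Hx'|]; intros r Hr [t [Ht He]].
    exists (g t); apply f_and; split; [exact (proj1 Ht)|]. intros z; apply f_iff; intros s Hs.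
    assert (Hg : mem (opn x (g t)) f s).
    { apply mem_graph, dns_now; intros s' Hs'; exists t; split; [eapply St_down; [exact Ht|eauto]|].
      split; [eapply eqn_down; [exact He|eauto]|apply eqn_refl]. }
    rewrite app_name by lia; unfold fequ; cbn [forces]; cbn [scons Nat.sub]; split; intros H.
    + eapply Hgk; [exact H|exact Hg].
    + eapply Hcongr; [apply eqn_refl|apply eqn_sym; exact H|exact Hg].
  - intros y; apply f_imp; intros q Hq Hy; assert (Hy' : mem y a q) by exact Hy; clear Hy; apply St_cover in Hy'.
    apply f_ex; eapply dns_imp; [exact Hy'|]; intros r Hr [t [Ht He]].
    exists (on lt wf St t); apply f_and; split; [exact (on_oset lt wf St t r r Ht (lep_refl r))|].
    intros z; apply f_iff; intros s Hs.
    assert (Hg : mem (opn (on lt wf St t) y) f s).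
    { apply mem_graph, dns_now; intros s' Hs'; exists t; split; [eapply St_down; [exact Ht|eauto]|].
      split; [apply eqn_refl|eapply eqn_down; [exact He|eauto]]. }
    rewrite app_name by lia; unfold fequ; cbn [forces]; cbn [scons Nat.sub]; split; intros H.
    + eapply Hgi; [exact H|exact Hg].
    + eapply Hcongr; [apply eqn_sym; exact H|apply eqn_refl|exact Hg].
Qed.
End Collapse.

Lemma forces_well_orderable e c : forces (well_orderable 0) e c.
Proof.
  intros [T g w]; destruct (well_order_exists T) as [lt [wf [tri tr]]].
  set (St := fun (t : T) (p : P) => mem (g t) (nm T g w) p /\ forall t' q, lt t' t -> lep q p -> ~ eqn (g t') (g t) q).
  apply f_ex_i with (oset lt wf St); apply f_and; split.
  - exact (proj1 (forces_ren (ordinal 0 1) (fun i => i) _ _) (oset_ordinal lt wf St tr (scons (nm T g w) e) c)).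
  - apply f_ex_i with (nm T (fun t => opn (on lt wf St t) (g t)) St).
    exact (collapse_bij lt wf tri g w e c).
Qed.
End Bij.

(** * Generic extensions *)

#[global] Opaque to_nat of_nat.

Fixpoint form_code (p : form) : nat :=
  match p with
  | Bot => to_nat (0, 0)
  | Mem i j => to_nat (1, to_nat (i, j))
  | Equ i j => to_nat (2, to_nat (i, j))
  | Imp a b => to_nat (3, to_nat (form_code a, form_code b))
  | All a => to_nat (4, form_code a)
  end.
Lemma form_code_inj p : forall q, form_code p = form_code q -> p = q.
Proof.
  induction p; intros []; cbn [form_code]; intros H; apply to_nat_inj in H; try discriminate; auto;
    injection H as H; try (apply to_nat_inj in H; injection H as H H'); f_equal; auto.
Qed.
(** Every formula recurs at arbitrarily late steps, so it is also treated after the witnesses among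
    its variables have been chosen. *)
Definition form_enum (n : nat) : form := epsilon (inhabits Bot) (fun p => form_code p = snd (of_nat n)).
Lemma form_enum_spec p m : exists n, m <= n /\ form_enum n = p.
Proof.
  exists (to_nat (m, form_code p)); split.
  - pose proof (to_nat_non_decreasing m (form_code p)); lia.
  - unfold form_enum; rewrite cancel_of_to; apply form_code_inj.
    apply (epsilon_spec (inhabits Bot) (fun q => form_code q = form_code p)); eauto.
Qed.

Lemma scoped_mono p : forall n m, n <= m -> scoped n p -> scoped m p.
Proof.
  induction p; simpl; intros k m H; try tauto; try lia.
  - intros []; split; eauto.
  - apply IHp; lia.
Qed.
Lemma scoped_ex p : exists n, scoped n p.
Proof.
  induction p as [|i j|i j|p [n Hn] q [m Hm]|p [n Hn]].
  - exists 0; exact I.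
  - exists (S (i + j)); split; lia.
  - exists (S (i + j)); split; lia.
  - exists (n + m); split; [apply (scoped_mono p n)|apply (scoped_mono q m)]; auto; lia.
  - exists n; apply (scoped_mono p n (S n)); auto.
Qed.

Section Henkin.
Context {P : Type} {OP : Order P}.
Local Notation Name := (Name P).
Context (p0 : P) (h : nat -> Name) (Dn : nat -> P -> Prop) (HD : forall n p, exists q, lep q p /\ Dn n q).

Definition refutes (a : form) (e : nat -> Name) (p : P) := forall q, lep q p -> ~ forces a e q.

Lemma decide a e p : exists q, lep q p /\ (forces a e q \/ refutes a e q).
Proof.
  destruct (classic (exists q, lep q p /\ forces a e q)) as [[q [Hq H]]|H]; [eauto|].
  exists p; split; auto; right; intros q Hq Hf; apply H; eauto.
Qed.
Lemma refutes_ex a e p : ~ forces a e p -> exists q, lep q p /\ refutes a e q.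
Proof.
  intros H; apply NNPP; intros Hn; apply H, forces_stable; intros q Hq.
  apply NNPP; intros Hn'; apply Hn; exists q; split; auto; intros r Hr Hf; apply Hn'; eauto.
Qed.

(* Even variables range over the names [h], odd ones over the witnesses: at step [n] the formula number [n] is decided,
   and the witness number [n] refutes the body of a refuted universal formula. *)
Definition step (n : nat) (st : P * (nat -> Name)) (r : P * Name) : Prop :=
  let e := mix h (snd st) in let a := form_enum n in
  lep (fst r) (fst st) /\ (exists s, Dn n s /\ lep (fst r) s) /\ (forces a e (fst r) \/ refutes a e (fst r)) /\
  (forall b, a = All b -> refutes a e (fst r) -> refutes b (scons (snd r) e) (fst r)) /\
  (forall i j, a = Mem i j -> forces a e (fst r) -> memr (e i) (e j) (fst r)).

Lemma step_ex n st : exists r, step n st r.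
Proof.
  destruct st as [p ws]; unfold step; cbn [fst snd]; set (e := mix h ws); set (a := form_enum n).
  destruct (HD n p) as [q [Hq HDq]]; destruct (decide a e q) as [r [Hr Hd]].
  clearbody a; destruct a as [|i j|i j|a1 a2|b0].
  5: destruct Hd as [Hd|Hd].
  2: destruct Hd as [Hd|Hd]; [destruct (Hd r (lep_refl r)) as [s [Hs Hm]]|].
  all: try (exists (r, h 0); cbn [fst snd]; split; [eauto|]; split; [eauto|]; split; [auto|];
    split; [intros; discriminate|intros; discriminate]).
  - exists (s, h 0); cbn [fst snd]; split; [eauto|]; split; [eauto|]; split; [left; eapply forces_down; eauto|].
    split; [intros; discriminate|intros ? ? [= <- <-] _; exact Hm].
  - exists (r, h 0); cbn [fst snd]; split; [eauto|]; split; [eauto|]; split; [auto|].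
    split; [intros; discriminate|intros ? ? [= <- <-] H; destruct (Hd r (lep_refl r) H)].
  - exists (r, h 0); cbn [fst snd]; split; [eauto|]; split; [eauto|]; split; [auto|].
    split; [intros b Hb H; destruct (H r (lep_refl r) Hd)|intros; discriminate].
  - assert (exists x, ~ forces b0 (scons x e) r) as [x Hx].
    { apply NNPP; intros Hn; apply (Hd r (lep_refl r)); intros x; apply NNPP; eauto. }
    destruct (refutes_ex _ _ _ Hx) as [s [Hs Hrf]].
    exists (s, x); cbn [fst snd]; split; [eauto|]; split; [eauto|]; split; [right; intros t Ht; apply Hd; eauto|].
    split; [intros b [= <-] _; exact Hrf|intros; discriminate].
Qed.

Fixpoint st (n : nat) : P * (nat -> Name) :=
  match n with
  | 0 => (p0, fun _ => h 0)
  | S n => let r := epsilon (inhabits (p0, h 0)) (step n (st n)) in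
           (fst r, fun k => if k =? n then snd r else snd (st n) k)
  end.
Definition wit (k : nat) : Name := snd (st (S k)) k.
Definition rho : nat -> Name := mix h wit.
Definition Gen (p : P) : Prop := exists n, lep (fst (st n)) p.

Lemma st_wit n k : k < n -> snd (st n) k = wit k.
Proof.
  induction n; intros H; [lia|]; destruct (Nat.eq_dec k n) as [->|Hn]; [reflexivity|].
  cbn [st snd]; replace (k =? n) with false by (symmetry; apply Nat.eqb_neq; auto). apply IHn; lia.
Qed.
Lemma st_step n : step n (st n) (fst (st (S n)), wit n).
Proof.
  unfold wit; cbn [st fst snd]; rewrite Nat.eqb_refl, <- surjective_pairing.
  apply (epsilon_spec (inhabits (p0, h 0)) (step n (st n))), step_ex.
Qed.
Lemma st_mono n m : n <= m -> lep (fst (st m)) (fst (st n)).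
Proof. induction 1; auto. eapply lep_trans; [apply (st_step m)|exact IHle]. Qed.
Lemma Gen_st n : Gen (fst (st n)). Proof. exists n; auto. Qed.
Lemma Gen_up p q : Gen p -> lep p q -> Gen q.
Proof. intros [n H] Hq; exists n; eauto. Qed.
Lemma Gen_dir p q : Gen p -> Gen q -> exists r, Gen r /\ lep r p /\ lep r q.
Proof.
  intros [n Hn] [m Hm]; exists (fst (st (n + m))); split; [apply Gen_st|].
  split; (eapply lep_trans; [apply st_mono|eassumption]); lia.
Qed.
Lemma rho_agree n m i : i < n -> n <= m -> rho i = mix h (snd (st m)) i.
Proof.
  intros Hi Hm; unfold rho; destruct (parity_split i) as [[k ->]|[k ->]];
    rewrite ?mix_even, ?mix_odd; auto. symmetry; apply st_wit; lia.
Qed.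

(** The step is so late that the values of all variables of the formula are final. *)
Lemma stage a : exists n, (forall p, forces a rho p <-> forces a (mix h (snd (st n))) p) /\
  (forall x b p, a = All b -> forces b (scons x rho) p <-> forces b (scons x (mix h (snd (st n)))) p) /\
  form_enum n = a /\ (forall i j, a = Mem i j -> mix h (snd (st n)) i = rho i /\ mix h (snd (st n)) j = rho j).
Proof.
  destruct (scoped_ex a) as [N HN]; destruct (form_enum_spec a N) as [n [Hn Hf]]; exists n.
  split; [|split; [|split; auto]].
  - intros p; apply forces_scoped with N; auto; intros; eapply rho_agree; eauto.
  - intros x b p ->; apply forces_scoped with (S N); [exact HN|].
    intros [|i] Hi; simpl; auto; eapply rho_agree; [|exact Hn]; lia.
  - intros i j ->; simpl in HN; split; symmetry; eapply rho_agree; [|exact Hn| |exact Hn]; lia.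
Qed.

Lemma gen_decide a : exists p, Gen p /\ (forces a rho p \/ refutes a rho p).
Proof.
  destruct (stage a) as [n [H [_ [Hf _]]]]; exists (fst (st (S n))); split; [apply Gen_st|].
  destruct (st_step n) as [_ [_ [H1 _]]]; rewrite Hf in H1; cbn [fst] in H1; destruct H1 as [H1|H1]; [left; apply H; auto|right].
  intros q Hq Hq'; apply H in Hq'; exact (H1 q Hq Hq').
Qed.
Lemma gen_witness b p : Gen p -> refutes (All b) rho p ->
  exists i q, Gen q /\ refutes b (scons (rho i) rho) q.
Proof.
  intros Hp Hr; destruct (stage (All b)) as [n [H [H' [Hf _]]]]; exists (S (2 * n)), (fst (st (S n))); split; [apply Gen_st|].
  destruct (st_step n) as [_ [_ [H1 [H2 _]]]]; rewrite Hf in H1, H2; cbn [fst snd] in H1, H2.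
  destruct (Gen_dir _ _ Hp (Gen_st (S n))) as [r [Hr1 [Hr2 Hr3]]].
  destruct H1 as [H1|H1].
  - exfalso; apply (Hr r Hr2); apply H; eapply forces_down; eauto.
  - pose proof (H2 b eq_refl H1) as H3; unfold rho at 1; rewrite mix_odd.
    intros q Hq Hq'; apply (H' _ b q eq_refl) in Hq'; exact (H3 q Hq Hq').
Qed.
Lemma gen_mem i j p : Gen p -> mem (rho i) (rho j) p -> exists q, Gen q /\ memr (rho i) (rho j) q.
Proof.
  intros Hp Hm; destruct (stage (Mem i j)) as [n [H [_ [Hf H']]]]; exists (fst (st (S n))); split; [apply Gen_st|].
  destruct (st_step n) as [_ [_ [H1 [_ H2]]]]; rewrite Hf in H1, H2; cbn [fst] in H1, H2.
  destruct (Gen_dir _ _ Hp (Gen_st (S n))) as [r [Hr1 [Hr2 Hr3]]].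
  destruct (H' i j eq_refl) as [<- <-]; apply H2; auto; destruct H1 as [H1|H1]; auto.
  exfalso; apply (H1 r Hr3), H; simpl. eapply mem_down; eauto.
Qed.

Definition EQ i j := exists p, Gen p /\ eqn (rho i) (rho j) p.
Lemma EQ_refl i : EQ i i. Proof. exists p0; split; [exists 0; apply lep_refl|apply eqn_refl]. Qed.
Lemma EQ_sym i j : EQ i j -> EQ j i.
Proof. intros [p [Hp H]]; exists p; split; auto; apply eqn_sym; auto. Qed.
Lemma EQ_trans i j k : EQ i j -> EQ j k -> EQ i k.
Proof.
  intros [p [Hp H]] [q [Hq H']]; destruct (Gen_dir _ _ Hp Hq) as [r [Hr [H1 H2]]]; exists r; split; auto.
  eapply eqn_trans; eapply eqn_down; eauto.
Qed.
Definition rep i := epsilon (inhabits 0) (EQ i).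
Lemma rep_EQ i : EQ i (rep i).
Proof. apply (epsilon_spec (inhabits 0) (EQ i)); exists i; apply EQ_refl. Qed.
Lemma rep_eq i j : EQ i j -> rep i = rep j.
Proof.
  intros H; unfold rep; f_equal; extensionality k; apply propositional_extensionality.
  split; intros; eapply EQ_trans; eauto; apply EQ_sym; auto.
Qed.
(** Variables modulo forced equality, by chosen representatives, so that equality in the model is
    the equality that [sat] uses. *)
Definition dM := {i | rep i = i}.
Definition ofn (i : nat) : dM := exist _ (rep i) (eq_sym (rep_eq _ _ (rep_EQ i))).
Definition dname (m : dM) : Name := rho (proj1_sig m).
Definition dE (x y : dM) := exists p, Gen p /\ mem (dname x) (dname y) p.

Lemma dM_eq (x y : dM) : EQ (proj1_sig x) (proj1_sig y) -> x = y.
Proof.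
  destruct x as [i Hi], y as [j Hj]; cbn [proj1_sig]; intros H; apply rep_eq in H; rewrite Hi, Hj in H; subst j.
  f_equal; apply proof_irrelevance.
Qed.

(** Elements of the model are variables of [rho], so a formula with parameters is, after renaming,
    one of the enumerated formulas; if a universal one is refuted, a witness against it was
    introduced at its step. *)
Lemma truth a : forall e : nat -> dM, sat dE e a <-> exists p, Gen p /\ forces a (fun i => dname (e i)) p.
Proof.
  assert (Dec : forall a (e : nat -> dM), exists p, Gen p /\ (forces a (fun i => dname (e i)) p \/ refutes a (fun i => dname (e i)) p)).
  { clear a; intros a e; destruct (gen_decide (ren (fun i => proj1_sig (e i)) a)) as [p [Hp [H|H]]]; exists p; split; auto.
    - left; exact (proj1 (forces_ren a _ rho p) H).
    - right; intros q Hq Hf; exact (H q Hq (proj2 (forces_ren a _ rho q) Hf)). }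
  induction a; intros e; cbn [sat].
  - split; [intros []|intros [p [_ []]]].
  - reflexivity.
  - split.
    + intros He; exists p0; split; [exists 0; apply lep_refl|]; simpl; rewrite He; apply eqn_refl.
    + intros He; apply dM_eq; exact He.
  - rewrite IHa1, IHa2; split.
    + intros H; destruct (Dec (Imp a1 a2) e) as [p [Hp [Hd|Hd]]]; [eauto|exfalso].
      destruct (Dec a1 e) as [q [Hq [Ha|Ha]]].
      * destruct H as [r [Hr Hb]]; [eauto|].
        destruct (Gen_dir _ _ Hp Hr) as [s [Hs [H1 H2]]]; apply (Hd s H1); intros t Ht _; eapply forces_down; eauto.
      * destruct (Gen_dir _ _ Hp Hq) as [s [Hs [H1 H2]]]; apply (Hd s H1); intros t Ht Hf.
        destruct (Ha t); eauto.
    + intros [p [Hp H]] [q [Hq Ha]]; destruct (Gen_dir _ _ Hp Hq) as [s [Hs [H1 H2]]]; exists s; split; auto.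
      apply H; auto; eapply forces_down; eauto.
  - assert (L : forall x p, forces a (fun i => dname (scons x e i)) p <-> forces a (scons (dname x) (fun i => dname (e i))) p).
    { intros x p; apply forces_ext; intros [|i]; reflexivity. }
    split.
    + intros H; destruct (Dec (All a) e) as [p [Hp [Hd|Hd]]]; [eauto|exfalso].
      set (r := fun i => proj1_sig (e i)) in *.
      assert (Hr : refutes (All (ren (up r) a)) rho p).
      { intros q Hq Hf; apply (Hd q Hq); exact (proj1 (forces_ren (All a) r rho q) Hf). }
      destruct (gen_witness _ _ Hp Hr) as [i [q [Hq Hi]]].
      specialize (H (ofn i)); apply IHa in H as [s [Hs Hf]]; apply L in Hf.
      destruct (rep_EQ i) as [t [Ht He]].
      destruct (Gen_dir _ _ Hq Hs) as [u [Hu [U1 U2]]], (Gen_dir _ _ Hu Ht) as [v [Hv [V1 V2]]].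
      apply (Hi v); [eauto|]; apply (forces_ren a (up r)); eapply forces_congr; [|eapply forces_down; [exact Hf|eauto]].
      intros [|j]; simpl; [|apply eqn_refl]. apply eqn_sym; eapply eqn_down; eauto.
    + intros [p [Hp H]] x; apply IHa; exists p; split; auto; apply L, H.
Qed.
End Henkin.

Definition Nm {P} {OP : Order P} {M : Type} (name : M -> Name P) (G : P -> Prop) (x : M) (u : Name P) : Prop :=
  exists p, G p /\ eqn (name x) u p.

(* [U] consists of the names that are guaranteed to have a value in the extension. *)
Record gext {P} {OP : Order P} (U : Name P -> Prop) {M : Type} (E : M -> M -> Prop) (name : M -> Name P) (G : P -> Prop) : Prop := {
  g_up : forall p q, G p -> lep p q -> G q;
  g_dir : forall p q, G p -> G q -> exists r, G r /\ lep r p /\ lep r q;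
  g_truth : forall a e, sat E e a <-> exists p, G p /\ forces a (fun i => name (e i)) p;
  g_val : forall u, U u -> exists x, Nm name G x u;
  g_mem : forall u x p, U u -> G p -> mem (name x) u p -> exists q, G q /\ memr (name x) u q }.

Lemma gext_exists {P} {OP : Order P} (p0 : P) (h : nat -> Name P) (Dn : nat -> P -> Prop) :
  (forall n p, exists q, lep q p /\ Dn n q) ->
  exists (M : Type) (E : M -> M -> Prop) name G, gext (fun u => exists n, u = h n) E name G /\ G p0 /\
    forall n, exists p, G p /\ Dn n p.
Proof.
  intros HD; exists (dM p0 h Dn), (dE p0 h Dn), (dname p0 h Dn), (Gen p0 h Dn).
  split; [split|split].
  - apply Gen_up.
  - apply Gen_dir; auto.
  - apply truth; auto.
  - intros u [n ->]; exists (ofn p0 h Dn HD (2 * n)). destruct (rep_EQ p0 h Dn (2 * n)) as [p [Hp He]].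
    exists p; split; auto. apply eqn_sym. unfold rho at 1 in He; rewrite mix_even in He; exact He.
  - intros u x p [n ->] Hp H.
    assert (Hn : h n = rho p0 h Dn (2 * n)) by (unfold rho; rewrite mix_even; auto).
    rewrite Hn in *. eapply gen_mem; eauto.
  - exists 0; apply lep_refl.
  - intros n; destruct (st_step p0 h Dn HD n) as [_ [[s [H1 H2]] _]]; exists s; split; auto; exists (S n); exact H2.
Qed.

(** * Countable sets of names and the extensions that evaluate them *)

Definition cble (X : Type) := exists f : X -> nat, forall x y, f x = f y -> x = y.
Lemma cble_nat : cble nat. Proof. exists (fun n => n); auto. Qed.
Lemma cble_unit : cble unit. Proof. exists (fun _ => 0); intros [] []; auto. Qed.
Lemma cble_sum X Y : cble X -> cble Y -> cble (X + Y).
Proof.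
  intros [f Hf] [g Hg]; exists (fun z => match z with inl x => to_nat (0, f x) | inr y => to_nat (1, g y) end).
  intros [x|y] [x'|y'] H; apply to_nat_inj in H; injection H; intros; try discriminate; f_equal; auto.
Qed.
Lemma cble_prod X Y : cble X -> cble Y -> cble (X * Y).
Proof.
  intros [f Hf] [g Hg]; exists (fun z => to_nat (f (fst z), g (snd z))).
  intros [x y] [x' y'] H; apply to_nat_inj in H; injection H; intros; f_equal; auto.
Qed.
Fixpoint lcode {X} (f : X -> nat) (l : list X) : nat :=
  match l with [] => 0 | x :: l => S (to_nat (f x, lcode f l)) end.
Lemma lcode_inj {X} (f : X -> nat) : (forall x y, f x = f y -> x = y) -> forall l m, lcode f l = lcode f m -> l = m.
Proof.
  intros Hf; induction l; intros [|y m] H; try discriminate; auto.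
  injection H as H; apply to_nat_inj in H; injection H as H1 H2; f_equal; auto.
Qed.
Lemma cble_list X : cble X -> cble (list X).
Proof. intros [f Hf]; exists (lcode f); apply lcode_inj, Hf. Qed.
#[global] Hint Resolve cble_nat cble_unit cble_sum cble_prod cble_list : core.

Section CName.
Context {P : Type} {OP : Order P}.
Local Notation Name := (Name P).
Definition cnt (U : Name -> Prop) := exists h : nat -> Name, forall u, U u -> exists n, h n = u.
Lemma cnt_img {X} (f : X -> Name) : cble X -> cnt (fun u => exists x, u = f x).
Proof.
  intros [c Hc]. exists (fun n => epsilon (inhabits (nm False (fun z => match z with end) (fun _ _ => True))) (fun u => exists x, c x = n /\ u = f x)).
  intros u [x ->]; exists (c x).
  destruct (epsilon_spec (inhabits (nm False (fun z => match z with end) (fun _ _ => True))) (fun u => exists y, c y = c x /\ u = f y)) as [y [Hy ->]]; eauto.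
  f_equal; auto.
Qed.
Lemma cnt_or U V : cnt U -> cnt V -> cnt (fun u => U u \/ V u).
Proof.
  intros [f Hf] [g Hg]; exists (mix f g); intros u [H|H]; [destruct (Hf u H) as [n <-]|destruct (Hg u H) as [n <-]].
  - exists (2 * n); apply mix_even.
  - exists (S (2 * n)); apply mix_odd.
Qed.
Lemma cnt_one a : cnt (fun u => u = a).
Proof. exists (fun _ => a); intros u ->; exists 0; auto. Qed.

Definition ck {T} (lt : T -> T -> Prop) wf (t : T) : Name := on lt wf (fun _ _ => True) t.
Definition cks {T} (lt : T -> T -> Prop) wf : Name := oset lt wf (fun _ _ => True).
Definition nn (n : nat) : Name := ck Nat.lt lt_wf n.
Definition nset : Name := cks Nat.lt lt_wf.

Definition en {X} (d : X) (l : list X) (i : nat) : X := nth i l d.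
Lemma scons_en {X} (x d : X) l i : scons x (en d l) i = en d (x :: l) i.
Proof. destruct i; reflexivity. Qed.

Record gx (U : Name -> Prop) {M : Type} (E : M -> M -> Prop) (name : M -> Name) (G : P -> Prop) (om : M) (num : nat -> M) : Prop := {
  gx_g : gext U E name G;
  gx_m : model E om num;
  gx_om : Nm name G om nset;
  gx_num : forall n, Nm name G (num n) (nn n) }.

Section Basics.
Context {U : Name -> Prop} {M : Type} {E : M -> M -> Prop} {name : M -> Name} {G : P -> Prop} (g : gext U E name G).
Local Notation Nm := (Nm name G).

Lemma Nm_name x : (exists p, G p) -> Nm x (name x).
Proof. intros [p Hp]; exists p; split; auto; apply eqn_refl. Qed.
Lemma Nm_unique x y u : Nm x u -> Nm y u -> x = y.
Proof.
  intros [p [Hp H]] [q [Hq H']]; destruct (g_dir _ _ _ _ g _ _ Hp Hq) as [r [Hr [H1 H2]]].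
  apply (proj2 (g_truth _ _ _ _ g (Equ 0 1) (fun i => match i with 0 => x | _ => y end))).
  exists r; split; auto; simpl; eapply eqn_trans; [eapply eqn_down; eauto|apply eqn_sym; eapply eqn_down; eauto].
Qed.

Lemma common (ms : list M) (us : list Name) : Forall2 Nm ms us -> (exists p, G p) ->
  exists p, G p /\ Forall2 (fun m u => eqn (name m) u p) ms us.
Proof.
  intros H [p0 Hp0]; induction H as [|m u ms us [p [Hp He]] H [q [Hq IH]]]; [exists p0; auto|].
  destruct (g_dir _ _ _ _ g _ _ Hp Hq) as [r [Hr [H1 H2]]]; exists r; split; auto; constructor.
  - eapply eqn_down; eauto.
  - clear -IH H2; induction IH; constructor; eauto using eqn_down.
Qed.

Lemma sat_names a md ud ms us : Nm md ud -> Forall2 Nm ms us ->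
  sat E (en md ms) a <-> exists p, G p /\ forces a (en ud us) p.
Proof.
  intros Hd Hm; destruct (common (md :: ms) (ud :: us)) as [p [Hp H]]; [auto|destruct Hd as [p [Hp _]]; eauto|].
  inversion H as [|? ? ? ? H1 H2]; subst.
  assert (He : forall q, lep q p -> forall i, eqn (name (en md ms i)) (en ud us i) q).
  { intros q Hq i; apply (eqn_down _ _ p); auto; clear -H1 H2; revert i; induction H2; intros [|i]; simpl; auto; apply IHForall2. }
  rewrite (g_truth _ _ _ _ g); split; intros [q [Hq Hf]]; destruct (g_dir _ _ _ _ g _ _ Hp Hq) as [r [Hr [R1 R2]]];
    exists r; split; auto.
  - eapply forces_congr; [apply He; auto|eapply forces_down; eauto].
  - eapply forces_congr; [intros i; apply eqn_sym, He; auto|eapply forces_down; eauto].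
Qed.
Lemma mem_names x y u v : Nm x u -> Nm y v -> E x y <-> exists p, G p /\ mem u v p.
Proof. intros Hx Hy; exact (sat_names (Mem 0 1) x u [x; y] [u; v] Hx ltac:(repeat constructor; auto)). Qed.
Lemma elem_val x y u : U u -> Nm y u -> E x y -> exists p, G p /\ memr (name x) u p.
Proof.
  intros Hu Hy Hx.
  assert (Hn : Nm x (name x)) by (apply Nm_name; destruct Hy as [p [Hp _]]; eauto).
  apply (mem_names _ _ _ _ Hn Hy) in Hx as [p [Hp Hm]]; eapply g_mem; eauto.
Qed.
End Basics.

Lemma gext_model U {M} (E : M -> M -> Prop) name G : gext U E name G -> (exists p, G p) ->
  U nset -> (forall n, U (nn n)) -> exists om num, gx U E name G om num.
Proof.
  intros g HG Us Un.
  destruct (g_val _ _ _ _ g _ Us) as [om Hom].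
  assert (exists num, forall n, Nm name G (num n) (nn n)) as [num Hnum].
  { exists (fun n => epsilon (inhabits om) (fun x => Nm name G x (nn n))); intros n.
    apply (epsilon_spec (inhabits om) (fun x => Nm name G x (nn n))), (g_val _ _ _ _ g _ (Un n)). }
  assert (T : forall a, (forall c e, forces (a 0) e c) -> sat E (fun _ => om) (a 0)).
  { intros a H; apply (g_truth _ _ _ _ g); destruct HG as [p Hp]; eauto. }
  exists om, num; split; auto; constructor.
  - assert (H : forall x y, (forall z, rand (E z x -> E z y) (E z y -> E z x)) -> x = y)
      by exact (T extensionality (fun c e => ax_extensionality e c)).
    rewrite rand_eq in H; exact H.
  - assert (H : forall x y, rex (fun z => Upair E rand ror x y z)) by exact (T pairing (fun c e => ax_pairing e c)).
    rewrite rex_eq, rand_eq, ror_eq in H; exact H.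
  - assert (H : forall x, rex (fun z => Union E rex rand x z)) by exact (T union_axiom (fun c e => ax_union e c)).
    rewrite rex_eq, rand_eq in H; exact H.
  - assert (H : forall x, rex (fun z => Power E rand x z)) by exact (T power_axiom (fun c e => ax_power e c)).
    rewrite rex_eq, rand_eq in H; exact H.
  - intros p e a.
    set (q := ren (fun i => match i with 0 => 0 | S i => 3 + i end) p).
    assert (H : sat E (scons a e) ((∃ s, ∀ x, x ∈ s ⇔ x ∈ 0 ∧ (fun _ => q)) 1)).
    { apply (g_truth _ _ _ _ g); destruct HG as [p0 Hp0]; exists p0; split; auto.
      set (en0 := fun i => name (scons a e i)).
      set (X := fun z r => forces p (scons z (fun i => name (e i))) r).
      apply f_ex_i with (spn X (name a)); intros z; apply f_iff; intros r Hr.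
      rewrite f_and; unfold fmem; cbn [forces scons Nat.sub]; rewrite mem_spn.
      - assert (HX : X z r <-> forces q (scons z (scons (spn X (name a)) en0)) r); [|rewrite HX; reflexivity].
        unfold X, q; rewrite forces_ren; apply forces_ext; intros [|i]; reflexivity.
      - intros; eapply forces_down; eauto.
      - intros; eapply forces_stable; eauto.
      - intros w w' s He; apply forces_congr; intros [|i]; simpl; auto; apply eqn_refl. }
    assert (H' : rex (fun s => forall x, rand (E x s -> rand (E x a) (sat E (scons x (scons s (scons a e))) q))
       (rand (E x a) (sat E (scons x (scons s (scons a e))) q) -> E x s))) by exact H.
    rewrite rex_eq, rand_eq in H'; destruct H' as [s Hs]; exists s; intros x; specialize (Hs x).
    assert (HX : sat E (scons x (scons s (scons a e))) q <-> sat E (scons x e) p)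
      by (unfold q; rewrite sat_ren; apply sat_ext; intros [|i]; reflexivity).
    rewrite HX in Hs; tauto.
  - assert (H : forall x, rex (fun y => E y x) -> rex (fun y => rand (E y x) (rex (fun z => rand (E z x) (E z y)) -> False)))
      by exact (T foundation (fun c e => ax_foundation e c)).
    rewrite rex_eq, rand_eq in H; intros x Hx; destruct (H x Hx) as [y [Hy H1]]; exists y; split; auto.
    intros z Hz Hzy; apply H1; eauto.
  - assert (H : forall x, rex (fun k => rand (Ordinal E rand k) (Equinum E rex rand ror k x)))
      by exact (T well_orderable (fun c e => forces_well_orderable e c)).
    rewrite rex_eq, rand_eq, ror_eq in H; exact H.
  - intros z; split.
    + intros Hz; destruct (elem_val g _ _ _ Us Hom Hz) as [p [Hp [n [t [_ [_ He]]]]]]; exists n.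
      apply (Nm_unique g _ _ (nn n)); auto; exists p; auto.
    + intros [n ->]; apply (mem_names g _ _ _ _ (Hnum n) Hom); destruct HG as [p Hp]; exists p; split; auto.
      exact (on_oset Nat.lt lt_wf (fun _ _ => True) n p p I (lep_refl p)).
  - intros z n; split.
    + intros Hz; destruct (elem_val g _ _ _ (Un n) (Hnum n) Hz) as [p [Hp Hm]].
      unfold nn, ck in Hm; rewrite on_unfold in Hm; destruct Hm as [[m Hm] [t [_ [_ He]]]]; exists m; split; auto.
      apply (Nm_unique g _ _ (nn m)); auto; exists p; auto.
    + intros [m [Hm ->]]; apply (mem_names g _ _ _ _ (Hnum m) (Hnum n)); destruct HG as [p Hp]; exists p; split; auto.
      exact (on_mem Nat.lt lt_wf (fun _ _ => True) m n p p Hm I (lep_refl p)).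
Qed.

Lemma gx_exists (p0 : P) (U : Name -> Prop) {X} (Dx : X -> P -> Prop) : cnt U -> cble X ->
  (forall x p, exists q, lep q p /\ Dx x q) ->
  exists U' (M : Type) (E : M -> M -> Prop) name G om num, gx U' E name G om num /\ (forall u, U u -> U' u) /\ G p0 /\
    forall x, exists p, G p /\ Dx x p.
Proof.
  intros HU [c Hc] HD.
  assert (HU' : cnt (fun u => U u \/ u = nset \/ exists n, u = nn n)).
  { apply cnt_or; auto; apply cnt_or; [apply cnt_one|apply cnt_img; auto]. }
  destruct HU' as [h Hh].
  destruct (gext_exists p0 h (fun n p => forall x, c x = n -> Dx x p)) as [M [E [name [G [g [Hp HG]]]]]].
  { intros n p; destruct (classic (exists x, c x = n)) as [[x Hx]|Hn].
    - destruct (HD x p) as [q [Hq H]]; exists q; split; auto; intros y Hy; replace y with x; auto; apply Hc; congruence.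
    - exists p; split; auto; intros x Hx; destruct Hn; eauto. }
  destruct (gext_model _ _ _ _ g) as [om [num Hg]].
  - eauto.
  - destruct (Hh nset) as [n Hn]; auto; exists n; auto.
  - intros k; destruct (Hh (nn k)) as [n Hn]; eauto.
  - exists (fun u => exists n, u = h n), M, E, name, G, om, num; split; auto; split; [|split; auto].
    + intros u Hu; destruct (Hh u) as [n Hn]; auto; exists n; auto.
    + intros x; destruct (HG (c x)) as [p [H1 H2]]; exists p; auto.
Qed.

(** Otherwise some [q] below [p] refutes [a], and an extension with [q] in its filter, evaluating
    the names in [U] and meeting the sets [Dx], would make [a] both true and false. Thus forcing
    statements can be proved by arguing inside models. *)
Lemma forces_of_generic a ud us p (U : Name -> Prop) {X} (Dx : X -> P -> Prop) : cnt U -> cble X ->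
  (forall x p, exists q, lep q p /\ Dx x q) ->
  (forall U' (M : Type) (E : M -> M -> Prop) name G om num, gx U' E name G om num -> (forall u, U u -> U' u) -> G p ->
    (forall x, exists p, G p /\ Dx x p) -> forall md ms, Nm name G md ud -> Forall2 (Nm name G) ms us -> sat E (en md ms) a) ->
  forces a (en ud us) p.
Proof.
  intros HU HX HD H; apply NNPP; intros Hn; destruct (refutes_ex _ _ _ Hn) as [q [Hq Hr]].
  assert (HU' : cnt (fun u => U u \/ u = ud \/ In u us)).
  { apply cnt_or; auto; apply cnt_or; [apply cnt_one|]. exists (fun n => nth n us ud); intros u Hu.
    apply (In_nth us u ud) in Hu as [n [_ Hn']]; eauto. }
  destruct (gx_exists q _ Dx HU' HX HD) as [U' [M [E [name [G [om [num [g [HU1 [Hq' HG]]]]]]]]]].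
  assert (exists md, Nm name G md ud) as [md Hmd] by (apply (g_val _ _ _ _ (gx_g _ _ _ _ _ _ g)), HU1; auto).
  assert (exists ms, Forall2 (Nm name G) ms us) as [ms Hms].
  { assert (Hin : forall u, In u us -> U' u) by auto; clear -g Hin; induction us as [|u us IH]; [exists []; auto|].
    destruct (g_val _ _ _ _ (gx_g _ _ _ _ _ _ g) u) as [m Hm]; [apply Hin; left; auto|].
    destruct IH as [ms Hms]; [intros; apply Hin; right; auto|]. exists (m :: ms); auto. }
  assert (Hs : sat E (en md ms) a).
  { eapply H; eauto. exact (g_up _ _ _ _ (gx_g _ _ _ _ _ _ g) _ _ Hq' Hq). }
  apply (sat_names (gx_g _ _ _ _ _ _ g) a md ud ms us Hmd Hms) in Hs as [r [Hr' Hf]].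
  destruct (g_dir _ _ _ _ (gx_g _ _ _ _ _ _ g) _ _ Hq' Hr') as [s [Hs [S1 S2]]].
  apply (Hr s S1); eapply forces_down; eauto.
Qed.
End CName.

(** * The poset and its limits *)

Definition dec (A : Prop) : {A} + {~ A} := excluded_middle_informative A.

(** * Countability and Delta-systems *)

Definition countable {X} (S : X -> Prop) := exists f : X -> nat, forall x y, S x -> S y -> f x = f y -> x = y.
Lemma countable_sub {X} (S S' : X -> Prop) : (forall x, S x -> S' x) -> countable S' -> countable S.
Proof. intros H [f Hf]; exists f; auto. Qed.
Lemma countable_union {X} (S : nat -> X -> Prop) : (forall n, countable (S n)) -> countable (fun x => exists n, S n x).
Proof.
  intros H.
  assert (exists f : nat -> X -> nat, forall n x y, S n x -> S n y -> f n x = f n y -> x = y) as [f Hf].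
  { exists (fun n => epsilon (inhabits (fun _ => 0)) (fun f => forall x y, S n x -> S n y -> f x = f y -> x = y)).
    intros n; apply (epsilon_spec (inhabits (fun _ => 0)) (fun f => forall x y, S n x -> S n y -> f x = f y -> x = y) (H n)). }
  set (w := fun x => epsilon (inhabits 0) (fun n => S n x)).
  assert (Hw : forall x, (exists n, S n x) -> S (w x) x) by (intros x Hx; apply (epsilon_spec (inhabits 0) (fun n => S n x) Hx)).
  exists (fun x => to_nat (w x, f (w x) x)); intros x y Hx Hy He; apply to_nat_inj in He; injection He as H1 H2.
  apply (Hf (w x)); [auto|rewrite H1; auto|rewrite H2, H1; auto].
Qed.
Lemma countable_or {X} (S S' : X -> Prop) : countable S -> countable S' -> countable (fun x => S x \/ S' x).
Proof.
  intros H H'; eapply countable_sub; [|apply (countable_union (fun n => match n with 0 => S | _ => S' end))].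
  - intros x [Hx|Hx]; [exists 0|exists 1]; auto.
  - intros []; auto.
Qed.
Lemma countable_list {X} (L : list X) : countable (fun x => In x L).
Proof.
  induction L as [|a L IH]; [exists (fun _ => 0); intros x y []|].
  eapply countable_sub; [|apply (countable_or (fun x => x = a) (fun x => In x L)); [|exact IH]].
  - intros x [<-|H]; auto.
  - exists (fun _ => 0); intros x y -> ->; auto.
Qed.
Lemma uncountable_fiber {X C} (S : X -> Prop) (c : X -> C) : cble C -> ~ countable S ->
  exists c0, ~ countable (fun x => S x /\ c x = c0).
Proof.
  intros [k Hk] HS; apply NNPP; intros Hn; apply HS.
  eapply countable_sub; [|apply (countable_union (fun n x => S x /\ k (c x) = n))].
  - intros x Hx; exists (k (c x)); auto.
  - intros n; apply NNPP; intros Hc; destruct (classic (exists x, S x /\ k (c x) = n)) as [[x [_ Hx]]|He].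
    + apply Hn; exists (c x); intros Hc'; apply Hc; eapply countable_sub; [|exact Hc'].
      intros y [Hy Hy']; split; auto; apply Hk; congruence.
    + apply Hc; exists (fun _ => 0); intros x y Hx; destruct He; eauto.
Qed.

Section DeltaSystem.
Context {X Z C : Type} (supp : X -> list Z) (col : X -> Z -> C) (HC : cble C).

Lemma delta_aux n : forall (S : X -> Prop) (f : X -> list Z), ~ countable S -> (forall x, S x -> length (f x) <= n) ->
  exists (R : list Z) (x : nat -> X), (forall n, S (x n)) /\ (forall n m, x n = x m -> n = m) /\
    (forall n m z, n <> m -> In z (f (x n)) -> In z (f (x m)) -> In z R) /\
    (forall n m z, In z R -> col (x n) z = col (x m) z).
Proof.
  induction n as [n IH] using lt_wf_ind; intros S f HS Hn.
  destruct (classic (exists z, ~ countable (fun x => S x /\ In z (f x)))) as [[z Hz]|Hz].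
  - destruct (uncountable_fiber _ (fun x => col x z) HC Hz) as [c Hc].
    destruct n as [|n].
    { exfalso; apply Hz; exists (fun _ => 0); intros x y [Hx Hx'] _; apply Hn in Hx; destruct (f x); [destruct Hx'|simpl in Hx; lia]. }
    set (f' := fun x => remove (fun a b => dec (a = b)) z (f x)).
    destruct (IH n (Nat.lt_succ_diag_r n) (fun x => (S x /\ In z (f x)) /\ col x z = c) f') as [R [x [H1 [H2 [H3 H4]]]]].
    + exact Hc.
    + intros x [[Hx Hzx] _]; pose proof (remove_length_lt (fun a b => dec (a = b)) (f x) z Hzx); specialize (Hn x Hx); unfold f'; lia.
    + exists (z :: R), x; split; [intros k; apply H1|split; [auto|split]].
      * intros k m y Hkm Hy Hy'; destruct (dec (z = y)) as [<-|Hne]; [left; auto|right].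
        apply (H3 k m y Hkm); apply in_in_remove; auto.
      * intros k m y [<-|Hy]; [transitivity c; [|symmetry]; apply H1|auto].
  - assert (Hc : forall L : list Z, countable (fun x => S x /\ exists z, In z L /\ In z (f x))).
    { induction L as [|z L IHL]; [exists (fun _ => 0); intros x y [_ [z [[] _]]]|].
      eapply countable_sub; [|apply (countable_or (fun x => S x /\ In z (f x)) (fun x => S x /\ exists z, In z L /\ In z (f x))); [|exact IHL]].
      - intros x [Hx [z' [[<-|Hz'] Hf]]]; [left|right]; eauto.
      - apply NNPP; eauto. }
    assert (Hpick : forall l : list X, exists x, S x /\ ~ In x l /\ forall y z, In y l -> In z (f y) -> ~ In z (f x)).
    { intros l; apply NNPP; intros Hp; apply HS.
      eapply countable_sub; [|apply (countable_or (fun x => In x l) (fun x => S x /\ exists z, In z (flat_map f l) /\ In z (f x)))];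
        [|apply countable_list|apply Hc].
      intros x Hx; apply NNPP; intros Hno; apply Hp; exists x; split; auto; split; [auto|].
      intros y z Hy Hzy Hzx; apply Hno; right; split; auto; exists z; split; auto; apply in_flat_map; eauto. }
    assert (exists pick : list X -> X, forall l, S (pick l) /\ ~ In (pick l) l /\ forall y z, In y l -> In z (f y) -> ~ In z (f (pick l))) as [pick Hpk].
    { destruct (Hpick []) as [x0 _].
      exists (fun l => epsilon (inhabits x0) (fun x => S x /\ ~ In x l /\ forall y z, In y l -> In z (f y) -> ~ In z (f x))).
      intros l; apply (epsilon_spec (inhabits x0) (fun x => S x /\ ~ In x l /\ forall y z, In y l -> In z (f y) -> ~ In z (f x)) (Hpick l)). }
    set (seq := fix seq n := match n with 0 => [] | Datatypes.S n => pick (seq n) :: seq n end).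
    assert (Hin : forall n m, n < m -> In (pick (seq n)) (seq m)).
    { intros k m H; induction H; simpl; auto. }
    assert (Hinj : forall n m, n < m -> pick (seq n) <> pick (seq m)).
    { intros k m H He; apply (Hpk (seq m)); rewrite <- He; auto. }
    exists [], (fun n => pick (seq n)); split; [intros k; apply Hpk|split; [|split; [|intros ? ? ? []]]].
    + intros k m He; destruct (lt_eq_lt_dec k m) as [[H|H]|H]; auto; exfalso; [|symmetry in He]; exact (Hinj _ _ H He).
    + intros k m z Hkm H1 H2; exfalso; destruct (lt_eq_lt_dec k m) as [[H|H]|H]; auto.
      * exact (proj2 (proj2 (Hpk (seq m))) _ z (Hin _ _ H) H1 H2).
      * exact (proj2 (proj2 (Hpk (seq k))) _ z (Hin _ _ H) H2 H1).
Qed.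

Lemma delta_system (S : X -> Prop) : ~ countable S ->
  exists (R : list Z) (x : nat -> X), (forall n, S (x n)) /\ (forall n m, x n = x m -> n = m) /\
    (forall n m z, n <> m -> In z (supp (x n)) -> In z (supp (x m)) -> In z R) /\
    (forall n m z, In z R -> col (x n) z = col (x m) z).
Proof.
  intros HS; destruct (uncountable_fiber S (fun x => length (supp x)) cble_nat HS) as [k Hk].
  destruct (delta_aux k _ supp Hk) as [R [x [H1 H2]]]; [intros x [_ ->]; auto|].
  exists R, x; split; auto; intros n; apply H1.
Qed.
End DeltaSystem.

Lemma inj_avoid {X} (x : nat -> X) (L : list X) : (forall n m, x n = x m -> n = m) ->
  exists N, forall n, N <= n -> ~ In (x n) L.
Proof.
  intros Hx; induction L as [|a L [N HN]]; [exists 0; auto|].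
  destruct (classic (exists n, x n = a)) as [[k Hk]|Hk].
  - exists (S (N + k)); intros n Hn [He|Hi]; [|apply (HN n); auto; lia].
    assert (n = k) by (apply Hx; congruence); lia.
  - exists N; intros n Hn [He|Hi]; [apply Hk; eauto|apply (HN n); auto].
Qed.

(** * The conditions and their order *)

Section Poset.
Context {I W : Type} (lt : W -> W -> Prop) (wf : well_founded lt).
Context (tri : forall x y, lt x y \/ x = y \/ lt y x) (tr : forall x y z, lt x y -> lt y z -> lt x z).
(* Constrains the values of one name at two levels. *)
Context (Adm : nat -> nat * nat -> nat -> nat * nat -> Prop).

(* An item [mki v F H] describes, at each level [l < length v], the set of points whose first coordinate is below [v l]
   or that belong to [F] ([Good]); the columns of [F] have at most [v l] points, so the set is in ED. [H] lists the
   names to be captured at the levels to come. The pair [y l k = (c, u)] of a name [y] says that [c] forces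
   the value [u] at level [l]. *)
Inductive cond : Type := mkc (coh : I -> list (nat * nat)) (co : W -> item)
with item : Type := mki (iv : list nat) (iF : list (nat * nat * nat)) (iH : list (nat -> nat -> cond * (nat * nat))).

Definition code := nat -> nat -> cond * (nat * nat).
Definition coh p := match p with mkc c _ => c end.
Definition co p := match p with mkc _ c => c end.
Definition iv x := match x with mki v _ _ => v end.
Definition iF x := match x with mki _ F _ => F end.
Definition iH x : list code := match x with mki _ _ H => H end.
Definition d0 := mki [] [] [].

Definition prefix {A} (a b : list A) := exists c, b = a ++ c.
Definition Good (v : list nat) (F : list (nat * nat * nat)) l (u : nat * nat) := fst u < nth l v 0 \/ In (l, fst u, snd u) F.

Definition oky (R : cond -> cond -> Prop) (y : code) := forall r l k l' k', R r (fst (y l k)) -> R r (fst (y l' k')) ->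
  (l = l' -> snd (y l k) = snd (y l' k')) /\ Adm l (snd (y l k)) l' (snd (y l' k')).
Definition bnd v (F : list (nat * nat * nat)) := forall l a bs, NoDup bs -> (forall b, In b bs -> In (l, a, b) F) -> length bs <= nth l v 0.
Definition okitem R x := bnd (iv x) (iF x) /\ forall y, In y (iH x) -> oky R y.
(** A new level must leave room for one point of each promised name, and [q] must force, through the
    coordinates below, that these points are captured. The lengths of the promise lists are compared
    besides their inclusion because lists may repeat names and the room is measured by the
    length. *)
Definition itemle (R : cond -> cond -> Prop) (q : cond) y x :=
  prefix (iv x) (iv y) /\ incl (iF x) (iF y) /\ incl (iH x) (iH y) /\ length (iH x) <= length (iH y) /\
  (forall l, length (iv x) <= l < length (iv y) -> length (iH x) <= nth l (iv y) 0) /\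
  (forall z l k r, In z (iH x) -> length (iv x) <= l < length (iv y) -> R r q -> R r (fst (z l k)) ->
     Good (iv y) (iF y) l (snd (z l k))).
Definition fin p := (exists L, forall i, coh p i <> [] -> In i L) /\ exists L, forall u, co p u <> d0 -> In u L.

(* The items at the coordinates in [D] are compared, where [K u] stands for the order of the coordinates below [u]:
   the names promised at [u] are evaluated there. *)
Definition ale_ (K : W -> cond -> cond -> Prop) (D : W -> Prop) q p :=
  fin q /\ (forall i, prefix (coh p i) (coh q i)) /\
  forall u, D u -> okitem (K u) (co q u) /\ itemle (K u) q (co q u) (co p u).

Definition K : W -> cond -> cond -> Prop :=
  Fix wf (fun _ => cond -> cond -> Prop) (fun u rec q p =>
    fin q /\ (forall i, prefix (coh p i) (coh q i)) /\
    forall u' (h : lt u' u), okitem (rec u' h) (co q u') /\ itemle (rec u' h) q (co q u') (co p u')).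
Definition ale := ale_ K.

Lemma K_eq u q p : K u q p <-> ale (fun w => lt w u) q p.
Proof.
  unfold K at 1; rewrite Fix_eq; [reflexivity|].
  intros x f g H; assert (f = g) as ->; auto.
  extensionality w; extensionality h; apply H.
Qed.

Lemma prefix_refl {A} (a : list A) : prefix a a. Proof. exists []; rewrite app_nil_r; auto. Qed.
Lemma prefix_trans {A} (a b c : list A) : prefix a b -> prefix b c -> prefix a c.
Proof. intros [x ->] [y ->]; exists (x ++ y); rewrite app_assoc; auto. Qed.
Lemma prefix_len {A} (a b : list A) : prefix a b -> length a <= length b.
Proof. intros [x ->]; rewrite length_app; lia. Qed.
Lemma prefix_nth {A} (a b : list A) l d : prefix a b -> l < length a -> nth l b d = nth l a d.
Proof. intros [x ->] H; apply app_nth1; auto. Qed.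
Lemma prefix_nil {A} (a : list A) : prefix [] a. Proof. exists a; auto. Qed.

Lemma itemle_refl R q x : itemle R q x x.
Proof.
  split; [apply prefix_refl|]; split; [apply incl_refl|]; split; [apply incl_refl|]; split; auto.
  split; intros; lia.
Qed.
Lemma itemle_d0 R q x : itemle R q x d0.
Proof.
  split; [apply prefix_nil|]; split; [intros ? []|]; split; [intros ? []|]; split; [simpl; lia|].
  split; [intros; simpl; lia|intros z l k r []].
Qed.
Lemma okitem_d0 R : okitem R d0.
Proof.
  split; [|intros y []]; intros l a [|b bs] _ H; [simpl; lia|]. destruct (H b (or_introl eq_refl)).
Qed.
Lemma ale_valid D q p : ale D q p -> ale D q q.
Proof.
  intros [H1 [H2 H3]]; split; auto; split; [intros; apply prefix_refl|].
  intros u Hu; split; [apply H3; auto|apply itemle_refl].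
Qed.

Definition down (D : W -> Prop) := forall w u, D u -> lt w u -> D w.
Lemma ale_sub (D D' : W -> Prop) q p : (forall w, D' w -> D w) -> ale D q p -> ale D' q p.
Proof. intros H [H1 [H2 H3]]; split; auto. Qed.
Lemma ale_K D u q p : down D -> D u -> ale D q p -> K u q p.
Proof. intros HD Hu H; apply K_eq; eapply ale_sub; [|exact H]; eauto. Qed.

(** The levels that [q] adds to [p] must stay good below [r]. The names promised in [p] are
    evaluated there under [K u], so transitivity at [u] rests on transitivity below [u]. *)
Lemma ale_trans_aux D : down D -> (forall u, D u -> forall r q p, K u r q -> K u q p -> K u r p) ->
  forall r q p, ale D r q -> ale D q p -> ale D r p.
Proof.
  intros HD HK r q p Hrq Hqp; pose proof Hrq as [H1 [H2 H3]]; pose proof Hqp as [H4 [H5 H6]].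
  split; auto; split; [intros i; eapply prefix_trans; eauto|]; intros u Hu; split; [apply H3; auto|].
  destruct (H3 u Hu) as [_ [A1 [A2 [A3 [A4 [A5 A6]]]]]], (H6 u Hu) as [_ [B1 [B2 [B3 [B4 [B5 B6]]]]]].
  pose proof (prefix_len _ _ A1); pose proof (prefix_len _ _ B1).
  split; [eapply prefix_trans; eauto|]; split; [eapply incl_tran; eauto|]; split; [eapply incl_tran; eauto|]; split; [lia|].
  split.
  - intros l Hl; destruct (le_lt_dec (length (iv (co q u))) l).
    + specialize (A5 l); lia.
    + rewrite (prefix_nth _ _ _ _ A1) by auto; apply B5; lia.
  - intros z l k s Hz Hl Hs Hs'; destruct (le_lt_dec (length (iv (co q u))) l).
    + apply (A6 z l k s); auto; lia.
    + assert (Hg : Good (iv (co q u)) (iF (co q u)) l (snd (z l k))).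
      { apply (B6 z l k s); auto; [lia|]. exact (HK u Hu s r q Hs (ale_K D u r q HD Hu Hrq)). }
      destruct Hg as [Hg|Hg]; [left|right; auto]. rewrite (prefix_nth _ _ _ _ A1) by auto; auto.
Qed.
Lemma down_lt u : down (fun w => lt w u). Proof. intros w v H1 H2; eauto. Qed.
Lemma K_trans u : forall r q p, K u r q -> K u q p -> K u r p.
Proof.
  induction u as [u IH] using (well_founded_induction wf); intros r q p; rewrite !K_eq.
  apply ale_trans_aux; [apply down_lt|exact IH].
Qed.
Lemma ale_trans D r q p : down D -> ale D r q -> ale D q p -> ale D r p.
Proof. intros HD; apply ale_trans_aux; auto; intros u _; apply K_trans. Qed.

Lemma ale_agree_r D q p p' : coh p = coh p' -> (forall w, D w -> co p w = co p' w) -> ale D q p -> ale D q p'.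
Proof.
  intros Hc Hw [H1 [H2 H3]]; split; auto; split; [rewrite <- Hc; auto|].
  intros u Hu; rewrite <- Hw by auto; auto.
Qed.
Lemma itemle_agree D u q q' y x : down D -> D u -> coh q = coh q' -> (forall w, lt w u -> co q w = co q' w) ->
  itemle (K u) q y x -> itemle (K u) q' y x.
Proof.
  intros HD Hu Hc Hw [A1 [A2 [A3 [A4 [A5 A6]]]]]; do 5 (split; auto).
  intros z l k r Hz Hl Hr Hr'; apply (A6 z l k r); auto.
  apply K_eq; apply K_eq in Hr; eapply ale_agree_r; [symmetry; exact Hc|intros w Hw'; symmetry; apply Hw, Hw'|exact Hr].
Qed.
Lemma ale_agree_l D q q' p : down D -> fin q' -> coh q = coh q' -> (forall w, D w -> co q w = co q' w) -> ale D q p -> ale D q' p.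
Proof.
  intros HD Hf Hc Hw [H1 [H2 H3]]; split; auto; split; [rewrite <- Hc; auto|].
  intros u Hu; rewrite <- Hw by auto; split; [apply H3; auto|].
  eapply (itemle_agree D); eauto; apply H3; auto.
Qed.

(** * Amalgamation and the countable chain condition *)

Definition join x y := if dec (x = d0) then y else mki (iv x) (iF x) (iH x ++ iH y).
Definition SCi x y := x = d0 \/ y = d0 \/ (iv x = iv y /\ iF x = iF y).
Definition mrg (D : W -> Prop) r t p := mkc (coh r) (fun w => if dec (D w) then co r w else join (co t w) (co p w)).

Lemma join_d0 x : join x d0 = x.
Proof. unfold join; destruct (dec (x = d0)); auto; destruct x; simpl; rewrite app_nil_r; auto. Qed.
Lemma join_l R q x y : itemle R q (join x y) x.
Proof.
  unfold join; destruct (dec (x = d0)) as [->|Hx]; [apply itemle_d0|].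
  split; [apply prefix_refl|]; split; [apply incl_refl|]; split; [apply incl_appl, incl_refl|].
  simpl; rewrite length_app; split; [lia|]; split; intros; lia.
Qed.
Lemma join_r R q x y : SCi x y -> itemle R q (join x y) y.
Proof.
  intros H; unfold join; destruct (dec (x = d0)) as [->|Hx]; [apply itemle_refl|].
  destruct H as [H|[->|[H1 H2]]]; [tauto|apply itemle_d0|].
  unfold itemle; simpl; rewrite <- H1, <- H2, length_app.
  split; [apply prefix_refl|]; split; [apply incl_refl|]; split; [apply incl_appr, incl_refl|].
  split; [lia|]; split; intros; lia.
Qed.
Lemma join_ok R x y : okitem R x -> okitem R y -> okitem R (join x y).
Proof.
  intros [H1 H2] [H3 H4]; unfold join; destruct (dec (x = d0)); [split; auto|].
  split; simpl; auto; intros z Hz; apply in_app_or in Hz as [Hz|Hz]; auto.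
Qed.
Lemma fin_mrg D r t p : fin r -> fin t -> fin p -> fin (mrg D r t p).
Proof.
  intros [H1 [L1 H2]] [_ [L2 H3]] [_ [L3 H4]]; split; [exact H1|]; exists (L1 ++ L2 ++ L3); intros u; simpl; intros Hu.
  apply in_or_app; destruct (dec (D u)); auto; right; apply in_or_app.
  destruct (dec (co t u = d0)) as [He|He]; auto; right; apply H4; intros Hp; apply Hu; rewrite He, Hp; apply join_d0.
Qed.
(** On [D] the condition [r] extends both. Elsewhere one item is trivial or the two have the same
    levels and points; uniting the promises then adds no level to either, so nothing has to be
    captured. *)
Lemma mrg_spec (D D' : W -> Prop) r t p : down D -> down D' -> (forall w, D w -> D' w) ->
  ale D r t -> ale D r p -> ale D' t t -> ale D' p p -> (forall w, D' w -> ~ D w -> SCi (co t w) (co p w)) ->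
  ale D' (mrg D r t p) t /\ ale D' (mrg D r t p) p.
Proof.
  intros HD HD' HDD Ht Hp Vt Vp HS.
  assert (Hf : fin (mrg D r t p)) by (apply fin_mrg; [apply Ht|apply Vt|apply Vp]).
  assert (Hag : forall x, ale D r x -> ale D (mrg D r t p) x).
  { intros x; apply ale_agree_l; auto; intros w Hw; simpl; destruct (dec (D w)); tauto. }
  assert (Hok : forall w, D' w -> ~ D w -> okitem (K w) (co (mrg D r t p) w)).
  { intros w Hw Hn; simpl; destruct (dec (D w)); [tauto|]; apply join_ok; [apply Vt|apply Vp]; auto. }
  split; (split; [auto|split; [first [apply Ht|apply Hp]|]]); intros w Hw; destruct (dec (D w)) as [Hd|Hd].
  - apply (Hag t Ht); auto.
  - split; auto; simpl; destruct (dec (D w)); [tauto|]; apply join_l.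
  - apply (Hag p Hp); auto.
  - split; auto; simpl; destruct (dec (D w)); [tauto|]; apply join_r; auto.
Qed.

Definition TT (w : W) := True.
Lemma down_TT : down TT. Proof. intros w u _ _; exact Logic.I. Qed.
Definition NO (w : W) := False.
Lemma down_NO : down NO. Proof. intros w u []. Qed.

Definition cjoin {A} (a b : list A) := match a with [] => b | _ => a end.
Definition SCc {A} (a b : list A) := a = [] \/ b = [] \/ a = b.
Definition base p q := mkc (fun i => cjoin (coh p i) (coh q i)) (fun _ => d0).
Lemma base_spec p q : fin p -> fin q -> (forall i, prefix (coh p i) (cjoin (coh p i) (coh q i)) /\ prefix (coh q i) (cjoin (coh p i) (coh q i))) ->
  ale NO (base p q) p /\ ale NO (base p q) q.
Proof.
  intros [[L HL] _] [[L' HL'] _] H.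
  assert (fin (base p q)).
  { split; [exists (L ++ L')|exists []; simpl; intros u Hu; tauto].
    intros i; simpl; intros Hi; apply in_or_app; destruct (coh p i) eqn:E; [right; apply HL'; auto|left; apply HL; congruence]. }
  split; (split; [auto|split; [intros i; apply H|intros u []]]).
Qed.
Definition mg p q := mrg NO (base p q) p q.
Definition SC D p q := (forall i, SCc (coh p i) (coh q i)) /\ forall w, D w -> SCi (co p w) (co q w).
Lemma cjoin_SC {A} (a b : list A) : SCc a b -> prefix a (cjoin a b) /\ prefix b (cjoin a b).
Proof.
  intros [->|[->| ->]]; simpl.
  - split; [apply prefix_nil|apply prefix_refl].
  - split; [destruct a; apply prefix_refl|apply prefix_nil].
  - destruct b; split; apply prefix_refl.
Qed.
Lemma mg_spec D p q : down D -> SC D p q -> ale D p p -> ale D q q -> ale D (mg p q) p /\ ale D (mg p q) q.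
Proof.
  intros HD [H1 H2] Hp Hq; destruct (base_spec p q) as [B1 B2]; [apply Hp|apply Hq|intros i; apply cjoin_SC, H1|].
  apply mrg_spec; auto using down_NO; intros w [].
Qed.
Lemma SC_mg D p q r : SC D p r -> SC D q r -> SC D (mg p q) r.
Proof.
  intros [H1 H2] [H3 H4]; split.
  - intros i; simpl; destruct (coh p i) eqn:E; simpl; auto; rewrite <- E; auto.
  - intros w Hw; simpl; destruct (dec (NO w)) as [[]|_]; unfold join; destruct (dec (co p w = d0)) as [He|He]; auto.
    destruct (H2 w Hw) as [Hx|[Hx|Hx]]; [tauto|right; left; auto|right; right; auto].
Qed.
Lemma SC_sym D p q : SC D p q -> SC D q p.
Proof. intros [H1 H2]; split; [intros i; destruct (H1 i) as [|[|]]|intros w Hw; destruct (H2 w Hw) as [|[|[]]]]; unfold SCc, SCi; auto. Qed.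

Context (HI : forall L : list I, exists i, ~ In i L).

Definition nontriv (p : cond) (z : I + W) := match z with inl i => coh p i <> [] | inr w => co p w <> d0 end.
Definition stem (p : cond) (z : I + W) : list (nat * nat) + (list nat * list (nat * nat * nat) * nat) :=
  match z with inl i => inl (coh p i) | inr w => inr (iv (co p w), iF (co p w), length (iH (co p w))) end.

Lemma fin_supp p : fin p -> exists L : list (I + W), forall z, nontriv p z -> In z L.
Proof.
  intros [[L HL] [L' HL']]; exists (map inl L ++ map inr L'); intros [i|w] H; apply in_or_app; [left|right]; apply in_map; auto.
Qed.

Lemma delta_conds {X} (S : X -> Prop) (p : X -> cond) (extra : X -> list (I + W)) : ~ countable S -> (forall x, S x -> fin (p x)) ->
  exists (R : list (I + W)) (x : nat -> X), (forall n, S (x n)) /\ (forall n m, x n = x m -> n = m) /\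
    (forall n m z, n <> m -> (In z (extra (x n)) \/ nontriv (p (x n)) z) -> (In z (extra (x m)) \/ nontriv (p (x m)) z) -> In z R) /\
    (forall n m z, In z R -> stem (p (x n)) z = stem (p (x m)) z).
Proof.
  intros HS Hf.
  set (sp := fun x => epsilon (inhabits []) (fun L => forall z, nontriv (p x) z -> In z L)).
  assert (Hsp : forall x, S x -> forall z, nontriv (p x) z -> In z (sp x)).
  { intros x Hx; apply (epsilon_spec (inhabits []) (fun L => forall z, nontriv (p x) z -> In z L)), fin_supp, Hf, Hx. }
  destruct (delta_system (fun x => extra x ++ sp x) (fun x => stem (p x)) ltac:(auto 10) S HS) as [R [x [H1 [H2 [H3 H4]]]]].
  exists R, x; split; auto; split; auto; split; auto.
  intros n m z Hnm Hn Hm; apply (H3 n m z Hnm); apply in_or_app; [destruct Hn|destruct Hm]; auto.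
Qed.

Lemma stem_SC D (p q : cond) : (forall z, nontriv p z -> nontriv q z -> stem p z = stem q z) -> SC D p q.
Proof.
  intros H; split.
  - intros i; destruct (dec (coh p i = [])); [left; auto|]; destruct (dec (coh q i = [])); [right; left; auto|].
    right; right; specialize (H (inl i) n n0); simpl in H; congruence.
  - intros w _; destruct (dec (co p w = d0)); [left; auto|]; destruct (dec (co q w = d0)); [right; left; auto|].
    right; right; specialize (H (inr w) n n0); simpl in H; split; congruence.
Qed.

Definition compat D s t := exists r, ale D r s /\ ale D r t.

(** Two members of a Delta-system have equal stems on the root and can be united. *)
Lemma ccc D (S : cond -> Prop) : down D -> (forall s, S s -> ale D s s) -> (forall s t, S s -> S t -> compat D s t -> s = t) -> countable S.
Proof.
  intros HD HV HA; apply NNPP; intros Hn.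
  destruct (delta_conds S (fun x => x) (fun _ => []) Hn) as [R [x [H1 [H2 [H3 H4]]]]].
  { intros s Hs; apply (HV s Hs). }
  assert (x 0 = x 1).
  { apply HA; auto; exists (mg (x 0) (x 1)).
    apply mg_spec; auto; apply stem_SC; intros z Hz Hz'; apply H4, (H3 0 1); auto. }
  apply H2 in H; discriminate.
Qed.

Lemma max_antichain D (O : cond -> Prop) : (forall s, O s -> ale D s s) -> exists A : cond -> Prop, (forall s, A s -> O s) /\
  (forall s t, A s -> A t -> compat D s t -> s = t) /\ forall s, O s -> exists t, A t /\ compat D s t.
Proof.
  intros HV; destruct (well_order_exists cond) as [l [lwf [ltri _]]].
  set (A := Fix lwf (fun _ => Prop) (fun t rec => O t /\ forall t' (h : l t' t), rec t' h -> ~ compat D t t')).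
  assert (HA : forall t, A t <-> O t /\ forall t', l t' t -> A t' -> ~ compat D t t').
  { intros t; unfold A at 1; rewrite Fix_eq; [reflexivity|].
    intros x f g H; assert (f = g) as ->; auto; extensionality w; extensionality h; apply H. }
  exists A; split; [intros s Hs; apply HA in Hs; tauto|split].
  - intros s t Hs Ht Hc; destruct (ltri s t) as [H|[H|H]]; auto; exfalso.
    + apply HA in Ht as [_ Ht]; apply (Ht s H Hs); destruct Hc as [r []]; exists r; auto.
    + apply HA in Hs as [_ Hs]; apply (Hs t H Ht Hc).
  - intros s Hs; destruct (classic (A s)) as [H|H].
    + exists s; split; auto; exists s; split; apply HV; auto.
    + apply NNPP; intros Hn; apply H, HA; split; auto; intros t' _ Ht' Hc; apply Hn; eauto.
Qed.

Definition badc : cond := mkc (fun _ => [(0, 0)]) (fun _ => d0).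
Lemma badc_invalid D r : ~ ale D r badc.
Proof.
  intros [[[L HL] _] [Hp _]]; destruct (HI L) as [i Hi]; apply Hi, HL.
  destruct (Hp i) as [c Hc]; rewrite Hc; discriminate.
Qed.

(** At each level a maximal antichain of the conditions deciding a value is taken; it is countable
    by [ccc], so its members can be numbered by the second argument of the code. *)
Lemma code_gen D (O : nat -> nat * nat -> cond -> Prop) : down D -> (forall l v t, O l v t -> ale D t t) ->
  exists y : code, (forall l k, O l (snd (y l k)) (fst (y l k)) \/ fst (y l k) = badc) /\
    forall l v t, O l v t -> exists k r, ale D r t /\ ale D r (fst (y l k)).
Proof.
  intros Hdn HV; set (B := (badc, (0, 0)) : cond * (nat * nat)).
  assert (HL : forall l, exists y : nat -> cond * (nat * nat), (forall k, O l (snd (y k)) (fst (y k)) \/ fst (y k) = badc) /\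
    forall v t, O l v t -> exists k r, ale D r t /\ ale D r (fst (y k))).
  { intros l; destruct (max_antichain D (fun t => exists v, O l v t)) as [A [A1 [A2 A3]]].
    { intros s [v Hs]; exact (HV l v s Hs). }
    destruct (ccc D A) as [f Hf]; auto.
    { intros s Hs; apply A1 in Hs as [v Hs]; exact (HV l v s Hs). }
    set (Q := fun k (c : cond * (nat * nat)) => A (fst c) /\ f (fst c) = k /\ O l (snd c) (fst c)).
    exists (fun k => if dec (exists c, Q k c) then epsilon (inhabits B) (Q k) else B); split.
    - intros k; destruct (dec (exists c, Q k c)) as [H|H]; [left|right; auto].
      apply (epsilon_spec (inhabits B) (Q k) H).
    - intros v t Ht; destruct (A3 t) as [t' [Ht' [r [R1 R2]]]]; [eauto|].
      destruct (A1 t' Ht') as [v' Hv']; exists (f t'), r; split; auto.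
      destruct (dec (exists c, Q (f t') c)) as [H|H]; [|destruct H; exists (t', v'); split; auto].
      pose proof (epsilon_spec (inhabits B) (Q (f t')) H) as [E1 [E2 E3]].
      rewrite (Hf _ _ E1 Ht' E2); auto. }
  exists (fun l => epsilon (inhabits (fun _ => B)) (fun y => (forall k, O l (snd (y k)) (fst (y k)) \/ fst (y k) = badc) /\
    forall v t, O l v t -> exists k r, ale D r t /\ ale D r (fst (y k)))).
  split; intros l; pose proof (epsilon_spec (inhabits (fun _ => B)) _ (HL l)) as [E1 E2]; auto.
Qed.
Lemma code_of u (O : nat -> nat * nat -> cond -> Prop) : (forall l v t, O l v t -> K u t t) ->
  exists y : code, (forall l k r, K u r (fst (y l k)) -> O l (snd (y l k)) (fst (y l k))) /\
    forall l v t, O l v t -> exists k r, K u r t /\ K u r (fst (y l k)).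
Proof.
  intros HV; destruct (code_gen (fun w => lt w u) O) as [y [Y1 Y2]].
  { apply down_lt. }
  { intros l v t H; apply K_eq; eauto. }
  exists y; split.
  - intros l k r Hr; destruct (Y1 l k) as [H|H]; auto; rewrite H in Hr; apply K_eq in Hr; destruct (badc_invalid _ _ Hr).
  - intros l v t H; destruct (Y2 l v t H) as [k [r [R1 R2]]]; exists k, r; split; apply K_eq; auto.
Qed.

(** * Deciding promised names, and dense sets *)

Definition yval u (y : code) l v t := exists k, K u t (fst (y l k)) /\ snd (y l k) = v.
(** The conditions of a code at a level need not be predense, so a level may also be decided by
    being left without a value. *)
Definition und u (y : code) l t := forall r k, K u r t -> ~ K u r (fst (y l k)).
Lemma yval_down u y l v t t' : K u t' t -> yval u y l v t -> yval u y l v t'.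
Proof. intros H [k [Hk Hv]]; exists k; split; auto; eapply K_trans; eauto. Qed.
Lemma und_down u y l t t' : K u t' t -> und u y l t -> und u y l t'.
Proof. intros H Hu r k Hr; apply Hu; eapply K_trans; eauto. Qed.
Lemma yval_unique u y l v v' t : oky (K u) y -> yval u y l v t -> yval u y l v' t -> v = v'.
Proof. intros Hy [k [Hk <-]] [k' [Hk' <-]]; apply (Hy t l k l k' Hk Hk'); auto. Qed.
Lemma K_valid u q p : K u q p -> K u q q.
Proof. rewrite !K_eq; apply ale_valid. Qed.

Lemma decide_list u (Ls : list (code * nat)) : forall t, K u t t -> exists t', K u t' t /\
  forall y l, In (y, l) Ls -> (exists v, yval u y l v t') \/ und u y l t'.
Proof.
  induction Ls as [|[y l] Ls IH]; intros t Ht; [exists t; split; auto; intros ? ? []|].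
  destruct (IH t Ht) as [t1 [Ht1 H1]]; pose proof (K_valid _ _ _ Ht1) as V1.
  assert (exists t2, K u t2 t1 /\ ((exists v, yval u y l v t2) \/ und u y l t2)) as [t2 [Ht2 H2]].
  { destruct (classic (und u y l t1)) as [H|H]; [exists t1; auto|].
    apply not_all_ex_not in H as [r H]; apply not_all_ex_not in H as [k H]; apply imply_to_and in H as [Hr H].
    exists r; split; auto; left; exists (snd (y l k)), k; split; auto; apply NNPP; auto. }
  exists t2; split; [eapply K_trans; eauto|]; intros y' l' [[= <- <-]|Hin]; auto.
  destruct (H1 y' l' Hin) as [[v Hv]|Hu]; [left; exists v; eapply yval_down; eauto|right; eapply und_down; eauto].
Qed.

Lemma dvals u l (Hs : list code) t : (forall y, In y Hs -> oky (K u) y) ->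
  (forall y, In y Hs -> (exists v, yval u y l v t) \/ und u y l t) ->
  exists F : list (nat * nat * nat), length F <= length Hs /\
    (forall l' a b, In (l', a, b) F -> l' = l /\ exists y, In y Hs /\ yval u y l (a, b) t) /\
    forall y r k, In y Hs -> K u r t -> K u r (fst (y l k)) -> In (l, fst (snd (y l k)), snd (snd (y l k))) F.
Proof.
  induction Hs as [|y Hs IH]; intros Hok Hd.
  { exists []; split; auto; split; [intros ? ? ? []|intros ? ? ? []]. }
  destruct IH as [F [F1 [F2 F3]]]; [intros; apply Hok; right; auto|intros; apply Hd; right; auto|].
  destruct (Hd y (or_introl eq_refl)) as [[[a b] Hv]|Hu].
  - exists ((l, a, b) :: F); split; [simpl; lia|split].
    + intros l' a' b' [[= <- <- <-]|H]; [split; auto; exists y; split; auto; left; auto|].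
      destruct (F2 l' a' b' H) as [H1 [z [Hz H2]]]; split; auto; exists z; split; auto; right; auto.
    + intros z r k [<-|Hz] Hr Hk; [left|right; apply (F3 z r k); auto].
      assert (He : (a, b) = snd (y l k)).
      { apply (yval_unique u y l _ _ r); [apply Hok; left; auto|exact (yval_down _ _ _ _ _ _ Hr Hv)|exists k; auto]. }
      rewrite <- He; auto.
  - exists F; split; [simpl; lia|split].
    + intros l' a' b' H; destruct (F2 l' a' b' H) as [H1 [z [Hz H2]]]; split; auto; exists z; split; auto; right; auto.
    + intros z r k [<-|Hz] Hr Hk; [destruct (Hu r k Hr Hk)|apply (F3 z r k); auto].
Qed.

Lemma count_triples (F : list (nat * nat * nat)) l a bs : NoDup bs -> (forall b, In b bs -> In (l, a, b) F) -> length bs <= length F.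
Proof.
  intros Hn Hi; rewrite <- (length_map (fun b => (l, a, b)) bs); apply NoDup_incl_length.
  - apply NoDup_map_NoDup_ForallPairs; auto. intros b b' _ _ [= ->]; auto.
  - intros e He; apply in_map_iff in He as [b [<- Hb]]; auto.
Qed.
Lemma bnd_level v F l a b : bnd v F -> In (l, a, b) F -> l < length v.
Proof.
  intros H Hi; destruct (le_lt_dec (length v) l) as [Hl|Hl]; auto; exfalso.
  assert (H1 : length [b] <= nth l v 0).
  { apply (H l a); [constructor; [intros []|constructor]|]; intros b' [<-|[]]; auto. }
  rewrite nth_overflow in H1 by auto; simpl in H1; lia.
Qed.

Definition leu u w := lt w u \/ w = u.
Lemma down_leu u : down (leu u). Proof. intros w v [H| ->] H'; left; eauto. Qed.
(** Built from [t] below [u] and from [p] above it, so that an extension found among the coordinates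
    below [u] becomes an extension of the whole condition. *)
Definition U3 u t y p := mkc (coh t) (fun w => if dec (lt w u) then co t w else if dec (w = u) then y else co p w).
Lemma lt_irr w : ~ lt w w.
Proof. induction w as [w IH] using (well_founded_induction wf); intros H; exact (IH w H H). Qed.
Lemma U3_lt u t y p w : lt w u -> co (U3 u t y p) w = co t w.
Proof. intros H; simpl; destruct (dec (lt w u)); tauto. Qed.
Lemma U3_eq u t y p : co (U3 u t y p) u = y.
Proof. simpl; destruct (dec (lt u u)) as [H|_]; [destruct (lt_irr _ H)|]; destruct (dec (u = u)); tauto. Qed.
Lemma U3_gt u t y p w : ~ leu u w -> co (U3 u t y p) w = co p w.
Proof. intros H; simpl; destruct (dec (lt w u)) as [H1|_]; [destruct H; left; auto|]; destruct (dec (w = u)); auto; destruct H; right; auto. Qed.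
Lemma fin_U3 u t y p : fin t -> fin p -> fin (U3 u t y p).
Proof.
  intros [H1 [L HL]] [_ [L' HL']]; split; [exact H1|]; exists (u :: L ++ L'); intros w Hw; simpl in *.
  destruct (dec (lt w u)); [right; apply in_or_app; auto|]; destruct (dec (w = u)); [left; auto|right; apply in_or_app; auto].
Qed.
Lemma U3_le u t y p x : fin p -> K u t x -> okitem (K u) y -> itemle (K u) t y (co x u) -> ale (leu u) (U3 u t y p) x.
Proof.
  intros Hp Ht Hy Hi; apply K_eq in Ht.
  assert (Hf : fin (U3 u t y p)) by (apply fin_U3; auto; apply Ht).
  assert (Ha : ale (fun w => lt w u) (U3 u t y p) x).
  { eapply ale_agree_l; [apply down_lt|exact Hf| | |exact Ht]; auto; intros w Hw; rewrite U3_lt; auto. }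
  split; auto; split; [apply Ha|]; intros w [Hw| ->]; [apply Ha; auto|].
  rewrite U3_eq; split; auto. eapply (itemle_agree TT); [apply down_TT|exact Logic.I| | |exact Hi]; auto.
  intros w Hw; rewrite U3_lt; auto.
Qed.
Lemma U3_top D u t y p : down D -> ale D p p -> K u t p -> okitem (K u) y -> itemle (K u) t y (co p u) -> ale D (U3 u t y p) p.
Proof.
  intros HD Hp Ht Hy Hi; assert (Ha : ale (leu u) (U3 u t y p) p) by (apply U3_le; auto; apply Hp).
  split; [apply Ha|split; [apply Ha|]]; intros w Hw; destruct (dec (leu u w)) as [H|H]; [apply Ha; auto|].
  rewrite U3_gt by auto; split; [apply Hp; auto|apply itemle_refl].
Qed.

(** Deciding all promised names at the next level, by a condition below [u], yields at most as many
    points as there are names; these points are added, and the number of names is the new bound. *)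
Lemma one_level p u : ale TT p p -> exists q, ale TT q p /\ length (iv (co q u)) = S (length (iv (co p u))).
Proof.
  intros Hp; set (x := co p u); set (l := length (iv x)).
  assert (Hx : okitem (K u) x) by (apply Hp; exact Logic.I).
  assert (Vp : K u p p) by (apply (ale_K TT); auto using down_TT; exact Logic.I).
  destruct (decide_list u (map (fun y => (y, l)) (iH x)) p Vp) as [t [Ht Hd]].
  destruct (dvals u l (iH x) t) as [F [F1 [F2 F3]]]; [apply Hx|intros y Hy; apply Hd, in_map_iff; eauto|].
  set (y := mki (iv x ++ [length (iH x)]) (iF x ++ F) (iH x)).
  exists (U3 u t y p); split; [|rewrite U3_eq; simpl; rewrite length_app; simpl; unfold l, x; lia].
  assert (Hnth : nth l (iv x ++ [length (iH x)]) 0 = length (iH x)) by (rewrite app_nth2, Nat.sub_diag; auto).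
  apply U3_top; auto using down_TT; split; simpl.
  - intros l' a bs Hn Hb; destruct (lt_eq_lt_dec l' l) as [[Hl| ->]|Hl].
    + rewrite app_nth1 by auto; apply (proj1 Hx l' a bs Hn); intros b Hb'; specialize (Hb b Hb').
      apply in_app_or in Hb as [Hb|Hb]; auto; apply F2 in Hb; lia.
    + rewrite Hnth; eapply Nat.le_trans; [|exact F1]; apply (count_triples F l a); auto; intros b Hb'; specialize (Hb b Hb').
      apply in_app_or in Hb as [Hb|Hb]; auto; apply (bnd_level _ _ _ _ _ (proj1 Hx)) in Hb; unfold l in Hb; lia.
    + destruct bs as [|b bs]; [simpl; lia|]; specialize (Hb b (or_introl eq_refl)).
      apply in_app_or in Hb as [Hb|Hb]; [apply (bnd_level _ _ _ _ _ (proj1 Hx)) in Hb; unfold l in *; lia|apply F2 in Hb; lia].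
  - apply Hx.
  - exists [length (iH x)]; auto.
  - split; [apply incl_appl, incl_refl|]; split; [apply incl_refl|]; split; auto.
    rewrite length_app; simpl; fold x; fold l; split.
    + intros l' Hl'; replace l' with l by lia; rewrite Hnth; auto.
    + intros z l' k r Hz Hl' Hr Hk; right; simpl; apply in_or_app; right.
      replace l' with l in * by lia; apply (F3 z r k); auto.
Qed.
Lemma levels_dense p u N : ale TT p p -> exists q, ale TT q p /\ N <= length (iv (co q u)).
Proof.
  intros Hp; induction N as [|N [q [Hq IH]]]; [exists p; split; auto; lia|].
  destruct (one_level q u) as [r [Hr Hl]]; [eapply ale_valid; eauto|].
  exists r; split; [eapply ale_trans; eauto using down_TT|lia].
Qed.

Definition setcoh i0 c p := mkc (fun i => if dec (i = i0) then c else coh p i) (co p).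
Lemma setcoh_le D i0 c p : down D -> ale D p p -> prefix (coh p i0) c -> ale D (setcoh i0 c p) p.
Proof.
  intros HD [[[L HL] H1] [_ H2]] Hc.
  split; [split; [exists (i0 :: L)|exact H1]|split].
  - intros i; simpl; destruct (dec (i = i0)) as [->|]; [left; auto|right; auto].
  - intros i; simpl; destruct (dec (i = i0)) as [->|]; auto using prefix_refl.
  - intros u Hu; split; [apply H2; auto|apply itemle_refl].
Qed.
Lemma cohen_dense p i N : ale TT p p -> exists q, ale TT q p /\ N <= length (coh q i).
Proof.
  intros Hp; exists (setcoh i (coh p i ++ repeat (0, 0) N) p); split.
  - apply setcoh_le; auto using down_TT; exists (repeat (0, 0) N); auto.
  - simpl; destruct (dec (i = i)); [|tauto]; rewrite length_app, repeat_length; lia.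
Qed.
Lemma add_name p u z : ale TT p p -> oky (K u) z -> exists q, ale TT q p /\ In z (iH (co q u)).
Proof.
  intros Hp Hz; set (x := co p u); exists (U3 u p (mki (iv x) (iF x) (z :: iH x)) p); split; [|rewrite U3_eq; left; auto].
  assert (Hx : okitem (K u) x) by (apply Hp; exact Logic.I).
  apply U3_top; auto using down_TT; [apply (ale_K TT); auto using down_TT; exact Logic.I|split; [apply Hx|]|].
  - intros y [<-|Hy]; auto; apply Hx; auto.
  - split; [apply prefix_refl|]; split; [apply incl_refl|]; split; [intros y Hy; right; auto|]; split; [simpl; auto|].
    simpl; split; [intros l' H'|intros z' l' k' r' _ H']; unfold x in H'; lia.
Qed.

(** The order [K u] says nothing about the coordinates from [u] on. If [s] is trivial there, erasing
    [r] from [u] on turns it into a genuine extension of [s]. *)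
Definition trunc u r : cond := mkc (coh r) (fun w => if dec (lt w u) then co r w else d0).
Lemma trunc_le u r s : K u r s -> (forall w, co s w <> d0 -> lt w u) -> ale TT (trunc u r) s.
Proof.
  intros H Hs; apply K_eq in H; destruct H as [[H1 [L H2]] [H3 H4]]; split; [split; [exact H1|]|split; [exact H3|]].
  - exists L; intros w Hw; simpl in Hw; destruct (dec (lt w u)); [auto|tauto].
  - intros w _; simpl; destruct (dec (lt w u)) as [Hw|Hw].
    + destruct (H4 w Hw) as [H5 H6]; split; auto; refine (itemle_agree (fun w => lt w u) w r (trunc u r) _ _ (down_lt u) Hw eq_refl _ H6).
      intros v Hv; simpl; destruct (dec (lt v u)); auto; exfalso; eauto.
    + assert (co s w = d0) as -> by (apply NNPP; auto). split; [apply okitem_d0|apply itemle_refl].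
Qed.

Ltac kt := match goal with
  | H1 : K ?u ?a ?b |- K ?u ?a ?b => exact H1
  | H1 : K ?u ?a ?c, H2 : K ?u ?c ?b |- K ?u ?a ?b => exact (K_trans _ _ _ _ H1 H2)
  | H1 : K ?u ?a ?c, H2 : K ?u ?c ?d, H3 : K ?u ?d ?b |- K ?u ?a ?b => exact (K_trans _ _ _ _ H1 (K_trans _ _ _ _ H2 H3)) end.

(* Below [s] it is dense that [A n] holds for arbitrarily large [n]. *)
Definition Pos (R : cond -> cond -> Prop) (A : nat -> cond -> Prop) (s : cond) :=
  forall s1 N, R s1 s -> exists s2 n, R s2 s1 /\ N <= n /\ A n s2.

(** * The limit item at one coordinate of the root *)

Section Limit.
Context (u : W) (q : nat -> cond) (Hq : forall n, ale TT (q n) (q n)).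
Context (v0 : list nat) (F0 : list (nat * nat * nat)) (m : nat).
Context (Hv0 : forall n, iv (co (q n) u) = v0) (HF0 : forall n, iF (co (q n) u) = F0) (Hm : forall n, length (iH (co (q n) u)) = m).
Local Notation R := (K u).
Local Notation P A s := (Pos (K u) A s).

Lemma Pos_down A s s' : P A s -> R s' s -> P A s'.
Proof. intros HA H s1 N H1; apply HA; eapply K_trans; eauto. Qed.
Lemma Pos_dense A s : (forall s1, R s1 s -> exists s2, R s2 s1 /\ P A s2) -> P A s.
Proof.
  intros H s1 N H1; destruct (H s1 H1) as [s2 [H2 HA]].
  destruct (HA s2 N (K_valid _ _ _ H2)) as [s3 [n [H3 [Hn Hs]]]]; exists s3, n; split; auto; eapply K_trans; eauto.
Qed.
Lemma Pos_mono A B s : (forall n t, R t s -> A n t -> exists t', R t' t /\ B n t') -> P A s -> P B s.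
Proof.
  intros H HA s1 N H1; destruct (HA s1 N H1) as [s2 [n [H2 [Hn Hs]]]].
  destruct (H n s2 (K_trans _ _ _ _ H2 H1) Hs) as [t [Ht HB]]; exists t, n; split; auto; eapply K_trans; eauto.
Qed.
(** As for infinite sets: where [B1] is positive nowhere, some stronger condition excludes it for
    all large [n], and the members of [A] found beyond belong to [B2]. *)
Lemma Pos_or A B1 B2 s : (forall n t, R t s -> A n t -> B1 n t \/ B2 n t) -> P A s -> (forall s', R s' s -> ~ P B1 s') -> P B2 s.
Proof.
  intros H HA HB s1 N H1.
  assert (Hn : ~ P B1 s1) by (apply HB; auto).
  apply not_all_ex_not in Hn as [s2 Hn]; apply not_all_ex_not in Hn as [N1 Hn]; apply imply_to_and in Hn as [H2 Hn].
  assert (H21 : R s2 s) by (eapply K_trans; eauto).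
  destruct (HA s2 (N + N1) H21) as [s3 [n [H3 [Hn3 Ha]]]].
  destruct (H n s3 (K_trans _ _ _ _ H3 H21) Ha) as [Hb|Hb].
  - destruct Hn; exists s3, n; split; auto; split; auto; lia.
  - exists s3, n; split; [eapply K_trans; eauto|split; auto; lia].
Qed.
Lemma Pos_split A (C : nat -> nat -> cond -> Prop) B s : R s s -> P A s -> (forall n t, R t s -> A n t -> exists b, b < B /\ C b n t) ->
  exists s' b, R s' s /\ P (C b) s'.
Proof.
  revert A; induction B as [|B IH]; intros A Hs HA HC.
  - destruct (HA s 0 Hs) as [t [n [Ht [_ Hn]]]]; destruct (HC n t Ht Hn) as [b [Hb _]]; lia.
  - apply NNPP; intros Hno; destruct (IH (fun n t => A n t /\ exists b, b < B /\ C b n t)) as [s' [b Hb]]; auto.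
    + apply (Pos_or A (C B)); auto.
      * intros n t Ht Ha; destruct (HC n t Ht Ha) as [b [Hb Hc]]; destruct (Nat.eq_dec b B) as [->|]; auto.
        right; split; auto; exists b; split; auto; lia.
      * intros s' Hs' Hp; apply Hno; eauto.
    + intros n t _ [_ H]; exact H.
    + apply Hno; eauto.
Qed.

Definition yv n j l v t := exists z, nth_error (iH (co (q n) u)) j = Some z /\ yval u z l v t.
Definition fibc (A : nat -> cond -> Prop) e c n t := A n t /\ yv n (snd (of_nat e)) (fst (of_nat e)) (of_nat c) t.
Definition fiba (A : nat -> cond -> Prop) e a n t := A n t /\ exists b, yv n (snd (of_nat e)) (fst (of_nat e)) (a, b) t.
Definition Rc A e c s := P (fibc A e c) s /\ forall c' s', c' < c -> R s' s -> ~ P (fibc A e c') s'.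
Definition Ra A e a s := (forall c s', R s' s -> ~ P (fibc A e c) s') /\ P (fiba A e a) s /\
  forall a' s', a' < a -> R s' s -> ~ P (fiba A e a') s'.
Definition Rn A e s := (forall c s', R s' s -> ~ P (fibc A e c) s') /\ (forall a s', R s' s -> ~ P (fiba A e a) s').
(* The pairs (level, number of a promised name) are treated one after the other, thinning out the [n]: at [e],
   either the values of the name agree on a positive set ([Rc]), or only their first coordinates do ([Ra]), or the first
   coordinates tend to infinity ([Rn]). Taking the least value or coordinate makes the choice unique. *)
Fixpoint At (e : nat) (n : nat) (t : cond) : Prop :=
  match e with
  | 0 => R t (q n)
  | S e => At e n t /\ ((exists c, Rc (At e) e c t /\ yv n (snd (of_nat e)) (fst (of_nat e)) (of_nat c) t) \/
      (exists a, Ra (At e) e a t /\ exists b, yv n (snd (of_nat e)) (fst (of_nat e)) (a, b) t) \/ Rn (At e) e t)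
  end.
Local Notation RC l j c s := (Rc (At (to_nat (l, j))) (to_nat (l, j)) c s).
Local Notation RA l j a s := (Ra (At (to_nat (l, j))) (to_nat (l, j)) a s).
Local Notation RN l j s := (Rn (At (to_nat (l, j))) (to_nat (l, j)) s).

Lemma yv_oky n j z : nth_error (iH (co (q n) u)) j = Some z -> oky R z.
Proof. intros H; apply (Hq n); [exact Logic.I|]; eapply nth_error_In; eauto. Qed.
Lemma yv_down n j l v t t' : yv n j l v t -> R t' t -> yv n j l v t'.
Proof. intros [z [Hz Hv]] H; exists z; split; auto; eapply yval_down; eauto. Qed.
Lemma yv_unique n j l v v' t : yv n j l v t -> yv n j l v' t -> v = v'.
Proof.
  intros [z [Hz Hv]] [z' [Hz' Hv']]; assert (z' = z) as -> by congruence.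
  eapply yval_unique; eauto using yv_oky.
Qed.
Lemma yv_adm n j l v l' v' t : yv n j l v t -> yv n j l' v' t -> Adm l v l' v'.
Proof.
  intros [z [Hz [k [Hk <-]]]] [z' [Hz' [k' [Hk' <-]]]]; assert (z' = z) as -> by congruence.
  apply (yv_oky _ _ _ Hz t l k l' k'); auto.
Qed.
Lemma Rc_down A e c s s' : Rc A e c s -> R s' s -> Rc A e c s'.
Proof. intros [H1 H2] H; split; [eapply Pos_down; eauto|]; intros c' t Hc Ht; apply H2; auto; eapply K_trans; eauto. Qed.
Lemma Ra_down A e c s s' : Ra A e c s -> R s' s -> Ra A e c s'.
Proof.
  intros [H0 [H1 H2]] H; split; [intros c' t Ht; apply H0; eapply K_trans; eauto|].
  split; [eapply Pos_down; eauto|]; intros c' t Hc Ht; apply H2; auto; eapply K_trans; eauto.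
Qed.
Lemma Rn_down A e s s' : Rn A e s -> R s' s -> Rn A e s'.
Proof. intros [H0 H1] H; split; intros c' t Ht; [apply H0|apply H1]; eapply K_trans; eauto. Qed.
Lemma Rc_unique A e c c' s : R s s -> Rc A e c s -> Rc A e c' s -> c = c'.
Proof.
  intros Hs [H1 H2] [H3 H4]; destruct (lt_eq_lt_dec c c') as [[H|H]|H]; auto; exfalso; [apply (H4 c s)|apply (H2 c' s)]; auto.
Qed.
Lemma Ra_unique A e c c' s : R s s -> Ra A e c s -> Ra A e c' s -> c = c'.
Proof.
  intros Hs [_ [H1 H2]] [_ [H3 H4]]; destruct (lt_eq_lt_dec c c') as [[H|H]|H]; auto; exfalso; [apply (H4 c s)|apply (H2 c' s)]; auto.
Qed.

Lemma least (Q : nat -> Prop) n : Q n -> exists k, Q k /\ forall i, i < k -> ~ Q i.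
Proof.
  induction n as [n IH] using lt_wf_ind; intros Hn.
  destruct (classic (exists i, i < n /\ Q i)) as [[i [Hi HQ]]|H]; [eauto|].
  exists n; split; auto; intros i Hi HQ; apply H; eauto.
Qed.

Lemma regions A e s : R s s -> exists s', R s' s /\ ((exists c, Rc A e c s') \/ (exists a, Ra A e a s') \/ Rn A e s').
Proof.
  intros Hs; destruct (classic (exists c s', R s' s /\ P (fibc A e c) s')) as [[c Hc]|Hc].
  - destruct (least (fun c => exists s', R s' s /\ P (fibc A e c) s') c Hc) as [c' [[s' [H1 H2]] H3]].
    exists s'; split; auto; left; exists c'; split; auto; intros c1 t H4 H5 H6; apply (H3 c1 H4); exists t; split; auto; eapply K_trans; eauto.
  - assert (Hn : forall c s', R s' s -> ~ P (fibc A e c) s') by (intros c t Ht Hp; apply Hc; eauto).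
    destruct (classic (exists a s', R s' s /\ P (fiba A e a) s')) as [[a Ha]|Ha].
    + destruct (least (fun a => exists s', R s' s /\ P (fiba A e a) s') a Ha) as [a' [[s' [H1 H2]] H3]].
      exists s'; split; auto; right; left; exists a'; split; [intros c t Ht; apply Hn; eapply K_trans; eauto|split; auto].
      intros c1 t H4 H5 H6; apply (H3 c1 H4); exists t; split; auto; eapply K_trans; eauto.
    + exists s; split; auto; right; right; split; auto. intros a t Ht Hp; apply Ha; eauto.
Qed.

Lemma At_down e : forall n t t', At e n t -> R t' t -> At e n t'.
Proof.
  induction e; cbn [At]; intros n t t'; [intros; eapply K_trans; eauto|].
  intros [H1 H2] Ht; split; [eapply IHe; eauto|]; destruct H2 as [[c [H2 H3]]|[[a [H2 [b H3]]]|H2]].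
  - left; exists c; split; [eapply Rc_down; eauto|eapply yv_down; eauto].
  - right; left; exists a; split; [eapply Ra_down; eauto|exists b; eapply yv_down; eauto].
  - right; right; eapply Rn_down; eauto.
Qed.
Lemma At_le e e' n t : e <= e' -> At e' n t -> At e n t.
Proof. induction 1; auto. intros [H1 _]; auto. Qed.

(** The three regions are dense. In the first two the part of [At e] that is retained is positive by
    the definition of the region, and in the third nothing is discarded. *)
Lemma At_pos e : forall s, P (At 0) s -> P (At e) s.
Proof.
  induction e; intros s Hs; auto; specialize (IHe s Hs); apply Pos_dense; intros s1 H1.
  destruct (regions (At e) e s1 (K_valid _ _ _ H1)) as [s2 [H2 Hr]]; exists s2; split; auto.
  destruct Hr as [[c Hc]|[[a Ha]|Hn]].
  - eapply Pos_mono; [|apply Hc]; intros n t Ht [Ht1 Ht2]; exists t; split; [eapply K_valid; eauto|].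
    split; auto; left; exists c; split; auto; eapply Rc_down; eauto.
  - eapply Pos_mono; [|apply Ha]; intros n t Ht [Ht1 Ht2]; exists t; split; [eapply K_valid; eauto|].
    split; auto; right; left; exists a; split; auto; eapply Ra_down; eauto.
  - eapply Pos_mono; [|eapply Pos_down; [exact IHe|eapply K_trans; eauto]]; intros n t Ht Ht1; exists t; split; [eapply K_valid; eauto|].
    split; auto; right; right; eapply Rn_down; eauto.
Qed.

Lemma At_c l j c e n t : R t t -> to_nat (l, j) < e -> At e n t -> RC l j c t -> yv n j l (of_nat c) t.
Proof.
  intros Ht He HA HC; apply (At_le (S (to_nat (l, j)))) in HA; [|lia]; destruct HA as [HA HR].
  rewrite cancel_of_to in HR; cbn [fst snd] in HR; destruct HR as [[c' [H1 H2]]|[[a [H1 _]]|H1]].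
  - rewrite (Rc_unique _ _ _ _ _ Ht HC H1); auto.
  - destruct (proj1 H1 c t Ht (proj1 HC)).
  - destruct (proj1 H1 c t Ht (proj1 HC)).
Qed.
Lemma At_a l j a e n t : R t t -> to_nat (l, j) < e -> At e n t -> RA l j a t -> exists b, yv n j l (a, b) t.
Proof.
  intros Ht He HA HC; apply (At_le (S (to_nat (l, j)))) in HA; [|lia]; destruct HA as [HA HR].
  rewrite cancel_of_to in HR; cbn [fst snd] in HR; destruct HR as [[c' [H1 H2]]|[[a' [H1 H2]]|H1]].
  - destruct (proj1 HC c' t Ht (proj1 H1)).
  - rewrite (Ra_unique _ _ _ _ _ Ht HC H1); auto.
  - destruct (proj2 H1 a t Ht (proj1 (proj2 HC))).
Qed.

(* Along a positive set with constant first coordinates at level [l], the second coordinates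
   cannot be bounded: otherwise some value would be attained positively often. *)
Lemma Ra_unbounded l j a s e (B : nat) : R s s -> to_nat (l, j) < e -> P (At e) s -> RA l j a s ->
  ~ (forall n t b, R t s -> At e n t -> yv n j l (a, b) t -> b < B).
Proof.
  intros Hs He HP HA HB.
  destruct (Pos_split (At e) (fun b => fibc (At (to_nat (l, j))) (to_nat (l, j)) (to_nat (a, b))) B s Hs HP) as [s' [b [H1 H2]]].
  - intros n t Ht Hat; assert (Vt := K_valid _ _ _ Ht).
    destruct (At_a l j a e n t Vt He Hat) as [b Hb]; [eapply Ra_down; eauto|].
    exists b; split; [eapply HB; eauto|]; split; [eapply At_le; [|eauto]; lia|].
    rewrite !cancel_of_to; auto.
  - apply (proj1 HA (to_nat (a, b)) s' H1 H2).
Qed.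

(** A constant first coordinate bounds the second coordinates at the same level, against
    [Ra_unbounded]. *)
Lemma no_bad_T1 s : (forall l x, Adm l x l x -> snd x <= fst x) -> P (At 0) s -> forall l j a s', R s' s -> ~ RA l j a s'.
Proof.
  intros HA HP l j a s' Hs' HR; assert (Vs := K_valid _ _ _ Hs').
  apply (Ra_unbounded l j a s' (S (to_nat (l, j))) (S a)); auto.
  - apply At_pos; eapply Pos_down; eauto.
  - intros n t b Ht _ Hy; pose proof (HA l (a, b) (yv_adm _ _ _ _ _ _ _ Hy Hy)); simpl in *; lia.
Qed.

(** For one name, two levels cannot both have constant first coordinates with unbounded second ones:
    the first coordinate at the later level would bound the second coordinates at the earlier. So
    below a suitable condition there is at most one such level. *)
Lemma bad_bound_T2 : (forall l x l' x', l < l' -> Adm l x l' x' -> snd x <= fst x') -> forall j s, R s s -> P (At 0) s ->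
  exists s' L B, R s' s /\ forall l a s'', R s'' s' -> RA l j a s'' -> l < L /\ a < B.
Proof.
  intros HA j s Hs HP; destruct (classic (exists l a s', R s' s /\ RA l j a s')) as [[l [a [s' [H1 H2]]]]|Hn].
  - exists s', (S l), (S a); split; auto; intros l' a' s'' H3 H4; assert (V := K_valid _ _ _ H3).
    assert (HPs : forall e, P (At e) s'') by (intros e; apply At_pos; eapply Pos_down; [exact HP|kt]).
    assert (H2' : RA l j a s'') by (eapply Ra_down; eauto).
    assert (Hno : forall l1 a1 l2 a2, RA l1 j a1 s'' -> RA l2 j a2 s'' -> ~ l1 < l2).
    { intros l1 a1 l2 a2 R1 R2 Hlt.
      apply (Ra_unbounded l1 j a1 s'' (S (to_nat (l1, j) + to_nat (l2, j))) (S a2)); auto; [lia|].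
      intros n t b Ht Hat Hy.
      assert (He2 : to_nat (l2, j) < S (to_nat (l1, j) + to_nat (l2, j))) by lia.
      destruct (At_a l2 j a2 _ n t (K_valid _ _ _ Ht) He2 Hat) as [b2 Hy2]; [eapply Ra_down; eauto|].
      pose proof (HA _ _ _ _ Hlt (yv_adm _ _ _ _ _ _ _ Hy Hy2)) as Hle; simpl in *; lia. }
    destruct (lt_eq_lt_dec l l') as [[H| ->]|H].
    + destruct (Hno _ _ _ _ H2' H4 H).
    + rewrite (Ra_unique _ _ _ _ _ V H4 H2'); lia.
    + destruct (Hno _ _ _ _ H4 H2' H).
  - exists s, 0, 0; split; auto; intros l a s'' H1 H2; destruct Hn; eauto.
Qed.

Lemma bad_bound_all : (forall l x l' x', l < l' -> Adm l x l' x' -> snd x <= fst x') -> forall J s, R s s -> P (At 0) s ->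
  exists s' L B, R s' s /\ forall l j a s'', j < J -> R s'' s' -> RA l j a s'' -> l < L /\ a < B.
Proof.
  intros HA; induction J; intros s Hs HP; [exists s, 0, 0; split; auto; intros; lia|].
  destruct (IHJ s Hs HP) as [s1 [L1 [B1 [H1 H2]]]].
  destruct (bad_bound_T2 HA J s1 (K_valid _ _ _ H1)) as [s2 [L2 [B2 [H3 H4]]]]; [eapply Pos_down; eauto|].
  exists s2, (L1 + L2), (B1 + B2); split; [kt|]; intros l j a s'' Hj Hs'' HR.
  destruct (Nat.eq_dec j J) as [->|].
  - destruct (H4 l a s'' Hs'' HR); lia.
  - destruct (H2 l j a s'' ltac:(lia) (K_trans _ _ _ _ Hs'' H3) HR); lia.
Qed.

Definition region l j s := (exists c, RC l j c s) \/ (exists a, RA l j a s) \/ RN l j s.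
Lemma region_down l j s s' : region l j s -> R s' s -> region l j s'.
Proof.
  intros [[c Hc]|[[a Ha]|Hn]] H; [left; exists c; eapply Rc_down; eauto|right; left; exists a; eapply Ra_down; eauto|right; right; eapply Rn_down; eauto].
Qed.
Lemma regions_list (TL : list (nat * nat)) : forall s, R s s -> exists s', R s' s /\ forall l j, In (l, j) TL -> region l j s'.
Proof.
  induction TL as [|[l j] TL IH]; intros s Hs; [exists s; split; auto; intros ? ? []|].
  destruct (IH s Hs) as [s1 [H1 H2]], (regions (At (to_nat (l, j))) (to_nat (l, j)) s1 (K_valid _ _ _ H1)) as [s2 [H3 H4]].
  exists s2; split; [kt|]; intros l' j' [[= <- <-]|H]; [exact H4|eapply region_down; eauto].
Qed.

(** The limit name takes at level [l] the value on which the names number [j] of the [q n] agree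
    positively often; where there is no such value it stays undefined. *)
Definition ylim_spec s0 j (y : code) :=
  (forall l k r, R r (fst (y l k)) -> R (fst (y l k)) s0 /\ exists c, RC l j c (fst (y l k)) /\ of_nat c = snd (y l k)) /\
  forall l c t, R t s0 -> RC l j c t -> exists k r, R r t /\ R r (fst (y l k)) /\ snd (y l k) = of_nat c.
Lemma ylim_ex s0 j : exists y, ylim_spec s0 j y.
Proof.
  destruct (code_of u (fun l v t => R t s0 /\ exists c, RC l j c t /\ of_nat c = v)) as [y [H1 H2]].
  { intros l v t [Ht _]; eapply K_valid; eauto. }
  exists y; split; [intros l k r Hr; exact (H1 l k r Hr)|].
  intros l c t Ht HR; destruct (H2 l (of_nat c) t) as [k [r [Hr1 Hr2]]]; [eauto|].
  exists k, r; split; auto; split; auto; destruct (H1 l k r Hr2) as [H3 [c' [H4 <-]]]; f_equal.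
  eapply Rc_unique; [eapply K_valid; exact Hr1|eapply Rc_down; [exact H4|exact Hr2]|eapply Rc_down; [exact HR|exact Hr1]].
Qed.
(** Any two compatible values of the limit name are, below some condition, values of a promised name
    of a single [q n], which is a legitimate code. *)
Lemma ylim_oky s0 j y : P (At 0) s0 -> ylim_spec s0 j y -> oky R y.
Proof.
  intros HP [H1 _] r l k l' k' Hr Hr'.
  destruct (H1 l k r Hr) as [Hs [c [Hc Ec]]], (H1 l' k' r Hr') as [_ [c' [Hc' Ec']]].
  assert (HPr : P (At (S (to_nat (l, j) + to_nat (l', j)))) r) by (apply At_pos; eapply Pos_down; [exact HP|kt]).
  destruct (HPr r 0 (K_valid _ _ _ Hr)) as [t [n [Ht [_ Hat]]]].
  assert (Y1 : yv n j l (of_nat c) t).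
  { eapply At_c; [eapply K_valid; eauto| |exact Hat|eapply Rc_down; [exact Hc|kt]]; lia. }
  assert (Y2 : yv n j l' (of_nat c') t).
  { eapply At_c; [eapply K_valid; eauto| |exact Hat|eapply Rc_down; [exact Hc'|kt]]; lia. }
  rewrite <- Ec, <- Ec'; split; [|eapply yv_adm; eauto].
  intros ->; eapply yv_unique; eauto.
Qed.

Context (s0 : cond) (HP0 : P (At 0) s0) (Vs0 : R s0 s0) (L B : nat).
Context (HL : length v0 <= L) (HBm : m <= B) (Hbad : forall l j a s, j < m -> R s s0 -> RA l j a s -> l < L /\ a < B).
Context (Hreg : forall l j, length v0 <= l < L -> j < m -> region l j s0).

Definition TL := list_prod (seq (length v0) (L - length v0)) (seq 0 m).
Definition Fnew : list (nat * nat * nat) := flat_map (fun lj =>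
  if dec (exists c, RC (fst lj) (snd lj) c s0)
  then [(fst lj, fst (of_nat (epsilon (inhabits 0) (fun c => RC (fst lj) (snd lj) c s0))),
         snd (of_nat (epsilon (inhabits 0) (fun c => RC (fst lj) (snd lj) c s0))))] else []) TL.
Definition yl j := epsilon (inhabits (fun _ _ => (badc, (0, 0)))) (ylim_spec s0 j).
(** The added levels up to [L] absorb the constant first coordinates, all of which are below [B]. On
    these levels the limit values are stored as points in [Fnew], since the limit names are promised
    only from [L] on. *)
Definition vstar := v0 ++ repeat B (L - length v0).
Definition lim_item := mki vstar (F0 ++ Fnew) (map yl (seq 0 m)).

Lemma yl_spec j : ylim_spec s0 j (yl j).
Proof. apply (epsilon_spec (inhabits (fun _ _ => (badc, (0, 0)))) (ylim_spec s0 j)), ylim_ex. Qed.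
Lemma vstar_len : length vstar = L.
Proof. unfold vstar; rewrite length_app, repeat_length; lia. Qed.
Lemma vstar_nth l : length v0 <= l < L -> nth l vstar 0 = B.
Proof.
  intros Hl; unfold vstar; rewrite app_nth2 by lia. rewrite (nth_indep _ 0 B) by (rewrite repeat_length; lia). apply nth_repeat.
Qed.
Lemma Fnew_in l a b : In (l, a, b) Fnew <-> exists j c, length v0 <= l < L /\ j < m /\ RC l j c s0 /\ of_nat c = (a, b).
Proof.
  unfold Fnew; rewrite in_flat_map; split.
  - intros [[l' j] [H1 H2]]; unfold TL in H1; apply in_prod_iff in H1 as [H1 H3]; apply in_seq in H1, H3; cbn [fst snd] in H2.
    destruct (dec _) as [H|H]; [|destruct H2]; destruct H2 as [[= -> <- <-]|[]].
    exists j, (epsilon (inhabits 0) (fun c => RC l j c s0)); split; [lia|split; [lia|split]].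
    + apply (epsilon_spec (inhabits 0) (fun c => RC l j c s0) H).
    + apply surjective_pairing.
  - intros [j [c [H1 [H2 [H3 H4]]]]]; exists (l, j); split; [apply in_prod_iff; rewrite !in_seq; lia|]; cbn [fst snd].
    destruct (dec _) as [H|H]; [|destruct H; eauto].
    pose proof (epsilon_spec (inhabits 0) (fun c => RC l j c s0) H) as H5.
    left; rewrite <- (Rc_unique _ _ _ _ _ Vs0 H3 H5), H4; reflexivity.
Qed.

(** On an added level each of the [m] promised names contributes at most one limit value, and [m] is
    at most [B]. *)
Lemma lim_item_ok : okitem R lim_item.
Proof.
  assert (HbF0 : bnd v0 F0) by (rewrite <- (Hv0 0), <- (HF0 0); apply (Hq 0); exact Logic.I).
  split; simpl.
  - intros l a bs Hn Hb.
    destruct (le_lt_dec (length v0) l) as [Hl|Hl].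
    + assert (Hb' : forall b, In b bs -> In (l, a, b) Fnew).
      { intros b Hb1; specialize (Hb b Hb1); apply in_app_or in Hb as [Hb|Hb]; auto.
        apply (bnd_level _ _ _ _ _ HbF0) in Hb; lia. }
      destruct (le_lt_dec L l) as [HLl|HLl].
      * destruct bs as [|b bs]; [simpl; lia|]; specialize (Hb' b (or_introl eq_refl)); apply Fnew_in in Hb' as [j [c [H _]]]; lia.
      * rewrite vstar_nth by lia; eapply Nat.le_trans; [|exact HBm].
        rewrite <- (length_seq m 0), <- (length_map (fun j => snd (of_nat (epsilon (inhabits 0) (fun c => RC l j c s0)))) (seq 0 m)).
        apply NoDup_incl_length; auto; intros b Hb1; apply Hb', Fnew_in in Hb1 as [j [c [_ [Hj [Hc He]]]]].
        apply in_map_iff; exists j; split; [|apply in_seq; lia].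
        assert (H5 : RC l j (epsilon (inhabits 0) (fun c => RC l j c s0)) s0) by (apply (epsilon_spec (inhabits 0) (fun c => RC l j c s0)); eauto).
        rewrite <- (Rc_unique _ _ _ _ _ Vs0 Hc H5), He; auto.
    + unfold vstar; rewrite app_nth1 by auto; apply (HbF0 l a bs Hn); intros b Hb1; specialize (Hb b Hb1).
      apply in_app_or in Hb as [Hb|Hb]; auto; apply Fnew_in in Hb as [j [c [H _]]]; lia.
  - intros y Hy; apply in_map_iff in Hy as [j [<- _]]; eapply ylim_oky; eauto using yl_spec.
Qed.

(** In the region [Rn] no first coordinate is taken positively often, so finitely many of them can
    be avoided one after the other by [Pos_or]. *)
Lemma avoid_list (CL : list (nat * nat * nat)) e s1 : R s1 s1 -> P (At e) s1 ->
  (forall l j a, In (l, j, a) CL -> to_nat (l, j) < e /\ RN l j s1) ->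
  P (fun n t => At e n t /\ forall l j a, In (l, j, a) CL -> forall t' b, R t' t -> ~ yv n j l (a, b) t') s1.
Proof.
  intros Hs HP; induction CL as [|[[l j] a] CL IH]; intros HCL.
  - eapply Pos_mono; [|exact HP]; intros n t Ht Hat; exists t; split; [eapply K_valid; eauto|]; split; auto; intros ? ? ? [].
  - destruct (HCL l j a (or_introl eq_refl)) as [He HN].
    apply (Pos_or _ (fun n t => At e n t /\ exists t' b, R t' t /\ yv n j l (a, b) t') _ s1) with (2 := IH (fun l j a H => HCL l j a (or_intror H))).
    + intros n t Ht [Hat Hno]; destruct (classic (exists t' b, R t' t /\ yv n j l (a, b) t')) as [H|H]; [left; auto|right].
      split; auto; intros l' j' a' [[= <- <- <-]|Hin] t' b Ht' Hy; [apply H; eauto|eapply Hno; eauto].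
    + intros s' Hs' HPs; apply (proj2 HN a s' Hs'); eapply Pos_mono; [|exact HPs].
      intros n t Ht [Hat [t' [b [Ht' Hy]]]]; exists t'; split; auto; split.
      * eapply At_down; [|exact Ht']; eapply At_le; [|exact Hat]; lia.
      * rewrite cancel_of_to; exists b; auto.
Qed.

(** To lie below [q n], a condition must capture the names promised by [q n] on all levels that [s]
    has beyond [v0]. A value that has a limit is captured by the limit name or stored in [Fnew]; one
    with constant first coordinate is below [B]; the others are added as new points, and [n] can be
    chosen so that their columns are still empty. *)
Lemma lim_step : forall s N, ale (leu u) s (U3 u s0 lim_item (mkc (coh s0) (fun _ => d0))) ->
  exists s' n, ale (leu u) s' s /\ N <= n /\ ale (leu u) s' (q n).
Proof.
  intros s N Hs; set (x := co s u).
  assert (Ks : R s s0).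
  { apply K_eq; eapply ale_agree_r; [| |eapply ale_sub; [|exact Hs]]; [reflexivity| |intros w Hw; left; auto].
    intros w Hw; apply U3_lt; auto. }
  assert (Hx : okitem R x /\ itemle R s x lim_item).
  { destruct Hs as [_ [_ Hs]]; destruct (Hs u (or_intror eq_refl)) as [H1 H2]; rewrite U3_eq in H2; auto. }
  destruct Hx as [Ox [X1 [X2 [X3 [X4 [X5 X6]]]]]].
  cbn [lim_item iv iF iH] in X1, X2, X3, X4, X5, X6; rewrite length_map, length_seq in X4, X5.
  rewrite vstar_len in X5, X6.
  assert (HLx : L <= length (iv x)) by (rewrite <- vstar_len; apply prefix_len, X1).
  set (TS := list_prod (seq (length v0) (length (iv x) - length v0)) (seq 0 m)).
  destruct (regions_list TS s (K_valid _ _ _ Ks)) as [s1 [Hs1 Hr1]].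
  assert (Vs1 := K_valid _ _ _ Hs1).
  assert (Ks1 : R s1 s0) by (kt).
  (* [e] exceeds the codes of all pairs of a level in question and a promised name, so at stage [e]
     all these pairs have been treated. *)
  set (e := S (list_max (map to_nat TS))).
  assert (He : forall l j, In (l, j) TS -> to_nat (l, j) < e).
  { intros l j Hin; unfold e; apply Nat.lt_succ_r.
    pose proof (proj1 (list_max_le (map to_nat TS) _) (Nat.le_refl _)) as HF; rewrite Forall_forall in HF; apply HF, in_map, Hin. }
  (* The columns to avoid: at a level of type [Rn], all first coordinates of points already present
     in [s]. *)
  set (CL := flat_map (fun lj => if dec (RN (fst lj) (snd lj) s1) then map (fun f => (fst lj, snd lj, snd (fst f))) (iF x) else []) TS).
  destruct (avoid_list CL e s1 Vs1) with (s1 := s1) (N := N) as [t [n [Ht [HN [Hat Hav]]]]]; auto.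
  { apply At_pos; eapply Pos_down; eauto. }
  { intros l j a Hin; unfold CL in Hin; apply in_flat_map in Hin as [[l' j'] [Hin1 Hin2]]; cbn [fst snd] in Hin2.
    destruct (dec _) as [H|H]; [|destruct Hin2]; apply in_map_iff in Hin2 as [f [[= -> -> <-] Hf]]; split; auto. }
  set (Hn := iH (co (q n) u)).
  assert (Hnm : length Hn = m) by apply Hm.
  assert (Okn : forall y, In y Hn -> oky R y) by (apply (Hq n); exact Logic.I).
  destruct (decide_list u (list_prod Hn (seq 0 (length (iv x)))) t (K_valid _ _ _ Ht)) as [t' [Ht' Hd]].
  assert (Ktq : R t' (q n)) by (eapply K_trans; [exact Ht'|]; exact (At_le 0 e n t ltac:(lia) Hat)).
  assert (Kt1 : R t' s1) by (kt).
  assert (HFL : forall l, exists F : list (nat * nat * nat), l < length (iv x) -> length F <= m /\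
    (forall l' a b, In (l', a, b) F -> l' = l /\ exists y, In y Hn /\ yval u y l (a, b) t') /\
    forall y r k, In y Hn -> K u r t' -> K u r (fst (y l k)) -> In (l, fst (snd (y l k)), snd (snd (y l k))) F).
  { intros l; destruct (le_lt_dec (length (iv x)) l) as [Hl|Hl]; [exists []; lia|].
    destruct (dvals u l Hn t') as [F HF]; auto.
    - intros y Hy; apply Hd, in_prod_iff; split; auto; apply in_seq; lia.
    - exists F; rewrite <- Hnm; auto. }
  set (FL := fun l => epsilon (inhabits []) (fun F : list (nat * nat * nat) => l < length (iv x) -> length F <= m /\
    (forall l' a b, In (l', a, b) F -> l' = l /\ exists y, In y Hn /\ yval u y l (a, b) t') /\
    forall y r k, In y Hn -> K u r t' -> K u r (fst (y l k)) -> In (l, fst (snd (y l k)), snd (snd (y l k))) F)).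
  assert (HFL' := fun l => epsilon_spec (inhabits []) _ (HFL l)); fold FL in HFL'; clear HFL.
  set (good := fun f : nat * nat * nat => Good (iv x) (iF x) (fst (fst f)) (snd (fst f), snd f)).
  (* The decided values of the promised names of [q n] that are not yet good. *)
  set (FF := flat_map (fun l => filter (fun f => if dec (good f) then false else true) (FL l)) (seq (length v0) (length (iv x) - length v0))).
  assert (HFF : forall l a b, In (l, a, b) FF -> length v0 <= l < length (iv x) /\ In (l, a, b) (FL l) /\ ~ Good (iv x) (iF x) l (a, b)).
  { intros l a b Hin; unfold FF in Hin; apply in_flat_map in Hin as [l' [H1 H2]]; apply in_seq in H1; apply filter_In in H2 as [H2 H3].
    destruct (dec (good (l, a, b))) as [Hg|Hg]; [discriminate|].
    destruct (proj1 (proj2 (HFL' l' ltac:(lia))) l a b H2) as [-> _]; split; [lia|split; auto]. }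
  (* A new triple can only come from a name whose first coordinates tend to infinity, so its node is fresh. *)
  assert (Hfresh : forall l a b, In (l, a, b) FF -> forall b', ~ In (l, a, b') (iF x)).
  { intros l a b Hin b' Hb'; destruct (HFF l a b Hin) as [Hl [Hin' Hng]].
    destruct (proj1 (proj2 (HFL' l ltac:(lia))) l a b Hin') as [_ [z [Hz Hyv]]].
    destruct (In_nth_error _ _ Hz) as [j Hj].
    assert (Hjm : j < m) by (rewrite <- Hnm; apply nth_error_Some; congruence).
    assert (Hy : yv n j l (a, b) t') by (exists z; auto).
    assert (HTS : In (l, j) TS) by (apply in_prod_iff; rewrite !in_seq; lia).
    destruct (Hr1 l j HTS) as [[c Hc]|[[a' Ha]|HN']].
    - assert (Hy' : yv n j l (of_nat c) t').
      { eapply yv_down; [|exact Ht']; eapply At_c; [eapply K_valid; eauto|apply He, HTS|exact Hat|eapply Rc_down; [exact Hc|exact Ht]]. }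
      pose proof (yv_unique _ _ _ _ _ _ Hy Hy') as Heq; apply Hng.
      destruct (le_lt_dec L l) as [HLl|HLl].
      + destruct (proj2 (yl_spec j) l c s1 Ks1 Hc) as [k [r [Kr1 [Kr2 Er]]]].
        rewrite Heq, <- Er; apply (X6 (yl j) l k r); auto; [apply in_map, in_seq; lia|lia|kt].
      + right; apply X2, in_or_app; right; apply Fnew_in.
        destruct (Hreg l j ltac:(lia) Hjm) as [[c' Hc']|[[a1 Ha1]|Hn1]].
        * exists j, c'; split; [lia|split; [lia|split; auto]].
          rewrite Heq, <- surjective_pairing; f_equal; eapply Rc_unique; [exact Vs1|eapply Rc_down; [exact Hc'|exact Ks1]|exact Hc].
        * destruct (proj1 Ha1 c s1 Ks1 (proj1 Hc)).
        * destruct (proj1 Hn1 c s1 Ks1 (proj1 Hc)).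
    - destruct (Hbad l j a' s1 Hjm Ks1 Ha) as [B1 B2]; apply Hng; left; cbn [fst].
      assert (exists b1, yv n j l (a', b1) t) as [b1 Hb1].
      { eapply At_a; [eapply K_valid; eauto|apply He, HTS|exact Hat|eapply Ra_down; [exact Ha|exact Ht]]. }
      pose proof (yv_unique _ _ _ _ _ _ Hy (yv_down _ _ _ _ _ _ Hb1 Ht')) as [= -> _].
      rewrite (prefix_nth _ _ _ _ X1) by (rewrite vstar_len; lia). rewrite vstar_nth by lia; auto.
    - apply (Hav l j a) with (t' := t') (b := b); auto; unfold CL; apply in_flat_map; exists (l, j); split; auto; cbn [fst snd].
      destruct (dec _) as [H|H]; [|tauto]; apply in_map_iff; exists (l, a, b'); auto. }
  set (y := mki (iv x) (iF x ++ FF) (iH x ++ Hn)).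
  assert (Oy : okitem R y).
  { split; simpl.
    (* A column receiving a new point was empty before, so it gets at most [m] points, for which
       every level beyond [v0] has room. *)
    - intros l a bs Hnd Hb; destruct (classic (exists b, In (l, a, b) FF)) as [[b Hbb]|Hno].
      + destruct (HFF l a b Hbb) as [Hl [_ _]].
        assert (Hml : m <= nth l (iv x) 0).
        { destruct (le_lt_dec L l); [apply X5; lia|]. rewrite (prefix_nth _ _ _ _ X1) by (rewrite vstar_len; lia). rewrite vstar_nth by lia; auto. }
        eapply Nat.le_trans; [|exact Hml]; eapply Nat.le_trans; [|exact (proj1 (HFL' l ltac:(lia)))].
        apply (count_triples (FL l) l a); auto; intros b' Hb'; specialize (Hb b' Hb'); apply in_app_or in Hb as [Hb|Hb].
        * destruct (Hfresh l a b Hbb b' Hb).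
        * apply HFF in Hb; tauto.
      + apply (proj1 Ox l a bs Hnd); intros b Hb1; specialize (Hb b Hb1); apply in_app_or in Hb as [Hb|Hb]; auto; destruct Hno; eauto.
    - intros z Hz; apply in_app_or in Hz as [Hz|Hz]; auto; apply Ox; auto. }
  assert (Kts : R t' s) by (kt).
  exists (U3 u t' y s), n; split; [|split; auto].
  - apply U3_le; auto; [apply Hs|]; fold x.
    split; [apply prefix_refl|]; split; [apply incl_appl, incl_refl|]; split; [apply incl_appl, incl_refl|].
    simpl; rewrite length_app; split; [lia|]; split; intros; lia.
  - apply U3_le; auto; [apply Hs|]; unfold itemle; rewrite Hv0, HF0; fold Hn; rewrite Hnm; simpl.
    split; [eapply prefix_trans; [|exact X1]; exists (repeat B (L - length v0)); auto|].
    split; [apply incl_appl; eapply incl_tran; [|exact X2]; apply incl_appl, incl_refl|].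
    split; [apply incl_appr, incl_refl|]; split; [rewrite length_app; lia|]; split.
    + intros l Hl; destruct (le_lt_dec L l); [apply X5; lia|]. rewrite (prefix_nth _ _ _ _ X1) by (rewrite vstar_len; lia). rewrite vstar_nth by lia; auto.
    + intros z l k r Hz Hl Hr Hk.
      pose proof (proj2 (proj2 (HFL' l ltac:(lia))) z r k Hz Hr Hk) as Hin.
      destruct (classic (Good (iv x) (iF x) l (snd (z l k)))) as [[Hg|Hg]|Hg]; [left; auto|right; apply in_or_app; auto|].
      right; apply in_or_app; right; unfold FF; apply in_flat_map; exists l; split; [apply in_seq; lia|].
      apply filter_In; split; auto; destruct (dec (good _)) as [H|H]; auto; destruct Hg; unfold good in H; cbn [fst snd] in H;
      rewrite <- surjective_pairing in H; auto.
Qed.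
End Limit.

(** * The limit of a sequence of conditions with a common root *)

Section LimitTheorem.
Context (q : nat -> cond) (Hq : forall n, ale TT (q n) (q n)) (RI : list I) (RW : list W).
Context (h1 : forall n i, In i RI -> coh (q n) i = coh (q 0) i).
Context (h2 : forall n w, In w RW -> iv (co (q n) w) = iv (co (q 0) w) /\ iF (co (q n) w) = iF (co (q 0) w) /\
  length (iH (co (q n) w)) = length (iH (co (q 0) w))).
Context (h3 : forall s, fin s -> exists N, forall n, N <= n ->
  (forall i, coh s i <> [] -> coh (q n) i = [] \/ In i RI) /\ (forall w, co s w <> d0 -> co (q n) w = d0 \/ In w RW)).

Definition T1 := forall l x, Adm l x l x -> snd x <= fst x.
Definition T2 := forall l x l' x', l < l' -> Adm l x l' x' -> snd x <= fst x'.

Definition PosD (D : W -> Prop) s0 := forall s N, ale D s s0 -> exists s' n, ale D s' s /\ N <= n /\ ale D s' (q n).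
(** Such a limit has the stems of the sequence on the root and is trivial off it, so a sequence of
    these limits again has a common root. *)
Definition small (D : W -> Prop) s0 := (forall i, coh s0 i = if dec (In i RI) then coh (q 0) i else []) /\
  forall w, (co s0 w <> d0 -> D w /\ In w RW) /\
    (D w -> In w RW -> iv (co s0 w) = iv (co (q 0) w) /\ iF (co s0 w) = iF (co (q 0) w) /\
       length (iH (co s0 w)) = length (iH (co (q 0) w))).

Lemma TT_sub D s p : ale TT s p -> ale D s p.
Proof. apply ale_sub; intros; exact Logic.I. Qed.

(** Off the root, the late [q n] are trivial wherever [s] is not, so an extension found on [D] is
    completed by uniting the items on the rest of [D']. *)
Lemma gap (D D' : W -> Prop) s0 : down D -> down D' -> (forall w, D w -> D' w) -> (forall w, D' w -> In w RW -> D w) ->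
  PosD D s0 -> PosD D' s0.
Proof.
  intros HD HD' Hs Hr HP s N Hsq; destruct (h3 s (proj1 Hsq)) as [N1 HN1].
  destruct (HP s (N + N1) (ale_sub _ _ _ _ Hs Hsq)) as [s2 [n [H1 [H2 H3]]]].
  destruct (mrg_spec D D' s2 s (q n)) as [M1 M2]; auto.
  - eapply ale_valid; eauto.
  - apply TT_sub, Hq.
  - intros w Hw Hn; destruct (dec (co s w = d0)) as [|He]; [left; auto|].
    destruct (proj2 (HN1 n ltac:(lia)) w He) as [|Hin]; [right; left; auto|destruct Hn; auto].
  - exists (mrg D s2 s (q n)), n; split; auto; split; auto; lia.
Qed.

Definition root0 := mkc (fun i => if dec (In i RI) then coh (q 0) i else []) (fun _ => d0).
Lemma root0_valid : ale TT root0 root0.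
Proof.
  split; [split; [exists RI|exists []; simpl; tauto]|split; [intros; apply prefix_refl|intros u _; split; [apply okitem_d0|apply itemle_refl]]].
  intros i; simpl; destruct (dec (In i RI)); tauto.
Qed.
Lemma root0_pos : PosD NO root0.
Proof.
  intros s N Hs; destruct (h3 s (proj1 Hs)) as [N1 HN1]; exists (base s (q (N + N1))), (N + N1).
  destruct (base_spec s (q (N + N1))) as [B1 B2]; [apply Hs|apply (Hq (N + N1))| |split; auto; split; auto; lia].
  intros i; destruct (coh s i) as [|a l] eqn:E; simpl; [split; [apply prefix_nil|apply prefix_refl]|split; [apply prefix_refl|]].
  rewrite <- E; destruct (proj1 (HN1 (N + N1) ltac:(lia)) i) as [He|Hin]; [congruence|rewrite He; apply prefix_nil|].
  rewrite (h1 _ i Hin); destruct Hs as [_ [Hs _]]; specialize (Hs i); simpl in Hs; destruct (dec (In i RI)); tauto.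
Qed.

Lemma U3_valid u s y : K u s s -> okitem (K u) y -> ale TT (U3 u s y (mkc (coh s) (fun _ => d0))) (U3 u s y (mkc (coh s) (fun _ => d0))).
Proof.
  intros Hs Hy; apply K_eq in Hs; split; [|split; [intros; apply prefix_refl|]].
  - apply fin_U3; [apply Hs|]; split; [apply Hs|exists []; simpl; tauto].
  - intros w _; split; [|apply itemle_refl]; simpl; destruct (dec (lt w u)); [apply Hs; auto|].
    destruct (dec (w = u)) as [->|]; [auto|apply okitem_d0].
Qed.

Lemma max_elem (L : list W) (D : W -> Prop) : (exists w, In w L /\ D w) ->
  exists u, In u L /\ D u /\ forall w, In w L -> D w -> leu u w.
Proof.
  induction L as [|a L IH]; intros [w [Hw HD]]; [destruct Hw|].
  destruct (classic (exists w, In w L /\ D w)) as [H|H].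
  - destruct (IH H) as [u [H4 [H5 H6]]]; destruct (classic (D a)) as [Ha|Ha].
    + destruct (tri a u) as [Hl|[Hl|Hl]].
      * exists u; split; [right; auto|split; auto]; intros v [<-|Hv] Hd; [left|]; auto.
      * subst; exists u; split; [left; auto|split; auto]; intros v [<-|Hv] Hd; [right|]; auto.
      * exists a; split; [left; auto|split; auto]; intros v [<-|Hv] Hd; [right; auto|left].
        destruct (H6 v Hv Hd) as [H7| ->]; eauto.
    + exists u; split; [right; auto|split; auto]; intros v [<-|Hv] Hd; [tauto|auto].
  - exists a; destruct Hw as [<-|Hw]; [|destruct H; eauto].
    split; [left; auto|split; auto]; intros v [<-|Hv] Hd; [right; auto|destruct H; eauto].
Qed.

(** Induction on the number of root coordinates in [D]. With [u] the last of them, a limit exists on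
    the coordinates below [u], [lim_step] adds [u], and [gap] reaches the rest of [D], where there
    is no root. *)
Lemma limit_aux (HT : T1 \/ T2) n : forall D L, down D -> (forall w, D w -> In w RW -> In w L) -> length L <= n ->
  exists s0, ale TT s0 s0 /\ PosD D s0 /\ (T1 -> small D s0).
Proof.
  induction n as [n IH] using lt_wf_ind; intros D Ls HD HLs Hn.
  destruct (classic (exists w, In w RW /\ D w)) as [Hex|Hno].
  2:{ exists root0; split; [apply root0_valid|split].
      - apply (gap NO D); auto using down_NO, root0_pos; [intros w []|intros w H1 H2; apply Hno; eauto].
      - intros _; split; [reflexivity|]; intros w; split; [simpl; tauto|]; intros H1 H2; destruct Hno; eauto. }
  destruct (max_elem RW D Hex) as [u [Hu [Du Hmax]]].
  assert (HuL : In u Ls) by auto.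
  pose proof (remove_length_lt (fun a b => dec (a = b)) Ls u HuL) as Hlen.
  destruct (IH (length (remove (fun a b => dec (a = b)) u Ls)) ltac:(lia) (fun w => lt w u) (remove (fun a b => dec (a = b)) u Ls)) as [s1 [V1 [P1 S1]]]; auto.
  { apply down_lt. }
  { intros w Hw Hin; apply in_in_remove; [intros ->; exact (lt_irr _ Hw)|]; apply HLs; eauto. }
  set (v0 := iv (co (q 0) u)); set (F0 := iF (co (q 0) u)); set (m := length (iH (co (q 0) u))).
  assert (Hv0 : forall k, iv (co (q k) u) = v0) by (intros k; apply h2; auto).
  assert (HF0 : forall k, iF (co (q k) u) = F0) by (intros k; apply h2; auto).
  assert (Hm : forall k, length (iH (co (q k) u)) = m) by (intros k; apply h2; auto).
  assert (VK1 : K u s1 s1) by (apply K_eq, TT_sub, V1).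
  assert (HP1 : Pos (K u) (At u q 0) s1).
  { intros s N Hs; apply K_eq in Hs; destruct (P1 s N Hs) as [s' [k [A1 [A2 A3]]]]; exists s', k; split; [apply K_eq; auto|].
    split; auto; apply K_eq; auto. }
  (* Under [T1] there are no constant first coordinates to absorb, so no level is added. Under [T2]
     the levels where they occur are bounded by [L], and the condition is strengthened to settle the
     region of every earlier level. *)
  assert (Hfin : exists s0 L B, K u s0 s1 /\ (T1 -> s0 = s1 /\ L = length v0) /\ length v0 <= L /\ m <= B /\
    (forall l j a s, j < m -> K u s s0 -> Ra u q (At u q (to_nat (l, j))) (to_nat (l, j)) a s -> l < L /\ a < B) /\
    (forall l j, length v0 <= l < L -> j < m -> region u q l j s0)).
  { destruct (classic T1) as [Ht|Ht].
    - exists s1, (length v0), m; split; auto; split; auto; split; auto; split; auto; split; [|intros; lia].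
      intros l j a s _ Hs HR; exfalso; revert HR; eapply no_bad_T1; eauto.
    - destruct HT as [HT|HT]; [tauto|].
      destruct (bad_bound_all u q Hq HT m s1 VK1 HP1) as [s2 [L [B [H4 H5]]]].
      destruct (regions_list u q (list_prod (seq (length v0) L) (seq 0 m)) s2 (K_valid _ _ _ H4)) as [s3 [H6 H7]].
      exists s3, (length v0 + L), (m + B); split; [kt|]; split; [tauto|]; split; [lia|]; split; [lia|]; split.
      + intros l j a s Hj Hs HR; destruct (H5 l j a s Hj ltac:(kt) HR); lia.
      + intros l j Hl Hj; apply H7, in_prod_iff; rewrite !in_seq; lia. }
  destruct Hfin as [s0 [L [B [K1 [T1s [HL [HB [Hbad Hreg]]]]]]]].
  assert (HP0 : Pos (K u) (At u q 0) s0) by (eapply Pos_down; eauto).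
  assert (Vs0 : K u s0 s0) by (eapply K_valid; eauto).
  set (it := lim_item u q v0 F0 m s0 L B).
  exists (U3 u s0 it (mkc (coh s0) (fun _ => d0))); split; [|split].
  - apply U3_valid; auto; eapply lim_item_ok; eauto.
  - apply (gap (leu u) D); auto using down_leu.
    + intros w [Hw| ->]; eauto.
    + intros s N Hs; eapply lim_step; eauto.
  - intros Ht; destruct (T1s Ht) as [-> ->]; destruct (S1 Ht) as [S2 S3]; split; [exact S2|].
    assert (Hit : iv it = v0 /\ iF it = F0 /\ length (iH it) = m).
    { unfold it, lim_item, vstar, Fnew, TL; simpl; rewrite Nat.sub_diag; simpl; rewrite !app_nil_r, length_map, length_seq; auto. }
    intros w; destruct (classic (lt w u)) as [Hw|Hw].
    + rewrite U3_lt by auto; split; [intros Hne; split; [eauto|apply S3; auto]|intros _ Hr; apply S3; auto].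
    + destruct (dec (w = u)) as [->|Hne]; [rewrite U3_eq; split; auto|].
      assert (~ leu u w) by (intros [|]; auto).
      rewrite U3_gt by auto; simpl; split; [tauto|]; intros Hd Hr; destruct H; auto.
Qed.

(* Under [T1] no bound has to be raised, so the limit keeps the common root of the sequence. *)
Theorem limit (HT : T1 \/ T2) : exists s0, ale TT s0 s0 /\ PosD TT s0 /\ (T1 -> small TT s0).
Proof. apply (limit_aux HT (length RW) TT RW); auto using down_TT. Qed.
End LimitTheorem.

(** * Systems of conditions for infinitely many Cohen reals *)

Section UncountableSystems.
Context {A : Type} (HA : forall g : I -> A, exists t, ~ countable (fun i => g i = t)).

Definition lI (R : list (I + W)) : list I := flat_map (fun z => match z with inl i => [i] | inr _ => [] end) R.
Definition lW (R : list (I + W)) : list W := flat_map (fun z => match z with inl _ => [] | inr w => [w] end) R.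
Lemma lI_in R i : In i (lI R) <-> In (inl i) R.
Proof.
  unfold lI; rewrite in_flat_map; split; [intros [[j|w] [H1 H2]]; simpl in H2; [destruct H2 as [->|[]]; auto|destruct H2]|].
  intros H; exists (inl i); split; auto; left; auto.
Qed.
Lemma lW_in R w : In w (lW R) <-> In (inr w) R.
Proof.
  unfold lW; rewrite in_flat_map; split; [intros [[j|v] [H1 H2]]; simpl in H2; [destruct H2|destruct H2 as [->|[]]; auto]|].
  intros H; exists (inr w); split; auto; left; auto.
Qed.

Record system (R : list (I + W)) (s : list (nat * nat)) (x : nat -> I) (p : nat -> cond) : Prop := {
  s_valid : forall n, ale TT (p n) (p n);
  s_stem : forall n, coh (p n) (x n) = s;
  s_inj : forall n m, x n = x m -> n = m;
  s_off : forall n, ~ In (inl (x n)) R;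
  s_disj : forall n m z, n <> m -> (inl (x n) = z \/ nontriv (p n) z) -> (inl (x m) = z \/ nontriv (p m) z) -> In z R;
  s_root : forall n m z, In z R -> stem (p n) z = stem (p m) z }.

(** A condition, an index [t] and a place [m] are chosen for each Cohen coordinate. By [HA]
    uncountably many choices agree in [t], and of these uncountably many agree in [m] and in the
    stem at their own coordinate; a Delta-system is taken among them. *)
Lemma extraction (Q : I -> A -> nat -> cond -> Prop) :
  (forall i t m p q, Q i t m p -> ale TT q p -> Q i t m q) ->
  (forall i, exists p t m, ale TT p p /\ Q i t m p) ->
  exists t m R s x p, m <= length s /\ system R s x p /\ forall n, Q (x n) t m (p n).
Proof.
  intros Hmono HQ.
  assert (HQ' : forall i, exists c : cond * A * nat, ale TT (fst (fst c)) (fst (fst c)) /\ Q i (snd (fst c)) (snd c) (fst (fst c)) /\ snd c <= length (coh (fst (fst c)) i)).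
  { intros i; destruct (HQ i) as [p [t [m [Hp H]]]]; destruct (cohen_dense p i m Hp) as [q [Hq Hl]].
    exists (q, t, m); split; [eapply ale_valid; eauto|split; eauto]. }
  assert (exists c : I -> cond * A * nat, forall i, ale TT (fst (fst (c i))) (fst (fst (c i))) /\ Q i (snd (fst (c i))) (snd (c i)) (fst (fst (c i))) /\ snd (c i) <= length (coh (fst (fst (c i))) i)) as [c Hc].
  { destruct (HI []) as [i0 _]; destruct (HQ' i0) as [c0 _].
    exists (fun i => epsilon (inhabits c0) (fun c => ale TT (fst (fst c)) (fst (fst c)) /\ Q i (snd (fst c)) (snd c) (fst (fst c)) /\ snd c <= length (coh (fst (fst c)) i))).
    intros i; exact (epsilon_spec (inhabits c0) _ (HQ' i)). }
  destruct (HA (fun i => snd (fst (c i)))) as [t Ht].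
  destruct (uncountable_fiber _ (fun i => (snd (c i), coh (fst (fst (c i))) i)) ltac:(auto 10) Ht) as [[m s] Hms].
  destruct (delta_conds _ (fun i => fst (fst (c i))) (fun i => [inl i]) Hms) as [R [x [H1 [H2 [H3 H4]]]]]; [intros i _; apply Hc|].
  (* Dropping finitely many members keeps the coordinates [x n] out of the root, so that their stems
     can be extended independently. *)
  destruct (inj_avoid x (lI R) H2) as [N HN].
  assert (Hx : forall n, snd (fst (c (x n))) = t /\ snd (c (x n)) = m /\ coh (fst (fst (c (x n)))) (x n) = s).
  { intros n; destruct (H1 n) as [E1 E2]; injection E2 as E2 E3; auto. }
  exists t, m, R, s, (fun n => x (N + n)), (fun n => fst (fst (c (x (N + n))))); split; [|split; [constructor|]].
  - destruct (Hx 0) as [E1 [E2 E3]]; rewrite <- E2, <- E3; apply Hc.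
  - intros n; apply Hc.
  - intros n; apply Hx.
  - intros n k H; apply H2 in H; lia.
  - intros n H; apply lI_in in H; exact (HN (N + n) ltac:(lia) H).
  - intros n k z Hnk Hn Hk; apply (H3 (N + n) (N + k)); [lia| |].
    + destruct Hn as [<-|Hn]; [left; left; auto|right; auto].
    + destruct Hk as [<-|Hk]; [left; left; auto|right; auto].
  - intros n k z Hz; apply H4, Hz.
  - intros n; destruct (Hx (N + n)) as [E1 [E2 E3]]; rewrite <- E1, <- E2; apply Hc.
Qed.

Section Amalgams.
Context (R : list (I + W)) (s : list (nat * nat)) (x : nat -> I) (p : nat -> cond) (HS : system R s x p).
Definition md n (e : list (nat * nat)) := setcoh (x n) (s ++ e) (p n).
Lemma md_le n e : ale TT (md n e) (p n).
Proof. apply setcoh_le; [apply down_TT|apply HS|]. rewrite (s_stem _ _ _ _ HS); exists e; auto. Qed.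
Lemma md_valid n e : ale TT (md n e) (md n e).
Proof. eapply ale_valid, md_le. Qed.
Lemma md_coh n e : coh (md n e) (x n) = s ++ e.
Proof. simpl; destruct (dec (x n = x n)); tauto. Qed.
Lemma md_nontriv n e z : nontriv (md n e) z -> inl (x n) = z \/ nontriv (p n) z.
Proof. destruct z as [i|w]; simpl; auto; destruct (dec (i = x n)) as [->|]; auto. Qed.
Lemma md_root n e z : In z R -> stem (md n e) z = stem (p n) z.
Proof.
  destruct z as [i|w]; simpl; auto; destruct (dec (i = x n)) as [->|]; auto.
  intros H; destruct (s_off _ _ _ _ HS n H).
Qed.
Lemma md_SC n m e e' : n <> m -> SC TT (md n e) (md m e').
Proof.
  intros H; apply stem_SC; intros z Hz Hz'; apply md_nontriv in Hz, Hz'.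
  assert (Hin : In z R) by (eapply (s_disj _ _ _ _ HS); eauto).
  rewrite !md_root by auto; apply (s_root _ _ _ _ HS); auto.
Qed.

(** Extending the stems at coordinates off the root leaves the members equal on the root and
    disjoint elsewhere, so they are united in pairs and then the pairs are united. *)
Lemma amalgam4 e0 e1 e2 e3 : exists q, ale TT q (md 0 e0) /\ ale TT q (md 1 e1) /\ ale TT q (md 2 e2) /\ ale TT q (md 3 e3).
Proof.
  destruct (mg_spec TT (md 0 e0) (md 1 e1)) as [A1 A2]; auto using down_TT, md_valid, md_SC.
  destruct (mg_spec TT (md 2 e2) (md 3 e3)) as [A3 A4]; auto using down_TT, md_valid, md_SC.
  assert (V : forall a b, ale TT a b -> ale TT a a) by (intros a b; apply ale_valid).
  destruct (mg_spec TT (mg (md 0 e0) (md 1 e1)) (mg (md 2 e2) (md 3 e3))) as [A5 A6]; eauto using down_TT.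
  - apply SC_mg; apply SC_sym, SC_mg; apply md_SC; auto.
  - exists (mg (mg (md 0 e0) (md 1 e1)) (mg (md 2 e2) (md 3 e3))).
    split; [exact (ale_trans _ _ _ _ down_TT A5 A1)|split; [exact (ale_trans _ _ _ _ down_TT A5 A2)|split]].
    + exact (ale_trans _ _ _ _ down_TT A6 A3).
    + exact (ale_trans _ _ _ _ down_TT A6 A4).
Qed.

Lemma off_root (L : list (I + W)) : exists N, forall n z, N <= n -> In z L -> (inl (x n) = z \/ nontriv (p n) z) -> In z R.
Proof.
  induction L as [|z L [N HN]]; [exists 0; intros ? ? _ []|].
  destruct (classic (exists n, inl (x n) = z \/ nontriv (p n) z)) as [[k Hk]|Hk].
  - exists (S (N + k)); intros n z' Hn [<-|Hz] Ht; [|apply (HN n); auto; lia].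
    apply (s_disj _ _ _ _ HS k n); auto; lia.
  - exists N; intros n z' Hn [<-|Hz] Ht; [destruct Hk; eauto|apply (HN n); auto].
Qed.

Lemma limit_md (f : nat -> nat) (e : nat -> list (nat * nat)) : (forall k, k <= f k) -> T1 \/ T2 ->
  exists q, ale TT q q /\ PosD (fun k => md (f k) (e k)) TT q /\ (T1 -> small (fun _ => p 0) (lI R) (lW R) TT q).
Proof.
  intros Hf HT.
  unshelve epose proof (limit (fun k => md (f k) (e k)) (fun k => md_valid _ _) (lI R) (lW R) _ _ _ HT) as [q [Q1 [Q2 Q3]]].
  - intros n i Hi; apply lI_in in Hi.
    pose proof (md_root (f n) (e n) _ Hi) as E1; pose proof (md_root (f 0) (e 0) _ Hi) as E2.
    pose proof (s_root _ _ _ _ HS (f n) (f 0) _ Hi) as E3; rewrite <- E1, <- E2 in E3; injection E3; auto.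
  - intros n w Hi; apply lW_in in Hi; pose proof (s_root _ _ _ _ HS (f n) (f 0) _ Hi) as E3; injection E3; auto.
  - intros t Ht; destruct (fin_supp t Ht) as [L HL]; destruct (off_root L) as [N HN]; exists N; intros n Hn; split.
    + intros i Hi; destruct (dec (coh (md (f n) (e n)) i = [])) as [|Hne]; auto; right; apply lI_in.
      apply (HN (f n)); [specialize (Hf n); lia|apply HL; exact Hi|eapply (md_nontriv _ _ (inl i)); exact Hne].
    + intros i Hi; destruct (dec (co (md (f n) (e n)) i = d0)) as [|Hne]; auto; right; apply lW_in.
      apply (HN (f n)); [specialize (Hf n); lia|apply HL; exact Hi|eapply (md_nontriv _ _ (inr i)); exact Hne].
  - exists q; split; auto; split; auto; intros Ht; destruct (Q3 Ht) as [S1 S2]; split.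
    + intros i; rewrite S1; destruct (dec (In i (lI R))) as [Hi|]; auto; apply lI_in in Hi.
      pose proof (md_root (f 0) (e 0) _ Hi) as E2; pose proof (s_root _ _ _ _ HS (f 0) 0 _ Hi) as E3.
      rewrite <- E2 in E3; injection E3; auto.
    + intros w; destruct (S2 w) as [S3 S4]; split; auto; intros Hd Hi; destruct (S4 Hd Hi) as [E1 [E2 E4]].
      apply lW_in in Hi; pose proof (s_root _ _ _ _ HS (f 0) 0 _ Hi) as E3; injection E3 as E5 E6 E7.
      simpl in E1, E2, E4; rewrite E1, E2, E4; auto.
Qed.

(** By [small] all inner limits have the root stems of the same system and are trivial elsewhere, so
    they form a sequence to which [limit] applies again. *)
Lemma limit_limit (HT : T1) (f : nat -> nat -> nat) (e : nat -> nat -> list (nat * nat)) : (forall a b, b <= f a b) ->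
  exists q (qa : nat -> cond), ale TT q q /\ (forall a, ale TT (qa a) (qa a)) /\ PosD qa TT q /\
    forall a, PosD (fun b => md (f a b) (e a b)) TT (qa a).
Proof.
  intros Hf; assert (Hex : forall a, exists q, ale TT q q /\ PosD (fun b => md (f a b) (e a b)) TT q /\ small (fun _ => p 0) (lI R) (lW R) TT q).
  { intros a; destruct (limit_md (f a) (e a) (Hf a)) as [q [Q1 [Q2 Q3]]]; [left; auto|eauto]. }
  assert (exists qa : nat -> cond, forall a, ale TT (qa a) (qa a) /\ PosD (fun b => md (f a b) (e a b)) TT (qa a) /\ small (fun _ => p 0) (lI R) (lW R) TT (qa a)) as [qa Hqa].
  { exists (fun a => epsilon (inhabits (p 0)) (fun q => ale TT q q /\ PosD (fun b => md (f a b) (e a b)) TT q /\ small (fun _ => p 0) (lI R) (lW R) TT q)).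
    intros a; exact (epsilon_spec (inhabits (p 0)) _ (Hex a)). }
  unshelve epose proof (limit qa (fun a => proj1 (Hqa a)) (lI R) (lW R) _ _ _ (or_introl HT)) as [q [Q1 [Q2 _]]].
  - intros n i _; rewrite (proj1 (proj2 (proj2 (Hqa n))) i), (proj1 (proj2 (proj2 (Hqa 0))) i); auto.
  - intros n w Hw; destruct (Hqa n) as [_ [_ [_ Hn]]], (Hqa 0) as [_ [_ [_ H0]]].
    destruct (proj2 (Hn w) Logic.I Hw) as [-> [-> ->]], (proj2 (H0 w) Logic.I Hw) as [-> [-> ->]]; auto.
  - intros t _; exists 0; intros n _; destruct (Hqa n) as [_ [_ [Hn1 Hn2]]]; split.
    + intros i _; rewrite Hn1; destruct (dec (In i (lI R))); auto.
    + intros w _; destruct (dec (co (qa n) w = d0)) as [|Hne]; auto; right; apply Hn2; auto.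
  - exists q, qa; split; auto; split; [apply Hqa|split; auto; apply Hqa].
Qed.
End Amalgams.
End UncountableSystems.
End Poset.

(** * Names in an extension *)

Section Toolkit.
Context {P : Type} {OP : Order P}.
Local Notation Name := (Name P).

Section InModel.
Context {U : Name -> Prop} {M : Type} {E : M -> M -> Prop} {name : M -> Name} {G : P -> Prop} {om : M} {num : nat -> M}
  (g : gx U E name G om num).
Local Notation Nm := (Nm name G).
Local Notation pr := (pr E om).
Let gg := gx_g _ _ _ _ _ _ g.
Let HM := gx_m _ _ _ _ _ _ g.

Lemma G_ex : exists p, G p.
Proof. destruct (gx_om _ _ _ _ _ _ g) as [p [Hp _]]; eauto. Qed.
Lemma G_up p q : G p -> lep p q -> G q.
Proof. apply (g_up _ _ _ _ gg). Qed.
Lemma G_dir p q : G p -> G q -> exists r, G r /\ lep r p /\ lep r q.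
Proof. apply (g_dir _ _ _ _ gg). Qed.
Lemma Nm_self x : Nm x (name x).
Proof. apply Nm_name, G_ex. Qed.
Lemma Nm_uniq x y u : Nm x u -> Nm y u -> x = y.
Proof. apply (Nm_unique gg). Qed.
Lemma Nm_ex u : U u -> exists x, Nm x u.
Proof. intros H; destruct (g_val _ _ _ _ gg u H) as [x Hx]; eauto. Qed.

Lemma elem_iff A (f : A -> Name) O y z : U (nm A f O) -> Nm y (nm A f O) -> E z y <-> exists a t, G t /\ O a t /\ Nm z (f a).
Proof.
  intros HU Hy; split.
  - intros Hz; destruct (elem_val gg _ _ _ HU Hy Hz) as [p [Hp [a [t [Ha [Ht He]]]]]]; exists a, t; split; [eapply G_up; eauto|].
    split; auto; exists p; auto.
  - intros [a [t [Ht [Ha Hz]]]]; apply (mem_names gg _ _ _ _ Hz Hy); exists t; split; auto; apply (mem_intro A f O a t); auto.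
Qed.

Lemma Nm_opn x y u v : Nm x u -> Nm y v -> Nm (pr x y) (opn u v).
Proof.
  intros Hx Hy; set (z := pr x y).
  assert (Hs : sat E (en z [z; y; x]) ((opair 0 1 2) 3)).
  { assert (H : Opair E rex rand ror x y z) by (rewrite rex_eq, rand_eq, ror_eq; apply (Opair_iff E om num HM); auto). exact H. }
  apply (sat_names gg _ z (name z) [z; y; x] [name z; v; u]) in Hs; [|apply Nm_self|repeat constructor; auto; apply Nm_self].
  destruct Hs as [p [Hp Hf]]; exists p; split; auto.
  apply (opair_name 0 1 2 3 (en (name z) [name z; v; u])) in Hf; auto.
Qed.
Lemma Nm_opn_inv z u v : Nm z (opn u v) -> exists x y, Nm x u /\ Nm y v /\ z = pr x y.
Proof.
  intros Hz; assert (Hs : sat E (en z [z]) ((∃ x, ∃ y, opair x y 0) 1)).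
  { apply (sat_names gg _ z (opn u v) [z] [opn u v] Hz); [repeat constructor; auto|].
    destruct G_ex as [p Hp]; exists p; split; auto; apply f_ex_i with u, f_ex_i with v.
    apply (opair_name 1 2 0 3); auto; apply eqn_refl. }
  assert (Hs' : rex (fun x => rex (fun y => Opair E rex rand ror x y z))) by exact Hs.
  rewrite rex_eq, rand_eq, ror_eq in Hs'; destruct Hs' as [x [y Hp]]; apply (Opair_iff E om num HM) in Hp as ->.
  exists x, y; destruct Hz as [p [Hp H1]]; destruct (Nm_opn x y _ _ (Nm_self x) (Nm_self y)) as [q [Hq H2]].
  destruct (G_dir p q Hp Hq) as [r [Hr [R1 R2]]].
  assert (He : eqn (opn (name x) (name y)) (opn u v) r).
  { eapply eqn_trans; [apply eqn_sym; exact (eqn_down _ _ _ _ H2 R2)|exact (eqn_down _ _ _ _ H1 R1)]. }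
  apply opn_inj in He as [E1 E2]; split; [exists r; auto|split; auto; exists r; auto].
Qed.
Lemma Nm_pr_inv x y u v : Nm (pr x y) (opn u v) -> Nm x u /\ Nm y v.
Proof.
  intros H; apply Nm_opn_inv in H as [x' [y' [Hx [Hy He]]]]; apply (pr_inj E om num HM) in He as [-> ->]; auto.
Qed.
Lemma Nm_num n : Nm (num n) (nn n).
Proof. apply (gx_num _ _ _ _ _ _ g). Qed.
Lemma Nm_num_iff x n : Nm x (nn n) <-> x = num n.
Proof. split; [intros H; eapply Nm_uniq; [exact H|apply Nm_num]|intros ->; apply Nm_num]. Qed.

Lemma pair_iff A (u v : A -> Name) O F x y : U (nm A (fun a => opn (u a) (v a)) O) -> Nm F (nm A (fun a => opn (u a) (v a)) O) ->
  E (pr x y) F <-> exists a t, G t /\ O a t /\ Nm x (u a) /\ Nm y (v a).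
Proof.
  intros HU HF; rewrite (elem_iff _ _ _ _ _ HU HF); split; intros [a [t [Ht [Ha H]]]]; exists a, t; split; auto; split; auto.
  - apply Nm_pr_inv; auto.
  - apply Nm_opn; tauto.
Qed.
Lemma pair_elem A (u v : A -> Name) O F z : U (nm A (fun a => opn (u a) (v a)) O) -> Nm F (nm A (fun a => opn (u a) (v a)) O) ->
  E z F -> exists a t x y, G t /\ O a t /\ Nm x (u a) /\ Nm y (v a) /\ z = pr x y.
Proof.
  intros HU HF Hz; apply (elem_iff _ _ _ _ _ HU HF) in Hz as [a [t [Ht [Ha H]]]]; apply Nm_opn_inv in H as [x [y [Hx [Hy ->]]]].
  exists a, t, x, y; auto.
Qed.

Section Checks.
Context {T : Type} (lt : T -> T -> Prop) (wf : well_founded lt) (tri : forall x y, lt x y \/ x = y \/ lt y x).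
Lemma cks_elem y z : U (cks lt wf) -> Nm y (cks lt wf) -> E z y <-> exists t, Nm z (ck lt wf t).
Proof.
  intros HU Hy; unfold cks, oset in *; rewrite (elem_iff _ _ _ _ _ HU Hy); split.
  - intros [a [t [_ [_ H]]]]; eauto.
  - intros [t H]; destruct G_ex as [p Hp]; exists t, p; auto.
Qed.
Lemma ck_inj z t t' : Nm z (ck lt wf t) -> Nm z (ck lt wf t') -> t = t'.
Proof.
  intros [p [Hp H]] [q [Hq H']]; destruct (G_dir p q Hp Hq) as [r [Hr [R1 R2]]].
  apply (on_inj lt wf (fun _ _ => True) tri t t' r r r); auto.
  eapply eqn_trans; [apply eqn_sym; exact (eqn_down _ _ _ _ H R1)|exact (eqn_down _ _ _ _ H' R2)].
Qed.
End Checks.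
End InModel.

Section Bounded.
Context {T : Type} (lt : T -> T -> Prop) (wf : well_founded lt).
Lemma en_scons_forces a x ud us p : forces a (scons x (en ud us)) p <-> forces a (en ud (x :: us)) p.
Proof. apply forces_ext; intros i; apply scons_en. Qed.
(** A name forced into a canonical set is, densely, forced equal to a canonical element, so a
    quantifier bounded by such a set ranges over the ground type. *)
Lemma all_ck (b : var -> fml) y d ud us p : y < d -> en ud us (d - S y) = cks lt wf ->
  (forall t q, lep q p -> forces (b d (S d)) (en ud (ck lt wf t :: us)) q) ->
  forces (fall (fun x => fimp (fmem x y) (b x)) d) (en ud us) p.
Proof.
  intros Hy Hn H; apply f_all; intros x; apply f_imp; intros q Hq Hx.
  unfold fmem in Hx; cbn [forces] in Hx; lkin Hx; rewrite Hn in Hx; apply mem_oset in Hx.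
  eapply forces_bind; [exact Hx|]; intros r Hr [t [s [_ [_ He]]]].
  apply (forces_congr _ (scons (ck lt wf t) (en ud us))).
  - intros [|i]; simpl; [apply eqn_sym; exact He|apply eqn_refl].
  - apply en_scons_forces, H; eauto.
Qed.
Lemma ex_ck (b : var -> fml) y d ud us p : y < d -> en ud us (d - S y) = cks lt wf ->
  forces (fex (fun x => fand (fmem x y) (b x)) d) (en ud us) p ->
  dns p (fun q => exists t, forces (b d (S d)) (en ud (ck lt wf t :: us)) q).
Proof.
  intros Hy Hn H; apply f_ex in H; eapply dns_bind; [exact H|]; intros q Hq [x Hx]; apply f_and in Hx as [Hx Hb].
  unfold fmem in Hx; cbn [forces] in Hx; lkin Hx; rewrite Hn in Hx; apply mem_oset in Hx.
  eapply dns_imp; [exact Hx|]; intros r Hr [t [s [_ [_ He]]]]; exists t; apply en_scons_forces.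
  apply (forces_congr _ (scons x (en ud us))); [|eapply forces_down; eauto].
  intros [|i]; simpl; [exact He|apply eqn_refl].
Qed.
Lemma ex_ck_i (b : var -> fml) y d ud us p t : y < d -> en ud us (d - S y) = cks lt wf ->
  forces (b d (S d)) (en ud (ck lt wf t :: us)) p ->
  forces (fex (fun x => fand (fmem x y) (b x)) d) (en ud us) p.
Proof.
  intros Hy Hn H; apply f_ex_i with (ck lt wf t), f_and; split; [|apply en_scons_forces; auto].
  unfold fmem; cbn [forces]; lk; rewrite Hn; exact (on_oset lt wf (fun _ _ => True) t p p I (lep_refl p)).
Qed.
End Bounded.
End Toolkit.

Section ZFCTrue.
Context {M : Type} (E : M -> M -> Prop) (om : M) (num : nat -> M) (HM : model E om num).
Lemma choice_true a : (forall x, E x a -> exists z, E z x) -> (forall x, E x a -> forall y, E y a -> (exists z, E z x /\ E z y) -> x = y) ->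
  exists c, forall x, E x a -> exists y, forall z, E z x /\ E z c <-> z = y.
Proof.
  intros H1 H2; destruct (choice_fun E om num HM a (un E om a) (fun x z => E z x)) as [f [F1 F2]]; [dfn| |].
  - intros x Hx; destruct (H1 x Hx) as [z Hz]; exists z; split; auto; apply (un_spec E om num HM); eauto.
  - exists (sp E om (un E om a) (fun z => exists x, E x a /\ App E (@ex M) and or f x z)); intros x Hx; exists (ap E om f x); intros z.
    rewrite (sp_spec E om num HM) by dfn; split.
    + intros [Hz [_ [x' [Hx' Hf]]]]; apply (App_iff E om num HM), (func_pr E om num HM _ _ _ _ _ F1) in Hf as [_ [_ ->]].
      rewrite (H2 x Hx x' Hx'); auto; exists (ap E om f x'); auto.
    + intros ->; split; auto; split; [apply (ap_spec E om num HM _ _ _ _ F1 Hx)|].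
      exists x; split; auto; apply (App_iff E om num HM), (func_ap E om num HM _ _ _ _ F1 Hx).
Qed.
End ZFCTrue.

Lemma zfc_true {P} {OP : Order P} {U M} {E : M -> M -> Prop} {name : M -> Name P} {G om num} (g : gx U E name G om num) q e : ZFC q -> sat E e q.
Proof.
  intros H; pose proof (gx_m _ _ _ _ _ _ g) as HM.
  assert (L : forall a, (forall e c, forces a e c) -> sat E e a).
  { intros a Ha; apply (g_truth _ _ _ _ (gx_g _ _ _ _ _ _ g)); destruct (G_ex g) as [p Hp]; exists p; split; auto. }
  destruct H; try (apply L; intros; first [apply ax_extensionality|apply ax_foundation|apply ax_pairing|apply ax_union|apply ax_power|apply ax_separation|apply ax_replacement]).
  - assert (H : rex (fun a => Inductive_ E rex rand ror a)); [|exact H].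
    rewrite rex_eq, rand_eq, ror_eq; exists om; apply (Inductive_om E om num HM).
  - assert (H : forall a, rand (forall x, E x a -> rex (fun z => E z x)) (forall x, E x a -> forall y, E y a -> rex (fun z => rand (E z x) (E z y)) -> x = y) ->
      rex (fun c => forall x, E x a -> rex (fun y => forall z, rand (rand (E z x) (E z c) -> z = y) (z = y -> rand (E z x) (E z c))))); [|exact H].
    rewrite rex_eq, rand_eq; intros a [H1 H2]; destruct (choice_true E om num HM a H1 H2) as [c Hc]; exists c; intros x Hx.
    destruct (Hc x Hx) as [y Hy]; exists y; intros z; apply Hy.
Qed.

(** * Cohen reals and captured sequences *)

Section Bodies.
Context {M : Type} (E : M -> M -> Prop) (EX : (M -> Prop) -> Prop) (AND OR : Prop -> Prop -> Prop) (om : M).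
Local Notation cApp := (App E EX AND OR).
Definition B1 f h m := AND (EX (fun Y => AND (Baire E EX AND OR Y) (E h Y)))
  (forall n, E n om -> Leq E OR m n -> EX (fun u => AND (cApp f n u) (EX (fun v => AND (cApp h n v) (Leq E OR u v))))).
Definition B2 f h m := AND (forall s v v', cApp h s v -> cApp h s v' -> v = v')
  (forall i, E i om -> Leq E OR m i -> EX (fun j => AND (Leq E OR i j) (AND (EX (fun e => AND (Succ E AND OR i e)
     (EX (fun e' => AND (Succ E AND OR e e') (E j e'))))) (Guesses E EX AND OR h f j)))).
Definition B3 f h m := AND (EX (fun F => AND (FinFin_ E EX AND OR F) (EX (fun O => AND (Omega2 E EX AND OR O)
     (EX (fun S => AND (FinSeqs E EX AND OR O S) (Func E EX AND OR h S F)))))))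
  (forall n, E n om -> Leq E OR m n -> EX (fun s => AND (Restr E EX AND OR f n s) (EX (fun c => AND (cApp h s c) (EX (fun v => AND (cApp f n v) (E v c))))))).
Definition Psi (B : M -> M -> M -> Prop) C η i t m :=
  EX (fun f => AND (cApp C i f) (EX (fun h => AND (cApp η t h) (AND (forall h', cApp η t h' -> h' = h) (B f h m))))).
Definition Chi B C η I A := forall i, E i I -> EX (fun t => AND (E t A) (EX (fun m => AND (E m om) (Psi B C η i t m)))).
End Bodies.

(** The numerals are quantifier levels: 0 to 9 stand for omega, [A], [I], the Cohen family [C], [η],
    [i], [t], [m], the real [f] at [i] and the value [h] of [η] at [t]. The sentence [chi] says that
    the family [η] handles all Cohen reals, with the place [m] from which [h] works made
    explicit. *)
Definition body1 : fml := (LET Y := baire IN 9 ∈ Y) ∧ ∀ n ∈ 0, leq 7 n ⇒ LET u := app 8 n IN LET v := app 9 n IN leq u v.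
Definition body2 : fml := (∀ s, ∀ v, ∀ v', app 9 s v ⇒ app 9 s v' ⇒ v ≡ v') ∧ ∀ i ∈ 0, leq 7 i ⇒ ∃ j, leq i j ∧
    (LET e := succ i IN LET e' := succ e IN j ∈ e') ∧ guesses 9 8 j.
Definition body3 : fml := (LET F := FinFin IN LET O := omega2 IN LET S := fin_seqs O IN func 9 S F) ∧
  ∀ n ∈ 0, leq 7 n ⇒ LET s := restr 8 n IN LET c := app 9 s IN LET v := app 8 n IN v ∈ c.
Definition psi (b : fml) : fml := ∃ f, app 3 5 f ∧ ∃ h, app 4 6 h ∧ (∀ h', app 4 6 h' ⇒ h' ≡ h) ∧ b.
Definition chi (b : fml) : fml := ∀ i ∈ 2, ∃ t ∈ 1, ∃ m ∈ 0, psi b.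

Section SatBodies.
Context {M : Type} (E : M -> M -> Prop) (md η C I A om i t m : M).
Local Ltac sb := unfold Chi, Psi, B1, B2, B3; rewrite <- rex_eq, <- rand_eq, <- ?ror_eq; reflexivity.
Lemma sat_chi1 : sat E (en md [η; C; I; A; om]) (chi body1 5) = Chi E (@ex M) and or om (B1 E (@ex M) and or om) C η I A.
Proof. sb. Qed.
Lemma sat_chi2 : sat E (en md [η; C; I; A; om]) (chi body2 5) = Chi E (@ex M) and or om (B2 E (@ex M) and or om) C η I A.
Proof. sb. Qed.
Lemma sat_chi3 : sat E (en md [η; C; I; A; om]) (chi body3 5) = Chi E (@ex M) and or om (B3 E (@ex M) and or om) C η I A.
Proof. sb. Qed.
Lemma sat_psi1 : sat E (en md [m; t; i; η; C; I; A; om]) (psi body1 8) = Psi E (@ex M) and or (B1 E (@ex M) and or om) C η i t m.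
Proof. sb. Qed.
Lemma sat_psi2 : sat E (en md [m; t; i; η; C; I; A; om]) (psi body2 8) = Psi E (@ex M) and or (B2 E (@ex M) and or om) C η i t m.
Proof. sb. Qed.
Lemma sat_psi3 : sat E (en md [m; t; i; η; C; I; A; om]) (psi body3 8) = Psi E (@ex M) and or (B3 E (@ex M) and or om) C η i t m.
Proof. sb. Qed.
End SatBodies.

Lemma prefix_nth_error {A} (a b : list A) n v : prefix a b -> nth_error a n = Some v -> nth_error b n = Some v.
Proof. intros [c ->] H; rewrite nth_error_app1; auto; apply nth_error_Some; congruence. Qed.

Section Cohen.
Context {I W A : Type} (lt : W -> W -> Prop) (wf : well_founded lt).
Context (tri : forall x y, lt x y \/ x = y \/ lt y x) (tr : forall x y z, lt x y -> lt y z -> lt x z).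
Context (Adm : nat -> nat * nat -> nat -> nat * nat -> Prop).
Context (HI : forall L : list I, exists i, ~ In i L) (HA : forall g : I -> A, exists t, ~ countable (fun i => g i = t)).
Context (ltI : I -> I -> Prop) (wfI : well_founded ltI) (triI : forall x y, ltI x y \/ x = y \/ ltI y x).
Context (ltA : A -> A -> Prop) (wfA : well_founded ltA) (triA : forall x y, ltA x y \/ x = y \/ ltA y x).
Local Notation cond := (@cond I W).
Local Notation ale := (ale lt wf Adm TT).

Definition Pc := {p : cond | ale p p}.
Definition mkPc (p : cond) (H : ale p p) : Pc := exist (fun p => ale p p) p H.
Definition lePc (p q : Pc) := ale (proj1_sig p) (proj1_sig q).
Lemma lePc_refl p : lePc p p.
Proof. exact (proj2_sig p). Qed.
Lemma lePc_trans p q r : lePc p q -> lePc q r -> lePc p r.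
Proof. intros H H'; exact (ale_trans lt wf tr Adm TT _ _ _ (down_TT lt) H H'). Qed.
#[local] Instance OPc : Order Pc := {| lep := lePc; lep_refl := lePc_refl; lep_trans := lePc_trans |}.
Local Notation Name := (Name Pc).
Definition mkP p q (H : ale p q) : Pc := mkPc p (ale_valid lt wf Adm TT p q H).

Definition cN (h : nat * nat -> Name) (i : I) : Name :=
  nm (nat * (nat * nat)) (fun x => opn (nn (fst x)) (h (snd x))) (fun x p => nth_error (coh (proj1_sig p) i) (fst x) = Some (snd x)).
Definition famN {T} (ltT : T -> T -> Prop) (wfT : well_founded ltT) (N : T -> Name) : Name := nm T (fun i => opn (ck ltT wfT i) (N i)) (fun _ _ => True).
Definition CN (h : nat * nat -> Name) : Name := famN ltI wfI (cN h).

Definition longcoh (i : I) (n : nat) (p : Pc) := n < length (coh (proj1_sig p) i).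
Lemma longcoh_dense i n p : exists q, lep q p /\ longcoh i n q.
Proof.
  destruct (cohen_dense lt wf Adm (proj1_sig p) i (S n) (proj2_sig p)) as [q [Hq Hl]]; exists (mkP _ _ Hq); auto.
Qed.

Section InModel.
Context {U : Name -> Prop} {M : Type} {E : M -> M -> Prop} {name : M -> Name} {G : Pc -> Prop} {om : M} {num : nat -> M}
  (g : gx U E name G om num).
Local Notation Nm := (Nm name G).
Local Notation pr := (pr E om).
Local Notation ap := (ap E om).
Local Notation cFunc := (Func E (@ex M) and or).
Let HM := gx_m _ _ _ _ _ _ g.
Definition cval (i : I) n v := exists t : Pc, G t /\ nth_error (coh (proj1_sig t) i) n = Some v.
Lemma cval_fun i n v v' : cval i n v -> cval i n v' -> v = v'.
Proof.
  intros [t [Ht H]] [t' [Ht' H']]; destruct (G_dir g t t' Ht Ht') as [r [_ [[_ [R1 _]] [_ [R2 _]]]]].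
  apply (prefix_nth_error _ _ _ _ (R1 i)) in H; apply (prefix_nth_error _ _ _ _ (R2 i)) in H'; congruence.
Qed.
Lemma cval_ex i n : (exists p, G p /\ longcoh i n p) -> exists v, cval i n v.
Proof.
  intros [p [Hp Hl]]; unfold longcoh in Hl; apply nth_error_Some in Hl.
  destruct (nth_error (coh (proj1_sig p) i) n) as [v|] eqn:He; [|congruence]; exists v, p; auto.
Qed.
Context (h : nat * nat -> Name) (hs : nat * nat -> M) (Hh : forall v, Nm (hs v) (h v)).
Lemma cN_pr i f x y : U (cN h i) -> Nm f (cN h i) -> E (pr x y) f <-> exists n v, cval i n v /\ x = num n /\ y = hs v.
Proof.
  intros HU Hf; unfold cN in *; rewrite (pair_iff g _ _ _ _ _ _ _ HU Hf); split.
  - intros [[n v] [t [Ht [Hn [Hx Hy]]]]]; exists n, v; split; [exists t; auto|split; [apply (Nm_num_iff g), Hx|exact (Nm_uniq g _ _ _ Hy (Hh v))]].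
  - intros [n [v [[t [Ht Hn]] [-> ->]]]]; exists (n, v), t; split; auto; split; auto; split; [apply (Nm_num g)|apply Hh].
Qed.
Lemma cN_func i f X : U (cN h i) -> Nm f (cN h i) -> (forall n, exists p, G p /\ longcoh i n p) -> (forall v, E (hs v) X) ->
  cFunc f om X /\ forall n v, cval i n v -> ap f (num n) = hs v.
Proof.
  intros HU Hf Hd HX; pose proof (fun x y => cN_pr i f x y HU Hf) as Hp.
  assert (Hfu : cFunc f om X).
  { apply (Func_iff E om num HM); split.
    - intros z Hz; destruct (pair_elem g _ _ _ _ _ _ HU Hf Hz) as [_ [_ [x [y [_ [_ [_ [_ ->]]]]]]]].
      apply Hp in Hz as [n [v [_ [-> ->]]]]; exists (num n), (hs v); split; auto; apply (num_om E om num HM).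
    - intros x Hx; apply (m_om _ _ _ HM) in Hx as [n ->]; destruct (cval_ex i n (Hd n)) as [v Hv]; exists (hs v); split; auto.
      intros z; rewrite Hp; split; [|intros ->; eauto].
      intros [n' [v' [Hv' [Hn ->]]]]; apply (num_inj E om num HM) in Hn as <-; rewrite (cval_fun i n v v' Hv Hv'); auto. }
  split; auto; intros n v Hv; assert (H : E (pr (num n) (hs v)) f) by (apply Hp; eauto).
  apply (func_pr E om num HM _ _ _ _ _ Hfu) in H as [_ [_ H]]; auto.
Qed.
Lemma famN_pr {T} (ltT : T -> T -> Prop) wfT (triT : forall x y, ltT x y \/ x = y \/ ltT y x) N C i f j :
  U (famN ltT wfT N) -> Nm C (famN ltT wfT N) -> Nm i (ck ltT wfT j) -> E (pr i f) C <-> Nm f (N j).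
Proof.
  intros HU HC Hi; unfold famN in *; rewrite (pair_iff g _ _ _ _ _ _ _ HU HC); split.
  - intros [k [t [_ [_ [Hk Hf]]]]]; rewrite (ck_inj g ltT wfT triT i j k Hi Hk); auto.
  - intros Hf; destruct (G_ex g) as [p Hp]; exists j, p; auto.
Qed.
Lemma CN_pr C i f j : U (CN h) -> Nm C (CN h) -> Nm i (ck ltI wfI j) -> E (pr i f) C <-> Nm f (cN h j).
Proof. exact (famN_pr ltI wfI triI (cN h) C i f j). Qed.
End InModel.

(** Some condition forces [chi]. For each [i] an extension of it decides the witnesses [t] and [m],
    and [extraction] arranges such conditions into a system with one [t] and one [m]. *)
Lemma ground_sat_chi b U M (E : M -> M -> Prop) name G om num (g : gx U E name G om num) h η C I' A' :
  Nm name G C (CN h) -> Nm name G I' (cks ltI wfI) -> Nm name G A' (cks ltA wfA) ->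
  sat E (en om [η; C; I'; A'; om]) (chi b 5) ->
  exists ηn t m R s x p, m <= length s /\ system lt wf Adm R s x p /\ forall n, exists H : ale (p n) (p n),
    forces (psi b 8) (en nset [nn m; ck ltA wfA t; ck ltI wfI (x n); ηn; CN h; cks ltI wfI; cks ltA wfA; nset]) (mkPc (p n) H).
Proof.
  intros HC HI' HA' Hs.
  apply (sat_names (gx_g _ _ _ _ _ _ g) _ om nset [η; C; I'; A'; om] [name η; CN h; cks ltI wfI; cks ltA wfA; nset]) in Hs.
  2: apply (gx_om _ _ _ _ _ _ g). 2: { repeat constructor; auto; [apply (Nm_self g)|apply (gx_om _ _ _ _ _ _ g)]. }
  destruct Hs as [p0 [_ Hf]]; exists (name η); set (ηn := name η) in *; clearbody ηn.
  destruct (extraction lt wf Adm HI HA (fun i t m p => exists H : ale p p,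
    forces (psi b 8) (en nset [nn m; ck ltA wfA t; ck ltI wfI i; ηn; CN h; cks ltI wfI; cks ltA wfA; nset]) (mkPc p H)))
    as [t [m [R [s [x [p [H1 [H2 H3]]]]]]]]; [| |exists t, m, R, s, x, p; auto].
  - intros i t m p q [H Hp] Hq; exists (ale_valid lt wf Adm TT q p Hq); eapply forces_down; [exact Hp|exact Hq].
  - intros i; pose proof (proj1 (f_all _ 5 _ p0) Hf (ck ltI wfI i)) as Hi.
    assert (Hi' : forces ((∃ t ∈ 1, ∃ m ∈ 0, psi b) 6) (scons (ck ltI wfI i) (en nset [ηn; CN h; cks ltI wfI; cks ltA wfA; nset])) p0).
    { apply (proj1 (f_imp _ _ 6 _ p0) Hi p0 (lep_refl p0)); exact (on_oset ltI wfI (fun _ _ => True) i p0 p0 Logic.I (lep_refl p0)). }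
    apply en_scons_forces in Hi'.
    apply (ex_ck ltA wfA (fun t => ∃ m ∈ 0, psi b) 1 6 nset [ck ltI wfI i; ηn; CN h; cks ltI wfI; cks ltA wfA; nset] p0 ltac:(lia) eq_refl) in Hi'.
    destruct (Hi' p0 (lep_refl p0)) as [p1 [Hp1 [t Ht]]].
    apply (ex_ck Nat.lt lt_wf (fun m => psi b) 0 7 nset [ck ltA wfA t; ck ltI wfI i; ηn; CN h; cks ltI wfI; cks ltA wfA; nset] p1 ltac:(lia) eq_refl) in Ht.
    destruct (Ht p1 (lep_refl p1)) as [p2 [Hp2 [m Hm]]]; exists (proj1_sig p2), t, m; split; [apply (proj2_sig p2)|].
    exists (proj2_sig p2); destruct p2 as [p2 V2]; exact Hm.
Qed.

(** If [q] is in the filter, meeting these sets brings in [c k] for arbitrarily large [k]; the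
    second alternative makes them dense everywhere. *)
Definition Dpos (c : nat -> cond) (q : cond) (N : nat) (r : Pc) :=
  (exists k, N <= k /\ ale (proj1_sig r) (c k)) \/ ~ exists s, ale s (proj1_sig r) /\ ale s q.
Lemma Dpos_dense c q N : PosD lt wf Adm c TT q -> forall p, exists r, lep r p /\ Dpos c q N r.
Proof.
  intros HP p; destruct (classic (exists s, ale s (proj1_sig p) /\ ale s q)) as [[s [Hs Hq]]|Hn].
  - destruct (HP s N Hq) as [s' [k [H1 [H2 H3]]]]; exists (mkP _ _ H1); split; [exact (ale_trans lt wf tr Adm TT _ _ _ (down_TT lt) H1 Hs)|].
    left; exists k; auto.
  - exists p; split; auto; right; auto.
Qed.
Lemma Dpos_met (G : Pc -> Prop) c q : (forall p q, G p -> G q -> exists r, G r /\ lep r p /\ lep r q) -> (exists q', G q' /\ ale (proj1_sig q') q) ->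
  (forall N, exists r, G r /\ Dpos c q N r) -> forall N, exists k r, N <= k /\ G r /\ ale (proj1_sig r) (c k).
Proof.
  intros Hd [q' [Hq' Hq]] HD N; destruct (HD N) as [r [Hr [[k [Hk Hrk]]|Hn]]]; [exists k, r; auto|].
  destruct (Hd r q' Hr Hq') as [s [_ [H1 H2]]]; destruct Hn; exists (proj1_sig s); split; auto.
  exact (ale_trans lt wf tr Adm TT _ _ _ (down_TT lt) H2 Hq).
Qed.

Section Contra.
Context (ηn : Name) (t : A) (m : nat) (R : list (I + W)) (s : list (nat * nat)) (x : nat -> I) (p : nat -> cond).
Context (Hm : m <= length s) (HS : system lt wf Adm R s x p) (h : nat * nat -> Name) (b : fml).
Context (HF : forall n, exists H : ale (p n) (p n),
  forces (psi b 8) (en nset [nn m; ck ltA wfA t; ck ltI wfI (x n); ηn; CN h; cks ltI wfI; cks ltA wfA; nset]) (mkPc (p n) H)).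

(** A new extension is built through [q], evaluating [η] and the Cohen reals [x n]. There [psi]
    holds for every [n] whose [p n] is met by the filter, with the same [η], [t] and [m], so all
    these reals are handled by one and the same object. *)
Lemma second_model (q : cond) (Hq : ale q q) {X} (Dx : X -> Pc -> Prop) : cble X -> (forall z p, exists r, lep r p /\ Dx z r) ->
  exists U M (E : M -> M -> Prop) name G om num (g : gx U E name G om num) (fn : nat -> M) (hs : nat * nat -> M),
  (forall v, Nm name G (hs v) (h v)) /\ G (mkPc q Hq) /\ (forall z, exists r, G r /\ Dx z r) /\
  (forall (Z : M), (forall v, E (hs v) Z) -> forall n, Func E (@ex M) and or (fn n) om Z /\ forall l v, @cval G (x n) l v -> ap E om (fn n) (num l) = hs v) /\
  exists η t' C (xi : nat -> M), (forall n f, E (pr E om (xi n) f) C -> f = fn n) /\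
    forall n, (exists r : Pc, G r /\ ale (proj1_sig r) (p n)) -> exists I' A', sat E (en om [num m; t'; xi n; η; C; I'; A'; om]) (psi b 8).
Proof.
  intros HX HD.
  set (U := fun u : Name => (u = ηn \/ u = ck ltA wfA t \/ u = CN h \/ u = cks ltI wfI \/ u = cks ltA wfA) \/
    (exists v, u = h v) \/ (exists n, u = ck ltI wfI (x n)) \/ (exists n, u = cN h (x n))).
  assert (HU : cnt U).
  { unfold U; repeat apply cnt_or; try apply cnt_one; apply cnt_img; auto. }
  destruct (gx_exists (mkPc q Hq : Pc) U (fun z => match z with inl nl => longcoh (x (fst nl)) (snd nl) | inr y => Dx y end) (X := (nat * nat) + X))
    as [U' [M [E [name [G [om [num [g [HU' [HG HDm]]]]]]]]]]; auto.
  { intros [[n l]|z]; [apply longcoh_dense|apply HD]. }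
  assert (exists hs, forall v, Nm name G (hs v) (h v)) as [hs Hhs].
  { exists (fun v => epsilon (inhabits om) (fun y => Nm name G y (h v))); intros v.
    apply (epsilon_spec (inhabits om) (fun y => Nm name G y (h v))), (Nm_ex g), HU'; right; left; eauto. }
  assert (exists xi, forall n, Nm name G (xi n) (ck ltI wfI (x n))) as [xi Hxi].
  { exists (fun v => epsilon (inhabits om) (fun y => Nm name G y (ck ltI wfI (x v)))); intros v.
    apply (epsilon_spec (inhabits om) (fun y => Nm name G y (ck ltI wfI (x v)))), (Nm_ex g), HU'; right; right; left; eauto. }
  assert (exists fn, forall n, Nm name G (fn n) (cN h (x n))) as [fn Hfn].
  { exists (fun v => epsilon (inhabits om) (fun y => Nm name G y (cN h (x v)))); intros v.
    apply (epsilon_spec (inhabits om) (fun y => Nm name G y (cN h (x v)))), (Nm_ex g), HU'; right; right; right; eauto. }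
  destruct (Nm_ex g ηn) as [η Hη]; [apply HU'; left; auto|].
  destruct (Nm_ex g (ck ltA wfA t)) as [t' Ht']; [apply HU'; left; auto|].
  destruct (Nm_ex g (CN h)) as [C HC]; [apply HU'; left; auto|].
  destruct (Nm_ex g (cks ltI wfI)) as [I' HI']; [apply HU'; left; auto 6|].
  destruct (Nm_ex g (cks ltA wfA)) as [A' HA']; [apply HU'; left; auto 6|].
  exists U', M, E, name, G, om, num, g, fn, hs; split; auto; split; auto; split; [intros z; apply (HDm (inr z))|split].
  - intros Z HZ n; apply (cN_func g h hs Hhs (x n) (fn n) Z); auto.
    + apply HU'; right; right; right; eauto.
    + intros l; apply (HDm (inl (n, l))).
  - exists η, t', C, xi; split.
    + intros n f Hf; apply (CN_pr g h C (xi n) f (x n)) in Hf; auto; [exact (Nm_uniq g _ _ _ Hf (Hfn n))|].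
      apply HU'; left; auto.
    + intros n [r [Hr Hrp]]; exists I', A'; destruct (HF n) as [V Hf].
      apply (sat_names (gx_g _ _ _ _ _ _ g) _ om nset _ [nn m; ck ltA wfA t; ck ltI wfI (x n); ηn; CN h; cks ltI wfI; cks ltA wfA; nset]).
      * apply (gx_om _ _ _ _ _ _ g).
      * repeat constructor; auto; [apply (Nm_num g)|apply (gx_om _ _ _ _ _ _ g)].
      * exists r; split; auto; eapply forces_down; [exact Hf|exact Hrp].
Qed.
End Contra.

(* The readings of a Cohen real as an element of [omega^omega], of [2^omega] and of [(omega * omega)^omega]. *)
Definition h1 (v : nat * nat) : Name := nn (snd v).
Definition h2 (v : nat * nat) : Name := nn (if fst v =? 0 then 0 else 1).
Definition h3 (v : nat * nat) : Name := opn (nn (fst v)) (nn (snd v)).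

Lemma md_val (G : Pc -> Prop) (x : nat -> I) s p k e (r : Pc) l v : G r -> ale (proj1_sig r) (md s x p k e) ->
  nth_error (s ++ e) l = Some v -> @cval G (x k) l v.
Proof.
  intros Hr [_ [H _]] Hl; exists r; split; auto; specialize (H (x k)); rewrite md_coh in H.
  eapply prefix_nth_error; eauto.
Qed.
Lemma nth_error_end {X} (s : list X) a e : nth_error (s ++ a :: e) (length s) = Some a.
Proof. rewrite nth_error_app2, Nat.sub_diag; auto. Qed.
Lemma nth_error_end2 {X} (s : list X) a b e : nth_error (s ++ a :: b :: e) (S (length s)) = Some b.
Proof. rewrite nth_error_app2 by lia; replace (S (length s) - length s) with 1 by lia; auto. Qed.

Section Facts.
Context {U : Name -> Prop} {M : Type} {E : M -> M -> Prop} {name : M -> Name} {G : Pc -> Prop} {om : M} {num : nat -> M}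
  (g : gx U E name G om num) (C I' A' : M).
Let HM := gx_m _ _ _ _ _ _ g.
Context (HI' : Nm name G I' (cks ltI wfI)) (HA' : Nm name G A' (cks ltA wfA)).
Local Notation fs := (fs E om).
Local Notation cFunc := (Func E (@ex M) and or).

(** Member [k] of the system takes the value [k] right after the stem. In an extension through the
    limit this happens for arbitrarily large [k], all of them bounded by one function from a place
    within the stem on, although its value after the stem is a fixed number. *)
Lemma factA1_true : T1 Adm \/ T2 Adm -> Nm name G C (CN h1) -> cFunc C I' (fs om om) -> factA1 E om I' A' C.
Proof.
  intros HT HC HCf η; apply NNPP; intros Hno.
  assert (Hchi : Chi E (@ex M) and or om (B1 E (@ex M) and or om) C η I' A').
  { intros i Hi; apply NNPP; intros Hn; apply Hno; exists i; split; auto; intros t Ht h [Hh Hu] Hb HL; apply Hn.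
    unfold LeqStar, AlmostAll in HL; rewrite (let_om E om num HM) in HL; destruct HL as [m [Hm HL]].
    exists t; split; auto; exists m; split; auto; exists (ap E om C i); split; [apply (App_iff E om num HM), (func_ap E om num HM _ _ _ _ HCf Hi)|].
    exists h; split; auto; split; auto; split; auto; exists (fs om om); split; auto; apply (Baire_iff E om num HM); auto. }
  rewrite <- (sat_chi1 E om) in Hchi.
  destruct (ground_sat_chi body1 U M E name G om num g h1 η C I' A' HC HI' HA' Hchi) as [ηn [t [m [R [s [x [p [Hm [HS HF]]]]]]]]].
  destruct (limit_md lt wf tri tr Adm HI R s x p HS (fun k => k) (fun k => [(0, k)]) (fun k => le_n k) HT) as [q [Hq [HP _]]].
  destruct (second_model ηn t m x p h1 body1 HF q Hq (Dpos (fun k => md s x p k [(0, k)]) q) cble_nat) as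
    [U2 [M2 [E2 [name2 [G2 [om2 [num2 [g2 [fn [hs [Hhs [Gq [HD [Hfn [η2 [t2 [C2 [xi [HC2 Hsat]]]]]]]]]]]]]]]]]]].
  { intros N; apply Dpos_dense; auto. }
  pose proof (gx_m _ _ _ _ _ _ g2) as HM2.
  assert (Hmet := Dpos_met G2 _ q (G_dir g2) (ex_intro _ _ (conj Gq Hq)) HD).
  assert (Hhs' : forall v, hs v = num2 (snd v)) by (intros v; apply (Nm_num_iff g2), Hhs).
  assert (Hk : forall k (r : Pc), G2 r -> ale (proj1_sig r) (md s x p k [(0, k)]) ->
    exists h, (App E2 (@ex M2) and or η2 t2 h /\ forall h', App E2 (@ex M2) and or η2 t2 h' -> h' = h) /\ B1 E2 (@ex M2) and or om2 (fn k) h (num2 m)).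
  { intros k r Hr Hrk; destruct (Hsat k) as [I2 [A2 Hs]].
    { exists r; split; auto; exact (ale_trans lt wf tr Adm TT _ _ _ (down_TT lt) Hrk (md_le lt wf Adm R s x p HS k _)). }
    rewrite sat_psi1 in Hs; destruct Hs as [f [Hf [h [H1 [H2 H3]]]]]; apply (App_iff E2 om2 num2 HM2), HC2 in Hf as ->; exists h; auto. }
  destruct (Hmet 0) as [k0 [r0 [_ [Hr0 Hk0]]]]; destruct (Hk k0 r0 Hr0 Hk0) as [h0 [[Hh0 Hu0] [[Y [HY Hb]] _]]].
  apply (Baire_iff E2 om2 num2 HM2) in HY as ->; apply (fs_spec E2 om2 num2 HM2) in Hb.
  pose proof (num_om E2 om2 num2 HM2 (length s)) as Hl.
  destruct (ap_spec E2 om2 num2 HM2 _ _ _ _ Hb Hl) as [Hv _]; apply (m_om _ _ _ HM2) in Hv as [v Hv].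
  destruct (Hmet (S v)) as [k [r [Hkv [Hr Hrk]]]]; destruct (Hk k r Hr Hrk) as [h [[Hh _] [_ H]]]; apply Hu0 in Hh as ->.
  destruct (H (num2 (length s)) Hl) as [u [Hu [v' [Hv' Hle]]]]; [apply (Leq_num E2 om2 num2 HM2); auto|].
  destruct (Hfn om2 (fun v => eq_ind_r (fun z => E2 z om2) (num_om E2 om2 num2 HM2 _) (Hhs' v)) k) as [F1 F2].
  apply (App_iff E2 om2 num2 HM2), (func_pr E2 om2 num2 HM2 _ _ _ _ _ F1) in Hu as [_ [_ ->]].
  apply (App_iff E2 om2 num2 HM2), (func_pr E2 om2 num2 HM2 _ _ _ _ _ Hb) in Hv' as [_ [_ ->]].
  rewrite (F2 (length s) (0, k)), Hhs', Hv in Hle by (eapply md_val; eauto; apply nth_error_end).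
  apply (Leq_num E2 om2 num2 HM2) in Hle; simpl in Hle; lia.
Qed.

(** The value right after the stem is the pair [(a, b)], and limits are taken over [b] and then over
    [a]. All these reals have the same restriction to the stem, so a single set of Fin⊗Fin would
    contain infinitely many points in each of infinitely many columns. *)
Lemma factA3_true : T1 Adm -> Nm name G C (CN h3) -> cFunc C I' (fs om (pd E om om om)) -> factA3 E om I' A' C.
Proof.
  intros HT HC HCf η; apply NNPP; intros Hno.
  assert (Hchi : Chi E (@ex M) and or om (B3 E (@ex M) and or om) C η I' A').
  { intros i Hi; apply NNPP; intros Hn; apply Hno; exists i; split; auto; intros t Ht h [Hh Hu] [F [HF Hb]] HL; apply Hn.
    unfold inM, AlmostAll in HL; rewrite (let_om E om num HM) in HL; destruct HL as [m [Hm HL]].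
    exists t; split; auto; exists m; split; auto; exists (ap E om C i); split; [apply (App_iff E om num HM), (func_ap E om num HM _ _ _ _ HCf Hi)|].
    exists h; split; auto; split; auto; split; auto; exists F; split; auto; exists (pd E om om om); split; [apply (Omega2_iff E om num HM); auto|].
    exists (fq E om (pd E om om om)); split; auto; apply (FinSeqs_iff E om num HM); auto. }
  rewrite <- (sat_chi3 E om) in Hchi.
  destruct (ground_sat_chi body3 U M E name G om num g h3 η C I' A' HC HI' HA' Hchi) as [ηn [t [m [R [s [x [p [Hm [HS HF]]]]]]]]].
  set (cc := fun a b => md s x p (to_nat (a, b)) [(a, b)]).
  assert (Hle : forall a b, b <= to_nat (a, b)) by (intros a b; pose proof (to_nat_non_decreasing a b); lia).
  destruct (limit_limit lt wf tri tr Adm HI R s x p HS HT (fun a b => to_nat (a, b)) (fun a b => [(a, b)]) Hle) as [q [qa [Hq [Hqa [HP HPa]]]]].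
  destruct (second_model ηn t m x p h3 body3 HF q Hq (fun z => match z with inl N => Dpos qa q N | inr aN => Dpos (cc (fst aN)) (qa (fst aN)) (snd aN) end)
    (X := nat + nat * nat) ltac:(auto)) as
    [U2 [M2 [E2 [name2 [G2 [om2 [num2 [g2 [fn [hs [Hhs [Gq [HD [Hfn [η2 [t2 [C2 [xi [HC2 Hsat]]]]]]]]]]]]]]]]]]].
  { intros [N|[a N]]; [exact (Dpos_dense _ _ N HP)|exact (Dpos_dense (cc a) (qa a) N (HPa a))]. }
  pose proof (gx_m _ _ _ _ _ _ g2) as HM2.
  assert (Hmet := Dpos_met G2 qa q (G_dir g2) (ex_intro _ _ (conj Gq Hq)) (fun N => HD (inl N))).
  assert (Hmeta : forall N, exists a, N <= a /\ forall N', exists b r, N' <= b /\ G2 r /\ ale (proj1_sig r) (cc a b)).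
  { intros N; destruct (Hmet N) as [a [r [Ha [Hr Hra]]]]; exists a; split; auto.
    exact (Dpos_met G2 (cc a) (qa a) (G_dir g2) (ex_intro _ _ (conj Hr Hra)) (fun N => HD (inr (a, N)))). }
  assert (Hhs' : forall v, hs v = pr E2 om2 (num2 (fst v)) (num2 (snd v))).
  { intros v; eapply (Nm_uniq g2); [apply Hhs|]; apply (Nm_opn g2); apply (Nm_num g2). }
  assert (HZ : forall v, E2 (hs v) (pd E2 om2 om2 om2)).
  { intros v; rewrite Hhs'; apply (pd_om E2 om2 num2 HM2); eauto. }
  assert (Hk : forall a b (r : Pc), G2 r -> ale (proj1_sig r) (cc a b) ->
    exists h, (App E2 (@ex M2) and or η2 t2 h /\ forall h', App E2 (@ex M2) and or η2 t2 h' -> h' = h) /\ B3 E2 (@ex M2) and or om2 (fn (to_nat (a, b))) h (num2 m)).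
  { intros a b r Hr Hrk; destruct (Hsat (to_nat (a, b))) as [I2 [A2 Hs]].
    { exists r; split; auto; exact (ale_trans lt wf tr Adm TT _ _ _ (down_TT lt) Hrk (md_le lt wf Adm R s x p HS _ _)). }
    rewrite sat_psi3 in Hs; destruct Hs as [f [Hf [h [H1 [H2 H3]]]]]; apply (App_iff E2 om2 num2 HM2), HC2 in Hf as ->; exists h; auto. }
  destruct (Hmeta 0) as [a0 [_ Hb0]]; destruct (Hb0 0) as [b0 [r0 [_ [Hr0 Hk0]]]]; destruct (Hk a0 b0 r0 Hr0 Hk0) as [h0 [[Hh0 Hu0] [[F [HFF [O [HO [S0 [HS0 Hb]]]]]] _]]].
  apply (Omega2_iff E2 om2 num2 HM2) in HO as ->; apply (FinSeqs_iff E2 om2 num2 HM2) in HS0 as ->.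
  set (k0 := to_nat (a0, b0)); set (σ := rs E2 om2 (fn k0) (num2 (length s))).
  assert (Hfn' : forall k, Func E2 (@ex M2) and or (fn k) om2 (pd E2 om2 om2 om2)) by (intros k; apply (Hfn _ HZ)).
  assert (Hσ : E2 σ (fq E2 om2 (pd E2 om2 om2 om2))) by (apply (rs_fq E2 om2 num2 HM2), (fs_spec E2 om2 num2 HM2), Hfn').
  assert (Hsame : forall a b (r : Pc), G2 r -> ale (proj1_sig r) (cc a b) -> rs E2 om2 (fn (to_nat (a, b))) (num2 (length s)) = σ).
  { intros a b r Hr Hrk; pose proof (num_sub_om E2 om2 num2 HM2 (length s)) as Hsub.
    apply (func_num_ext E2 om2 num2 HM2 _ _ (length s) (pd E2 om2 om2 om2) (pd E2 om2 om2 om2)); [eapply (rs_func E2 om2 num2 HM2); eauto..|].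
    intros j Hj; unfold σ; rewrite !(rs_ap E2 om2 num2 HM2 _ _ _ _ _ (Hfn' _) Hsub) by (apply (num_E E2 om2 num2 HM2); auto).
    assert (exists v, nth_error s j = Some v) as [v Hv].
    { apply nth_error_Some in Hj; destruct (nth_error s j); [eauto|congruence]. }
    rewrite (proj2 (Hfn _ HZ (to_nat (a, b))) j v), (proj2 (Hfn _ HZ k0) j v); auto.
    - eapply md_val; [exact Hr0|exact Hk0|]; rewrite nth_error_app1; auto.
    - eapply md_val; [exact Hr|exact Hrk|]; rewrite nth_error_app1; auto. }
  destruct (ap_spec E2 om2 num2 HM2 _ _ _ _ Hb Hσ) as [Hc _]; set (c := ap E2 om2 h0 σ) in *.
  apply (FinFin_in E2 om2 num2 HM2 F c HFF) in Hc as [_ [N HN]].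
  destruct (Hmeta N) as [a [Ha Hba]]; destruct (HN a Ha) as [L HL].
  destruct (inj_avoid num2 L (num_inj E2 om2 num2 HM2)) as [N' HN'].
  destruct (Hba N') as [b [r [Hb' [Hr Hrk]]]]; apply (HN' b Hb'), HL.
  destruct (Hk a b r Hr Hrk) as [h [[Hh _] [_ H]]]; apply Hu0 in Hh as ->.
  pose proof (num_om E2 om2 num2 HM2 (length s)) as Hl.
  destruct (H (num2 (length s)) Hl) as [s' [Hs' [c' [Hc' [v [Hv Hin]]]]]]; [apply (Leq_num E2 om2 num2 HM2); auto|].
  apply (Restr_iff E2 om2 num2 HM2) in Hs' as ->; rewrite (Hsame a b r Hr Hrk) in Hc'.
  apply (App_iff E2 om2 num2 HM2), (func_pr E2 om2 num2 HM2 _ _ _ _ _ Hb) in Hc' as [_ [_ ->]].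
  apply (App_iff E2 om2 num2 HM2), (func_pr E2 om2 num2 HM2 _ _ _ _ _ (Hfn' _)) in Hv as [_ [_ ->]].
  rewrite (proj2 (Hfn _ HZ _) (length s) (a, b)), Hhs' in Hin; [exact Hin|].
  eapply md_val; [exact Hr|exact Hrk|apply nth_error_end].
Qed.

(** In one condition, four members of the system continue the stem by the four pairs of bits. The
    first bit is chosen against the common predictor and then the second, given the first; the
    member with these bits is mispredicted at two successive places. *)
Lemma factA2_true : Nm name G C (CN h2) -> cFunc C I' (fs om om) -> factA2 E om I' A' C.
Proof.
  intros HC HCf η; apply NNPP; intros Hno.
  assert (Hchi : Chi E (@ex M) and or om (B2 E (@ex M) and or om) C η I' A').
  { intros i Hi; apply NNPP; intros Hn; apply Hno; exists i; split; auto; intros t Ht h [Hh Hu] Hb HL; apply Hn.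
    unfold Predicts2, AlmostAll in HL; rewrite (let_om E om num HM) in HL; destruct HL as [m [Hm HL]].
    exists t; split; auto; exists m; split; auto; exists (ap E om C i); split; [apply (App_iff E om num HM), (func_ap E om num HM _ _ _ _ HCf Hi)|].
    exists h; split; auto; split; auto; split; auto. }
  rewrite <- (sat_chi2 E om) in Hchi.
  destruct (ground_sat_chi body2 U M E name G om num g h2 η C I' A' HC HI' HA' Hchi) as [ηn [t [m [R [s [x [p [Hm [HS HF]]]]]]]]].
  set (cc := fun a b : nat => md s x p (2 * a + b) [(a, 0); (b, 0)]).
  destruct (amalgam4 lt wf tr Adm R s x p HS [(0, 0); (0, 0)] [(0, 0); (1, 0)] [(1, 0); (0, 0)] [(1, 0); (1, 0)]) as [q [Q0 [Q1 [Q2 Q3]]]].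
  assert (Hq : ale q q) by (eapply ale_valid; exact Q0).
  assert (HQ : forall a b, a <= 1 -> b <= 1 -> ale q (cc a b)).
  { intros [|[|]] [|[|]] Ha Hb; try lia; assumption. }
  destruct (second_model ηn t m x p h2 body2 HF q Hq (fun (_ : nat) _ => True) cble_nat) as
    [U2 [M2 [E2 [name2 [G2 [om2 [num2 [g2 [fn [hs [Hhs [Gq [_ [Hfn [η2 [t2 [C2 [xi [HC2 Hsat]]]]]]]]]]]]]]]]]]].
  { intros _ p'; exists p'; auto. }
  pose proof (gx_m _ _ _ _ _ _ g2) as HM2.
  assert (Hhs' : forall v, hs v = num2 (if fst v =? 0 then 0 else 1)) by (intros v; apply (Nm_num_iff g2), Hhs).
  assert (HZ : forall v, E2 (hs v) om2) by (intros v; rewrite Hhs'; apply (num_om E2 om2 num2 HM2)).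
  assert (Hk : forall a b, a <= 1 -> b <= 1 ->
    exists h, (App E2 (@ex M2) and or η2 t2 h /\ forall h', App E2 (@ex M2) and or η2 t2 h' -> h' = h) /\ B2 E2 (@ex M2) and or om2 (fn (2 * a + b)) h (num2 m)).
  { intros a b Ha Hb; destruct (Hsat (2 * a + b)) as [I2 [A2 Hs]].
    { eexists; split; [exact Gq|]; exact (ale_trans lt wf tr Adm TT _ _ _ (down_TT lt) (HQ a b Ha Hb) (md_le lt wf Adm R s x p HS _ _)). }
    rewrite sat_psi2 in Hs; destruct Hs as [f [Hf [h [H1 [H2 H3]]]]]; apply (App_iff E2 om2 num2 HM2), HC2 in Hf as ->; exists h; auto. }
  destruct (Hk 0 0 ltac:(lia) ltac:(lia)) as [h0 [[Hh0 Hu0] [Hfun _]]].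
  assert (Hfn' : forall k, Func E2 (@ex M2) and or (fn k) om2 om2) by (intros k; apply (Hfn _ HZ)).
  assert (Hval : forall a b j v, a <= 1 -> b <= 1 -> nth_error (s ++ [(a, 0); (b, 0)]) j = Some v ->
    ap E2 om2 (fn (2 * a + b)) (num2 j) = num2 (if fst v =? 0 then 0 else 1)).
  { intros a b j v Ha Hb Hv; rewrite <- Hhs'; apply (proj2 (Hfn _ HZ _)); eapply md_val; [exact Gq|exact (HQ a b Ha Hb)|exact Hv]. }
  assert (Hsame : forall n a b a' b', a <= 1 -> b <= 1 -> a' <= 1 -> b' <= 1 ->
     (forall j, j < n -> exists v, nth_error (s ++ [(a, 0); (b, 0)]) j = Some v /\ nth_error (s ++ [(a', 0); (b', 0)]) j = Some v) ->
     rs E2 om2 (fn (2 * a + b)) (num2 n) = rs E2 om2 (fn (2 * a' + b')) (num2 n)).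
  { intros n a b a' b' Ha Hb Ha' Hb' Hj; pose proof (num_sub_om E2 om2 num2 HM2 n) as Hsub.
    apply (func_num_ext E2 om2 num2 HM2 _ _ n om2 om2); [eapply (rs_func E2 om2 num2 HM2); eauto..|].
    intros j Hjn; rewrite !(rs_ap E2 om2 num2 HM2 _ _ _ _ _ (Hfn' _) Hsub) by (apply (num_E E2 om2 num2 HM2); auto).
    destruct (Hj j Hjn) as [v [V1 V2]]; rewrite (Hval a b j v), (Hval a' b' j v); auto. }
  assert (Hpick : forall σ, exists a, a <= 1 /\ ~ App E2 (@ex M2) and or h0 σ (num2 a)).
  { intros σ; destruct (classic (App E2 (@ex M2) and or h0 σ (num2 0))) as [H0|H0]; [|exists 0; auto].
    exists 1; split; auto; intros H1; pose proof (Hfun _ _ _ H0 H1) as He; apply (num_inj E2 om2 num2 HM2) in He; discriminate. }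
  destruct (Hpick (rs E2 om2 (fn (2 * 0 + 0)) (num2 (length s)))) as [a [Ha Hna]].
  destruct (Hpick (rs E2 om2 (fn (2 * a + 0)) (num2 (S (length s))))) as [b [Hb Hnb]].
  rewrite (Hsame (length s) 0 0 a b) in Hna; try lia.
  2: { intros j Hj; assert (exists v, nth_error s j = Some v) as [v Hv] by (apply nth_error_Some in Hj; destruct (nth_error s j); [eauto|congruence]).
       exists v; rewrite !nth_error_app1 by auto; auto. }
  rewrite (Hsame (S (length s)) a 0 a b) in Hnb; try lia.
  2: { intros j Hj; destruct (Nat.eq_dec j (length s)) as [->|Hne]; [exists (a, 0); rewrite !nth_error_end; auto|].
       assert (exists v, nth_error s j = Some v) as [v Hv] by (assert (Hj' : j < length s) by lia; apply nth_error_Some in Hj'; destruct (nth_error s j); [eauto|congruence]).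
       exists v; rewrite !nth_error_app1 by lia; auto. }
  assert (Hbit : forall c, c <= 1 -> (if c =? 0 then 0 else 1) = c) by (intros [|[|]] Hc; auto; lia).
  assert (V1 : ap E2 om2 (fn (2 * a + b)) (num2 (length s)) = num2 a) by (rewrite (Hval a b _ (a, 0)) by auto using nth_error_end; simpl fst; rewrite Hbit; auto).
  assert (V2 : ap E2 om2 (fn (2 * a + b)) (num2 (S (length s))) = num2 b) by (rewrite (Hval a b _ (b, 0)) by auto using nth_error_end2; simpl fst; rewrite Hbit; auto).
  destruct (Hk a b Ha Hb) as [h [[Hh _] [_ H]]]; apply Hu0 in Hh as ->.
  pose proof (num_om E2 om2 num2 HM2 (length s)) as Hl.
  destruct (H (num2 (length s)) Hl) as [j [Hj1 [[e [He [e' [He' Hj2]]]] [σ [Hσ [v [Hv Hg]]]]]]]; [apply (Leq_num E2 om2 num2 HM2); auto|].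
  apply (Succ_num E2 om2 num2 HM2) in He as ->; apply (Succ_num E2 om2 num2 HM2) in He' as ->.
  apply (m_num _ _ _ HM2) in Hj2 as [k [Hk2 ->]]; apply (Leq_num E2 om2 num2 HM2) in Hj1.
  apply (Restr_iff E2 om2 num2 HM2) in Hσ as ->.
  apply (App_iff E2 om2 num2 HM2), (func_pr E2 om2 num2 HM2 _ _ _ _ _ (Hfn' _)) in Hv as [_ [_ ->]].
  assert (k = length s \/ k = S (length s)) as [->| ->] by lia.
  - rewrite V1 in Hg; auto.
  - rewrite V2 in Hg; auto.
Qed.
End Facts.

(** * Properties of families given by names *)

Definition famf (tail : fml) : fml := ∀ i ∈ 0, ∃ f, (∀ f', app 1 i f' ⇔ f' ≡ f) ∧ tail.
Definition Famf {M} (E : M -> M -> Prop) EX AND OR (T : M -> Prop) I' C := forall i, E i I' -> EX (fun f => AND (forall f', seqv AND (App E EX AND OR C i f') (f' = f)) (T f)).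

(** A filter is made to meet the dense sets of countably many indices only. So the property of the
    member [j] is verified in an extension chosen for [j], which shows that it is forced for every
    [j]. *)
Lemma fam_gen {T0} (ltT : T0 -> T0 -> Prop) (wfT : well_founded ltT) (triT : forall x y, ltT x y \/ x = y \/ ltT y x)
  (N : T0 -> Name) (tail : fml) (T : forall M : Type, (M -> M -> Prop) -> M -> Prop) (Ux : T0 -> Name -> Prop) {X} (Dx : T0 -> X -> Pc -> Prop) :
  (forall j, cnt (Ux j)) -> cble X -> (forall j z p, exists q, lep q p /\ Dx j z q) ->
  (forall M (E : M -> M -> Prop) e, sat E e (tail 4) = T M E (e 0)) ->
  (forall j U M (E : M -> M -> Prop) name G om num (g : gx U E name G om num) f, (forall u, Ux j u -> U u) -> U (N j) ->
    (forall z, exists p, G p /\ Dx j z p) -> Nm name G f (N j) -> T M E f) ->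
  forall U M (E : M -> M -> Prop) name G om num (g : gx U E name G om num) C I', Nm name G C (famN ltT wfT N) -> Nm name G I' (cks ltT wfT) ->
    Famf E (@ex M) and or (T M E) I' C.
Proof.
  intros HUx HX HD HT H U M E name G om num g C I' HC HI'.
  assert (Hs : sat E (en om [C; I']) (famf tail 2)).
  { apply (sat_names (gx_g _ _ _ _ _ _ g) _ om nset [C; I'] [famN ltT wfT N; cks ltT wfT]); [apply (gx_om _ _ _ _ _ _ g)|repeat constructor; auto|].
    destruct (G_ex g) as [p0 Hp0]; exists p0; split; auto.
    apply (all_ck ltT wfT (fun i => ∃ f, (∀ f', app 1 i f' ⇔ f' ≡ f) ∧ tail) 0 2); [lia|reflexivity|]; intros j q _.
    apply (forces_of_generic _ nset _ q (fun u => u = N j \/ u = famN ltT wfT N \/ Ux j u) (Dx j)); auto.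
    { repeat apply cnt_or; try apply cnt_one; auto. }
    clear U M E name G om num g C I' HC HI' p0 Hp0.
    intros U M E name G om num g HU Hq HDm md ms Hmd Hms.
    inversion Hms as [|i ? ms1 ? Hi Hms1]; subst; inversion Hms1 as [|C ? ms2 ? HC Hms2]; subst; inversion Hms2 as [|I' ? ms3 ? HI' Hms3]; subst; inversion Hms3; subst.
    change (rex (fun f => rand (forall f', seqv rand (App E rex rand ror C i f') (f' = f)) (sat E (scons f (en md [i; C; I'])) (tail 4)))).
    rewrite rex_eq, rand_eq, ror_eq.
    destruct (Nm_ex g (N j)) as [f Hf]; [apply HU; auto|]; exists f; rewrite HT; split.
    - intros f'; unfold seqv; rewrite (App_iff E om num (gx_m _ _ _ _ _ _ g)), (famN_pr g ltT wfT triT N C i f' j); auto.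
      split; [intros Hf'; exact (Nm_uniq g _ _ _ Hf' Hf)|intros ->; auto].
    - apply (H j U M E name G om num g f); auto. }
  assert (Hs' : forall i, E i I' -> rex (fun f => rand (forall f', seqv rand (App E rex rand ror C i f') (f' = f)) (sat E (scons f (scons i (en om [C; I']))) (tail 4)))) by exact Hs.
  rewrite rex_eq, rand_eq, ror_eq in Hs'; intros i Hi; destruct (Hs' i Hi) as [f [F1 F2]]; exists f; split; auto; rewrite HT in F2; exact F2.
Qed.
Lemma fam_true (h : nat * nat -> Name) (tail : fml) (T : forall M : Type, (M -> M -> Prop) -> M -> Prop) :
  (forall M (E : M -> M -> Prop) e, sat E e (tail 4) = T M E (e 0)) ->
  (forall U M (E : M -> M -> Prop) name G om num (g : gx U E name G om num) (hs : nat * nat -> M) f, (forall v, Nm name G (hs v) (h v)) ->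
    (forall Z, (forall v, E (hs v) Z) -> Func E (@ex M) and or f om Z /\ forall n, exists v, ap E om f (num n) = hs v) -> T M E f) ->
  forall U M (E : M -> M -> Prop) name G om num (g : gx U E name G om num) C I', Nm name G C (CN h) -> Nm name G I' (cks ltI wfI) ->
    Famf E (@ex M) and or (T M E) I' C.
Proof.
  intros HT H; apply (fam_gen ltI wfI triI (cN h) tail T (fun _ u => exists v, u = h v) longcoh); auto.
  - intros _; apply cnt_img; auto.
  - exact longcoh_dense.
  - intros j U M E name G om num g f HU UN HD Hf.
    assert (exists hs, forall v, Nm name G (hs v) (h v)) as [hs Hhs].
    { exists (fun v => epsilon (inhabits om) (fun y => Nm name G y (h v))); intros v.
      apply (epsilon_spec (inhabits om) (fun y => Nm name G y (h v))), (Nm_ex g), HU; eauto. }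
    apply (H U M E name G om num g hs f Hhs); intros Z HZ.
    destruct (cN_func g h hs Hhs j f Z) as [F1 F2]; auto; split; auto; intros n; destruct (cval_ex j n (HD n)) as [v Hv]; exists v; auto.
Qed.

Section Families.
Context {U : Name -> Prop} {M : Type} {E : M -> M -> Prop} {name : M -> Name} {G : Pc -> Prop} {om : M} {num : nat -> M}
  (g : gx U E name G om num) (C I' : M).
Let HM := gx_m _ _ _ _ _ _ g.
Context (HI' : Nm name G I' (cks ltI wfI)) (UI : U (cks ltI wfI)).
Local Notation cFunc := (Func E (@ex M) and or).
Lemma fam_func h T Y : U (CN h) -> Nm name G C (CN h) -> Famf E (@ex M) and or T I' C -> (forall f, T f -> E f Y) ->
  cFunc C I' Y /\ forall i, E i I' -> T (ap E om C i).
Proof.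
  intros UC HC HF HY.
  assert (H : cFunc C I' Y).
  { apply (Func_iff E om num HM); split.
    - intros z Hz; destruct (pair_elem g _ _ _ _ _ _ UC HC Hz) as [j [_ [i [f [_ [_ [Hi [_ ->]]]]]]]].
      assert (Hi' : E i I') by (apply (cks_elem g ltI wfI I' i UI HI'); eauto).
      exists i, f; split; auto; split; auto; destruct (HF i Hi') as [f0 [F1 F2]]; apply HY.
      apply (App_iff E om num HM), F1 in Hz as ->; auto.
    - intros i Hi; destruct (HF i Hi) as [f [F1 F2]]; exists f; split; auto; intros z; rewrite <- (App_iff E om num HM); apply F1. }
  split; auto; intros i Hi; destruct (HF i Hi) as [f [F1 F2]].
  pose proof (func_ap E om num HM _ _ _ _ H Hi) as Ha; apply (App_iff E om num HM), F1 in Ha; rewrite Ha; auto.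
Qed.

Lemma factC1_true : U (CN h1) -> Nm name G C (CN h1) -> cFunc C I' (fs E om om om).
Proof.
  intros UC HC; eapply fam_func with (T := fun f => exists Y, Baire E (@ex M) and or Y /\ E f Y); eauto.
  - apply (fam_true h1 (LET Y := baire IN 3 ∈ Y) (fun M E f => exists Y, Baire E (@ex M) and or Y /\ E f Y)) with (U := U) (name := name) (G := G) (om := om) (num := num); auto.
    + intros; rewrite <- rex_eq, <- rand_eq, <- ror_eq; reflexivity.
    + clear; intros U M E name G om num g hs f Hhs H; pose proof (gx_m _ _ _ _ _ _ g) as HM.
      exists (fs E om om om); split; [apply (Baire_iff E om num HM); auto|]; apply (fs_spec E om num HM), H.
      intros v; rewrite (proj1 (Nm_num_iff g _ _) (Hhs v)); apply (num_om E om num HM).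
  - intros f [Y [HY Hf]]; apply (Baire_iff E om num HM) in HY as ->; auto.
Qed.
Lemma factC3_true : U (CN h3) -> Nm name G C (CN h3) -> cFunc C I' (fs E om om (pd E om om om)).
Proof.
  intros UC HC; eapply fam_func with (T := fun f => exists Y, Seqs E (@ex M) and or (Omega2 E (@ex M) and or) Y /\ E f Y); eauto.
  - apply (fam_true h3 (LET Y := seqs omega2 IN 3 ∈ Y) (fun M E f => exists Y, Seqs E (@ex M) and or (Omega2 E (@ex M) and or) Y /\ E f Y)) with (U := U) (name := name) (G := G) (om := om) (num := num); auto.
    + intros; rewrite <- rex_eq, <- rand_eq, <- ror_eq; reflexivity.
    + clear; intros U M E name G om num g hs f Hhs H; pose proof (gx_m _ _ _ _ _ _ g) as HM.
      exists (fs E om om (pd E om om om)); split; [apply (Seqs_iff E om num HM _ _ (Omega2_iff E om num HM)); auto|]; apply (fs_spec E om num HM), H.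
      intros v; apply (pd_om E om num HM); exists (fst v), (snd v); eapply (Nm_uniq g); [apply Hhs|]; apply (Nm_opn g); apply (Nm_num g).
  - intros f [Y [HY Hf]]; apply (Seqs_iff E om num HM _ _ (Omega2_iff E om num HM)) in HY as ->; auto.
Qed.
Definition isTwo {M} (E : M -> M -> Prop) EX AND OR t : Prop := EX (fun z => AND (Empty E AND z) (EX (fun o => AND (Succ E AND OR z o) (Succ E AND OR o t)))).
Definition bits {M} (E : M -> M -> Prop) EX AND OR f : Prop := EX (fun Y => AND (AND (Baire E EX AND OR Y) (E f Y))
  (EX (fun t => AND (isTwo E EX AND OR t) (forall n v, App E EX AND OR f n v -> E v t)))).
Definition bitsf : fml := ∃ Y, (baire Y ∧ 3 ∈ Y) ∧ ∃ t, (LET z := empty IN LET o := succ z IN succ o t) ∧ ∀ n, ∀ v, app 3 n v ⇒ v ∈ t.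
Lemma factC2_true : U (CN h2) -> Nm name G C (CN h2) -> cFunc C I' (fs E om om om) /\ forall i n, E i I' -> E (ap E om (ap E om C i) (num n)) (num 2).
Proof.
  intros UC HC.
  assert (Htwo : forall M (E : M -> M -> Prop) om num, model E om num -> forall t, isTwo E (@ex M) and or t <-> t = num 2).
  { clear; intros M E om num HM t; unfold isTwo; rewrite (let_iff _ _ _ (Empty_num E om num HM)), (let_iff _ _ _ (Succ_num E om num HM 0)).
    apply (Succ_num E om num HM). }
  assert (Hb : forall M (E : M -> M -> Prop) om num, model E om num -> forall f, bits E (@ex M) and or f <-> E f (fs E om om om) /\ forall n v, App E (@ex M) and or f n v -> E v (num 2)).
  { clear -Htwo; intros M E om num HM f; unfold bits; split.
    - intros [Y [[HY Hf] [t [Ht H]]]]; apply (Baire_iff E om num HM) in HY as ->; apply (Htwo M E om num HM) in Ht as ->; auto.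
    - intros [Hf H]; exists (fs E om om om); split; [split; auto; apply (Baire_iff E om num HM); auto|]; exists (num 2); split; auto; apply (Htwo M E om num HM); auto. }
  destruct (fam_func h2 (bits E (@ex M) and or) (fs E om om om) UC HC) as [H1 H2].
  - apply (fam_true h2 bitsf (fun M E f => bits E (@ex M) and or f)) with (U := U) (name := name) (G := G) (om := om) (num := num); auto.
    + intros; unfold bits, isTwo; rewrite <- rex_eq, <- rand_eq, <- ror_eq; reflexivity.
    + clear -Hb; intros U M E name G om num g hs f Hhs H; pose proof (gx_m _ _ _ _ _ _ g) as HM.
      assert (Hhs' : forall v, hs v = num (if fst v =? 0 then 0 else 1)) by (intros v; apply (Nm_num_iff g), Hhs).
      destruct (H (num 2)) as [F1 F2].
      { intros v; rewrite Hhs'; apply (num_E E om num HM); destruct (fst v =? 0); lia. }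
      destruct (H om) as [F3 _]; [intros v; rewrite Hhs'; apply (num_om E om num HM)|].
      apply (Hb M E om num HM); split; [apply (fs_spec E om num HM); auto|].
      intros n v Hv; apply (App_iff E om num HM), (func_pr E om num HM _ _ _ _ _ F1) in Hv; tauto.
  - intros f Hf; apply (Hb M E om num HM) in Hf; tauto.
  - split; auto; intros i n Hi; pose proof (H2 i Hi) as Hbi; apply (Hb M E om num HM) in Hbi as [Hf Hbi]; apply (fs_spec E om num HM) in Hf.
    apply (Hbi (num n)), (App_iff E om num HM), (func_ap E om num HM _ _ _ _ Hf), (num_om E om num HM).
Qed.
End Families.

(** * Slaloms from the generic items *)

Section Capture.
(* [fl] selects the ideal [M] on [omega * omega] ([true]) or [K] on [Delta] ([false]); a point [(a, b)] following the
   sequence [s] is captured in the form [(th s a, b)]. *)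
Context (fl : bool) (th : list (nat * nat) -> nat -> nat).
Context (th_le : forall s a, a <= th s a) (th_K : fl = false -> forall s a, th s a = a).
Context (Hadm : forall s a b s' a' b', (fl = false -> b <= a) -> (length s < length s' -> nth_error s' (length s) = Some (a, b)) ->
  Adm (length s) (th s a, b) (length s') (th s' a', b')).

Definition fw (w : W) (s : list (nat * nat)) : Name := nm (nat * nat) h3
  (fun x p => (fl = false -> snd x <= fst x) /\ Good (iv (co (proj1_sig p) w)) (iF (co (proj1_sig p) w)) (length s) (th s (fst x), snd x)).
Definition ln (s : list (nat * nat)) : Name := nm nat (fun k => opn (nn k) (h3 (nth k s (0, 0)))) (fun k _ => k < length s).
Definition dn (s : list (nat * nat)) : Name := if fl then ln s else nn (length s).
Definition ph (w : W) : Name := nm (list (nat * nat)) (fun s => opn (dn s) (fw w s)) (fun _ _ => True).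
Definition longiv (w : W) (n : nat) (p : Pc) := n < length (iv (co (proj1_sig p) w)).
Lemma longiv_dense w n p : exists q, lep q p /\ longiv w n q.
Proof.
  destruct (levels_dense lt wf tr Adm (proj1_sig p) w (S n) (proj2_sig p)) as [q [Hq Hl]]; exists (mkP _ _ Hq); auto.
Qed.
Definition UW (w : W) (u : Name) := (exists s, u = fw w s) \/ (exists s, u = dn s) \/ (exists s, u = ln s).
Lemma UW_cnt w : cnt (UW w).
Proof. unfold UW; repeat apply cnt_or; apply cnt_img; auto. Qed.

Lemma mem_item p w : okitem Adm (K lt wf Adm w) (co (proj1_sig (p : Pc)) w).
Proof. destruct p as [p Hp]; apply Hp; exact Logic.I. Qed.
Lemma lep_item (q p : Pc) w : lep q p -> itemle (K lt wf Adm w) (proj1_sig q) (co (proj1_sig q) w) (co (proj1_sig p) w).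
Proof. intros H; apply H; exact Logic.I. Qed.

Section InModel2.
Context {U : Name -> Prop} {M : Type} {E : M -> M -> Prop} {name : M -> Name} {G : Pc -> Prop} {om : M} {num : nat -> M}
  (g : gx U E name G om num).
Local Notation Nm := (Nm name G).
Local Notation pr := (pr E om).
Local Notation ap := (ap E om).
Local Notation fq := (fq E om).
Local Notation Om2 := (pd E om om om).
Local Notation cFunc := (Func E (@ex M) and or).
Let HM := gx_m _ _ _ _ _ _ g.
Definition vl (v : nat * nat) := pr (num (fst v)) (num (snd v)).
Lemma Nm_h3 v x : Nm x (h3 v) <-> x = vl v.
Proof.
  assert (H : Nm (vl v) (h3 v)) by (apply (Nm_opn g); apply (Nm_num g)).
  split; [intros Hx; exact (Nm_uniq g _ _ _ Hx H)|intros ->; auto].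
Qed.
Lemma vl_inj v v' : vl v = vl v' -> v = v'.
Proof.
  intros H; apply (pr_inj E om num HM) in H as [H1 H2]; apply (num_inj E om num HM) in H1, H2; destruct v, v'; simpl in *; congruence.
Qed.

Section Seq.
Context (s : list (nat * nat)) (x : M) (HU : U (ln s)) (Hx : Nm x (ln s)).
Lemma ln_pr u v : E (pr u v) x <-> exists k, k < length s /\ u = num k /\ v = vl (nth k s (0, 0)).
Proof.
  unfold ln in *; rewrite (pair_iff g _ _ _ _ _ _ _ HU Hx); split.
  - intros [k [t [_ [Hk [H1 H2]]]]]; exists k; split; auto; split; [apply (Nm_num_iff g), H1|apply Nm_h3, H2].
  - intros [k [Hk [-> ->]]]; destruct (G_ex g) as [p Hp]; exists k, p; split; auto; split; auto; split; [apply (Nm_num g)|apply Nm_h3; auto].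
Qed.
Lemma vl_Om2 v : E (vl v) Om2.
Proof. apply (pd_om E om num HM); exists (fst v), (snd v); auto. Qed.
Lemma ln_func : cFunc x (num (length s)) Om2.
Proof.
  apply (Func_iff E om num HM); split.
  - intros z Hz; destruct (pair_elem g _ _ _ _ _ _ HU Hx Hz) as [_ [_ [u [v [_ [_ [_ [_ ->]]]]]]]].
    apply ln_pr in Hz as [k [Hk [-> ->]]]; exists (num k), (vl (nth k s (0, 0))); split; [apply (num_E E om num HM); auto|split; auto; apply vl_Om2].
  - intros u Hu; apply (m_num _ _ _ HM) in Hu as [k [Hk ->]]; exists (vl (nth k s (0, 0))); split; [apply vl_Om2|].
    intros z; rewrite ln_pr; split; [|intros ->; eauto].
    intros [k' [_ [He ->]]]; apply (num_inj E om num HM) in He as ->; auto.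
Qed.
Lemma ln_ap k : k < length s -> ap x (num k) = vl (nth k s (0, 0)).
Proof.
  intros Hk; symmetry; assert (H : E (pr (num k) (vl (nth k s (0, 0)))) x) by (apply ln_pr; eauto).
  apply (func_pr E om num HM _ _ _ _ _ ln_func) in H; tauto.
Qed.
End Seq.

Context (HUs : forall s, U (ln s)).
Lemma ln_of f n X : cFunc f (num n) X -> (forall k, k < n -> exists v, ap f (num k) = vl v) ->
  exists s, length s = n /\ (forall k, k < n -> ap f (num k) = vl (nth k s (0, 0))) /\ Nm f (ln s).
Proof.
  intros Hf Hv; assert (exists s, length s = n /\ forall k, k < n -> ap f (num k) = vl (nth k s (0, 0))) as [s [Hl Hs]].
  { assert (forall m, m <= n -> exists s, length s = m /\ forall k, k < m -> ap f (num k) = vl (nth k s (0, 0))) as H; [|apply (H n); auto].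
    induction m as [|m IH]; intros Hm; [exists []; split; auto; intros; lia|].
    destruct IH as [s [Hl Hs]]; [lia|]; destruct (Hv m) as [v Hvm]; [lia|]; exists (s ++ [v]); rewrite length_app, Hl; split; [simpl; lia|].
    intros k Hk; destruct (Nat.eq_dec k m) as [->|Hne]; [rewrite <- Hl at 2; rewrite nth_middle; auto|].
    rewrite app_nth1 by lia; apply Hs; lia. }
  exists s; split; auto; split; auto; destruct (Nm_ex g (ln s) (HUs s)) as [x Hx].
  assert (f = x) as ->; auto; subst n; apply (func_num_ext E om num HM _ _ _ _ _ Hf (ln_func s x (HUs s) Hx)).
  intros k Hk; rewrite (ln_ap s x (HUs s) Hx k Hk); auto.
Qed.
Lemma ln_inj x s s' : Nm x (ln s) -> Nm x (ln s') -> s = s'.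
Proof.
  intros H H'; pose proof (ln_func s x (HUs s) H) as F; pose proof (ln_func s' x (HUs s') H') as F'.
  pose proof (func_dom E om num HM _ _ _ _ F F') as Hl; apply (num_inj E om num HM) in Hl.
  apply (nth_ext _ _ (0, 0) (0, 0) Hl); intros k Hk; apply vl_inj.
  rewrite <- (ln_ap s x (HUs s) H k Hk), <- (ln_ap s' x (HUs s') H' k) by lia; auto.
Qed.

Definition dmv := if fl then fq Om2 else om.
(** For [K] the index remembers only the length of [s], and [fw] depends on no more, since [th s] is
    then the identity. *)
Lemma dn_inj w x s s' : Nm x (dn s) -> Nm x (dn s') -> fw w s = fw w s'.
Proof.
  unfold dn; destruct fl eqn:Hfl; intros H H'; [rewrite (ln_inj x s s' H H'); auto|].
  apply (Nm_num_iff g) in H, H'; rewrite H in H'; apply (num_inj E om num HM) in H'; unfold fw; rewrite H'; f_equal.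
  extensionality y; extensionality p; rewrite !th_K by auto; auto.
Qed.
Lemma dn_dm x : E x dmv <-> exists s, Nm x (dn s).
Proof.
  unfold dmv, dn; destruct fl.
  - rewrite (fq_in E om num HM); split.
    + intros [n Hf]; destruct (ln_of x n Om2 Hf) as [s [_ [_ Hs]]]; eauto.
      intros k Hk; destruct (ap_spec E om num HM _ _ _ (num k) Hf) as [H1 _]; [apply (num_E E om num HM); auto|].
      apply (pd_om E om num HM) in H1 as [a [b ->]]; exists (a, b); auto.
    + intros [s Hs]; exists (length s); apply ln_func; auto.
  - rewrite (m_om _ _ _ HM); split.
    + intros [n ->]; exists (repeat (0, 0) n); rewrite repeat_length; apply (Nm_num g).
    + intros [s Hs]; apply (Nm_num_iff g) in Hs; eauto.
Qed.

Context (w : W) (HUw : forall u, UW w u -> U u).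
Lemma fw_pr s c z : Nm c (fw w s) -> E z c <-> exists v (p : Pc), G p /\ z = vl v /\ (fl = false -> snd v <= fst v) /\
  Good (iv (co (proj1_sig p) w)) (iF (co (proj1_sig p) w)) (length s) (th s (fst v), snd v).
Proof.
  intros Hc; assert (HU : U (fw w s)) by (apply HUw; left; eauto); unfold fw in *; rewrite (elem_iff g _ _ _ _ _ HU Hc); split.
  - intros [v [p [Hp [[H1 H2] Hz]]]]; apply Nm_h3 in Hz as ->; exists v, p; auto.
  - intros [v [p [Hp [-> [H1 H2]]]]]; exists v, p; split; auto; split; auto; apply Nm_h3; auto.
Qed.
Context (HD : forall n, exists p, G p /\ longiv w n p).
(** Conditions of the filter agree on the levels that they have; one without level [l] shows the
    default 0 there, which is below the settled value [V]. *)
Lemma level_val l : exists V, (forall p : Pc, G p -> nth l (iv (co (proj1_sig p) w)) 0 <= V) /\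
  forall L, (forall q, In q L -> G q) -> exists p : Pc, G p /\ (forall q, In q L -> lep p q) /\ nth l (iv (co (proj1_sig p) w)) 0 = V.
Proof.
  destruct (HD l) as [p0 [Hp0 Hl]]; exists (nth l (iv (co (proj1_sig p0) w)) 0); split.
  - intros p Hp; destruct (G_dir g p p0 Hp Hp0) as [r [_ [R1 R2]]]; apply (lep_item _ _ w) in R1 as [R1 _], R2 as [R2 _].
    rewrite <- (prefix_nth _ _ _ _ R2) by exact Hl; destruct (le_lt_dec (length (iv (co (proj1_sig p) w))) l); [rewrite (nth_overflow (iv (co (proj1_sig p) w))) by auto; lia|].
    rewrite (prefix_nth _ _ _ _ R1) by auto; auto.
  - induction L as [|q L IH]; intros HL; [exists p0; split; auto; split; auto; intros q []|].
    destruct IH as [p [Hp [H1 H2]]]; [intros; apply HL; right; auto|].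
    destruct (G_dir g q p (HL q (or_introl eq_refl)) Hp) as [r [Hr [R1 R2]]]; destruct (G_dir g r p0 Hr Hp0) as [r' [Hr' [R3 R4]]].
    exists r'; split; auto; split.
    + intros q' [<-|Hq']; [exact (lep_trans r' r q R3 R1)|]; apply (lep_trans r' r q' R3), (lep_trans r p q' R2); auto.
    + apply (lep_item _ _ w) in R4 as [R4 _]; rewrite (prefix_nth _ _ _ _ R4); auto.
Qed.
(** Let [V] be the settled bound of the level. For [a] from [V] on, [th s a] is at least [V], so the
    points of column [a] are captured only as members of [iF]; finitely many of them occur in the
    item of one condition, where [bnd] allows at most [V]. *)
Lemma fw_ed s c : Nm c (fw w s) -> edp E om num c.
Proof.
  intros Hc; destruct (level_val (length s)) as [V [V1 V2]]; exists V, V; intros a Ha.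
  destruct (bounded_list E (sct E om c (num a)) V) as [L [_ [H1 H2]]].
  - intros L HL Hin.
    assert (exists bs (ps : list Pc), L = map num bs /\ (forall p, In p ps -> G p) /\ forall b, In b bs -> exists p, In p ps /\ In (length s, th s a, b) (iF (co (proj1_sig p) w))) as [bs [ps [-> [Hps Hbs]]]].
    { clear HL; induction L as [|z L IH]; [exists [], []; split; auto; split; intros ? []|].
      destruct IH as [bs [ps [-> [Hps Hbs]]]]; [intros; apply Hin; right; auto|].
      pose proof (Hin z (or_introl eq_refl)) as Hz; apply (sct_in E om num HM), (fw_pr s c) in Hz as [[a' b] [p [Hp [He [_ Hg]]]]]; auto.
      apply (pr_inj E om num HM) in He as [He ->]; apply (num_inj E om num HM) in He; simpl in He, Hg; subst a'.
      exists (b :: bs), (p :: ps); split; auto; split; [intros q [<-|Hq]; auto|].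
      intros b' [<-|Hb']; [exists p; split; [left; auto|]|destruct (Hbs b' Hb') as [q [Hq Hq']]; exists q; split; auto; right; auto].
      destruct Hg as [Hg|Hg]; auto; simpl in Hg; pose proof (V1 p Hp); pose proof (th_le s a); lia. }
    destruct (V2 ps Hps) as [p [Hp [Hle <-]]]; rewrite length_map; apply (proj1 (mem_item p w) (length s) (th s a)).
    + exact (NoDup_map_inv _ _ HL).
    + intros b Hb; destruct (Hbs b Hb) as [q [Hq Hin']]; apply (lep_item _ _ w (Hle q Hq)); auto.
  - exists L; split; auto; intros z Hz; apply H1, (sct_in E om num HM); auto.
Qed.
Context (φ : M) (HUφ : U (ph w)) (Hφ : Nm φ (ph w)).
Lemma ph_pr x c : E (pr x c) φ <-> exists s, Nm x (dn s) /\ Nm c (fw w s).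
Proof.
  unfold ph in *; rewrite (pair_iff g _ _ _ _ _ _ _ HUφ Hφ); split; [intros [s [_ [_ [_ H]]]]; eauto|].
  intros [s H]; destruct (G_ex g) as [p Hp]; exists s, p; auto.
Qed.
Lemma ph_func i0 : (forall c, E c i0 <-> (if fl then Sub E c Om2 else forall d, Delta_ E (@ex M) and or d -> Sub E c d) /\ edp E om num c) ->
  cFunc φ dmv i0.
Proof.
  intros Hi.
  assert (Hc : forall s c, Nm c (fw w s) -> E c i0).
  { intros s c Hc; apply Hi; split; [|eapply fw_ed; eauto]; pose proof (fun z => fw_pr s c z Hc) as Hz; destruct fl.
    - intros z Hz'; apply Hz in Hz' as [v [_ [_ [-> _]]]]; apply vl_Om2.
    - intros d Hd z Hz'; apply Hz in Hz' as [v [_ [_ [-> [Hv _]]]]]; apply (Delta_in E om num HM _ _ Hd); exists (fst v), (snd v); auto. }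
  apply (Func_iff E om num HM); split.
  - intros z Hz; destruct (pair_elem g _ _ _ _ _ _ HUφ Hφ Hz) as [s [_ [x [c [_ [_ [Hx [Hcs ->]]]]]]]].
    exists x, c; split; [apply dn_dm; eauto|split; eauto].
  - intros x Hx; apply dn_dm in Hx as [s Hs]; destruct (Nm_ex g (fw w s)) as [c Hcs]; [apply HUw; left; eauto|].
    exists c; split; eauto; intros z; rewrite ph_pr; split; [|intros ->; eauto].
    intros [s' [Hs' Hz]]; rewrite (dn_inj w x s' s Hs' Hs) in Hz; exact (Nm_uniq g _ _ _ Hz Hcs).
Qed.
End InModel2.

Definition phtail : fml := if fl then LET O := omega2 IN LET S := fin_seqs O IN LET i := ED IN func 3 S i
  else LET w := omega IN LET i := EDfin IN func 3 w i.
Definition Phtail {M} (E : M -> M -> Prop) EX AND OR f := if fl then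
    EX (fun O => AND (Omega2 E EX AND OR O) (EX (fun S => AND (FinSeqs E EX AND OR O S) (EX (fun i => AND (ED_ E EX AND OR i) (Func E EX AND OR f S i))))))
  else EX (fun w => AND (Omega E EX AND OR w) (EX (fun i => AND (EDfin_ E EX AND OR i) (Func E EX AND OR f w i)))).
Definition PHI : Name := famN lt wf ph.

Section PhiFacts.
Context {U : Name -> Prop} {M : Type} {E : M -> M -> Prop} {name : M -> Name} {G : Pc -> Prop} {om : M} {num : nat -> M}
  (g : gx U E name G om num) (F W' : M) (HF : Nm name G F PHI) (HW : Nm name G W' (cks lt wf)).
Let HM := gx_m _ _ _ _ _ _ g.
Lemma ph_fam : Famf E (@ex M) and or (Phtail E (@ex M) and or) W' F.
Proof.
  apply (fam_gen lt wf tri ph phtail (fun M E f => Phtail E (@ex M) and or f) UW longiv) with (U := U) (name := name) (G := G) (om := om) (num := num); auto.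
  - exact UW_cnt.
  - intros j z p; apply longiv_dense.
  - intros; unfold Phtail, phtail; destruct fl; rewrite <- rex_eq, <- rand_eq, <- ror_eq; reflexivity.
  - intros w U2 M2 E2 name2 G2 om2 num2 g2 φ HU Uph HD Hφ; pose proof (gx_m _ _ _ _ _ _ g2) as HM2.
    assert (HUs : forall s, U2 (ln s)) by (intros s; apply HU; right; right; eauto).
    pose proof (ph_func g2 HUs w HU HD φ Uph Hφ) as HP; unfold Phtail, dmv in *; destruct fl.
    + exists (pd E2 om2 om2 om2); split; [apply (Omega2_iff E2 om2 num2 HM2); auto|]; eexists; split; [apply (FinSeqs_iff E2 om2 num2 HM2); auto|].
      destruct (ED_ex E2 om2 num2 HM2) as [i Hi]; exists i; split; auto; apply HP; intros c; rewrite (ED_in E2 om2 num2 HM2 i c Hi); tauto.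
    + exists om2; split; [apply (Omega_iff E2 om2 num2 HM2); auto|]; destruct (EDfin_ex E2 om2 num2 HM2) as [i Hi], (Delta_ex E2 om2 num2 HM2) as [d Hd].
      exists i; split; auto; apply HP; intros c; rewrite (EDfin_in E2 om2 num2 HM2 i c d Hd Hi); split; intros [H1 H2]; split; auto.
      intros d' Hd'; rewrite (proj1 (Delta_iff E2 om2 num2 HM2 d') Hd'), <- (proj1 (Delta_iff E2 om2 num2 HM2 d) Hd); auto.
Qed.
Lemma factPHI_M i0 : fl = true -> ED_ E (@ex M) and or i0 -> factPHI E i0 (fq E om (pd E om om om)) W' F.
Proof.
  intros Hfl Hi w Hw; destruct (ph_fam w Hw) as [φ [H1 H2]]; exists φ; split; [exact H1|].
  unfold Phtail in H2; rewrite Hfl in H2; destruct H2 as [O [HO [S [HS [i [Hi' Hf]]]]]].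
  apply (Omega2_iff E om num HM) in HO as ->; apply (FinSeqs_iff E om num HM) in HS as ->; rewrite (setof_unique E om num HM _ _ _ Hi Hi'); auto.
Qed.
Lemma factPHI_K i0 : fl = false -> EDfin_ E (@ex M) and or i0 -> factPHI E i0 om W' F.
Proof.
  intros Hfl Hi w Hw; destruct (ph_fam w Hw) as [φ [H1 H2]]; exists φ; split; [exact H1|].
  unfold Phtail in H2; rewrite Hfl in H2; destruct H2 as [w0 [HO [i [Hi' Hf]]]].
  apply (Omega_iff E om num HM) in HO as ->; rewrite (setof_unique E om num HM _ _ _ Hi Hi'); auto.
Qed.
End PhiFacts.

(** * Capturing families of sequences *)

Section Names.
Context {T0 : Type} (ltT : T0 -> T0 -> Prop) (wfT : well_founded ltT) (triT : forall x y, ltT x y \/ x = y \/ ltT y x).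
Context (HBd : forall F : T0 -> nat -> nat -> list W, exists u, forall t l k w, In w (F t l k) -> lt w u).

Definition funf : fml := LET Y := (if fl then seqs omega2 else seqs Delta) IN func 0 1 Y.
Definition Funf {M} (E : M -> M -> Prop) EX AND OR Z T' := EX (fun Y => AND ((if fl then Seqs E EX AND OR (Omega2 E EX AND OR) Y else Seqs E EX AND OR (Delta_ E EX AND OR) Y)) (Func E EX AND OR Z T' Y)).
Definition valf : fml := ∃ f, app 0 1 f ∧ app 4 2 3.

Lemma Funf_elim {M} (E : M -> M -> Prop) om num (HM : model E om num) Z T' : Funf E (@ex M) and or Z T' ->
  exists x0, (forall z, E z x0 -> exists v, z = @vl M E om num v /\ (fl = false -> snd v <= fst v)) /\ Func E (@ex M) and or Z T' (fs E om om x0).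
Proof.
  unfold Funf; destruct fl.
  - intros [Y [HY H]]; apply (Seqs_iff E om num HM _ _ (Omega2_iff E om num HM)) in HY as ->; exists (pd E om om om); split; auto.
    intros z Hz; apply (pd_om E om num HM) in Hz as [a [b ->]]; exists (a, b); split; [auto|discriminate].
  - intros [Y [HY H]]; destruct (Delta_ex E om num HM) as [d Hd].
    assert (Hd' : forall x, Delta_ E (@ex M) and or x <-> x = d).
    { intros x; split; [|intros ->; auto]; intros Hx; exact (setof_unique E om num HM _ _ _ Hx Hd). }
    apply (Seqs_iff E om num HM _ _ Hd') in HY as ->; exists d; split; auto.
    intros z Hz; apply (Delta_in E om num HM _ _ Hd) in Hz as [a [b [Hab ->]]]; exists (a, b); auto.
Qed.

Section ValSat.
Context {U : Name -> Prop} {M : Type} {E : M -> M -> Prop} {name : M -> Name} {G : Pc -> Prop} {om : M} {num : nat -> M}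
  (g : gx U E name G om num) (Z T' t' : M) (Zn : Name) (t : T0).
Context (HZ : Nm name G Z Zn) (UT : U (cks ltT wfT)) (HT : Nm name G T' (cks ltT wfT)) (Ht : Nm name G t' (ck ltT wfT t)).
Let HM := gx_m _ _ _ _ _ _ g.
Context (x0 : M) (HZf : Func E (@ex M) and or Z T' (fs E om om x0)).
Lemma t_in : E t' T'.
Proof. apply (cks_elem g ltT wfT T' t' UT HT); eauto. Qed.
Lemma Zt_func : Func E (@ex M) and or (ap E om Z t') om x0.
Proof. apply (fs_spec E om num HM), (ap_spec E om num HM _ _ _ _ HZf t_in). Qed.
Lemma val_sat j v : (exists st, G st /\ forces (valf 4) (en nset [h3 v; nn j; ck ltT wfT t; Zn]) st) <-> ap E om (ap E om Z t') (num j) = @vl M E om num v.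
Proof.
  rewrite <- (sat_names (gx_g _ _ _ _ _ _ g) (valf 4) om nset [@vl M E om num v; num j; t'; Z] [h3 v; nn j; ck ltT wfT t; Zn]).
  2: apply (gx_om _ _ _ _ _ _ g). 2: { repeat constructor; auto; [apply (Nm_h3 g); auto|apply (Nm_num g)]. }
  assert (Hs : sat E (en om [@vl M E om num v; num j; t'; Z]) (valf 4) =
    exists f, App E (@ex M) and or Z t' f /\ App E (@ex M) and or f (num j) (@vl M E om num v)).
  { rewrite <- rex_eq, <- rand_eq, <- ror_eq; reflexivity. }
  rewrite Hs, (App_let E om num HM _ _ _ _ _ HZf t_in), (App_iff E om num HM).
  rewrite (proj2 (ap_spec E om num HM _ _ _ (num j) Zt_func (num_om E om num HM j))); split; auto.
Qed.
End ValSat.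

Section Ground.
Context (Zn : Name) (p0 : Pc) (Hp0 : forces (funf 2) (en nset [cks ltT wfT; Zn]) p0).
Definition vals (t : T0) (st : Pc) (zs : list (nat * nat)) := forall j v, nth_error zs j = Some v -> forces (valf 4) (en nset [h3 v; nn j; ck ltT wfT t; Zn]) st.
Lemma fun_sat {U M} {E : M -> M -> Prop} {name G om num} (g : gx U E name G om num) Z T' : G p0 -> Nm name G Z Zn -> Nm name G T' (cks ltT wfT) ->
  exists x0, (forall z, E z x0 -> exists v, z = @vl M E om num v /\ (fl = false -> snd v <= fst v)) /\ Func E (@ex M) and or Z T' (fs E om om x0).
Proof.
  intros HG HZ HT; apply (Funf_elim E om num (gx_m _ _ _ _ _ _ g)).
  assert (Hs : sat E (en om [T'; Z]) (funf 2) = Funf E (@ex M) and or Z T').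
  { unfold Funf, funf; destruct fl; rewrite <- rex_eq, <- rand_eq, <- ?ror_eq; reflexivity. }
  rewrite <- Hs; apply (sat_names (gx_g _ _ _ _ _ _ g) (funf 2) om nset [T'; Z] [cks ltT wfT; Zn]); [apply (gx_om _ _ _ _ _ _ g)|repeat constructor; auto|eauto].
Qed.
Lemma vals_unique t st zs zs' j v v' : lep st p0 -> vals t st zs -> vals t st zs' -> nth_error zs j = Some v -> nth_error zs' j = Some v' ->
  v = v' /\ (fl = false -> snd v <= fst v).
Proof.
  intros Hst H H' Hv Hv'.
  destruct (gx_exists st (fun u => u = Zn \/ u = cks ltT wfT \/ u = ck ltT wfT t) (fun (_ : nat) _ => True)) as
    [U [M [E [name [G [om [num [g [HU [HG _]]]]]]]]]]; auto.
  { repeat apply cnt_or; apply cnt_one. }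
  { intros _ p; exists p; auto. }
  destruct (Nm_ex g Zn) as [Z HZ]; auto; destruct (Nm_ex g (cks ltT wfT)) as [T' HT]; auto; destruct (Nm_ex g (ck ltT wfT t)) as [t' Ht]; auto.
  destruct (fun_sat g Z T' (G_up g st p0 HG Hst) HZ HT) as [x0 [X1 X2]].
  pose proof (proj1 (val_sat g Z T' t' Zn t HZ (HU (cks ltT wfT) ltac:(auto)) HT Ht x0 X2 j v) (ex_intro _ st (conj HG (H j v Hv)))) as V1.
  pose proof (proj1 (val_sat g Z T' t' Zn t HZ (HU (cks ltT wfT) ltac:(auto)) HT Ht x0 X2 j v') (ex_intro _ st (conj HG (H' j v' Hv')))) as V2.
  assert (v = v') as <- by (apply (vl_inj g); congruence); split; auto.
  pose proof (Zt_func g Z T' t' t (HU (cks ltT wfT) ltac:(auto)) HT Ht x0 X2) as Hf.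
  destruct (ap_spec E om num (gx_m _ _ _ _ _ _ g) _ _ _ (num j) Hf (num_om E om num (gx_m _ _ _ _ _ _ g) j)) as [Hx _].
  destruct (X1 _ Hx) as [u [Hu Hle]]; rewrite V1 in Hu; apply (vl_inj g) in Hu as <-; auto.
Qed.
(** The condition decides the sequence with index [t] up to place [l] included: through [th], the
    coded value at [l] depends on all earlier values. *)
Definition Ob (t : T0) (l : nat) (u : nat * nat) (c : cond) := exists st : Pc, proj1_sig st = c /\ lep st p0 /\
  exists zl a b, length zl = l /\ u = (th zl a, b) /\ vals t st (zl ++ [(a, b)]).

Lemma vals_down t st st' zs : vals t st zs -> lep st' st -> vals t st' zs.
Proof. intros H Hl j v Hv; exact (forces_down _ _ _ _ (H j v Hv) Hl). Qed.

(** Each code uses countably many conditions of finite support, and [HBd] puts the supports of all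
    the codes below one [u]. Conditions of a code that are compatible below [u] are then compatible,
    by truncation, so the values they decide agree. *)
Lemma codes : exists (u : W) (y : T0 -> @code I W), (forall t, oky Adm (K lt wf Adm u) (y t)) /\
  (forall t l k (r : Pc), ale (proj1_sig r) (fst (y t l k)) -> Ob t l (snd (y t l k)) (fst (y t l k))) /\
  forall t l v c, Ob t l v c -> exists k r, ale r c /\ ale r (fst (y t l k)).
Proof.
  assert (HV : forall t l v c, Ob t l v c -> ale c c) by (intros t l v c [st [<- _]]; exact (proj2_sig st)).
  assert (exists y : T0 -> @code I W, forall t, (forall l k, Ob t l (snd (y t l k)) (fst (y t l k)) \/ fst (y t l k) = badc) /\
    forall l v c, Ob t l v c -> exists k r, ale r c /\ ale r (fst (y t l k))) as [y Hy].
  { exists (fun t => epsilon (inhabits (fun _ _ => (badc, (0, 0)))) (fun y => (forall l k, Ob t l (snd (y l k)) (fst (y l k)) \/ fst (y l k) = badc) /\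
      forall l v c, Ob t l v c -> exists k r, ale r c /\ ale r (fst (y l k)))).
    intros t; apply (epsilon_spec (inhabits (fun _ _ => (badc, (0, 0)))) (fun y => (forall l k, Ob t l (snd (y l k)) (fst (y l k)) \/ fst (y l k) = badc) /\
      forall l v c, Ob t l v c -> exists k r, ale r c /\ ale r (fst (y l k)))).
    apply (code_gen lt wf Adm TT (Ob t) (down_TT lt)); apply HV. }
  assert (Hsup : forall t l k, exists L : list W, forall w, co (fst (y t l k)) w <> d0 -> In w L).
  { intros t l k; destruct (proj1 (Hy t) l k) as [H| ->]; [|exists []; simpl; tauto].
    apply HV in H; destruct H as [[_ H] _]; exact H. }
  destruct (HBd (fun t l k => epsilon (inhabits []) (fun L => forall w, co (fst (y t l k)) w <> d0 -> In w L))) as [u Hu].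
  assert (Hu' : forall t l k w, co (fst (y t l k)) w <> d0 -> lt w u).
  { intros t l k w Hw; apply (Hu t l k w), (epsilon_spec (inhabits []) (fun L => forall w, co (fst (y t l k)) w <> d0 -> In w L) (Hsup t l k)); auto. }
  assert (HO : forall t l k r, ale r (fst (y t l k)) -> Ob t l (snd (y t l k)) (fst (y t l k))).
  { intros t l k r Hr; destruct (proj1 (Hy t) l k) as [H|H]; auto; rewrite H in Hr; destruct (badc_invalid lt wf Adm HI TT _ Hr). }
  exists u, y; split; [|split; [intros t l k r Hr; eapply HO; eauto|intros t; apply Hy]].
  intros t r l k l' k' H1 H2.
  pose proof (trunc_le lt wf tr Adm u r _ H1 (Hu' t l k)) as R1; pose proof (trunc_le lt wf tr Adm u r _ H2 (Hu' t l' k')) as R2.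
  set (r' := mkP _ _ R1); assert (Q1 : ale (proj1_sig r') (fst (y t l k))) by exact R1; assert (Q2 : ale (proj1_sig r') (fst (y t l' k'))) by exact R2.
  pose proof (HO t l k _ Q1) as [st [E1 [Hst [zl [a [b [Hl [Hv HVs]]]]]]]]; pose proof (HO t l' k' _ Q2) as [st' [E1' [Hst' [zl' [a' [b' [Hl' [Hv' HVs']]]]]]]].
  rewrite <- E1 in Q1; rewrite <- E1' in Q2; apply (vals_down _ _ r') in HVs; auto; apply (vals_down _ _ r') in HVs'; auto.
  assert (Hr0 : lep r' p0) by exact (lep_trans r' st p0 Q1 Hst).
  pose proof (fun j v v' => vals_unique t r' _ _ j v v' Hr0 HVs HVs') as HU; rewrite Hv, Hv'; subst l l'.
  split.
  - intros Hll.
    assert (He : zl ++ [(a, b)] = zl' ++ [(a', b')]).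
    { apply nth_error_ext; intros j; destruct (nth_error (zl ++ [(a, b)]) j) as [v|] eqn:Hj; destruct (nth_error (zl' ++ [(a', b')]) j) as [v'|] eqn:Hj'; auto.
      - f_equal; apply (HU j v v' Hj Hj').
      - exfalso; apply nth_error_None in Hj'; assert (Hn : nth_error (zl ++ [(a, b)]) j <> None) by congruence; apply nth_error_Some in Hn.
        rewrite length_app in *; simpl in *; lia.
      - exfalso; apply nth_error_None in Hj; assert (Hn : nth_error (zl' ++ [(a', b')]) j <> None) by congruence; apply nth_error_Some in Hn.
        rewrite length_app in *; simpl in *; lia. }
    apply app_inj_tail in He as [-> [= -> ->]]; auto.
  - apply Hadm.
    + intros Hfl; destruct (vals_unique t r' _ _ (length zl) (a, b) (a, b) Hr0 HVs HVs (nth_error_end _ _ _) (nth_error_end _ _ _)) as [_ H]; auto.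
    + intros Hll; destruct (nth_error zl' (length zl)) as [v'|] eqn:Hj; [|apply nth_error_None in Hj; lia].
      f_equal; symmetry; apply (HU (length zl)); [apply nth_error_end|rewrite nth_error_app1; auto].
Qed.

Definition insf : fml := if fl then almost_all (fun n => LET s := restr 7 n IN LET c := app 6 s IN LET v := app 7 n IN v ∈ c)
  else almost_all (fun n => LET c := app 6 n IN LET v := app 7 n IN v ∈ c).
Definition bodyB : fml := ∀ φ, app 0 4 φ ⇒ ∀ f, app 3 5 f ⇒ insf.
Definition InS {M} (E : M -> M -> Prop) EX AND OR φ f := if fl
  then AlmostAll E EX AND OR (fun n => EX (fun s => AND (Restr E EX AND OR f n s) (EX (fun c => AND (App E EX AND OR φ s c) (EX (fun v => AND (App E EX AND OR f n v) (E v c)))))))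
  else AlmostAll E EX AND OR (fun n => EX (fun c => AND (App E EX AND OR φ n c) (EX (fun v => AND (App E EX AND OR f n v) (E v c))))).
Definition BodyB {M} (E : M -> M -> Prop) EX AND OR (F w Z t : M) := forall φ, App E EX AND OR F w φ -> forall f, App E EX AND OR Z t f -> InS E EX AND OR φ f.
Lemma sat_bodyB {M} (E : M -> M -> Prop) md t w Z T' W' F : sat E (en md [t; w; Z; T'; W'; F]) (bodyB 6) = BodyB E (@ex M) and or F w Z t.
Proof. unfold BodyB, InS, bodyB, insf; destruct fl; rewrite <- rex_eq, <- rand_eq, <- ror_eq; reflexivity. Qed.

Context (u : W) (t : T0) (y : @code I W).
Context (Yout : forall l k (r : Pc), ale (proj1_sig r) (fst (y l k)) -> Ob t l (snd (y l k)) (fst (y l k))).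
Context (Ymax : forall l v c, Ob t l v c -> exists k r, ale r c /\ ale r (fst (y l k))).

(** If the filter contains a condition deciding the sequence at place [l], meeting this set brings a
    condition of the code at level [l] into it. *)
Definition Dcode (l : nat) (p : Pc) := (exists k, ale (proj1_sig p) (fst (y l k))) \/ forall v c, Ob t l v c -> ~ exists r, ale r c /\ ale r (proj1_sig p).
Lemma Ob_down l v c r : Ob t l v c -> ale r c -> Ob t l v r.
Proof.
  intros [st [<- [Hst [zl [a [b [H1 [H2 H3]]]]]]]] Hr; exists (mkP _ _ Hr); split; auto; split; [exact (lep_trans (mkP _ _ Hr) st p0 Hr Hst)|].
  exists zl, a, b; split; auto; split; auto; apply (vals_down _ st); auto.
Qed.
Lemma Dcode_dense l p : exists q, lep q p /\ Dcode l q.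
Proof.
  destruct (classic (exists v c r, Ob t l v c /\ ale r c /\ ale r (proj1_sig p))) as [[v [c [r [H1 [H2 H3]]]]]|Hn].
  - destruct (Ymax l v r (Ob_down l v c r H1 H2)) as [k [r' [R1 R2]]]; exists (mkP _ _ R1); split.
    + exact (ale_trans lt wf tr Adm TT _ _ _ (down_TT lt) R1 H3).
    + left; exists k; exact R2.
  - exists p; split; auto; right; intros v c H [r [R1 R2]]; apply Hn; exists v, c, r; auto.
Qed.

Section Captured.
Context {U : Name -> Prop} {M : Type} {E : M -> M -> Prop} {name : M -> Name} {G : Pc -> Prop} {om : M} {num : nat -> M}
  (g : gx U E name G om num) (r : Pc) (Hr : G r) (Hrp : lep r p0) (Hy : In y (iH (co (proj1_sig r) u))).
Let HM := gx_m _ _ _ _ _ _ g.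
Context (HUw : forall n, UW u n -> U n) (HUp : U (ph u)) (UT : U (cks ltT wfT)).
Context (HDl : forall n, exists p, G p /\ longiv u n p) (HDc : forall l, exists p, G p /\ Dcode l p).
Context (Z T' t' : M) (HZ : Nm name G Z Zn) (HT : Nm name G T' (cks ltT wfT)) (Ht : Nm name G t' (ck ltT wfT t)).
Local Notation ap := (ap E om).
Local Notation vl := (@vl M E om num).

Lemma vals_met zs : (forall j v, nth_error zs j = Some v -> ap (ap Z t') (num j) = vl v) -> exists st, G st /\ lep st p0 /\ vals t st zs.
Proof.
  intros Hz; destruct (fun_sat g Z T' (G_up g r p0 Hr Hrp) HZ HT) as [x0 [_ X2]].
  assert (H : forall m, exists st, G st /\ lep st p0 /\ forall j v, j < m -> nth_error zs j = Some v -> forces (valf 4) (en nset [h3 v; nn j; ck ltT wfT t; Zn]) st).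
  { induction m as [|m [st [H1 [H2 H3]]]]; [exists r; split; auto; split; auto; intros; lia|].
    destruct (nth_error zs m) as [v|] eqn:Hm.
    - destruct (proj2 (val_sat g Z T' t' Zn t HZ UT HT Ht x0 X2 m v) (Hz m v Hm)) as [st' [H4 H5]].
      destruct (G_dir g st st' H1 H4) as [s [Hs [S1 S2]]]; exists s; split; auto; split; [exact (lep_trans s st p0 S1 H2)|].
      intros j v' Hj Hv'; destruct (Nat.eq_dec j m) as [->|Hne].
      + rewrite Hm in Hv'; injection Hv' as <-; exact (forces_down _ _ _ _ H5 S2).
      + refine (forces_down _ _ _ _ (H3 j v' _ Hv') S1); lia.
    - exists st; split; auto; split; auto; intros j v' Hj Hv'; apply H3; auto.
      destruct (Nat.eq_dec j m) as [->|Hne]; [congruence|lia]. }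
  destruct (H (length zs)) as [st [H1 [H2 H3]]]; exists st; split; auto; split; auto; intros j v Hv; apply H3; auto.
  apply nth_error_Some; congruence.
Qed.

(** The filter contains a condition deciding the values up to [n], one from the code at level [n]
    and one whose item at [u] has more than [n] levels. Below these and [r] the promise of [y]
    applies to level [n] and makes the coded value good; the two decisions agree by
    [vals_unique]. *)
Lemma captured_at n : length (iv (co (proj1_sig r) u)) <= n -> exists s c v, length s = n /\ Nm name G (rs E om (ap Z t') (num n)) (ln s) /\
  Nm name G c (fw u s) /\ E (vl v) c /\ ap (ap Z t') (num n) = vl v.
Proof.
  intros Hn; destruct (fun_sat g Z T' (G_up g r p0 Hr Hrp) HZ HT) as [x0 [X1 X2]].
  pose proof (Zt_func g Z T' t' t UT HT Ht x0 X2) as Hf; set (f := ap Z t') in *.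
  assert (HUs : forall s, U (ln s)) by (intros s; apply HUw; right; right; eauto).
  assert (Hval : forall k, exists v, ap f (num k) = vl v /\ (fl = false -> snd v <= fst v)).
  { intros k; apply X1, (ap_spec E om num HM _ _ _ _ Hf), (num_om E om num HM). }
  pose proof (num_sub_om E om num HM n) as Hsub.
  destruct (ln_of g HUs (rs E om f (num n)) n x0) as [s [Hs1 [Hs2 Hs3]]].
  { eapply (rs_func E om num HM); eauto. }
  { intros k Hk; rewrite (rs_ap E om num HM _ _ _ _ _ Hf Hsub) by (apply (num_E E om num HM); auto); destruct (Hval k) as [v [Hv _]]; eauto. }
  destruct (Hval n) as [v [Hv Hle]]; destruct (Nm_ex g (fw u s)) as [c Hc]; [apply HUw; left; eauto|].
  exists s, c, v; split; auto; split; auto; split; auto; split; auto.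
  destruct (vals_met (s ++ [v])) as [st [S1 [S2 S3]]].
  { intros j v' Hj; destruct (Nat.eq_dec j n) as [->|Hne].
    - rewrite <- Hs1 in Hj; rewrite nth_error_end in Hj; injection Hj as <-; auto.
    - assert (Hjn : j < n).
      { assert (Hl : j < length (s ++ [v])) by (apply nth_error_Some; congruence); rewrite length_app in Hl; simpl in Hl; lia. }
      rewrite nth_error_app1 in Hj by lia; pose proof (Hs2 j Hjn) as H2.
      rewrite (rs_ap E om num HM _ _ _ _ _ Hf Hsub) in H2 by (apply (num_E E om num HM); auto).
      fold f; rewrite H2; f_equal; exact (nth_error_nth _ _ _ Hj). }
  assert (HO : Ob t n (th s (fst v), snd v) (proj1_sig st)).
  { exists st; split; auto; split; auto; exists s, (fst v), (snd v); split; auto; split; auto; rewrite <- surjective_pairing; auto. }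
  destruct (HDc n) as [p1 [Hp1 Hd]]; destruct (HDl n) as [p2 [Hp2 Hlong]].
  destruct (G_dir g p1 p2 Hp1 Hp2) as [p3 [Hp3 [L1 L2]]]; destruct (G_dir g st r S1 Hr) as [p4 [Hp4 [L3 L4]]]; destruct (G_dir g p3 p4 Hp3 Hp4) as [q [Hq [L5 L6]]].
  assert (Q1 : lep q p1) by exact (lep_trans q p3 p1 L5 L1). assert (Q2 : lep q p2) by exact (lep_trans q p3 p2 L5 L2).
  assert (Q3 : lep q st) by exact (lep_trans q p4 st L6 L3). assert (Q4 : lep q r) by exact (lep_trans q p4 r L6 L4).
  destruct Hd as [[k Hk]|Hd]; [|destruct (Hd _ _ HO); exists (proj1_sig q); split; [exact Q3|exact Q1]].
  assert (Hqk : ale (proj1_sig q) (fst (y n k))) by exact (ale_trans lt wf tr Adm TT _ _ _ (down_TT lt) Q1 Hk).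
  destruct (Yout n k q Hqk) as [st' [E1 [E2 [zl [a [b [Hl [Hsnd HV]]]]]]]].
  rewrite <- E1 in Hqk; apply (vals_down t st' q) in HV; auto; apply (vals_down t st q) in S3; auto.
  assert (Hq0 : lep q p0) by exact (lep_trans q r p0 Q4 Hrp).
  assert (He : zl ++ [(a, b)] = s ++ [v]).
  { apply nth_error_ext; intros j; destruct (nth_error (zl ++ [(a, b)]) j) as [w|] eqn:Hj; destruct (nth_error (s ++ [v]) j) as [w'|] eqn:Hj'; auto.
    - f_equal; apply (vals_unique t q _ _ j w w' Hq0 HV S3 Hj Hj').
    - exfalso; apply nth_error_None in Hj'; assert (Hx : nth_error (zl ++ [(a, b)]) j <> None) by congruence; apply nth_error_Some in Hx.
      rewrite length_app in *; simpl in *; lia.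
    - exfalso; apply nth_error_None in Hj; assert (Hx : nth_error (s ++ [v]) j <> None) by congruence; apply nth_error_Some in Hx.
      rewrite length_app in *; simpl in *; lia. }
  apply app_inj_tail in He as [-> <-]; simpl in *.
  apply (fw_pr g u HUw s c _ Hc); exists (a, b), q; split; auto; split; auto; split; auto; rewrite Hs1.
  change (th s (fst (a, b)), snd (a, b)) with (th s a, b); rewrite <- Hsnd.
  assert (Hlq : n < length (iv (co (proj1_sig q) u))).
  { pose proof (prefix_len _ _ (proj1 (lep_item q p2 u Q2))); unfold longiv in Hlong; lia. }
  destruct (lep_item q r u Q4) as [_ [_ [_ [_ [_ HG]]]]].
  apply (HG y n k (proj1_sig q) Hy); [lia| |].
  - apply (ale_K lt wf Adm TT); [apply down_TT|exact Logic.I|exact (proj2_sig q)].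
  - apply (ale_K lt wf Adm TT); [apply down_TT|exact Logic.I|]. rewrite <- E1; exact Hqk.
Qed.

Lemma captured F w' : U PHI -> Nm name G F PHI -> Nm name G w' (ck lt wf u) -> BodyB E (@ex M) and or F w' Z t'.
Proof.
  intros UP HF Hw φ Hφ f HfZ; destruct (fun_sat g Z T' (G_up g r p0 Hr Hrp) HZ HT) as [x0 [X1 X2]].
  apply (App_iff E om num HM), (famN_pr g lt wf tri ph F w' φ u UP HF Hw) in Hφ.
  apply (App_iff E om num HM) in HfZ; destruct (func_pr E om num HM _ _ _ _ _ X2 HfZ) as [_ [_ Hfe]]; subst f.
  pose proof (Zt_func g Z T' t' t UT HT Ht x0 X2) as Hf.
  assert (Hfl : fl = true \/ fl = false) by (clear; destruct fl; auto).
  unfold InS; destruct Hfl as [Hfl|Hfl]; rewrite Hfl; apply (AlmostAll_iff E om num HM); exists (length (iv (co (proj1_sig r) u))); intros n Hn;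
    destruct (captured_at n Hn) as [s [c [v [Hs [Hls [Hc [Hin Hv]]]]]]].
  - exists (rs E om (ap Z t') (num n)); split; [apply (Restr_iff E om num HM); auto|]; exists c; split.
    + apply (App_iff E om num HM), (ph_pr g u φ HUp Hφ); exists s; split; auto; unfold dn; rewrite Hfl; auto.
    + exists (vl v); split; auto; rewrite <- Hv; apply (App_iff E om num HM), (func_ap E om num HM _ _ _ _ Hf), (num_om E om num HM).
  - exists c; split.
    + apply (App_iff E om num HM), (ph_pr g u φ HUp Hφ); exists s; split; auto; unfold dn; rewrite Hfl, Hs; apply (Nm_num g).
    + exists (vl v); split; auto; rewrite <- Hv; apply (App_iff E om num HM), (func_ap E om num HM _ _ _ _ Hf), (num_om E om num HM).
Qed.
End Captured.
End Ground.

(** A condition forces the name of [Z] to be a family of sequences, and [codes] yields codes for it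
    with a coordinate [u] above their supports. For each [t] the conditions promising [y t] at [u]
    are dense, and capture is verified in an extension through one of them. *)
Lemma capture_all U M (E : M -> M -> Prop) name G om num (g : gx U E name G om num) F W' T' Z : Nm name G F PHI -> Nm name G W' (cks lt wf) ->
  Nm name G T' (cks ltT wfT) -> Funf E (@ex M) and or Z T' ->
  exists w, E w W' /\ forall t, E t T' -> BodyB E (@ex M) and or F w Z t.
Proof.
  intros HF HW HT HZ.
  assert (Hs : sat E (en om [T'; Z]) (funf 2)).
  { enough (Hx : sat E (en om [T'; Z]) (funf 2) = Funf E (@ex M) and or Z T') by (rewrite Hx; auto).
    unfold Funf, funf; destruct fl; rewrite <- rex_eq, <- rand_eq, <- ?ror_eq; reflexivity. }
  apply (sat_names (gx_g _ _ _ _ _ _ g) (funf 2) om nset [T'; Z] [cks ltT wfT; name Z]) in Hs; [|apply (gx_om _ _ _ _ _ _ g)|repeat constructor; auto; apply (Nm_self g)].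
  destruct Hs as [p0 [Gp0 Hp0]]; assert (HZn : Nm name G Z (name Z)) by apply (Nm_self g); set (Zn := name Z) in *; clearbody Zn.
  destruct (codes Zn p0 Hp0) as [u [y [Y1 [Y2 Y3]]]].
  assert (Hf : forces ((∃ w ∈ 1, ∀ t ∈ 2, bodyB) 4) (en nset [Zn; cks ltT wfT; cks lt wf; PHI]) p0).
  { apply (ex_ck_i lt wf (fun w => ∀ t ∈ 2, bodyB) 1 4 nset _ p0 u); [lia|reflexivity|].
    apply (all_ck ltT wfT (fun t => bodyB) 2 5 nset); [lia|reflexivity|]; intros t q Hq.
    apply (forces_bind _ _ q (fun r : Pc => In (y t) (iH (co (proj1_sig r) u)))).
    { intros q' _; destruct (add_name lt wf tr Adm (proj1_sig q') u (y t) (proj2_sig q') (Y1 t)) as [r [Hr Hy]]; exists (mkP _ _ Hr); auto. }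
    intros r Hr Hy.
    apply (forces_of_generic (bodyB 6) nset _ r (fun n => UW u n \/ n = ph u \/ n = cks ltT wfT \/ n = PHI)
      (fun z => match z with inl n => longiv u n | inr l => Dcode Zn p0 t (y t) l end) (X := nat + nat)).
    { apply cnt_or; [apply UW_cnt|repeat apply cnt_or; apply cnt_one]. }
    { auto. }
    { intros [n|l] p; [apply longiv_dense|exact (Dcode_dense Zn p0 t (y t) (Y3 t) l p)]. }
    clear U M E name G om num g F W' T' Z HF HW HT HZ Gp0 HZn.
    intros U M E name G om num g HU Gr HD md ms Hmd Hms.
    inversion Hms as [|t' ? ms1 ? Ht Hms1]; subst; inversion Hms1 as [|w' ? ms2 ? Hw Hms2]; subst; inversion Hms2 as [|Z ? ms3 ? HZ Hms3]; subst;
      inversion Hms3 as [|T' ? ms4 ? HT Hms4]; subst; inversion Hms4 as [|W' ? ms5 ? HW Hms5]; subst; inversion Hms5 as [|F ? ms6 ? HF Hms6]; subst; inversion Hms6; subst.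
    rewrite sat_bodyB.
    apply (captured Zn p0 Hp0 u t (y t) (Y2 t) g r Gr (lep_trans r q p0 Hr Hq) Hy) with (T' := T'); auto.
    - intros n; apply (HD (inl n)).
    - intros l; apply (HD (inr l)). }
  assert (Hs : sat E (en om [Z; T'; W'; F]) ((∃ w ∈ 1, ∀ t ∈ 2, bodyB) 4)).
  { apply (sat_names (gx_g _ _ _ _ _ _ g) _ om nset [Z; T'; W'; F] [Zn; cks ltT wfT; cks lt wf; PHI]); [apply (gx_om _ _ _ _ _ _ g)|repeat constructor; auto|eauto]. }
  change (rex (fun w => rand (E w W') (forall t, E t T' -> sat E (scons t (scons w (en om [Z; T'; W'; F]))) (bodyB 6)))) in Hs.
  rewrite rex_eq, rand_eq in Hs; destruct Hs as [w [Hw H]]; exists w; split; auto; intros t Ht; specialize (H t Ht).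
  rewrite <- (sat_bodyB E om t w Z T' W' F); revert H; apply sat_ext; intros [|[|[|[|[|[|]]]]]]; reflexivity.
Qed.

(** What the inequalities require of one extension. The last two clauses identify index sets whose
    canonical names coincide. *)
Record World {M} (E : M -> M -> Prop) (om : M) (num : nat -> M) (I' A' W' T' C1 C2 C3 F : M) : Prop := {
  w_model : model E om num;
  w_zfc : forall q e, ZFC q -> sat E e q;
  w_C1 : Func E (@ex M) and or C1 I' (fs E om om om);
  w_C2 : Func E (@ex M) and or C2 I' (fs E om om om) /\ forall i n, E i I' -> E (ap E om (ap E om C2 i) (num n)) (num 2);
  w_C3 : Func E (@ex M) and or C3 I' (fs E om om (pd E om om om));
  w_A1 : T1 Adm \/ T2 Adm -> factA1 E om I' A' C1;
  w_A2 : factA2 E om I' A' C2;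
  w_A3 : T1 Adm -> factA3 E om I' A' C3;
  w_M : fl = true -> exists i0, ED_ E (@ex M) and or i0 /\ factPHI E i0 (fq E om (pd E om om om)) W' F /\ factB E om (pd E om om om) (inM E) W' T' F;
  w_K : fl = false -> exists d i0, Delta_ E (@ex M) and or d /\ EDfin_ E (@ex M) and or i0 /\ factPHI E i0 om W' F /\ factB E om d (inK E) W' T' F;
  w_A : exists t, E t A';
  w_T : exists t, E t T';
  w_TI : cks ltT wfT = cks ltI wfI :> Name -> T' = I';
  w_AW : cks ltA wfA = cks lt wf :> Name -> A' = W' }.

Lemma world (a0 : A) (t0 : T0) : exists M (E : M -> M -> Prop) om num I' A' W' T' C1 C2 C3 F, World E om num I' A' W' T' C1 C2 C3 F.
Proof.
  set (V := fun n : Name => (n = CN h1 \/ n = CN h2 \/ n = CN h3 \/ n = PHI) \/ (n = cks ltI wfI \/ n = cks ltA wfA \/ n = cks lt wf \/ n = cks ltT wfT)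
    \/ n = ck ltA wfA a0 \/ n = ck ltT wfT t0).
  assert (HV : cnt V) by (unfold V; repeat apply cnt_or; apply cnt_one).
  assert (Hc : ale (mkc (fun _ : I => []) (fun _ : W => d0)) (mkc (fun _ => []) (fun _ => d0))).
  { split; [split; exists []; simpl; tauto|split; [intros; apply prefix_refl|]]; intros w _; split; [apply okitem_d0|apply itemle_refl]. }
  destruct (gx_exists (mkPc _ Hc) V (fun (_ : nat) _ => True) HV cble_nat) as [U [M [E [name [G [om [num [g [HU _]]]]]]]]].
  { intros _ p; exists p; auto. }
  pose proof (gx_m _ _ _ _ _ _ g) as HM.
  assert (HU' : forall n, V n -> U n) by auto; unfold V in HU'; clear HU HV; clearbody V; clear V.
  assert (Hx : forall n, U n -> exists x, Nm name G x n) by (intros n; apply (Nm_ex g)).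
  destruct (Hx (CN h1)) as [C1 HC1]; [auto 12|]. destruct (Hx (CN h2)) as [C2 HC2]; [auto 12|]. destruct (Hx (CN h3)) as [C3 HC3]; [auto 12|].
  destruct (Hx PHI) as [F HF]; [auto 12|]. destruct (Hx (cks ltI wfI)) as [I' HI']; [auto 12|]. destruct (Hx (cks ltA wfA)) as [A' HA']; [auto 12|].
  destruct (Hx (cks lt wf)) as [W' HW']; [auto 12|]. destruct (Hx (cks ltT wfT)) as [T' HT']; [auto 12|].
  destruct (Hx (ck ltA wfA a0)) as [a Ha]; [auto 12|]. destruct (Hx (ck ltT wfT t0)) as [t Ht]; [auto 12|].
  pose proof (factC1_true g C1 I' HI' ltac:(auto 12) ltac:(auto 12) HC1) as F1.
  pose proof (factC2_true g C2 I' HI' ltac:(auto 12) ltac:(auto 12) HC2) as F2.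
  pose proof (factC3_true g C3 I' HI' ltac:(auto 12) ltac:(auto 12) HC3) as F3.
  exists M, E, om, num, I', A', W', T', C1, C2, C3, F; constructor; auto.
  - intros q e; apply (zfc_true g).
  - intros HT; apply (factA1_true g); auto.
  - apply (factA2_true g); auto; apply F2.
  - intros HT; apply (factA3_true g); auto.
  - intros Hfl; destruct (ED_ex E om num HM) as [i0 Hi]; exists i0; split; auto; split; [exact (factPHI_M g F W' HF HW' i0 Hfl Hi)|].
    intros Z HZ; destruct (capture_all U M E name G om num g F W' T' Z HF HW' HT') as [w [Hw H]].
    + unfold Funf; rewrite Hfl; exists (fs E om om (pd E om om om)); split; auto; apply (Seqs_iff E om num HM _ _ (Omega2_iff E om num HM)); auto.
    + exists w; split; auto; intros φ Hφ t' Ht' f Hf; pose proof (H t' Ht' φ Hφ f Hf) as Hin; unfold InS in Hin; rewrite Hfl in Hin; exact Hin.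
  - intros Hfl; destruct (EDfin_ex E om num HM) as [i0 Hi], (Delta_ex E om num HM) as [d Hd]; exists d, i0; split; auto; split; auto.
    split; [exact (factPHI_K g F W' HF HW' i0 Hfl Hi)|].
    intros Z HZ; destruct (capture_all U M E name G om num g F W' T' Z HF HW' HT') as [w [Hw H]].
    + unfold Funf; rewrite Hfl; exists (fs E om om d); split; auto; apply (Seqs_iff E om num HM _ d); auto.
      intros x; split; [|intros ->; auto]; intros Hx'; exact (setof_unique E om num HM _ _ _ Hx' Hd).
    + exists w; split; auto; intros φ Hφ t' Ht' f Hf; pose proof (H t' Ht' φ Hφ f Hf) as Hin; unfold InS in Hin; rewrite Hfl in Hin; exact Hin.
  - exists a; apply (cks_elem g ltA wfA A' a); [auto 12|auto|eauto].
  - exists t; apply (cks_elem g ltT wfT T' t); [auto 12|auto|eauto].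
  - intros He; rewrite He in HT'; exact (Nm_uniq g _ _ _ HT' HI').
  - intros He; rewrite He in HA'; exact (Nm_uniq g _ _ _ HA' HW').
Qed.
End Names.
End Capture.
End Cohen.

(** * The models *)

Lemma cantor_inj {X} (f : (X -> bool) -> X) : exists g h, f g = f h /\ g <> h.
Proof.
  apply NNPP; intros Hn.
  assert (Hinj : forall g h, f g = f h -> g = h) by (intros g h He; apply NNPP; intros Hne; apply Hn; eauto).
  set (D := fun x => if dec (exists g, f g = x /\ g x = true) then false else true).
  assert (HD : D (f D) = true <-> ~ exists g, f g = f D /\ g (f D) = true).
  { unfold D at 1; destruct (dec _); split; intros; congruence || tauto. }
  destruct (D (f D)) eqn:He.
  - apply (proj1 HD eq_refl); exists D; auto.
  - assert (Hx : ~ ~ exists g, f g = f D /\ g (f D) = true) by (intros H; apply HD in H; discriminate).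
    apply Hx; intros [g [Hg Hg']]; apply Hinj in Hg as ->; congruence.
Qed.
Lemma cantor_surj {X} (f : X -> X -> bool) : exists g, forall x, f x <> g.
Proof. exists (fun x => negb (f x x)); intros x H; assert (H' := f_equal (fun h => h x) H); simpl in H'; destruct (f x x); discriminate. Qed.

Section Fibers.
Context (A : Type) (a0 : A).
Definition index := A * nat -> bool.
(** Were all fibers countable, the value under [g] together with a number inside the fiber would
    inject [A * nat -> bool] into [A * nat], against Cantor. *)
Lemma index_fiber (g : index -> A) : exists t, ~ countable (fun i => g i = t).
Proof.
  apply NNPP; intros Hn.
  assert (H : forall t, exists f : index -> nat, forall x y, g x = t -> g y = t -> f x = f y -> x = y).
  { intros t; apply NNPP; intros H; apply Hn; exists t; exact H. }
  assert (exists f : A -> index -> nat, forall t x y, g x = t -> g y = t -> f t x = f t y -> x = y) as [f Hf].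
  { exists (fun t => epsilon (inhabits (fun _ => 0)) (fun f => forall x y, g x = t -> g y = t -> f x = f y -> x = y)).
    intros t; exact (epsilon_spec (inhabits (fun _ => 0)) (fun f => forall x y, g x = t -> g y = t -> f x = f y -> x = y) (H t)). }
  destruct (cantor_inj (fun x : index => (g x, f (g x) x))) as [x [y [He Hne]]]; injection He as E1 E2.
  apply Hne, (Hf (g x)); auto; rewrite E1 in E2 |- *; auto.
Qed.
Lemma index_infinite (L : list index) : exists i, ~ In i L.
Proof.
  apply NNPP; intros Hn; destruct (index_fiber (fun _ => a0)) as [t Ht]; apply Ht.
  eapply countable_sub; [|apply (countable_list L)]; intros i _; apply NNPP; eauto.
Qed.
End Fibers.

(* The least initial segment of a well-order of [K -> bool] that is not an image of [K]; its order type is regular enough for [K]-indexed families to be bounded. *)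
Section Long.
Context (K : Type) (pair : K -> K * K) (Hpair : forall z, exists k, pair k = z) (idx : K -> nat) (Hidx : forall n, exists k, idx k = n).
Definition Big := K -> bool.
Context (lt : Big -> Big -> Prop) (wf : well_founded lt) (tri : forall x y, lt x y \/ x = y \/ lt y x) (tr : forall x y z, lt x y -> lt y z -> lt x z).
Definition small_set (S : Big -> Prop) := exists f : K -> Big, forall x, S x -> exists k, f k = x.
Definition seg (x y : Big) := lt y x.
Definition Long := {x : Big | small_set (seg x)}.
Definition ltL (x y : Long) := lt (proj1_sig x) (proj1_sig y).
Lemma ltL_wf : well_founded ltL.
Proof. exact (wf_inverse_image Long Big lt (@proj1_sig _ _) wf). Qed.
Lemma Long_eq (x y : Long) : proj1_sig x = proj1_sig y -> x = y.
Proof. destruct x as [x Hx], y as [y Hy]; simpl; intros <-; f_equal; apply proof_irrelevance. Qed.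
Lemma ltL_tri x y : ltL x y \/ x = y \/ ltL y x.
Proof. destruct (tri (proj1_sig x) (proj1_sig y)) as [H|[H|H]]; auto; right; left; apply Long_eq, H. Qed.
Lemma ltL_tr x y z : ltL x y -> ltL y z -> ltL x z.
Proof. apply tr. Qed.
(** If all initial segments are small, the given map would send [K] onto [K -> bool]. Otherwise take
    the least point whose segment is not small: all points below it have small segments, so the
    given map would cover its segment. *)
Lemma not_small_set : ~ small_set (fun x => small_set (seg x)).
Proof.
  intros Hs; destruct (classic (forall x, small_set (seg x))) as [Hall|Hex].
  - destruct Hs as [f Hf]; destruct (cantor_surj f) as [g Hg]; destruct (Hf g (Hall g)) as [k Hk]; exact (Hg k Hk).
  - apply not_all_ex_not in Hex as [x Hx]; revert Hx; induction x as [x IH] using (well_founded_induction wf); intros Hx.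
    apply Hx; destruct Hs as [f Hf]; exists f; intros y Hy; apply Hf; apply NNPP; intros Hn; exact (IH y Hy Hn).
Qed.
Lemma Long_inh : inhabited Long.
Proof.
  apply NNPP; intros Hn; apply not_small_set; exists (fun _ _ => true); intros x Hx; exfalso; apply Hn; constructor; exists x; auto.
Qed.
(** Were the values of [F] unbounded, every point of [Long] would be one of them or lie below one.
    There are at most [K] many values and each has a small segment, so all of [Long] would be an
    image of [K]. *)
Lemma bounded {J} (e : K -> J) (He : forall j, exists k, e k = j) (F : J -> list Long) : exists u, forall j w, In w (F j) -> ltL w u.
Proof.
  apply NNPP; intros Hn; apply not_small_set.
  assert (Hc : forall u : Long, exists j w, In w (F j) /\ (ltL u w \/ u = w)).
  { intros u; apply NNPP; intros H; apply Hn; exists u; intros j w Hw; destruct (ltL_tri w u) as [H1|[H1|H1]]; auto; exfalso; apply H; exists j, w; auto. }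
  set (en := fun x => epsilon (inhabits (fun _ _ => true)) (fun f : K -> Big => forall y, seg x y -> exists k, f k = y)).
  assert (Hen : forall x, small_set (seg x) -> forall y, seg x y -> exists k, en x k = y).
  { intros x Hx; exact (epsilon_spec (inhabits (fun _ _ => true)) (fun f : K -> Big => forall y, seg x y -> exists k, f k = y) Hx). }
  (* [k1] codes [j] and a place in the list [F j], which gives [w]; [k2] codes whether to take [w]
     itself or which point below it. *)
  exists (fun k => let k1 := fst (pair k) in let k2 := snd (pair k) in
    match nth_error (F (e (fst (pair k1)))) (idx (snd (pair k1))) with None => fun _ => true | Some w =>
      if idx (fst (pair k2)) =? 0 then proj1_sig w else en (proj1_sig w) (snd (pair k2)) end).
  intros x Hx; destruct (Hc (exist _ x Hx)) as [j [w [Hw H]]]; apply In_nth_error in Hw as [n Hn'].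
  destruct (He j) as [kj Hj], (Hidx n) as [kn Hkn]; destruct (Hpair (kj, kn)) as [k1 Hk1].
  assert (exists k2, (if idx (fst (pair k2)) =? 0 then proj1_sig w else en (proj1_sig w) (snd (pair k2))) = x) as [k2 Hk2].
  { destruct H as [H|H].
    - destruct (Hen _ (proj2_sig w) x H) as [k Hk]; destruct (Hidx 1) as [k' Hk']; destruct (Hpair (k', k)) as [k2 Hk2]; exists k2.
      rewrite Hk2; simpl; rewrite Hk'; auto.
    - destruct (Hidx 0) as [k' Hk']; destruct (Hpair (k', k')) as [k2 Hk2]; exists k2; rewrite Hk2; simpl; rewrite Hk'; simpl; rewrite <- H; auto. }
  destruct (Hpair (k1, k2)) as [k Hk]; exists k; rewrite Hk; simpl; rewrite Hk1; simpl; rewrite Hj, Hkn, Hn'; auto.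
Qed.
Lemma bounded_levels (F : K -> nat -> nat -> list Long) : exists u, forall t l k w, In w (F t l k) -> ltL w u.
Proof.
  destruct (bounded (fun k => (fst (pair k), (idx (fst (pair (snd (pair k)))), idx (snd (pair (snd (pair k)))))))) with (F := fun j => F (fst j) (fst (snd j)) (snd (snd j))) as [u Hu].
  - intros [t [l k]]; destruct (Hidx l) as [kl Hl], (Hidx k) as [kk Hk]; destruct (Hpair (kl, kk)) as [k2 H2]; destruct (Hpair (t, k2)) as [k1 H1].
    exists k1; rewrite H1; simpl; rewrite H2; simpl; rewrite Hl, Hk; auto.
  - exists u; intros t l k w Hw; apply (Hu (t, (l, k)) w Hw).
Qed.
End Long.

(* For [M] the value captured at level [l] codes the point as [(th s a, b)], where [s] is the sequence so far: adding
   the earlier second coordinates to [a] makes all later first coordinates bound them, and keeps the sets in ED. *)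
Definition Adm1 (l : nat) (x : nat * nat) (l' : nat) (x' : nat * nat) := snd x <= fst x.
Definition Adm2 (l : nat) (x : nat * nat) (l' : nat) (x' : nat * nat) := l < l' -> snd x <= fst x'.
Definition th1 (s : list (nat * nat)) (a : nat) := a.
Definition th2 (s : list (nat * nat)) (a : nat) := a + list_sum (map snd s).
Lemma Hadm1 s a b s' a' b' : (false = false -> b <= a) -> (length s < length s' -> nth_error s' (length s) = Some (a, b)) ->
  Adm1 (length s) (th1 s a, b) (length s') (th1 s' a', b').
Proof. intros H _; exact (H eq_refl). Qed.
Lemma sum_ge (s : list (nat * nat)) n v : nth_error s n = Some v -> snd v <= list_sum (map snd s).
Proof.
  revert n; induction s as [|w s IH]; intros [|n] H; try discriminate;
    change (list_sum (map snd (w :: s))) with (snd w + list_sum (map snd s)).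
  - injection H as ->; lia.
  - specialize (IH n H); lia.
Qed.
(** The value at the earlier level occurs in the later sequence, so its second coordinate is one of
    the summands of [th2]. *)
Lemma Hadm2 s a b s' a' b' : (true = false -> b <= a) -> (length s < length s' -> nth_error s' (length s) = Some (a, b)) ->
  Adm2 (length s) (th2 s a, b) (length s') (th2 s' a', b').
Proof. intros _ H Hl; pose proof (sum_ge _ _ _ (H Hl)) as Hs; unfold th2; simpl in *; lia. Qed.
Lemma Adm1_T1 : T1 Adm1. Proof. intros l x H; exact H. Qed.
Lemma Adm2_T2 : T2 Adm2. Proof. intros l x l' x' Hl H; exact (H Hl). Qed.

Definition Ia := nat * nat -> bool.
Definition pair_a (k : Ia) : Ia * Ia := (fun x => k (2 * fst x, snd x), fun x => k (S (2 * fst x), snd x)).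
Lemma pair_a_surj z : exists k, pair_a k = z.
Proof.
  destruct z as [f g]; exists (fun x => if Nat.even (fst x) then f (Nat.div2 (fst x), snd x) else g (Nat.div2 (fst x), snd x)).
  unfold pair_a; f_equal; extensionality x; destruct x as [m n]; cbn [fst snd].
  - rewrite Nat.even_even, Nat.div2_double; auto.
  - rewrite Nat.even_succ, <- Nat.negb_even, Nat.even_even, Nat.div2_succ_double; auto.
Qed.
Definition idx_a (k : Ia) : nat := epsilon (inhabits 0) (fun n => k (n, 0) = true).
Lemma idx_a_surj n : exists k, idx_a k = n.
Proof.
  exists (fun x => fst x =? n); unfold idx_a.
  apply Nat.eqb_eq, (epsilon_spec (inhabits 0) (fun m => (m =? n) = true)); exists n; apply Nat.eqb_refl.
Qed.

(* [I] and [T] have the size of the continuum. *)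
Lemma world_a Adm fl th (th_le : forall s a, a <= th s a) (th_K : fl = false -> forall s a, th s a = a)
  (Hadm : forall s a b s' a' b', (fl = false -> b <= a) -> (length s < length s' -> nth_error s' (length s) = Some (a, b)) -> Adm (length s) (th s a, b) (length s') (th s' a', b')) :
  exists M (E : M -> M -> Prop) om num I A W C1 C2 C3 F,
    (exists (W0 : Type) (lt : W0 -> W0 -> Prop) wf (ltI : Ia -> Ia -> Prop) wfI, World lt wf Adm ltI wfI Nat.lt lt_wf fl ltI wfI E om num I A W I C1 C2 C3 F).
Proof.
  destruct (well_order_exists (Big Ia)) as [lt [wf [tri tr]]]; destruct (well_order_exists Ia) as [ltI [wfI [triI _]]].
  destruct (world (ltL Ia lt) (ltL_wf Ia lt wf) (ltL_tri Ia lt tri) (ltL_tr Ia lt tr) Adm (index_infinite nat 0) (index_fiber nat) ltI wfI triI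
    Nat.lt lt_wf fl th th_le th_K Hadm ltI wfI (bounded_levels Ia pair_a pair_a_surj idx_a idx_a_surj lt wf tri) 0 (fun _ => true))
    as [M [E [om [num [I [A [W [T [C1 [C2 [C3 [F H]]]]]]]]]]]].
  pose proof (w_TI _ _ _ _ _ _ _ _ _ _ _ _ _ _ _ _ _ _ _ _ _ H eq_refl); subst T.
  exists M, E, om, num, I, A, W, C1, C2, C3, F, _, (ltL Ia lt), (ltL_wf Ia lt wf), ltI, wfI; exact H.
Qed.
(* [W] is of the first uncountable length, [A = W] and [T] is countable; [I] is so large that maps to [A] have uncountable fibers. *)
Lemma world_b Adm fl th (th_le : forall s a, a <= th s a) (th_K : fl = false -> forall s a, th s a = a)
  (Hadm : forall s a b s' a' b', (fl = false -> b <= a) -> (length s < length s' -> nth_error s' (length s) = Some (a, b)) -> Adm (length s) (th s a, b) (length s') (th s' a', b')) :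
  exists M (E : M -> M -> Prop) om num I W T C1 C2 C3 F,
    (exists (W0 I0 : Type) (lt : W0 -> W0 -> Prop) wf (ltI : I0 -> I0 -> Prop) wfI, World lt wf Adm ltI wfI lt wf fl Nat.lt lt_wf E om num I W W T C1 C2 C3 F).
Proof.
  destruct (well_order_exists (Big nat)) as [lt [wf [tri tr]]].
  set (L := Long nat lt); destruct (Long_inh nat lt wf) as [w0]; destruct (well_order_exists (index L)) as [ltI [wfI [triI _]]].
  assert (Hp : forall z, exists k, of_nat k = z) by (intros z; exists (to_nat z); apply cancel_of_to).
  destruct (world (ltL nat lt) (ltL_wf nat lt wf) (ltL_tri nat lt tri) (ltL_tr nat lt tr) Adm (index_infinite L w0) (index_fiber L) ltI wfI triI
    (ltL nat lt) (ltL_wf nat lt wf) fl th th_le th_K Hadm Nat.lt lt_wf (bounded_levels nat of_nat Hp (fun n => n) (fun n => ex_intro _ n eq_refl) lt wf tri) w0 0)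
    as [M [E [om [num [I [A [W [T [C1 [C2 [C3 [F H]]]]]]]]]]]].
  pose proof (w_AW _ _ _ _ _ _ _ _ _ _ _ _ _ _ _ _ _ _ _ _ _ H eq_refl); subst A.
  exists M, E, om, num, I, W, T, C1, C2, C3, F, _, _, (ltL nat lt), (ltL_wf nat lt wf), ltI, wfI; exact H.
Qed.

(** * The four models and the consistency statements *)

Lemma consistent_of_sat (p : fml) (R : Prop) M (E : M -> M -> Prop) (x : M) : (forall q e, ZFC q -> sat E e q) ->
  (forall e, sat E e (p 0) = R) -> R -> consistent (ZFC_plus p).
Proof.
  intros HZ Hp HR; apply (consistent_of_model E _ x); intros q e [Hq| ->]; [auto|rewrite Hp; auto].
Qed.

Lemma th1_K : false = false -> forall s a, th1 s a = a.
Proof. reflexivity. Qed.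
Lemma th2_K : true = false -> forall s a, th2 s a = a.
Proof. discriminate. Qed.
Lemma th1_le s a : a <= th1 s a.
Proof. apply le_n. Qed.
Lemma th2_le s a : a <= th2 s a.
Proof. unfold th2; lia. Qed.

Lemma model_1a : exists M (E : M -> M -> Prop), inhabited M /\ (forall q e, ZFC q -> sat E e q) /\ Stmt1a E (@ex M) and or.
Proof.
  destruct (world_a Adm2 true th2 th2_le th2_K Hadm2) as [M [E [om [num [I [A [W [C1 [C2 [C3 [F [W0 [lt [wf [ltI [wfI H]]]]]]]]]]]]]]]].
  destruct H as [HM HZ HC1 [HC2 HC2'] HC3 HA1 HA2 HA3 HI HK [a Ha] HT _ _]; destruct HI as [i0 [Hi [HP HB]]]; auto.
  exists M, E; split; [constructor; exact om|split; auto].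
  eapply (stmt1a E om num HM I A C1 C2); eauto using Adm2_T2.
Qed.
Lemma model_1b : exists M (E : M -> M -> Prop), inhabited M /\ (forall q e, ZFC q -> sat E e q) /\ Stmt1b E (@ex M) and or.
Proof.
  destruct (world_b Adm2 true th2 th2_le th2_K Hadm2) as [M [E [om [num [I [W [T [C1 [C2 [C3 [F [W0 [I0 [lt [wf [ltI [wfI H]]]]]]]]]]]]]]]]].
  destruct H as [HM HZ HC1 [HC2 HC2'] HC3 HA1 HA2 HA3 HI HK HA [t Ht] _ _]; destruct HI as [i0 [Hi [HP HB]]]; auto.
  exists M, E; split; [constructor; exact om|split; auto].
  eapply (stmt1b E om num HM I C1 C2); eauto using Adm2_T2.
Qed.
(** Both statements concern the same ideal on Delta, so one model serves them; [Adm1] satisfies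
    [T1], as the limit of limits against Fin⊗Fin requires. *)
Lemma model_23a : exists M (E : M -> M -> Prop), inhabited M /\ (forall q e, ZFC q -> sat E e q) /\ Stmt2a E (@ex M) and or /\ Stmt3a E (@ex M) and or.
Proof.
  destruct (world_a Adm1 false th1 th1_le th1_K Hadm1) as [M [E [om [num [I [A [W [C1 [C2 [C3 [F [W0 [lt [wf [ltI [wfI H]]]]]]]]]]]]]]]].
  destruct H as [HM HZ HC1 [HC2 HC2'] HC3 HA1 HA2 HA3 HI HK [a Ha] HT _ _]; destruct HK as [d [i0 [Hd [Hi [HP HB]]]]]; auto.
  exists M, E; split; [constructor; exact om|split; auto]; split.
  - eapply (stmt2a E om num HM I A C3); eauto using Adm1_T1.
  - eapply (stmt3a E om num HM I A C1 C2); eauto using Adm1_T1.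
Qed.
Lemma model_23b : exists M (E : M -> M -> Prop), inhabited M /\ (forall q e, ZFC q -> sat E e q) /\ Stmt2b E (@ex M) and or /\ Stmt3b E (@ex M) and or.
Proof.
  destruct (world_b Adm1 false th1 th1_le th1_K Hadm1) as [M [E [om [num [I [W [T [C1 [C2 [C3 [F [W0 [I0 [lt [wf [ltI [wfI H]]]]]]]]]]]]]]]]].
  destruct H as [HM HZ HC1 [HC2 HC2'] HC3 HA1 HA2 HA3 HI HK HA [t Ht] _ _]; destruct HK as [d [i0 [Hd [Hi [HP HB]]]]]; auto.
  exists M, E; split; [constructor; exact om|split; auto]; split.
  - eapply (stmt2b E om num HM I C3); eauto using Adm1_T1.
  - eapply (stmt3b E om num HM I C1 C2); eauto using Adm1_T1.
Qed.

Theorem theoremC (hZFC : consistent ZFC) :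
  (consistent (ZFC_plus
     (max_card bounding e_const ≺ non (seqs omega2) (M_ideal omega2 ED))) /\
   consistent (ZFC_plus
     (cov (seqs omega2) (M_ideal omega2 ED) ≺ min_card dominating v_const)))
  /\
  (consistent (ZFC_plus
     (non (seqs omega2) (M_ideal omega2 FinFin)
        ≺ non (seqs Delta) (K_ideal Delta EDfin))) /\
   consistent (ZFC_plus
     (cov (seqs Delta) (K_ideal Delta EDfin)
        ≺ cov (seqs omega2) (M_ideal omega2 FinFin))))
  /\
  (consistent (ZFC_plus
     (∀ b, bound_fun b ∧ increasing b ⇒
        max_card bounding (e_const_b b)
          ≺ non (seqs Delta) (K_ideal Delta EDfin))) /\
   consistent (ZFC_plus
     (∀ b, bound_fun b ∧ increasing b ⇒
        cov (seqs Delta) (K_ideal Delta EDfin)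
          ≺ min_card dominating (v_const_b b)))).
Proof.
  destruct model_1a as [Ma [Ea [[xa] [Za Ha]]]], model_1b as [Mb [Eb [[xb] [Zb Hb]]]].
  destruct model_23a as [Mc [Ec [[xc] [Zc [Hc2 Hc3]]]]], model_23b as [Md [Ed [[xd] [Zd [Hd2 Hd3]]]]].
  repeat split.
  - exact (consistent_of_sat _ _ Ma Ea xa Za (sat1a Ea) Ha).
  - exact (consistent_of_sat _ _ Mb Eb xb Zb (sat1b Eb) Hb).
  - exact (consistent_of_sat _ _ Mc Ec xc Zc (sat2a Ec) Hc2).
  - exact (consistent_of_sat _ _ Md Ed xd Zd (sat2b Ed) Hd2).
  - exact (consistent_of_sat _ _ Mc Ec xc Zc (sat3a Ec) Hc3).
  - exact (consistent_of_sat _ _ Md Ed xd Zd (sat3b Ed) Hd3).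
Qed.
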